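(* Let $\Omega\subset\mathbb{R}^2$ be an open bounded and simply connected set with real analytic boundary $\partial\Omega$, and let $\bm{t}$ and $\bm{n}$ denote the unit tangent and unit outward normal vectors on $\partial\Omega$ respectively. Let $f,h\in C^1(\partial\Omega)$ be real-valued. There exist an open connected set $U\subset\mathbb{R}^2$ satisfying $\overline{\Omega}\subset U$ and a vector field $\bm{B}=(B_1,B_2)\in C^1(U\setminus\overline{\Omega};\mathbb{R}^2)\cap C(U\setminus\Omega;\mathbb{R}^2)$ that solves $$\begin{cases} \operatorname{div}\bm{B}:=\dfrac{\partial B_1}{\partial x}+\dfrac{\partial B_2}{\partial y}=0 & \text{in } U\setminus\overline{\Omega},\\[4pt] \operatorname{curl}\bm{B}:=\dfrac{\partial B_2}{\partial x}-\dfrac{\partial B_1}{\partial y}=0 & \text{in } U\setminus\overline{\Omega},\\ \bm{B}\cdot\bm{t}=f & \text{on } \partial\Omega,\\ \bm{B}\cdot\bm{n}=h & \text{on } \partial\Omega, \end{cases}$$ if and only if $f-\mathcal{H}h$ is real analytic on $\partial\Omega$, where $$\mathcal{H}h(\bm{v}) := \frac{1}{\pi}\lim_{\varepsilon\to0}\int_{\partial\Omega\setminus B_\varepsilon(\bm{v})} h(\bm{w})\,\frac{\bm{t}(\bm{v})\cdot(\bm{v}-\bm{w})}{|\bm{v}-\bm{w}|^2}\,\mathrm{d}\bm{w}, \qquad \bm{v}\in\partial\Omega.$$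
   Context: $B_\varepsilon(\bm{v})$ is the ball in $\mathbb{R}^2$ centred at $\bm{v}$ with radius $\varepsilon$, and $\mathrm{d}\bm{w}$ denotes integration with respect to arc length on $\partial\Omega$. Let $\mathbb{T}$ be the unit circle, identified with $[0,2\pi]$ (endpoints identified). That $\partial\Omega$ is real analytic means there exists a parameterisation $\bm{\gamma}=(\gamma_1,\gamma_2)\colon\mathbb{T}\to\partial\Omega$ (of the closed curve $\partial\Omega$) that is real analytic (each component is real analytic) and regular ($\bm{\gamma}'(t)\neq0$ for all $t\in\mathbb{T}$). A function $F$ on $\partial\Omega$ is real analytic at $\bm{v}_0=\bm{\gamma}(t_0)\in\partial\Omega$ if $t\mapsto F(\bm{\gamma}(t))$ is real analytic at $t_0$ (this is independent of the choice of such a parameterisation), and is real analytic on $\partial\Omega$ if it is real analytic at every point of $\partial\Omega$. The unit tangent field $\bm{t}$ is a continuous one (a fixed orientation of $\partial\Omega$), the same in the boundary condition and in $\mathcal{H}$. *)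

(* Defs.v *)
From mathcomp Require Import all_boot all_order all_algebra.
From mathcomp Require Import all_classical all_reals all_analysis.

Set Implicit Arguments.
Unset Strict Implicit.
Unset Printing Implicit Defensive.

Import Order.TTheory GRing.Theory Num.Theory.
Import numFieldNormedType.Exports.

Local Open Scope classical_set_scope.
Local Open Scope ring_scope.

Section Plane.
Context {R : realType}.
Implicit Types (u v w p : R * R) (A V Omega : set (R * R)).

Definition dot u v : R := u.1 * v.1 + u.2 * v.2.

(* The library's norm on [R * R] is the maximum norm. *)
Definition enorm u : R := Num.sqrt (dot u u).

Definition eball v (eps : R) : set (R * R) := [set w | enorm (w - v) < eps].

Definition boundary A : set (R * R) := closure A `\` interior A.

Definition path_in A (c : R -> R * R) :=
  {within `[0, 1], continuous c} /\ (forall s, s \in `[0, 1] -> A (c s)).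

Definition path_connected A :=
  forall u v, A u -> A v -> exists c, [/\ path_in A c, c 0 = u & c 1 = v].

(* Loops contract with both endpoints fixed; [H (s, r)] is the position at
   parameter [s] of the loop at time [r] of the homotopy. *)
Definition simply_connected A :=
  path_connected A /\
  forall c, path_in A c -> c 0 = c 1 ->
    exists H : R * R -> R * R,
      [/\ {within `[0, 1] `*` `[0, 1], continuous H},
          forall s r, s \in `[0, 1] -> r \in `[0, 1] -> A (H (s, r)),
          forall s, s \in `[0, 1] -> H (s, 0) = c s /\ H (s, 1) = c 0 &
          forall r, r \in `[0, 1] -> H (0, r) = c 0 /\ H (1, r) = c 0].

Definition analytic_at (g : R -> R) (t0 : R) :=
  exists (a : nat -> R) (r : R), 0 < r /\
    forall t, `|t - t0| < r -> pseries a (t - t0) @ \oo --> g t.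

Definition velocity (gamma : R -> R * R) (t : R) : R * R :=
  (derive1 (fst \o gamma) t, derive1 (snd \o gamma) t).

(* A map on the circle is encoded as a [2 * pi]-periodic map on the line. *)
Definition analytic_parameterisation (gamma : R -> R * R) (C : set (R * R)) :=
  [/\ forall t, gamma (t + 2 * pi) = gamma t,
      {in `[0, 2 * pi[ &, injective gamma},
      range gamma = C,
      forall t, analytic_at (fst \o gamma) t /\ analytic_at (snd \o gamma) t &
      forall t, velocity gamma t != 0].

(* Functions and fields on the curve are represented by maps on the whole plane,
   of which only the values on the curve matter. *)
Definition C1_on_curve (gamma : R -> R * R) (F : R * R -> R) :=
  (forall t, derivable (F \o gamma) t 1) /\ continuous (derive1 (F \o gamma)).

Definition analytic_on_curve (gamma : R -> R * R) (F : R * R -> R) :=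
  forall t0, analytic_at (F \o gamma) t0.

Definition unit_tangent (gamma : R -> R * R) (tau : R * R -> R * R) :=
  {within range gamma, continuous tau} /\
  forall t, enorm (tau (gamma t)) = 1 /\
            exists k : R, tau (gamma t) = k *: velocity gamma t.

Definition unit_outward_normal Omega (gamma : R -> R * R)
    (nu : R * R -> R * R) :=
  forall t, [/\ enorm (nu (gamma t)) = 1,
                dot (nu (gamma t)) (velocity gamma t) = 0 &
                \forall e \near 0^'+, ~ closure Omega (gamma t + e *: nu (gamma t))].

Definition arclength_integral (gamma : R -> R * R) A (F : R * R -> R) : R :=
  \int[lebesgue_measure]_(s in `[0, 2 * pi] `&` gamma @^-1` A)
    (F (gamma s) * enorm (velocity gamma s)).

Definition hilbert_transform (gamma : R -> R * R) (tau : R * R -> R * R)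
    (h : R * R -> R) v : R :=
  pi^-1 * lim (arclength_integral gamma (range gamma `\` eball v eps)
    (fun w => h w * (dot (tau v) (v - w) / enorm (v - w) ^+ 2))
    @[eps --> 0^'+]).

Definition partial_x (g : R * R -> R) p : R := 'D_(1, 0) g p.
Definition partial_y (g : R * R -> R) p : R := 'D_(0, 1) g p.

Definition divergence (B : R * R -> R * R) p : R :=
  partial_x (fst \o B) p + partial_y (snd \o B) p.
Definition curl (B : R * R -> R * R) p : R :=
  partial_x (snd \o B) p - partial_y (fst \o B) p.

(* [V] is meant to be open. *)
Definition C1_scalar V (g : R * R -> R) :=
  forall p, V p ->
    [/\ derivable g p (1, 0), derivable g p (0, 1),
        {for p, continuous (partial_x g)} & {for p, continuous (partial_y g)}].

Definition C1_field V (B : R * R -> R * R) :=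
  C1_scalar V (fst \o B) /\ C1_scalar V (snd \o B).

End Plane.

(* Main.v *)
(** Identify the plane with the complex numbers and extend the parameterisation to a
    conformal map [G] of a strip around the real line.  A field [B] is divergence and
    curl free exactly when [F = B1 - 'i B2] is holomorphic, and then [F (G z) * G' z] is a
    periodic holomorphic function on the half strip of the exterior side, with boundary
    value [|gamma'| (f -+ 'i h)].  On the circle such an extension exists if and only
    if [|gamma'| f - H (|gamma'| h)] is real analytic, [H] being the conjugate function:
    an extension kills half of the Fourier coefficients up to a geometrically decaying
    error, and conversely a real analytic function extends to a strip.

    The kernel of the Hilbert transform along the curve differs from that of [H] by a
    kernel [A] which is bounded and, integrated against [|gamma'| h], gives a function
    holomorphic on both half strips with the same boundary values, hence real analytic.
    So [|gamma'|] times the transform along the curve equals [H (|gamma'| h)] up to a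
    real analytic function, and [|gamma'|] itself is real analytic and positive. *)
Require Import Defs.
From mathcomp Require Import all_boot all_order all_algebra.
From mathcomp Require Import all_classical all_reals all_analysis.
From mathcomp Require Import measurable_realfun lebesgue_measure.
From mathcomp Require Import complex ring lra.
Set Implicit Arguments.
Unset Strict Implicit.
Unset Printing Implicit Defensive.
Import Order.TTheory GRing.Theory Num.Theory.
Import numFieldNormedType.Exports.
Local Open Scope classical_set_scope.
Local Open Scope ring_scope.
Local Open Scope complex_scope.

(** Contour integration is reduced to one form of Cauchy's theorem: the integral over a period of a
    periodic holomorphic function does not depend on the height. A field is merely continuous up to
    the curve, so the Fourier coefficients of its boundary values are compared with those at heights
    inside the strip by dominated convergence. The transform is truncated by Euclidean balls, and
    the parameters outside a ball need not form an interval. This geometry is bypassed: the real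
    part of [dg / (w - g)] times a function of [|w - g|] is an exact derivative, so the truncated
    integrals of this kernel vanish for every radius, and subtracting the value at the singularity
    leaves a bounded integrand. Two independent signs occur: [k] compares the tangent field with the
    parameterisation, [l] tells which half strip is mapped outside. The reflection
    [z -> conj (F (conj z))] exchanges the half strips and conjugates boundary values, which is why
    [l] disappears from the condition and [k] is left as a factor of [f]. *)

Notation re := complex.Re.
Notation im := complex.Im.
Notation cabs := Normc.normc.

(** * Complex differentiability *)

Section ComplexBasics.
Context {R : realType}.
Local Notation C := R[i].
Implicit Types (z w d : C) (f g : C -> C).

Lemma cabsD z w : cabs (z + w) <= cabs z + cabs w.
Proof. exact: le_normcD. Qed.

Lemma cabsN z : cabs (- z) = cabs z.
Proof. exact: normcN. Qed.

Lemma cabsBC z w : cabs (z - w) = cabs (w - z).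
Proof. by rewrite -cabsN opprB. Qed.

Lemma cabsM z w : cabs (z * w) = cabs z * cabs w.
Proof. exact: Normc.normcM. Qed.

Lemma cabsV z : cabs z^-1 = (cabs z)^-1.
Proof. exact: Normc.normcV. Qed.

Lemma cabs0 : cabs (0 : C) = 0.
Proof. exact: Normc.normc0. Qed.

Lemma cabs1 : cabs (1 : C) = 1.
Proof. exact: Normc.normc1. Qed.

Lemma cabsX z n : cabs (z ^+ n) = cabs z ^+ n.
Proof. by elim: n => [|n IH]; rewrite ?expr0 ?cabs1// !exprS cabsM IH. Qed.

Lemma cabs_ge0 z : 0 <= cabs z.
Proof. by case: z => a b; rewrite sqrtr_ge0. Qed.
Hint Resolve cabs_ge0 : core.

Lemma cabs_eq0 z : (cabs z == 0) = (z == 0).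
Proof.
apply/eqP/eqP => [|->]; last exact: cabs0.
exact: Normc.eq0_normc.
Qed.

Lemma cabs_gt0 z : (0 < cabs z) = (z != 0).
Proof. by rewrite lt_neqAle cabs_ge0 andbT eq_sym cabs_eq0. Qed.

Lemma cabs_sqr z : cabs z ^+ 2 = re z ^+ 2 + im z ^+ 2.
Proof. by case: z => a b /=; rewrite sqr_sqrtr// addr_ge0 ?sqr_ge0. Qed.

Lemma re_le_cabs z : `|re z| <= cabs z.
Proof.
by case: z => a b /=; rewrite -sqrtr_sqr ler_sqrt ?lerDl ?addr_ge0 ?sqr_ge0.
Qed.

Lemma im_le_cabs z : `|im z| <= cabs z.
Proof.
by case: z => a b /=; rewrite -sqrtr_sqr ler_sqrt ?lerDr ?addr_ge0 ?sqr_ge0.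
Qed.

Lemma cabs_le z : cabs z <= `|re z| + `|im z|.
Proof.
rewrite -(@ler_pXn2r _ 2) ?nnegrE ?addr_ge0// cabs_sqr sqrrD.
rewrite !real_normK ?num_real//.
have : 0 <= `|re z| * `|im z| by rewrite mulr_ge0.
by lra.
Qed.

Lemma cabs_real (x : R) : cabs (x%:C) = `|x|.
Proof. by rewrite /= expr0n addr0 sqrtr_sqr. Qed.

Lemma cabs_i : cabs ('i : C) = 1.
Proof. by rewrite /= expr0n add0r expr1n sqrtr1. Qed.

Lemma cabsB z w : cabs (z - w) <= cabs z + cabs w.
Proof. by rewrite -(cabsN w) cabsD. Qed.

Lemma cabs_subr z w : cabs z - cabs w <= cabs (z - w).
Proof. by rewrite lerBlDr -{1}(subrK w z) cabsD. Qed.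

Lemma cabsBtri u z w : cabs (z - w) <= cabs (z - u) + cabs (u - w).
Proof. by rewrite -(subrKA u) cabsD. Qed.

Lemma reD z w : re (z + w) = re z + re w. Proof. by case: z; case: w. Qed.
Lemma imD z w : im (z + w) = im z + im w. Proof. by case: z; case: w. Qed.
Lemma reN z : re (- z) = - re z. Proof. by case: z. Qed.
Lemma imN z : im (- z) = - im z. Proof. by case: z. Qed.
Lemma reB z w : re (z - w) = re z - re w. Proof. by rewrite reD reN. Qed.
Lemma imB z w : im (z - w) = im z - im w. Proof. by rewrite imD imN. Qed.
Lemma reM z w : re (z * w) = re z * re w - im z * im w.
Proof. by case: z; case: w. Qed.
Lemma imM z w : im (z * w) = re z * im w + im z * re w.
Proof. by case: z => a b; case: w => c d. Qed.
Definition reimE := (reD, imD, reN, imN, reM, imM).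

Lemma complex_eq z w : re z = re w -> im z = im w -> z = w.
Proof. by case: z => a b; case: w => c d /= -> ->. Qed.

Lemma complex_eta z : re z +i* im z = z. Proof. by case: z. Qed.

(** Epsilon-delta form with the real-valued modulus, so that estimates apply directly;
    [ccont_comp_cont] and [cont_ccont] translate to and from the topology of the plane. *)
Definition ccont f z := forall e : R, 0 < e ->
  exists2 d : R, 0 < d & forall w, cabs (w - z) < d -> cabs (f w - f z) < e.

Lemma ccont_cst a z : ccont (fun=> a) z.
Proof. by move=> e e0; exists 1 => // w _; rewrite subrr cabs0. Qed.

Lemma ccont_id z : ccont id z.
Proof. by move=> e e0; exists e. Qed.

Lemma ccont_local f g z (r : R) : 0 < r ->
  (forall w, cabs (w - z) < r -> f w = g w) -> ccont f z -> ccont g z.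
Proof.
move=> r0 fg cf e e0; have [d d0 H] := cf _ e0.
exists (Num.min d r); first by rewrite lt_min d0.
move=> w; rewrite lt_min => /andP[wd wr].
rewrite -!fg// ?H// subrr cabs0//.
Qed.

Lemma ccontN f z : ccont f z -> ccont (fun w => - f w) z.
Proof.
move=> cf e e0; have [d d0 H] := cf _ e0; exists d => // w /H.
by rewrite -opprD cabsN.
Qed.

Lemma ccontD f g z : ccont f z -> ccont g z -> ccont (fun w => f w + g w) z.
Proof.
move=> cf cg e e0.
have e2 : 0 < e / 2 by rewrite divr_gt0.
have [d d0 H] := cf _ e2; have [d' d0' H'] := cg _ e2.
exists (Num.min d d'); first by rewrite lt_min d0.
move=> w; rewrite lt_min => /andP[wd wr].
rewrite opprD addrACA (le_lt_trans (cabsD _ _))//.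
by rewrite [e]splitr ltrD ?H ?H'.
Qed.

Lemma ccontB f g z : ccont f z -> ccont g z -> ccont (fun w => f w - g w) z.
Proof. by move=> cf cg; apply: ccontD => //; exact: ccontN. Qed.

Lemma ccont_bnd f z : ccont f z -> exists2 d : R, 0 < d &
  forall w, cabs (w - z) < d -> cabs (f w) < cabs (f z) + 1.
Proof.
move=> cf; have [d d0 H] := cf _ ltr01; exists d => // w /H h.
by rewrite -ltrBlDl (le_lt_trans _ h)// cabs_subr.
Qed.

Lemma ccontM f g z : ccont f z -> ccont g z -> ccont (fun w => f w * g w) z.
Proof.
move=> cf cg e e0.
pose M := cabs (f z) + 1; pose N := cabs (g z) + 1.
have M0 : 0 < M by rewrite ltr_wpDl. have N0 : 0 < N by rewrite ltr_wpDl.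
have [d d0 H] := cf (e / 2 / N) ltac:(by rewrite !divr_gt0).
have [d' d0' H'] := cg (e / 2 / M) ltac:(by rewrite !divr_gt0).
have [d'' d0'' H''] := ccont_bnd cf.
exists (Num.min (Num.min d d') d''); first by rewrite !lt_min d0 d0'.
move=> w; rewrite !lt_min => /andP[/andP[wd wr] wr'].
have -> : f w * g w - f z * g z = f w * (g w - g z) + (f w - f z) * g z by ring.
rewrite (le_lt_trans (cabsD _ _))// !cabsM [e]splitr ltr_leD//.
  rewrite -(divfK (lt0r_neq0 M0) (e/2)) mulrC.
  by apply: ltr_pM => //; [exact: H'|exact: H''].
rewrite -(divfK (lt0r_neq0 N0) (e/2)); apply: ler_pM => //; first exact: ltW (H _ wd).
by rewrite lerDl.
Qed.

Lemma ccontV f z : f z != 0 -> ccont f z -> ccont (fun w => (f w)^-1) z.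
Proof.
move=> fz cf e e0.
have m0 : 0 < cabs (f z) by rewrite cabs_gt0.
set m := cabs (f z) in m0.
have [d d0 H] := cf (Num.min (m / 2) (e * m ^+ 2 / 2))
  ltac:(by rewrite lt_min !divr_gt0 ?mulr_gt0 ?exprn_gt0).
exists d => // w /H; rewrite lt_min => /andP[h1 h2].
have h3 : m / 2 < cabs (f w).
  have := cabs_subr (f z) (f w); rewrite cabsBC -/m => h.
  have := le_lt_trans h h1; lra.
have fw : f w != 0 by rewrite -cabs_gt0 (lt_trans _ h3)// divr_gt0.
have -> : (f w)^-1 - (f z)^-1 = - (f w - f z) / (f w * f z) by field; rewrite fz fw.
rewrite cabsM cabsN cabsV cabsM -/m ltr_pdivrMr ?mulr_gt0 ?cabs_gt0//.
apply: (lt_le_trans h2).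
rewrite expr2 [X in _ <= X](_ : _ = e * m * cabs (f w)); last by ring.
rewrite [X in X <= _](_ : _ = e * m * (m / 2)); last by ring.
by rewrite ler_pM2l ?mulr_gt0// ltW.
Qed.

Lemma ccont_comp f g z : ccont f z -> ccont g (f z) -> ccont (fun w => g (f w)) z.
Proof.
move=> cf cg e e0; have [d d0 H] := cg _ e0; have [d' d0' H'] := cf _ d0.
by exists d' => // w /H'/H.
Qed.

(* Caratheodory's form of the derivative: the difference quotient extends continuously. *)
Definition cder f z d := exists p : C -> C,
  [/\ ccont p z, p z = d & forall w, f w - f z = p w * (w - z)].

Lemma cderP f z d : cder f z d <-> forall e : R, 0 < e ->
  exists2 r : R, 0 < r & forall w, cabs (w - z) < r ->
    cabs (f w - f z - d * (w - z)) <= e * cabs (w - z).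
Proof.
split=> [[p [cp pz H]] e e0|H].
  have [r r0 h] := cp _ e0; exists r => // w /h wr.
  by rewrite H -mulrBl cabsM ler_wpM2r// ltW// -pz.
exists (fun w => if w == z then d else (f w - f z) / (w - z)); split; first last.
- move=> w; case: eqP => [->|/eqP wz]; first by rewrite !subrr mulr0.
  by rewrite divfK// subr_eq0.
- by rewrite eqxx.
- move=> e e0; have [r r0 h] := H (e / 2) ltac:(by rewrite divr_gt0).
  exists r => // w /h {}h; rewrite eqxx; case: eqP => [_|/eqP wz].
    by rewrite subrr cabs0.
  have wz' : w - z != 0 by rewrite subr_eq0.
  have -> : (f w - f z) / (w - z) - d = (f w - f z - d * (w - z)) / (w - z).
    by field.
  rewrite cabsM cabsV ltr_pdivrMr ?cabs_gt0// (le_lt_trans h)//.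
  by rewrite ltr_pM2r ?cabs_gt0// ltr_pdivrMr// ltr_pMr// ltr1n.
Qed.

Lemma cder_local f g z d (r : R) : 0 < r ->
  (forall w, cabs (w - z) < r -> f w = g w) -> cder f z d -> cder g z d.
Proof.
move=> r0 fg /cderP H; apply/cderP => e e0; have [s s0 h] := H _ e0.
exists (Num.min s r); first by rewrite lt_min s0.
move=> w; rewrite lt_min => /andP[ws wr].
by rewrite -!fg// ?h// subrr cabs0.
Qed.

(** Power series and Cauchy integrals are differentiated through this quadratic remainder, which
    avoids interchanging a derivative with a sum or an integral. *)
Lemma cder_quad f z d (r M : R) : 0 < r ->
  (forall w, cabs (w - z) < r -> cabs (f w - f z - d * (w - z)) <= M * cabs (w - z) ^+ 2) ->
  cder f z d.
Proof.
move=> r0 H; apply/cderP => e e0.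
have M0 : 0 < `|M| + 1 by rewrite ltr_wpDl.
exists (Num.min r (e / (`|M| + 1))); first by rewrite lt_min r0 divr_gt0.
move=> w; rewrite lt_min => /andP[wr we]; apply: (le_trans (H _ wr)).
rewrite expr2 mulrA ler_wpM2r//.
move: we; rewrite ltr_pdivlMr// => /ltW; apply: le_trans.
by rewrite mulrC ler_wpM2l// (le_trans (ler_norm _))// lerDl.
Qed.

Lemma cder_ccont f z d : cder f z d -> ccont f z.
Proof.
move=> [p [cp pz H]].
apply: (@ccont_local (fun w => p w * (w - z) + f z) _ _ 1) => //.
  by move=> w _; rewrite -H subrK.
apply: ccontD (ccont_cst _ _); apply: ccontM => //.
by apply: ccontB (ccont_cst _ _); exact: ccont_id.
Qed.

Lemma cder_cst a z : cder (fun=> a) z 0.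
Proof.
by exists (fun=> 0); split => //; [exact: ccont_cst|move=> w; rewrite subrr mul0r].
Qed.

Lemma cder_id z : cder id z 1.
Proof.
by exists (fun=> 1); split => //; [exact: ccont_cst|move=> w; rewrite mul1r].
Qed.

Lemma cderD f g z a b : cder f z a -> cder g z b -> cder (fun w => f w + g w) z (a + b).
Proof.
move=> [p [cp <- hp]] [q [cq <- hq]]; exists (fun w => p w + q w); split => //.
  exact: ccontD.
by move=> w; rewrite opprD addrACA hp hq mulrDl.
Qed.

Lemma cderM f g z a b : cder f z a -> cder g z b ->
  cder (fun w => f w * g w) z (a * g z + f z * b).
Proof.
move=> cf cg; move: (cf) (cg) => [p [cp <- hp]] [q [cq <- hq]].
exists (fun w => p w * g w + f z * q w); split => //.
  apply: ccontD; apply: ccontM => //; first exact: cder_ccont cg.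
  exact: ccont_cst.
move=> w; have -> : f w * g w - f z * g z = (f w - f z) * g w + f z * (g w - g z) by ring.
by rewrite hp hq; ring.
Qed.

Lemma cderZ c f z a : cder f z a -> cder (fun w => c * f w) z (c * a).
Proof. by move=> cf; have := cderM (cder_cst c z) cf; rewrite mul0r add0r. Qed.

Lemma cderN f z a : cder f z a -> cder (fun w => - f w) z (- a).
Proof.
move=> /(cderZ (-1)); rewrite mulN1r.
by apply: cder_local (ltr01) _ => w _; rewrite mulN1r.
Qed.

Lemma cderB f g z a b : cder f z a -> cder g z b -> cder (fun w => f w - g w) z (a - b).
Proof. by move=> cf cg; apply: cderD => //; exact: cderN. Qed.

Lemma cderV f z a : f z != 0 -> cder f z a ->
  cder (fun w => (f w)^-1) z (- a / f z ^+ 2).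
Proof.
move=> fz cf; move: (cf) => [p [cp <- hp]].
have cff := cder_ccont cf.
have [r r0 fw0] : exists2 r : R, 0 < r & forall w, cabs (w - z) < r -> f w != 0.
  have [r r0 H] := cff (cabs (f z)) ltac:(by rewrite cabs_gt0); exists r => // w /H.
  by apply: contraTneq => ->; rewrite sub0r cabsN ltxx.
pose q w := - p w * (f w * f z)^-1.
have cq : ccont q z.
  apply: ccontM; first exact: ccontN.
  apply: ccontV; first by rewrite mulf_neq0.
  by apply: ccontM => //; exact: ccont_cst.
have : cder (fun w => (f z)^-1 + q w * (w - z)) z (- p z / f z ^+ 2).
  exists q; split => // w; first by rewrite subrr mulr0 addr0 addrAC subrr add0r.
apply: cder_local r0 _ => w /fw0 fw.
rewrite /q; have := hp w => h.
have -> : - p w / (f w * f z) * (w - z) = - (p w * (w - z)) / (f w * f z) by ring.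
by rewrite -h; field; rewrite fw fz.
Qed.

Lemma cder_comp f g z a b : cder f z a -> cder g (f z) b ->
  cder (fun w => g (f w)) z (b * a).
Proof.
move=> cf [q [cq <- hq]]; move: (cf) => [p [cp <- hp]].
exists (fun w => q (f w) * p w); split => //.
  by apply: ccontM => //; apply: ccont_comp => //; exact: cder_ccont cf.
by move=> w; rewrite hq hp mulrA.
Qed.

(** Continuity of the derivative is part of the notion: it feeds the fundamental theorem of
    calculus, the bounds by compactness and the mean value estimates. Second derivatives are
    supplied separately where they are needed. *)
Definition hol1 (D : set C) f f' := forall z, D z -> cder f z (f' z) /\ ccont f' z.

End ComplexBasics.
#[export] Hint Resolve cabs_ge0 : core.

(** * Real and complex derivatives, the exponential *)

Section RealBridge.
Context {R : realType}.
Local Notation C := R[i].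
Implicit Types (z w d : C) (f g : C -> C).

Lemma is_derive_slope (g p : R -> R) (x d : R) :
  {for x, continuous p} -> p x = d -> (forall t, g t - g x = p t * (t - x)) ->
  is_derive x 1 g d.
Proof.
move=> cp pd H.
have L : (fun h : R => h^-1 *: (g (h *: (1 : R) + x) - g x)) @ 0^' --> d.
  have -> : d = p (0 + x) by rewrite add0r.
  apply: (@cvg_trans _ ((fun h : R => p (h + x)) @ 0^')).
    apply: near_eq_cvg; near=> h.
    have h0 : h != 0 by near: h; exact: nbhs_dnbhs_neq.
    by rewrite H -[h *: 1]/(h * 1) -[_ *: _]/(_ * _) mulr1 addrK mulrCA mulVf// mulr1.
  apply: cvg_within_filter.
  apply: (@cvg_comp _ _ _ (fun h => h + x) p _ (nbhs (0 + x))); last first.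
    by rewrite add0r.
  apply: cvgD; [exact: cvg_id|exact: cvg_cst].
split; last by apply: cvg_lim.
by apply/cvg_ex; exists d.
Unshelve. all: by end_near. Qed.

Lemma mvt_dist (g dg : R -> R) (a b c e : R) :
  (forall x, Num.min a b <= x <= Num.max a b -> is_derive x 1 g (dg x)) ->
  (forall x, Num.min a b <= x <= Num.max a b -> `|dg x - c| <= e) ->
  `|g b - g a - c * (b - a)| <= e * `|b - a|.
Proof.
wlog ab : a b / a <= b => [W D B|].
  case: (leP a b) => [ab|/ltW ba]; first exact: W.
  have := W b a ba; rewrite minC maxC => /(_ D B).
 have -> : `|g b - g a - c * (b - a)| = `|g a - g b - c * (a - b)|.
    by rewrite -[LHS]normrN; congr `|_|; ring.
  by rewrite (distrC b a).
rewrite min_l// max_r// => D B.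
have [E|nE] := eqVneq a b; first by rewrite E !subrr mulr0 subrr normr0 mulr0.
have lab : a < b by rewrite lt_neqAle nE.
have D' x : x \in `[a, b] -> is_derive x 1 g (dg x) by rewrite in_itv/=; exact: D.
have D1 x : x \in `]a, b[ -> is_derive x 1 g (dg x).
  by move=> xab; apply: D'; move: x xab; exact: subset_itv_oo_cc.
have cg : {within `[a, b], continuous g}.
  by apply: derivable_within_continuous => x /D'[].
have [x xab E] := MVT lab D1 cg; rewrite E.
rewrite -mulrBl normrM ler_wpM2r//; apply: B.
by move: xab; rewrite in_itv/= => /andP[/ltW -> /ltW ->].
Qed.

Lemma ccont_comp_cont (T : topologicalType) (p : T -> C) (x : T) f :
  {for x, continuous (fun t => re (p t))} -> {for x, continuous (fun t => im (p t))} ->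
  ccont f (p x) ->
  {for x, continuous (fun t => re (f (p t)))} /\
  {for x, continuous (fun t => im (f (p t)))}.
Proof.
move=> c1 c2 cf.
have H (e : R) : 0 < e -> \forall t \near x, cabs (f (p t) - f (p x)) < e.
  move=> e0; have [d d0 h] := cf _ e0.
  have d2 : 0 < d / 2 by rewrite divr_gt0.
  move/cvgrPdist_lt : c1 => /(_ _ d2) c1; move/cvgrPdist_lt : c2 => /(_ _ d2) c2.
  near=> t; apply: h; rewrite (le_lt_trans (cabs_le _))// reB imB [d]splitr.
  by rewrite ltrD// distrC; near: t.
by split; apply/cvgrPdist_lt => e /H; apply: filterS => t;
  rewrite cabsBC; apply: le_lt_trans; rewrite -?reB -?imB ?re_le_cabs ?im_le_cabs.
Unshelve. all: by end_near. Qed.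

Lemma cont_ccont f z :
  {for (re z, im z), continuous (fun q : R * R => re (f (q.1 +i* q.2)))} ->
  {for (re z, im z), continuous (fun q : R * R => im (f (q.1 +i* q.2)))} ->
  ccont f z.
Proof.
move=> c1 c2 e e0.
have e2 : 0 < e / 2 by rewrite divr_gt0.
move/cvgrPdist_lt : c1 => /(_ _ e2) c1; move/cvgrPdist_lt : c2 => /(_ _ e2) c2.
have : \forall q \near (re z, im z), cabs (f (q.1 +i* q.2) - f z) < e.
  near=> q; rewrite (le_lt_trans (cabs_le _))// reB imB [e]splitr -[in f z](complex_eta z).
  by rewrite ltrD// distrC; near: q.
move=> [[A B] [/= /nbhs_ballP[a /= a0 hA] /nbhs_ballP[b /= b0 hB]] AB].
exists (Num.min a b); first by rewrite lt_min a0.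
move=> w; rewrite lt_min => /andP[wa wb].
rewrite -[in f w](complex_eta w); apply: (AB (re w, im w)); split => /=.
  by apply: hA; rewrite /ball/= distrC -reB (le_lt_trans (re_le_cabs _)).
by apply: hB; rewrite /ball/= distrC -imB (le_lt_trans (im_le_cabs _)).
Unshelve. all: by end_near. Qed.

Lemma continuous_lineC z0 h x :
  {for x, continuous (fun t : R => re (z0 + t%:C * h))} /\
  {for x, continuous (fun t : R => im (z0 + t%:C * h))}.
Proof.
split.
  have -> : (fun t : R => re (z0 + t%:C * h)) = (fun t => re z0 + t * re h).
    by apply/funext => t; rewrite reD reM /= mul0r subr0.
  by apply: cvgD; [exact: cvg_cst|apply: cvgMl; exact: cvg_id].
have -> : (fun t : R => im (z0 + t%:C * h)) = (fun t => im z0 + t * im h).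
  by apply/funext => t; rewrite imD imM /= mul0r addr0.
by apply: cvgD; [exact: cvg_cst|apply: cvgMl; exact: cvg_id].
Qed.

Lemma cder_line f z0 h (x : R) d : cder f (z0 + x%:C * h) d ->
  is_derive x 1 (fun t : R => re (f (z0 + t%:C * h))) (re (d * h)) /\
  is_derive x 1 (fun t : R => im (f (z0 + t%:C * h))) (im (d * h)).
Proof.
move=> [p [cp pd H]].
have cph : ccont (fun w => p w * h) (z0 + x%:C * h) by apply: ccontM => //; exact: ccont_cst.
have [c1 c2] := continuous_lineC z0 h x.
have [c3 c4] := ccont_comp_cont c1 c2 cph.
have E t : f (z0 + t%:C * h) - f (z0 + x%:C * h) = p (z0 + t%:C * h) * h * (t - x)%:C.
  by rewrite H rmorphB/=; ring.
split; apply: (is_derive_slope _ _ _); [exact: c3| | |exact: c4| | ]; rewrite /= ?pd//.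
- by move=> t; rewrite -reB E reM/= mulr0 subr0.
- by move=> t; rewrite -imB E imM/= mulr0 add0r.
Qed.

(** The increment from [z] to [w] is split at the corner [m] of an axis-parallel path; the mean
    value theorem on both legs compares it with [fx z] and [fy z], and the equation
    [fy z = 'i * fx z] merges the two linear terms. *)
Lemma cder_cauchy_riemann f (fx fy : C -> C) z (r : R) : 0 < r ->
  (forall w, cabs (w - z) < r ->
    [/\ is_derive (re w) 1 (fun x => re (f (x +i* im w))) (re (fx w)),
        is_derive (re w) 1 (fun x => im (f (x +i* im w))) (im (fx w)),
        is_derive (im w) 1 (fun y => re (f (re w +i* y))) (re (fy w)) &
        is_derive (im w) 1 (fun y => im (f (re w +i* y))) (im (fy w))]) ->
  ccont fx z -> ccont fy z -> fy z = 'i * fx z ->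
  cder f z (fx z).
Proof.
move=> r0 D cx cy CR; apply/cderP => e e0.
(* Four real estimates, for two legs and two components, share the error. *)
have e4 : 0 < e / 4 by rewrite divr_gt0.
have [r1 r10 h1] := cx _ e4; have [r2 r20 h2] := cy _ e4.
exists (Num.min r (Num.min r1 r2)); first by rewrite !lt_min r0 r10.
move=> w; rewrite !lt_min => /and3P[wr wr1 wr2].
pose m := re z +i* im w.
have hx x : Num.min (re z) (re w) <= x <= Num.max (re z) (re w) ->
    cabs ((x +i* im w) - z) <= cabs (w - z).
  move=> xb; rewrite -(@ler_pXn2r _ 2) ?nnegrE// !cabs_sqr !reB !imB lerD2r.
  rewrite -(real_normK (num_real (_ - _))) -[leRHS](real_normK (num_real (_ - _))) ler_pXn2r ?nnegrE//=.
  move: xb; rewrite ge_min le_max; case: (leP (re z) (re w)) => ?.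
    by move=> /andP[/orP[] ? /orP[] ?]; rewrite !ger0_norm; lra.
  by move=> /andP[/orP[] ? /orP[] ?]; rewrite !ler0_norm; lra.
have hy y : Num.min (im z) (im w) <= y <= Num.max (im z) (im w) ->
    cabs ((re z +i* y) - z) <= cabs (w - z).
  move=> xb; rewrite -(@ler_pXn2r _ 2) ?nnegrE// !cabs_sqr !reB !imB /= subrr expr0n add0r.
  apply: (@le_trans _ _ ((im w - im z) ^+ 2)); last by rewrite lerDr sqr_ge0.
  rewrite -(real_normK (num_real (_ - _))) -[leRHS](real_normK (num_real (_ - _))) ler_pXn2r ?nnegrE//=.
  move: xb; rewrite ge_min le_max; case: (leP (im z) (im w)) => ?.
    by move=> /andP[/orP[] ? /orP[] ?]; rewrite !ger0_norm; lra.
  by move=> /andP[/orP[] ? /orP[] ?]; rewrite !ler0_norm; lra.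
have A1 : `|re (f w) - re (f m) - re (fx z) * (re w - re z)| <= e / 4 * `|re w - re z|.
  rewrite -[in f w](complex_eta w).
  apply: (@mvt_dist (fun x => re (f (x +i* im w))) (fun x => re (fx (x +i* im w)))) => x /hx h.
    by have [] := D (x +i* im w) (le_lt_trans h wr).
  by rewrite -reB (le_trans (re_le_cabs _))// ltW// h1// (le_lt_trans h).
have A2 : `|im (f w) - im (f m) - im (fx z) * (re w - re z)| <= e / 4 * `|re w - re z|.
  rewrite -[in f w](complex_eta w).
  apply: (@mvt_dist (fun x => im (f (x +i* im w))) (fun x => im (fx (x +i* im w)))) => x /hx h.
    by have [] := D (x +i* im w) (le_lt_trans h wr).
  by rewrite -imB (le_trans (im_le_cabs _))// ltW// h1// (le_lt_trans h).
have A3 : `|re (f m) - re (f z) - re (fy z) * (im w - im z)| <= e / 4 * `|im w - im z|.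
  rewrite -[in f z](complex_eta z).
  apply: (@mvt_dist (fun y => re (f (re z +i* y))) (fun y => re (fy (re z +i* y)))) => x /hy h.
    by have [] := D (re z +i* x) (le_lt_trans h wr).
  by rewrite -reB (le_trans (re_le_cabs _))// ltW// h2// (le_lt_trans h).
have A4 : `|im (f m) - im (f z) - im (fy z) * (im w - im z)| <= e / 4 * `|im w - im z|.
  rewrite -[in f z](complex_eta z).
  apply: (@mvt_dist (fun y => im (f (re z +i* y))) (fun y => im (fy (re z +i* y)))) => x /hy h.
    by have [] := D (re z +i* x) (le_lt_trans h wr).
  by rewrite -imB (le_trans (im_le_cabs _))// ltW// h2// (le_lt_trans h).
have B1 : `|re w - re z| <= cabs (w - z) by rewrite -reB re_le_cabs.
have B2 : `|im w - im z| <= cabs (w - z) by rewrite -imB im_le_cabs.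
have B1' : e / 4 * `|re w - re z| <= e / 4 * cabs (w - z) by rewrite ler_wpM2l// ltW.
have B2' : e / 4 * `|im w - im z| <= e / 4 * cabs (w - z) by rewrite ler_wpM2l// ltW.
rewrite (le_trans (cabs_le _))//.
have -> : re (f w - f z - fx z * (w - z)) =
  (re (f w) - re (f m) - re (fx z) * (re w - re z)) +
  (re (f m) - re (f z) - re (fy z) * (im w - im z)).
  by rewrite CR !reimE /=; ring.
have -> : im (f w - f z - fx z * (w - z)) =
  (im (f w) - im (f m) - im (fx z) * (re w - re z)) +
  (im (f m) - im (f z) - im (fy z) * (im w - im z)).
  by rewrite CR !reimE /=; ring.
move: (ler_normD (re (f w) - re (f m) - re (fx z) * (re w - re z)) (re (f m) - re (f z) - re (fy z) * (im w - im z))).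
move: (ler_normD (im (f w) - im (f m) - im (fx z) * (re w - re z)) (im (f m) - im (f z) - im (fy z) * (im w - im z))).
lra.
Qed.

Definition cexp z : C := (expR (re z) * cos (im z)) +i* (expR (re z) * sin (im z)).

Lemma cexpD z w : cexp (z + w) = cexp z * cexp w.
Proof.
apply: complex_eq; rewrite ?reM ?imM /= reD imD expRD.
  by rewrite cosD; ring.
by rewrite sinD; ring.
Qed.

Lemma cexp0 : cexp 0 = 1.
Proof. by apply: complex_eq; rewrite /= expR0 ?cos0 ?sin0; ring. Qed.

Lemma cabs_cexp z : cabs (cexp z) = expR (re z).
Proof.
rewrite /= !exprMn -mulrDr cos2Dsin2 mulr1 sqrtr_sqr ger0_norm ?expR_ge0//.
Qed.

Lemma cexp_neq0 z : cexp z != 0.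
Proof. by rewrite -cabs_gt0 cabs_cexp expR_gt0. Qed.

Lemma cexpN z : cexp (- z) = (cexp z)^-1.
Proof.
by apply: (mulfI (cexp_neq0 z)); rewrite -cexpD subrr cexp0 divff// cexp_neq0.
Qed.

Lemma cexp_natM n z : cexp (n%:R * z) = cexp z ^+ n.
Proof.
elim: n => [|n IH]; first by rewrite mul0r cexp0.
by rewrite -addn1 natrD mulrDl mul1r cexpD IH addn1 exprSr.
Qed.

Lemma ccont_cexp z : ccont cexp z.
Proof.
have c1 : {for (re z, im z), continuous (fun q : R * R => expR q.1)}.
  by apply: continuous_comp; [exact: cvg_fst|exact: continuous_expR].
apply: cont_ccont => /=.
  apply: cvgM; first exact: c1.
  by apply: (@continuous_comp _ _ _ snd cos); [exact: cvg_snd|exact: continuous_cos].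
apply: cvgM; first exact: c1.
by apply: (@continuous_comp _ _ _ snd sin); [exact: cvg_snd|exact: continuous_sin].
Qed.

Lemma cder_cexp z : cder cexp z (cexp z).
Proof.
apply: (@cder_cauchy_riemann cexp cexp (fun w => 'i * cexp w) z 1) => //.
- move=> w _; split => /=.
  + have := is_deriveM (is_derive_expR (re w)) (is_derive_cst (cos (im w)) (re w) 1).
    by move/is_derive_eq; apply; rewrite scaler0 add0r /= -[_ *: _]/(_ * _) mulrC.
  + have := is_deriveM (is_derive_expR (re w)) (is_derive_cst (sin (im w)) (re w) 1).
    by move/is_derive_eq; apply; rewrite scaler0 add0r /= -[_ *: _]/(_ * _) mulrC.
  + have := is_deriveZ (expR (re w)) (is_derive_cos (im w)).
    move/is_derive_eq; apply; rewrite -[_ *: _]/(_ * _); ring.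
  + have := is_deriveZ (expR (re w)) (is_derive_sin (im w)).
    move/is_derive_eq; apply; rewrite -[_ *: _]/(_ * _); ring.
- exact: ccont_cexp.
- by apply: ccontM; [exact: ccont_cst|exact: ccont_cexp].
Qed.

End RealBridge.

(** * Integrals of bounded functions *)

Section BoundedIntegrals.
Context {R : realType}.
Local Notation C := R[i].
Local Notation mu := (@lebesgue_measure R).
Implicit Types (D : set R) (f g : R -> R).

(** On a set of finite measure this implies integrability and, unlike integrability, it is stable
    under products. *)
Definition bmf D f := measurable_fun D f /\ exists M, forall x, D x -> `|f x| <= M.

Definition finD D := measurable D /\ (mu D < +oo)%E.

Lemma finD_itv (a b : R) : finD `[a, b].
Proof.
split; first exact: measurable_itv.
by rewrite lebesgue_measure_itv /=; case: ifP => // _; rewrite -EFinB ltry.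
Qed.

Lemma bmf_bounded D f : bmf D f -> [bounded f x | x in D].
Proof.
move=> [_ [M H]]; exists M; split; first exact: num_real.
by move=> M' MM' x Dx /=; rewrite (le_trans (H _ Dx))// ltW.
Qed.

Lemma bmf_integrable D f : finD D -> bmf D f -> mu.-integrable D (EFin \o f).
Proof.
by move=> [mD fD] bf; apply: measurable_bounded_integrable => //;
  [exact: bf.1|exact: bmf_bounded].
Qed.

Lemma bmf_cst D r : measurable D -> bmf D (fun=> r).
Proof. by move=> mD; split; [exact: measurable_cst|exists `|r|]. Qed.

Lemma bmfM D f g : bmf D f -> bmf D g -> bmf D (fun x => f x * g x).
Proof.
move=> [mf [M H]] [mg [N K]]; split; first exact: measurable_funM.
by exists (M * N) => x Dx; rewrite normrM ler_pM ?H ?K.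
Qed.

Lemma bmf_norm D f : bmf D f -> bmf D (fun x => `|f x|).
Proof.
move=> [mf [M H]]; split; first exact: measurableT_comp.
by exists M => x Dx; rewrite normr_id H.
Qed.

Lemma bmf_cont (a b : R) f : {within `[a, b], continuous f} -> bmf `[a, b] f.
Proof.
move=> cf; split; first exact: subspace_continuous_measurable_fun.
have := compact_bounded (continuous_compact cf (@segment_compact R a b)).
move=> [M [_ H]]; exists (M + 1) => x abx.
by apply: (H (M + 1)); [rewrite ltrDl|exists x].
Qed.

(** Inversion takes the value 0 at 0 and is discontinuous there, so that point is split off. Kernels
    can then be inverted without excluding the diagonal. *)
Lemma measurable_inv : measurable_fun setT (fun x : R => x^-1).
Proof.
have m1 : measurable [set 0 : R] by exact: measurable_set1.
rewrite -(setvU [set 0]); apply/measurable_funU => //; first exact: measurableC.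
split; last exact: measurable_fun_set1.
apply: open_continuous_measurable_fun; first by apply: closed_openC; exact: (accessible_closed_set1 (hausdorff_accessible (@Rhausdorff R))).
by move=> x; rewrite inE/= => /eqP x0; exact: inv_continuous.
Qed.

Lemma Rint_bound D f (M : R) : finD D -> bmf D f -> (forall x, D x -> `|f x| <= M) ->
  `|\int[mu]_(x in D) f x| <= M * fine (mu D).
Proof.
move=> fD bf H; rewrite (le_trans (le_normr_Rintegral _ _))//; first exact: fD.1.
  exact: bmf_integrable.
rewrite -Rintegral_cst; last exact: fD.1.
apply: le_Rintegral => //; first exact: fD.1.
- by apply: bmf_integrable => //; exact: bmf_norm.
- by apply: bmf_integrable => //; apply: bmf_cst; exact: fD.1.
Qed.

(** The exceptional set is countable rather than null because those that occur below are empty or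
    fibres of [ez] on the line. *)
Lemma Rint_dct D (N : set R) (f_ : nat -> R -> R) f (M : R) : finD D -> countable N ->
  (forall n, measurable_fun D (f_ n)) -> bmf D f ->
  (forall n x, D x -> `|f_ n x| <= M) ->
  (forall x, D x -> ~ N x -> f_ n x @[n --> \oo] --> f x) ->
  \int[mu]_(x in D) f_ n x @[n --> \oo] --> \int[mu]_(x in D) f x.
Proof.
move=> fD cN mf bf fM cvf.
have N0 : mu N = 0%E by exact: countable_lebesgue_measure0.
have mN : measurable N by exact: countable_measurable.
have [] := @dominated_convergence _ _ _ mu D fD.1
  (fun n x => (f_ n x)%:E) (EFin \o f) (fun=> M%:E).
- by move=> n; apply/measurable_EFinP; exact: mf.
- by apply/measurable_EFinP; exact: bf.1.
- exists N; split => // x /=; apply: contra_notP => Nx Dx.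
  by apply: cvg_EFin; [exact: nearW|exact: cvf].
- by apply: (@bmf_integrable D (fun=> M)) => //; apply: bmf_cst; exact: fD.1.
- by apply: aeW => x n Dx; rewrite lee_fin; exact: fM.
move=> _ _ h; apply: fine_cvg; rewrite fineK; first exact: h.
apply: integral_fune_fin_num; first exact: fD.1.
exact: bmf_integrable.
Qed.

(* [g] need not extend continuously to the endpoints. *)
Lemma FTC_bounded (G g : R -> R) (a b : R) : a <= b ->
  {within `[a, b], continuous G} -> bmf `[a, b] g ->
  (forall x, a < x < b -> is_derive x 1 G (g x)) ->
  (forall x, a < x < b -> {for x, continuous g}) ->
  \int[mu]_(x in `[a, b]) g x = G b - G a.
Proof.
rewrite le_eqVlt => /predU1P[<- _ _ _ _|ab cG bg dG cg].
  by rewrite set_itv1 Rintegral_set1 subrr.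
have ig : mu.-integrable `[a, b] (EFin \o g) by apply: bmf_integrable bg; exact: finD_itv.
pose F x := \int[mu]_(t in `[a, x]) g t.
have cF : {within `[a, b], continuous F}.
  by apply: parameterized_integral_continuous; rewrite // ltW.
have dF x : x \in `]a, b[ -> is_derive x 1 (fun t => F t - G t) 0.
  rewrite in_itv/= => xab.
  have [ax xb] := andP xab.
  have [] := @continuous_FTC1_closed R g a x b xb ig ax (cg _ xab).
  move=> d1 d2.
  have dF : is_derive x 1 F (g x).
    apply: DeriveDef; first exact: d1.
    rewrite -derive1E; exact: d2.
  by have := is_deriveB dF (dG _ xab); rewrite subrr.
have cFG : {within `[a, b], continuous (fun t => F t - G t)}.
  by move=> t; apply: continuousB; [exact: cF|exact: cG].
have [x _] := MVT ab dF cFG; rewrite mul0r => /eqP; rewrite subr_eq0 => /eqP.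
have -> : F a = 0 by rewrite /F set_itv1 Rintegral_set1.
by rewrite sub0r /F => h; rewrite -[LHS](subrK (G b)) h; ring.
Qed.

Definition mcf D (u : R -> C) :=
  measurable_fun D (fun x => re (u x)) /\ measurable_fun D (fun x => im (u x)).

Definition cbm D (u : R -> C) :=
  mcf D u /\ exists M, forall x, D x -> cabs (u x) <= M.

Definition cint D (u : R -> C) : C :=
  (\int[mu]_(x in D) re (u x)) +i* (\int[mu]_(x in D) im (u x)).

Implicit Types u v : R -> C.

Lemma eq_cint D u v : (forall x, D x -> u x = v x) -> cint D u = cint D v.
Proof.
by move=> uv; congr (_ +i* _); apply: eq_Rintegral => x /set_mem/uv ->.
Qed.

Lemma cbm_bmf D u : cbm D u -> bmf D (fun x => re (u x)) /\ bmf D (fun x => im (u x)).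
Proof.
move=> [[m1 m2] [M H]]; split; split => //; exists M => x /H; apply: le_trans.
  exact: re_le_cabs.
exact: im_le_cabs.
Qed.

Lemma bmf_cbm D u : bmf D (fun x => re (u x)) -> bmf D (fun x => im (u x)) -> cbm D u.
Proof.
move=> [m1 [M H]] [m2 [N K]]; split; first by split.
by exists (M + N) => x Dx; rewrite (le_trans (cabs_le _))// lerD ?H ?K.
Qed.

Lemma mcf_cst D z : mcf D (fun=> z).
Proof. by split; exact: measurable_cst. Qed.

Lemma mcfN D u : mcf D u -> mcf D (fun x => - u x).
Proof.
move=> [m1 m2]; split.
  by under eq_fun do rewrite reN; exact: measurable_funN.
by under eq_fun do rewrite imN; exact: measurable_funN.
Qed.

Lemma mcfD D u v : mcf D u -> mcf D v -> mcf D (fun x => u x + v x).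
Proof.
move=> [m1 m2] [m3 m4]; split.
  by under eq_fun do rewrite reD; exact: measurable_funD.
by under eq_fun do rewrite imD; exact: measurable_funD.
Qed.

Lemma mcfB D u v : mcf D u -> mcf D v -> mcf D (fun x => u x - v x).
Proof. by move=> bf bg; apply: mcfD => //; exact: mcfN. Qed.

Lemma mcfM D u v : mcf D u -> mcf D v -> mcf D (fun x => u x * v x).
Proof.
move=> [m1 m2] [m3 m4]; split.
  by under eq_fun do rewrite reM; apply: measurable_funB; exact: measurable_funM.
by under eq_fun do rewrite imM; apply: measurable_funD; exact: measurable_funM.
Qed.

Lemma mcfV D u : mcf D u -> mcf D (fun x => (u x)^-1).
Proof.
move=> [m1 m2].
have m3 : measurable_fun D (fun x => (re (u x) ^+ 2 + im (u x) ^+ 2)^-1).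
  apply: (measurableT_comp measurable_inv).
  by apply: measurable_funD; exact: measurable_funX.
split.
  rewrite [X in measurable_fun _ X](_ : _ = fun x => re (u x) * (re (u x) ^+ 2 + im (u x) ^+ 2)^-1).
    exact: measurable_funM.
  by apply/funext => x; case: (u x).
rewrite [X in measurable_fun _ X](_ : _ = fun x => - (im (u x) * (re (u x) ^+ 2 + im (u x) ^+ 2)^-1)).
  by apply: measurable_funN; exact: measurable_funM.
by apply/funext => x; case: (u x).
Qed.

Lemma cbm_cst D z : cbm D (fun=> z).
Proof. by split; [exact: mcf_cst|exists (cabs z)]. Qed.

Lemma cbmN D u : cbm D u -> cbm D (fun x => - u x).
Proof.
by move=> [m [M H]]; split; [exact: mcfN|exists M => x /H; rewrite cabsN].
Qed.

Lemma cbmD D u v : cbm D u -> cbm D v -> cbm D (fun x => u x + v x).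
Proof.
move=> [mf [M H]] [mg [N K]]; split; first exact: mcfD.
by exists (M + N) => x Dx; rewrite (le_trans (cabsD _ _))// lerD ?H ?K.
Qed.

Lemma cbmB D u v : cbm D u -> cbm D v -> cbm D (fun x => u x - v x).
Proof. by move=> bf bg; apply: cbmD => //; exact: cbmN. Qed.

Lemma cbmM D u v : cbm D u -> cbm D v -> cbm D (fun x => u x * v x).
Proof.
move=> [mf [M H]] [mg [N K]]; split; first exact: mcfM.
by exists (M * N) => x Dx; rewrite cabsM ler_pM ?H ?K.
Qed.

Definition rcont u := continuous (fun x => re (u x)) /\ continuous (fun x => im (u x)).

Lemma cbm_cont (a b : R) u : rcont u -> cbm `[a, b] u.
Proof.
by move=> [c1 c2]; apply: bmf_cbm; apply: bmf_cont; apply: continuous_subspaceT.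
Qed.

Lemma cintD D u v : finD D -> cbm D u -> cbm D v ->
  cint D (fun x => u x + v x) = cint D u + cint D v.
Proof.
move=> fD /cbm_bmf[a b] /cbm_bmf[c d]; apply: complex_eq; rewrite /cint /=.
  rewrite -RintegralD; [|exact: fD.1|exact: bmf_integrable|exact: bmf_integrable].
  by apply: eq_Rintegral => x _; rewrite reD.
rewrite -RintegralD; [|exact: fD.1|exact: bmf_integrable|exact: bmf_integrable].
by apply: eq_Rintegral => x _; rewrite imD.
Qed.

Lemma cintZ D z u : finD D -> cbm D u -> cint D (fun x => z * u x) = z * cint D u.
Proof.
move=> fD /cbm_bmf[a b].
have i1 (r : R) : mu.-integrable D (EFin \o (fun x => r * re (u x))).
  by apply: bmf_integrable => //; apply: bmfM => //; apply: bmf_cst; exact: fD.1.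
have i2 (r : R) : mu.-integrable D (EFin \o (fun x => r * im (u x))).
  by apply: bmf_integrable => //; apply: bmfM => //; apply: bmf_cst; exact: fD.1.
apply: complex_eq; rewrite ?reM ?imM /cint /=.
  rewrite -!RintegralZl; [|exact: fD.1|exact: bmf_integrable|exact: fD.1|exact: bmf_integrable].
  by rewrite -RintegralB//; [apply: eq_Rintegral => x _; rewrite reM|exact: fD.1].
rewrite -!RintegralZl; [|exact: fD.1|exact: bmf_integrable|exact: fD.1|exact: bmf_integrable].
by rewrite -RintegralD//; [apply: eq_Rintegral => x _; rewrite imM|exact: fD.1].
Qed.

Lemma cintN D u : finD D -> cbm D u -> cint D (fun x => - u x) = - cint D u.
Proof.
move=> fD bu; rewrite -mulN1r -cintZ//.
by apply: eq_cint => x _; rewrite mulN1r.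
Qed.

Lemma cintB D u v : finD D -> cbm D u -> cbm D v ->
  cint D (fun x => u x - v x) = cint D u - cint D v.
Proof. by move=> fD bu bv; rewrite cintD ?cintN//; exact: cbmN. Qed.

Lemma cint_bound D u (M : R) : finD D -> cbm D u -> (forall x, D x -> cabs (u x) <= M) ->
  cabs (cint D u) <= 2 * M * fine (mu D).
Proof.
move=> fD /cbm_bmf[a b] H; rewrite (le_trans (cabs_le _))// /cint/=.
have -> : 2 * M * fine (mu D) = M * fine (mu D) + M * fine (mu D) by ring.
by apply: lerD; apply: Rint_bound => // x /H; apply: le_trans;
  [exact: re_le_cabs|exact: im_le_cabs].
Qed.

Lemma cint_cst D z : finD D -> cint D (fun=> z) = z * (fine (mu D))%:C.
Proof.
move=> fD; apply: complex_eq; rewrite ?reM ?imM /cint /= Rintegral_cst; [|exact: fD.1| |exact: fD.1].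
  by rewrite mulr0 subr0.
by rewrite mulr0 add0r.
Qed.

Definition ccvg (z_ : nat -> C) (z : C) := cabs (z_ n - z) @[n --> \oo] --> 0.

Lemma ccvgP (z_ : nat -> C) z : ccvg z_ z <->
  (re (z_ n) @[n --> \oo] --> re z) /\ (im (z_ n) @[n --> \oo] --> im z).
Proof.
split=> [/cvgr0Pnorm_lt H|[/cvgrPdist_lt H /cvgrPdist_lt K]].
  split; apply/cvgrPdist_lt => e /H; apply: filterS => n; rewrite ger0_norm//;
  apply: le_lt_trans; rewrite distrC -?reB -?imB ?re_le_cabs ?im_le_cabs//.
apply/cvgr0Pnorm_lt => e e0.
have e2 : 0 < e / 2 by rewrite divr_gt0.
near=> n; rewrite ger0_norm// (le_lt_trans (cabs_le _))// reB imB [e]splitr.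
by rewrite ltrD// distrC; near: n; [exact: H|exact: K].
Unshelve. all: by end_near. Qed.

Lemma cint_dct D (N : set R) (u_ : nat -> R -> C) u (M : R) : finD D -> countable N ->
  (forall n, mcf D (u_ n)) -> cbm D u ->
  (forall n x, D x -> cabs (u_ n x) <= M) ->
  (forall x, D x -> ~ N x -> ccvg (u_ ^~ x) (u x)) ->
  ccvg (fun n => cint D (u_ n)) (cint D u).
Proof.
move=> fD cN mu_ /cbm_bmf[b1 b2] uM cvu.
apply/ccvgP; split; apply: (@Rint_dct _ N _ _ M) => //.
- by move=> n; have [] := mu_ n.
- by move=> n x /(uM n); apply: le_trans; exact: re_le_cabs.
- by move=> x Dx Nx; have /ccvgP[] := cvu _ Dx Nx.
- by move=> n; have [] := mu_ n.
- by move=> n x /(uM n); apply: le_trans; exact: im_le_cabs.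
- by move=> x Dx Nx; have /ccvgP[] := cvu _ Dx Nx.
Qed.

End BoundedIntegrals.

(** * Integrals of holomorphic functions over a period *)

Section PeriodIntegrals.
Context {R : realType}.
Local Notation C := R[i].
Local Notation mu := (@lebesgue_measure R).
Implicit Types (f g : C -> C) (u v : R -> C).

(** The map [exp (i z)] from the cylinder of period [2 * pi] to the punctured plane; the lower half
    plane goes outside the unit circle. *)
Definition ez (z : C) : C := cexp ('i * z).

Lemma ezD z w : ez (z + w) = ez z * ez w.
Proof. by rewrite /ez mulrDr cexpD. Qed.

Lemma ezN z : ez (- z) = (ez z)^-1.
Proof. by rewrite /ez mulrN cexpN. Qed.

Lemma ez_neq0 z : ez z != 0. Proof. exact: cexp_neq0. Qed.

Lemma ez_real (t : R) : ez t%:C = cos t +i* sin t.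
Proof.
rewrite /ez /cexp reM imM /= !(mul0r, mulr0, mul1r, mulr1, subr0, addr0, add0r, oppr0).
by rewrite expR0 !mul1r.
Qed.

Lemma cabs_ez z : cabs (ez z) = expR (- im z).
Proof. by rewrite cabs_cexp reM /= mul0r mul1r sub0r. Qed.

Lemma cabs_ez_real (t : R) : cabs (ez t%:C) = 1.
Proof. by rewrite cabs_ez /= oppr0 expR0. Qed.

Lemma ez_2pi : ez (2 * pi)%:C = 1 :> C.
Proof.
by rewrite ez_real mulrC mulr_natr cos2pi sin2pi.
Qed.

Lemma ez_per z : ez (z + (2 * pi)%:C) = ez z.
Proof. by rewrite ezD ez_2pi mulr1. Qed.

Lemma conj_ez_real (t : R) : conjc (ez t%:C) = (ez t%:C)^-1.
Proof. by rewrite -ezN -rmorphN !ez_real /= cosN sinN. Qed.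

Lemma cder_ez z : cder ez z ('i * ez z).
Proof.
rewrite mulrC; apply: (@cder_comp _ (fun w => 'i * w) cexp); last exact: cder_cexp.
by have := cderZ 'i (cder_id z); rewrite mulr1.
Qed.

Lemma ccont_ez z : ccont ez z.
Proof. exact: cder_ccont (cder_ez z). Qed.

Lemma re_conj (z : C) : re (conjc z) = re z. Proof. by case: z. Qed.
Lemma im_conj (z : C) : im (conjc z) = - im z. Proof. by case: z. Qed.
Lemma cabs_conj (z : C) : cabs (conjc z) = cabs z.
Proof. by case: z => a b /=; rewrite sqrrN. Qed.

Lemma cabs_sqr_conj (z : C) : (cabs z ^+ 2)%:C = z * conjc z.
Proof. by case: z => a b; apply: complex_eq; rewrite cabs_sqr ?reM ?imM /=; ring. Qed.

Lemma rect_bounded f (a b c d : R) :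
  (forall z, a <= re z <= b -> c <= im z <= d -> ccont f z) ->
  exists M, forall z, a <= re z <= b -> c <= im z <= d -> cabs (f z) <= M.
Proof.
move=> cf.
have cA : compact (`[a, b] `*` `[c, d] : set (R * R)).
  by apply: compact_setX; exact: segment_compact.
have cc q : (`[a, b] `*` `[c, d]) q ->
    {for q, continuous (fun q : R * R => re (f (q.1 +i* q.2)))} /\
    {for q, continuous (fun q : R * R => im (f (q.1 +i* q.2)))}.
  rewrite /= !in_itv/= => -[h1 h2].
  apply: (@ccont_comp_cont _ _ (fun q : R * R => q.1 +i* q.2)); last exact: cf.
    exact: cvg_fst.
  exact: cvg_snd.
have [M1 [_ H1]] := compact_bounded (continuous_compact (@continuous_in_subspaceT _ _ _
  (fun q : R * R => re (f (q.1 +i* q.2))) (fun q Aq => (cc q (set_mem Aq)).1)) cA).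
have [M2 [_ H2]] := compact_bounded (continuous_compact (@continuous_in_subspaceT _ _ _
  (fun q : R * R => im (f (q.1 +i* q.2))) (fun q Aq => (cc q (set_mem Aq)).2)) cA).
exists (M1 + 1 + (M2 + 1)) => z h1 h2; rewrite (le_trans (cabs_le _))// lerD//.
  apply: (H1 (M1 + 1)); rewrite ?ltrDl//; exists (re z, im z); rewrite /= ?in_itv/= ?h1//.
  by rewrite complex_eta.
apply: (H2 (M2 + 1)); rewrite ?ltrDl//; exists (re z, im z); rewrite /= ?in_itv/= ?h1//.
by rewrite complex_eta.
Qed.

Definition rder u (t : R) (d : C) :=
  is_derive t 1 (fun s => re (u s)) (re d) /\ is_derive t 1 (fun s => im (u s)) (im d).

Lemma rder_horiz f (t y : R) d : cder f (t +i* y) d -> rder (fun s => f (s +i* y)) t d.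
Proof.
move=> fd.
have E (s : R) : s +i* y = (0 +i* y) + s%:C * 1.
  by apply: complex_eq; rewrite reimE /=; ring.
have := @cder_line _ f (0 +i* y) 1 t d; rewrite -E mulr1 => /(_ fd)[h1 h2].
by split; [move: h1|move: h2]; under eq_fun do rewrite -E.
Qed.

Lemma rder_vert f (t y : R) d : cder f (t +i* y) d ->
  rder (fun s => f (t +i* s)) y ('i * d).
Proof.
move=> fd.
have E (s : R) : t +i* s = t%:C + s%:C * 'i.
  by apply: complex_eq; rewrite reimE /=; ring.
have := @cder_line _ f t%:C 'i y d; rewrite -E mulrC => /(_ fd)[h1 h2].
by split; [move: h1|move: h2]; under eq_fun do rewrite -E.
Qed.

Lemma rcont_horiz f (y : R) : (forall t, ccont f (t +i* y)) -> rcont (fun t => f (t +i* y)).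
Proof.
move=> cf; split => t.
  apply: (proj1 (@ccont_comp_cont _ _ (fun s : R => s +i* y) t f _ _ _)) => //.
  exact: cvg_cst.
apply: (proj2 (@ccont_comp_cont _ _ (fun s : R => s +i* y) t f _ _ _)) => //.
exact: cvg_cst.
Qed.

Lemma is_derive_cont (g : R -> R) (x d : R) : is_derive x 1 g d -> {for x, continuous g}.
Proof. by case=> /derivable1_diffP/differentiable_continuous. Qed.

Lemma rder_rcont u (du : R -> C) : (forall t, rder u t (du t)) -> rcont u.
Proof. by move=> d; split=> t; have [h1 h2] := d t; [exact: is_derive_cont h1|exact: is_derive_cont h2]. Qed.

Lemma cint_FTC u (du : R -> C) (a b : R) : a <= b ->
  (forall t, rder u t (du t)) -> rcont du -> cint `[a, b] du = u b - u a.
Proof.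
move=> ab d [c1 c2].
have [k1 k2] := rder_rcont d.
apply: complex_eq.
  rewrite reB; apply: (@FTC_bounded R (fun s => re (u s)) (fun s => re (du s)) a b) => //.
  - exact: continuous_subspaceT.
  - by apply: bmf_cont; exact: continuous_subspaceT.
  - by move=> x _; have [] := d x.
  - by move=> x _; exact: c1.
rewrite imB; apply: (@FTC_bounded R (fun s => im (u s)) (fun s => im (du s)) a b) => //.
- exact: continuous_subspaceT.
- by apply: bmf_cont; exact: continuous_subspaceT.
- by move=> x _; have [] := d x.
- by move=> x _; exact: c2.
Qed.

Definition I0 : set R := `[0, 2 * pi].
Lemma finI0 : finD I0. Proof. exact: finD_itv. Qed.
Lemma pi2_ge0 : 0 <= 2 * pi :> R. Proof. by rewrite mulr_ge0// pi_ge0. Qed.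
Lemma pi2_gt0 : 0 < 2 * pi :> R. Proof. by rewrite mulr_gt0// pi_gt0. Qed.
Lemma muI0 : fine (mu I0) = 2 * pi.
Proof.
rewrite lebesgue_measure_itv /= lte_fin pi2_gt0 -EFinB /= subr0//.
Qed.

Lemma re_cint D u : re (cint D u) = \int[mu]_(x in D) re (u x). Proof. by []. Qed.
Lemma im_cint D u : im (cint D u) = \int[mu]_(x in D) im (u x). Proof. by []. Qed.

Lemma cint_conj D u : finD D -> cbm D u -> cint D (fun s => conjc (u s)) = conjc (cint D u).
Proof.
move=> fD /cbm_bmf[b1 b2]; apply: complex_eq; rewrite ?re_conj ?im_conj ?re_cint ?im_cint.
  by apply: eq_Rintegral => x _; rewrite re_conj.
rewrite -[RHS]mulN1r -RintegralZl; [|exact: fD.1|exact: bmf_integrable].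
by apply: eq_Rintegral => x _; rewrite im_conj mulN1r.
Qed.

Definition per (f : C -> C) := forall z, f (z + (2 * pi)%:C) = f z.

Lemma is_derive0_const (g : R -> R) (a b : R) :
  (forall x, a < x < b -> is_derive x 1 g 0) ->
  forall x y, a < x < b -> a < y < b -> g x = g y.
Proof.
move=> H x y /andP[ax xb] /andP[ay yb].
have := @mvt_dist R g (fun=> 0) x y 0 0; rewrite !mul0r.
have B t : Num.min x y <= t <= Num.max x y -> a < t < b.
  rewrite ge_min le_max => /andP[/orP[] h1 /orP[] h2]; lra.
move=> /(_ (fun t h => H t (B t h)))/=; rewrite subr0 normr0 => /(_ (fun _ _ => lexx _)).
by rewrite subr0 normr_le0 subr_eq0 => /eqP.
Qed.

(** Cauchy's theorem in this setting: the derivative in the height is the integral of ['i * f'] over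
    a period, which vanishes by periodicity. *)
Lemma period_integral_const f f' (a b : R) :
  hol1 (fun z => a < im z < b) f f' -> per f ->
  forall y1 y2, a < y1 < b -> a < y2 < b ->
  cint I0 (fun t => f (t +i* y1)) = cint I0 (fun t => f (t +i* y2)).
Proof.
move=> hf pf.
have cf z : a < im z < b -> ccont f z by move=> /hf[/cder_ccont].
have zero y : a < y < b -> cint I0 (fun t => 'i * f' (t +i* y)) = 0.
  move=> yab; rewrite cintZ; [|exact: finI0| ]; last first.
    by apply: cbm_cont; apply: rcont_horiz => t; have [] := hf (t +i* y) yab.
  rewrite (@cint_FTC (fun t => f (t +i* y))).
  - rewrite (_ : f ((2 * pi) +i* y) = f (0 +i* y)) ?subrr ?mulr0//.
    by rewrite -[RHS]pf; congr f; apply: complex_eq; rewrite reimE /=; ring.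
  - exact: pi2_ge0.
  - by move=> t; apply: rder_horiz; have [] := hf (t +i* y) yab.
  - by apply: rcont_horiz => t; have [] := hf (t +i* y) yab.
(* Differentiation under the integral concerns real functions, so it is done for [re] and [im] at
   once. *)
have key (p : C -> R) : p = @complex.Re R \/ p = @complex.Im R -> forall y, a < y < b ->
    is_derive y 1 (fun y => \int[mu]_(t in I0) p (f (t +i* y))) 0.
  move=> pE y yab.
  have ccp (q : R -> C) : rcont q -> continuous (fun t => p (q t)) by case: pE => -> [].
  have rdp (q : R -> C) t d : rder q t d -> is_derive t 1 (fun s => p (q s)) (p d).
    by case: pE => -> [].
  have cap (z : C) : `|p z| <= cabs z by case: pE => ->; [exact: re_le_cabs|exact: im_le_cabs].
  (* Halfway to the ends of []a, b[], so that [f'] is bounded on a compact rectangle and a constant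
     dominates the partial derivatives. *)
  pose u := (a + y) / 2; pose v := (y + b) / 2.
  have [ay yb] := andP yab.
  have uv t : u < t < v -> a < t < b by rewrite /u /v; lra.
  have uv' t : u <= t <= v -> a < t < b by rewrite /u /v; lra.
  have [M HM] := @rect_bounded f' 0 (2 * pi) u v (fun z _ h => (hf z (uv' _ h)).2).
  have D1 x t : u < x < v -> is_derive x 1 (fun y => p (f (t +i* y))) (p ('i * f' (t +i* x))).
    move=> /uv xab; have [h _] := hf (t +i* x) xab.
    exact: rdp (rder_vert h).
  have uyv : u < y < v by rewrite /u /v; lra.
  have Iy : `]u, v[%classic y by rewrite /= in_itv.
  have intf x : `]u, v[%classic x -> mu.-integrable I0 (EFin \o (fun t => p (f (t +i* x)))).
    rewrite /= in_itv /= => /uv xab; apply: bmf_integrable finI0 _.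
    by apply: bmf_cont; apply: continuous_subspaceT; apply: ccp;
      apply: rcont_horiz => t; exact: cf.
  have der x t : `]u, v[%classic x -> I0 t -> derivable (fun y => p (f (t +i* y))) x 1.
    by rewrite /= in_itv /= => /D1 h _; have [] := h t.
  have dE x t : u < x < v -> partial1of2 (fun y t => p (f (t +i* y))) x t = p ('i * f' (t +i* x)).
    by move=> /D1 h; rewrite partial1of2E; have [_ ->] := h t.
  have Gub x t : `]u, v[%classic x -> I0 t ->
      `|partial1of2 (fun y t => p (f (t +i* y))) x t| <= `|M|.
    rewrite /= in_itv /= => xuv; rewrite /I0 /= in_itv /= => tI; rewrite dE//.
    rewrite (le_trans (cap _))// cabsM cabs_i mul1r (le_trans (HM _ _ _))//= ?ler_norm//.
    by case/andP : xuv => /ltW -> /ltW ->.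
  have iG : mu.-integrable I0 (EFin \o (fun=> `|M|)).
    by apply: bmf_integrable finI0 _; apply: bmf_cst; exact: finI0.1.
  have G0 (t : R) : 0 <= (fun=> `|M|) t :> R by [].
  have dd := @derivable_under_integral _ _ _ mu _ I0 finI0.1 y u v Iy intf der _ G0 iG Gub.
  have ddE := @differentiation_under_integral _ _ _ mu _ I0 finI0.1 y u v Iy intf der _ G0 iG Gub.
  apply: DeriveDef; first exact: dd.
  rewrite -derive1E ddE.
  rewrite (_ : Rintegral _ _ _ = \int[mu]_(t in I0) p ('i * f' (t +i* y))).
    by have := zero y yab; case: pE => -> h; rewrite -?re_cint -?im_cint h.
  by apply: eq_Rintegral => t _; apply: dE.
move=> y1 y2 h1 h2; apply: complex_eq; rewrite ?re_cint ?im_cint.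
  exact: (is_derive0_const (key (@complex.Re R) (or_introl erefl))).
exact: (is_derive0_const (key (@complex.Im R) (or_intror erefl))).
Qed.

End PeriodIntegrals.

(** * Fourier coefficients *)

Section Fourier.
Context {R : realType}.
Local Notation C := R[i].
Local Notation mu := (@lebesgue_measure R).
Implicit Types (u v : R -> C) (t s : R).
Local Notation I0 := (@I0 R).
Local Notation finI0 := (@finI0 R).

Lemma conjcM (z w : C) : conjc (z * w) = conjc z * conjc w.
Proof. exact: rmorphM. Qed.
Lemma conjcB (z w : C) : conjc (z - w) = conjc z - conjc w.
Proof. exact: rmorphB. Qed.
Lemma conjcX (z : C) n : conjc (z ^+ n) = conjc z ^+ n.
Proof. exact: rmorphXn. Qed.
Lemma conj_ezV_real t : conjc ((ez t%:C)^-1) = ez t%:C :> C.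
Proof. by rewrite -conj_ez_real conjcK. Qed.
Definition conjE := (conjcM, conjcB, conjcX, @conj_ez_real R, conj_ezV_real, @conjcK R).

Lemma rcont_cst (c : C) : rcont (fun=> c : C).
Proof. by split => t; exact: cvg_cst. Qed.

Lemma rcontM u v : rcont u -> rcont v -> rcont (fun t => u t * v t).
Proof.
move=> [a b] [c d]; split.
  rewrite (_ : (fun _ => _) = (fun t => re (u t) * re (v t) - im (u t) * im (v t))).
    by move=> t; apply: cvgB; apply: cvgM; [exact: a|exact: c|exact: b|exact: d].
  by apply/funext => t; rewrite reM.
rewrite (_ : (fun _ => _) = (fun t => re (u t) * im (v t) + im (u t) * re (v t))).
  by move=> t; apply: cvgD; apply: cvgM; [exact: a|exact: d|exact: b|exact: c].
by apply/funext => t; rewrite imM.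
Qed.

Lemma rcont_ez : rcont (fun t : R => ez t%:C).
Proof.
split => t.
  rewrite (_ : (fun _ => _) = cos); first exact: continuous_cos.
  by apply/funext => s; rewrite ez_real.
rewrite (_ : (fun _ => _) = sin); first exact: continuous_sin.
by apply/funext => s; rewrite ez_real.
Qed.

Lemma rcont_conj u : rcont u -> rcont (fun t => conjc (u t)).
Proof.
move=> [a b]; split.
  rewrite (_ : (fun _ => _) = (fun t => re (u t)))//.
  by apply/funext => t; rewrite re_conj.
rewrite (_ : (fun _ => _) = (fun t => - im (u t))).
  by move=> t; apply: cvgN; exact: b.
by apply/funext => t; rewrite im_conj.
Qed.

Lemma rcontX u n : rcont u -> rcont (fun t => u t ^+ n).
Proof.
move=> cu; elim: n => [|n IH]; first exact: rcont_cst.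
rewrite (_ : (fun _ => _) = (fun t => u t * u t ^+ n)); first exact: rcontM.
by apply/funext => t; rewrite exprS.
Qed.

Lemma rcont_ezV : rcont (fun t : R => (ez t%:C)^-1).
Proof.
rewrite (_ : (fun _ => _) = (fun t => conjc (ez t%:C))).
  exact: rcont_conj rcont_ez.
by apply/funext => t; rewrite conj_ez_real.
Qed.

Lemma cbm_ezX n : cbm I0 (fun t : R => ez t%:C ^+ n).
Proof. exact: cbm_cont (rcontX _ rcont_ez). Qed.

Lemma cbm_ezVX n : cbm I0 (fun t : R => (ez t%:C)^-1 ^+ n).
Proof. exact: cbm_cont (rcontX _ rcont_ezV). Qed.

Lemma rder_ezX n t : rder (fun t : R => ez t%:C ^+ n) t ('i * n%:R * ez t%:C ^+ n).
Proof.
have E s : s%:C = s +i* 0 :> C by [].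
have En z : ez z ^+ n = ez (n%:R * z) :> C.
  by rewrite /ez mulrCA cexp_natM.
have h : cder (fun z => ez (n%:R * z)) (t +i* 0) ('i * ez (n%:R * (t +i* 0)) * n%:R).
  apply: (@cder_comp _ (fun z => n%:R * z) ez); last exact: cder_ez.
  by have := cderZ (n%:R) (cder_id (t +i* 0 : C)); rewrite mulr1.
have := rder_horiz h; rewrite -En -E -mulrA (mulrC (ez _ ^+ n)) mulrA.
by rewrite (_ : (fun s : R => ez (n%:R * (s +i* 0))) = (fun s : R => ez s%:C ^+ n))//;
  apply/funext => s; rewrite En.
Qed.

Lemma cint_ezX n : (0 < n)%N -> cint I0 (fun t : R => ez t%:C ^+ n) = 0.
Proof.
move=> n0.
have c : ('i * n%:R : C) != 0.
  by rewrite mulf_neq0// ?pnatr_eq0 -?lt0n// -cabs_eq0 cabs_i oner_eq0.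
apply: (mulfI c); rewrite mulr0 -cintZ; [|exact: finI0|exact: cbm_ezX].
rewrite (@cint_FTC _ (fun t => ez t%:C ^+ n)); first 1 last.
- exact: pi2_ge0.
- by move=> t; exact: rder_ezX.
- by apply: rcontM (rcont_cst _) _; exact: rcontX rcont_ez.
by rewrite ez_2pi -[0%:C]/(0:C) /ez mulr0 cexp0 subrr.
Qed.

Lemma cint_ezVX n : (0 < n)%N -> cint I0 (fun t : R => (ez t%:C)^-1 ^+ n) = 0.
Proof.
move=> n0; rewrite (eq_cint (v := fun t : R => conjc (ez t%:C ^+ n))).
  by rewrite cint_conj ?cint_ezX ?conjc0//; [exact: finI0|exact: cbm_ezX].
by move=> t _; rewrite !conjE.
Qed.

(** Fourier coefficients of index [n] and [- n], without the factor [1 / (2 * pi)]. *)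
Definition fcp u n : C := cint I0 (fun s => u s * (ez s%:C)^-1 ^+ n).
Definition fcm u n : C := cint I0 (fun s => u s * ez s%:C ^+ n).

Lemma fcm_conj u n : cbm I0 u -> fcm u n = conjc (fcp (fun s => conjc (u s)) n).
Proof.
move=> bu; rewrite /fcp /fcm -cint_conj.
- by apply: eq_cint => s _; rewrite !conjE.
- exact: finI0.
- apply: cbmM; last exact: cbm_ezVX.
  move: bu => [[m1 m2] [M HM]]; split; last by exists M => x /HM; rewrite cabs_conj.
  split; first by under eq_fun do rewrite re_conj.
  by under eq_fun do rewrite im_conj; exact: measurable_funN.
Qed.

Lemma cbm_conj D u : cbm D u -> cbm D (fun s => conjc (u s)).
Proof.
move=> [[m1 m2] [M HM]]; split; last by exists M => x /HM; rewrite cabs_conj.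
split; first by under eq_fun do rewrite re_conj.
by under eq_fun do rewrite im_conj; exact: measurable_funN.
Qed.

(** Removing one mode at a time makes Bessel's inequality an induction: removing mode [n] leaves the
    later coefficients unchanged and lowers [sqint] by exactly the contribution of that mode. *)
Fixpoint bessel_rem u N : R -> C :=
  if N is n.+1 then fun s => bessel_rem u n s - (fcp u n / (2 * pi)%:C) * ez s%:C ^+ n else u.

Lemma bessel_rem_cbm u N : cbm I0 u -> cbm I0 (bessel_rem u N).
Proof.
move=> bu; elim: N => [|n IH] //=; apply: cbmB => //.
by apply: cbmM; [exact: cbm_cst|exact: cbm_ezX].
Qed.

Lemma pi2C_neq0 : ((2 * pi)%:C : C) != 0.
Proof. by rewrite -cabs_eq0 cabs_real normr_eq0 gt_eqF// pi2_gt0. Qed.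

Lemma bessel_rem_fcp u N m : cbm I0 u -> (N <= m)%N -> fcp (bessel_rem u N) m = fcp u m.
Proof.
move=> bu; elim: N => [|n IH] // nm; rewrite -IH ?(ltnW nm)// /fcp /=.
(* The subtracted integral is zero because [n < m]. *)
have -> : cint I0 (fun s => bessel_rem u n s * (ez s%:C)^-1 ^+ m) =
  cint I0 (fun s => bessel_rem u n s * (ez s%:C)^-1 ^+ m) - (fcp u n / (2 * pi)%:C) * cint I0 (fun s : R => (ez s%:C)^-1 ^+ (m - n)).
  by rewrite cint_ezVX ?subn_gt0// mulr0 subr0.
have b2 := @cbm_ezVX (m - n).
rewrite -cintZ//; last exact: finI0.
rewrite -cintB; [|exact: finI0| |].
- apply: eq_cint => s _; rewrite mulrBl; congr (_ - _).
  have e1 : ez s%:C ^+ n * (ez s%:C)^-1 ^+ n = 1 :> C.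
    by rewrite -exprMn mulfV ?expr1n// ez_neq0.
  by rewrite -[RHS]mulr1 -e1 -(subnK (ltnW nm)) exprD addnK; ring.
- by apply: cbmM (bessel_rem_cbm _ bu) (cbm_ezVX _).
- by apply: cbmM (cbm_cst _ _) _.
Qed.

Definition sqint u : R := \int[mu]_(s in I0) (cabs (u s) ^+ 2).

Lemma sqint_re u : cbm I0 u -> sqint u = re (cint I0 (fun s => u s * conjc (u s))).
Proof. by move=> bu; apply: eq_Rintegral => s _; rewrite -cabs_sqr_conj. Qed.

Lemma bessel_rem_sqint u N : cbm I0 u ->
  sqint (bessel_rem u N) = sqint u - \sum_(0 <= n < N) cabs (fcp u n) ^+ 2 / (2 * pi).
Proof.
move=> bu; elim: N => [|n IH]; first by rewrite big_geq// subr0.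
rewrite big_nat_recr// opprD addrA -IH.
set r := bessel_rem u n; have br : cbm I0 r by exact: bessel_rem_cbm.
pose c := fcp u n / (2 * pi)%:C.
have bcr := cbm_conj br.
rewrite !sqint_re//; last by apply: (@bessel_rem_cbm u n.+1).
have F : fcp r n = fcp u n by apply: bessel_rem_fcp.
(* Expansion of [|r - c e_n| ^ 2], where [e_n] denotes the [n]-th mode. *)
have E : cint I0 (fun s => r s * conjc (r s)) - conjc c * fcp r n - c * conjc (fcp r n) + c * conjc c * (2 * pi)%:C =
  cint I0 (fun s => bessel_rem u n.+1 s * conjc (bessel_rem u n.+1 s)).
  rewrite -muI0 -cint_cst; last exact: finI0.
  have b1 : cbm I0 (fun s => r s * (ez s%:C)^-1 ^+ n) by apply: cbmM br (cbm_ezVX _).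
  rewrite -cint_conj//; last exact: finI0.
  rewrite /fcp -!cintZ//; try exact: finI0; last exact: cbm_conj.
  have b2 : cbm I0 (fun x => conjc c * (r x * (ez x%:C)^-1 ^+ n)).
    by apply: cbmM (cbm_cst _ _) _.
  have b3 : cbm I0 (fun x => c * conjc (r x * (ez x%:C)^-1 ^+ n)).
    by apply: cbmM (cbm_cst _ _) _; exact: cbm_conj.
  have b4 : cbm I0 (fun s => r s * conjc (r s)) by apply: cbmM.
  rewrite -!(cintB, cintD)//; try exact: finI0; try exact: cbm_cst.
  - apply: eq_cint => s _; rewrite [bessel_rem u n.+1 s]/= -/r -/(fcp u n) -/c.
    rewrite !conjE.
    have e1 : ez s%:C ^+ n * (ez s%:C)^-1 ^+ n = 1 :> C.
      by rewrite -exprMn mulfV ?expr1n// ez_neq0.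
    rewrite -[X in _ + X = _]mulr1 -[in LHS]e1; ring.
  - by apply: cbmB => //; apply: cbmB.
  - by apply: cbmB.
rewrite -E F /c.
have -> : (fcp u n / (2 * pi)%:C) ^* = conjc (fcp u n) / (2 * pi)%:C.
  by rewrite conjcM; congr (_ * _); rewrite -fmorphV conjc_real.
have -> : forall X Y : C, X - Y / (2 * pi)%:C * fcp u n - fcp u n / (2 * pi)%:C * Y + fcp u n / (2 * pi)%:C * (Y / (2 * pi)%:C) * (2 * pi)%:C = X - (fcp u n * Y) / (2 * pi)%:C.
  by move: pi2C_neq0; generalize ((2 * pi)%:C : C) => p p0 X Y; field.
rewrite reB -cabs_sqr_conj; congr (_ - _).
by rewrite -fmorphV -rmorphM.
Qed.

Lemma bessel u N : cbm I0 u -> \sum_(0 <= n < N) cabs (fcp u n) ^+ 2 <= 2 * pi * sqint u.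
Proof.
move=> bu; have := bessel_rem_sqint N bu.
have : 0 <= sqint (bessel_rem u N) by apply: Rintegral_ge0 => s _; exact: sqr_ge0.
move=> + E; rewrite E subr_ge0 -mulr_suml ler_pdivrMr ?pi2_gt0//.
by rewrite mulrC.
Qed.

(** The Riemann-Lebesgue lemma: the terms of the convergent series in Bessel's inequality tend to
    zero. *)
Lemma fcp_cvg0 u : cbm I0 u -> cabs (fcp u n) @[n --> \oo] --> 0.
Proof.
move=> bu.
have c : cvgn (series (fun n => cabs (fcp u n) ^+ 2)).
  apply: nondecreasing_is_cvgn.
    by apply: nondecreasing_series => n _ _; exact: sqr_ge0.
  exists (2 * pi * sqint u) => _ [n _ <-].
  exact: bessel.
have /cvgrPdist_lt h := cvg_series_cvg_0 c.
apply/cvgrPdist_lt => e e0; have := h _ (exprn_gt0 2 e0).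
apply: filterS => n; rewrite !sub0r !normrN (ger0_norm (sqr_ge0 _)) ger0_norm// ltr_pXn2r ?nnegrE//; first exact: cabs_ge0.
exact: ltW.
Qed.

(* [kap z s = cot ((z - s) / 2) / 2 + 'i / 2], with value [0] on the diagonal. *)
Definition kap (z : C) s : C := 'i * ez z / (ez z - ez s%:C).

Lemma geo_sum (x : C) N : x != 1 -> \sum_(1 <= n < N.+1) x ^+ n = x * (1 - x ^+ N) / (1 - x).
Proof.
move=> x1; have x1' : 1 - x != 0 by rewrite subr_eq0 eq_sym.
elim: N => [|N IH]; first by rewrite big_geq// expr0 subrr mulr0 mul0r.
by rewrite big_nat_recr//= IH exprS; field.
Qed.

(* The partial sums minus their limit are Fourier coefficients of [(u s - u t) * kap], which vanish at infinity by Bessel's inequality. *)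
Lemma dini_plus u t : cbm I0 u ->
  (forall s, ez s%:C = ez t%:C -> u s = u t) ->
  cbm I0 (fun s => (u s - u t) * kap t%:C s) ->
  ccvg (fun N => \sum_(1 <= n < N.+1) ez t%:C ^+ n * fcp u n)
       ('i * cint I0 (fun s => (u s - u t) * kap t%:C s)).
Proof.
move=> bu hu bk.
pose S N := \sum_(1 <= n < N.+1) ez t%:C ^+ n * fcp u n.
pose x s := ez t%:C * (ez s%:C)^-1.
have bx n : cbm I0 (fun s => x s ^+ n).
  rewrite (_ : (fun s => x s ^+ n) = (fun s => ez t%:C ^+ n * (ez s%:C)^-1 ^+ n)).
    by apply: cbmM (cbm_cst _ _) (cbm_ezVX _).
  by apply/funext => s; rewrite exprMn.
have bS N : cbm I0 (fun s => \sum_(1 <= n < N.+1) x s ^+ n).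
  elim: N => [|N IH].
    rewrite (_ : (fun _ => _) = (fun=> 0)); first exact: cbm_cst.
    by apply/funext => s; rewrite big_geq.
  rewrite (_ : (fun _ => _) = (fun s => \sum_(1 <= n < N.+1) x s ^+ n + x s ^+ N.+1)).
    exact: cbmD.
  by apply/funext => s; rewrite big_nat_recr.
have S0 N : cint I0 (fun s => \sum_(1 <= n < N.+1) x s ^+ n) = 0.
  elim: N => [|N IH].
    rewrite (eq_cint (v := fun=> 0)); last by move=> s _; rewrite big_geq.
    by rewrite cint_cst ?mul0r//; exact: finI0.
  rewrite (eq_cint (v := fun s => \sum_(1 <= n < N.+1) x s ^+ n + x s ^+ N.+1)).
    rewrite cintD//; last exact: finI0.
    rewrite IH add0r (eq_cint (v := fun s => ez t%:C ^+ N.+1 * (ez s%:C)^-1 ^+ N.+1)).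
      by rewrite cintZ ?cint_ezVX ?mulr0//; [exact: finI0|exact: cbm_ezVX].
    by move=> s _; rewrite exprMn.
  by move=> s _; rewrite big_nat_recr.
have S1 N : S N = cint I0 (fun s => u s * \sum_(1 <= n < N.+1) x s ^+ n).
  rewrite /S; elim: N => [|N IH].
    rewrite big_geq// (eq_cint (v := fun=> 0)) ?cint_cst ?mul0r//; first exact: finI0.
    by move=> s _; rewrite big_geq// mulr0.
  rewrite big_nat_recr//= IH.
  rewrite (eq_cint (u := fun s => u s * \sum_(1 <= n < N.+2) x s ^+ n)
    (v := fun s => u s * \sum_(1 <= n < N.+1) x s ^+ n + ez t%:C ^+ N.+1 * (u s * (ez s%:C)^-1 ^+ N.+1))).
    rewrite cintD ?cintZ//; try exact: finI0.
    - by apply: cbmM bu (cbm_ezVX _).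
    - exact: cbmM.
    - by apply: cbmM (cbm_cst _ _) _; apply: cbmM bu (cbm_ezVX _).
  by move=> s _; rewrite big_nat_recr//= mulrDr exprMn; ring.
(* Off the diagonal the geometric sum equals ['i * kap t s * (1 - (ez t / ez s) ^ N)]; on it
   [u s = u t] makes both integrands zero. *)
have S2 N : S N = 'i * cint I0 (fun s => (u s - u t) * kap t%:C s) -
    'i * ez t%:C ^+ N * fcp (fun s => (u s - u t) * kap t%:C s) N.
  have -> : S N = cint I0 (fun s => u s * \sum_(1 <= n < N.+1) x s ^+ n) -
      u t * cint I0 (fun s => \sum_(1 <= n < N.+1) x s ^+ n).
    by rewrite S0 mulr0 subr0.
  rewrite /fcp.
  have b5 : cbm I0 (fun s => (u s - u t) * kap t%:C s * (ez s%:C)^-1 ^+ N).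
    by apply: cbmM bk (cbm_ezVX _).
  rewrite -!cintZ//; try exact: finI0.
  rewrite -!cintB; try exact: finI0.
  - apply: eq_cint => s _; rewrite -mulrBl.
    have [h|h] := eqVneq (ez s%:C : C) (ez t%:C).
      by rewrite (hu _ h) subrr !(mul0r, mulr0) subrr.
    rewrite geo_sum; last first.
      apply: contraNneq h => h; apply/eqP.
      by rewrite -[RHS]mulr1 -[in RHS](mulVf (ez_neq0 s%:C)) mulrA -/(x s) h mul1r.
    rewrite /kap /x !exprMn exprVn.
    have e0 : (ez s%:C : C) ^+ N != 0 by rewrite expf_neq0// ez_neq0.
    have h' : ez t%:C - ez s%:C != 0 :> C by rewrite subr_eq0 eq_sym.
    have h2 : ez s%:C - ez t%:C != 0 :> C by rewrite subr_eq0.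
    have := ez_neq0 (s%:C : C) => es.
    move: (sqr_i R) => ii.
    transitivity ((u s - u t) * (('i ^+ 2) * ez t%:C / (ez t%:C - ez s%:C)) * (1 - ez t%:C ^+ N / ez s%:C ^+ N)); last first.
      by field; rewrite e0 h'.
    by rewrite ii; field; rewrite e0 h' h2 es.
  - by apply: cbmM (cbm_cst _ _) _.
  - by apply: cbmM (cbm_cst _ _) _.
  - exact: cbmM.
  - by apply: cbmM (cbm_cst _ _) _.
rewrite /ccvg.
rewrite (_ : (fun n => _) = (fun N => cabs (fcp (fun s => (u s - u t) * kap t%:C s) N))).
  exact: fcp_cvg0.
apply/funext => N; rewrite -/(S N) S2 addrAC subrr add0r cabsN !cabsM cabs_i cabsX.
by rewrite cabs_ez_real expr1n !mul1r.
Qed.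

(** Conjugation exchanges the coefficients of index [n] and [- n], so this is [dini_plus] for the
    conjugate of [u]. *)
Lemma dini_minus u t : cbm I0 u ->
  (forall s, ez s%:C = ez t%:C -> u s = u t) ->
  cbm I0 (fun s => (u s - u t) * conjc (kap t%:C s)) ->
  ccvg (fun N => \sum_(1 <= n < N.+1) (ez t%:C)^-1 ^+ n * fcm u n)
       (- 'i * cint I0 (fun s => (u s - u t) * conjc (kap t%:C s))).
Proof.
move=> bu hu bk.
have E (z : R -> C) : (fun s => (conjc (z s) - conjc (z t)) * kap t%:C s) =
   (fun s => conjc ((z s - z t) * conjc (kap t%:C s))).
  by apply/funext => s; rewrite !conjE.
have := @dini_plus (fun s => conjc (u s)) t (cbm_conj bu) (fun s h => f_equal _ (hu s h)).
rewrite E => /(_ (cbm_conj bk)); rewrite cint_conj//; last exact: finI0.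
rewrite /ccvg; set F := (X in X @ _ --> _ -> _); set G := (X in _ -> X @ _ --> _).
suff -> : F = G by [].
apply/funext => N; rewrite /F /G -[LHS]cabs_conj conjcB conjcM conjcK (rmorph_sum (@conjc R)).
congr (cabs (_ - _)).
  apply: eq_bigr => n _; transitivity (conjc (ez t%:C ^+ n * fcp (fun s => conjc (u s)) n)) => //.
  by rewrite fcm_conj// !conjE.
by congr (_ * _); apply: complex_eq; rewrite /= ?oppr0.
Qed.

End Fourier.

(** * Power series *)

Section PowerSeries.
Context {R : realType}.
Local Notation C := R[i].
Implicit Types (c a : nat -> C) (z w : C).

Lemma ccvg_unique (S : nat -> C) (a b : C) : ccvg S a -> ccvg S b -> a = b.
Proof.
move=> /ccvgP[h1 h2] /ccvgP[h3 h4]; apply: complex_eq.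
  exact: (cvg_unique _ h1 h3).
exact: (cvg_unique _ h2 h4).
Qed.

Lemma ccvgD (S T : nat -> C) (a b : C) : ccvg S a -> ccvg T b -> ccvg (fun n => S n + T n) (a + b).
Proof.
move=> /ccvgP[h1 h2] /ccvgP[h3 h4]; apply/ccvgP; rewrite reD imD; split.
  by under eq_fun do rewrite reD; exact: cvgD.
by under eq_fun do rewrite imD; exact: cvgD.
Qed.

Lemma ccvgM (S T : nat -> C) (a b : C) : ccvg S a -> ccvg T b -> ccvg (fun n => S n * T n) (a * b).
Proof.
move=> /ccvgP[h1 h2] /ccvgP[h3 h4]; apply/ccvgP; rewrite reM imM; split.
  by under eq_fun do rewrite reM; apply: cvgB; exact: cvgM.
by under eq_fun do rewrite imM; apply: cvgD; exact: cvgM.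
Qed.

Lemma ccvg_cst (a : C) : ccvg (fun=> a) a.
Proof. by apply/ccvgP; split; exact: cvg_cst. Qed.

Lemma ccvgN (S : nat -> C) (a : C) : ccvg S a -> ccvg (fun n => - S n) (- a).
Proof.
move=> /(ccvgM (ccvg_cst (-1))); rewrite mulN1r.
by under [X in ccvg X _ -> _]eq_fun do rewrite mulN1r.
Qed.

Lemma ccvgB (S T : nat -> C) (a b : C) : ccvg S a -> ccvg T b -> ccvg (fun n => S n - T n) (a - b).
Proof. by move=> h1 h2; apply: ccvgD => //; exact: ccvgN. Qed.

Lemma ccvg_le (S : nat -> C) (a b : C) (M : R) : ccvg S a ->
  (\forall n \near \oo, cabs (S n - b) <= M) -> cabs (a - b) <= M.
Proof.
move=> h H; apply/ler_addgt0Pr => e e0.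
move/cvgrPdist_lt : h => /(_ _ e0) h.
near \oo => n.
rewrite (le_trans (cabsBtri (S n) _ _))// addrC lerD//; first by near: n.
by rewrite cabsBC ltW//; near: n; apply: filterS h => n; rewrite sub0r normrN ger0_norm// cabs_ge0.
Unshelve. all: by end_near. Qed.

Lemma ccvgS (S : nat -> C) (a : C) : ccvg S a -> ccvg (fun n => S n.+1) a.
Proof. by move=> h; rewrite /ccvg (cvg_shiftS (fun n => cabs (S n - a))). Qed.

Lemma ccvg_comp (f : C -> C) (S : nat -> C) (a : C) : ccont f a -> ccvg S a -> ccvg (fun n => f (S n)) (f a).
Proof.
move=> cf /cvgrPdist_lt h; apply/cvgrPdist_lt => e e0; have [d d0 H] := cf _ e0.
apply: filterS (h _ d0) => n; rewrite !sub0r !normrN !ger0_norm ?cabs_ge0//; exact: H.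
Qed.

Definition csum a : C := limn (series (fun n => re (a n))) +i* limn (series (fun n => im (a n))).

Lemma csum_cvg a (b : nat -> R) : (forall n, cabs (a n) <= b n) -> cvgn (series b) ->
  ccvg (fun N => \sum_(0 <= n < N) a n) (csum a).
Proof.
move=> ab cb; apply/ccvgP.
have Ere N : re (\sum_(0 <= n < N) a n) = series (fun n => re (a n)) N.
  rewrite /series /=; elim: N => [|N IH]; first by rewrite !big_geq.
  by rewrite !big_nat_recr//= reD IH.
have Eim N : im (\sum_(0 <= n < N) a n) = series (fun n => im (a n)) N.
  rewrite /series /=; elim: N => [|N IH]; first by rewrite !big_geq.
  by rewrite !big_nat_recr//= imD IH.
have b0 n : 0 <= b n by rewrite (le_trans _ (ab n))// cabs_ge0.
split.
  under eq_fun do rewrite Ere; apply: normed_cvg.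
  by apply: (series_le_cvg _ b0 _ cb) => n; [exact: normr_ge0|exact: le_trans (re_le_cabs _) (ab n)].
under eq_fun do rewrite Eim; apply: normed_cvg.
by apply: (series_le_cvg _ b0 _ cb) => n; [exact: normr_ge0|exact: le_trans (im_le_cabs _) (ab n)].
Qed.

Lemma geo_sum_le (y : R) N : 0 <= y < 1 -> \sum_(0 <= n < N) y ^+ n <= (1 - y)^-1.
Proof.
move=> /andP[y0 y1]; have h : 0 < 1 - y by rewrite subr_gt0.
have -> : \sum_(0 <= n < N) y ^+ n = (1 - y ^+ N) / (1 - y).
  elim: N => [|N IH]; first by rewrite big_geq// expr0 subrr mul0r.
  by rewrite big_nat_recr//= IH exprSr; field; rewrite gt_eqF.
by rewrite ler_pdivrMr// mulVf ?gt_eqF// lerBlDr lerDl exprn_ge0.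
Qed.

(** A factor [n] produced by differentiating a series is absorbed by a slightly larger ratio. *)
Lemma natr_geo (x y : R) : 0 <= x < y ->
  forall n, n%:R * x ^+ n <= y / (y - x) * y ^+ n.
Proof.
move=> /andP[x0 xy] n; have d0 : 0 < y - x by rewrite subr_gt0.
have y0 : 0 < y by exact: le_lt_trans xy.
have H : n.+1%:R * x ^+ n * (y - x) <= y ^+ n.+1.
  elim: n => [|n IH]; first by rewrite expr0 expr1 !mul1r lerBlDr lerDl.
  have -> : n.+2%:R * x ^+ n.+1 * (y - x) = x * (n.+1%:R * x ^+ n * (y - x)) + x ^+ n.+1 * (y - x).
    by rewrite (natrD _ 1 n.+1) exprS; ring.
  rewrite [y ^+ n.+2]exprS (_ : y * y ^+ n.+1 = x * y ^+ n.+1 + y ^+ n.+1 * (y - x)); last by ring.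
  apply: lerD; first by rewrite ler_wpM2l.
  apply: ler_wpM2r; first exact: ltW.
  by apply: lerXn2r; rewrite ?nnegrE// ltW.
rewrite mulrAC -exprS ler_pdivlMr// (le_trans _ H)// ler_wpM2r ?(ltW d0)//.
by rewrite ler_wpM2r ?exprn_ge0// ler_nat.
Qed.

Definition geo c (K th : R) := forall n, cabs (c n) <= K * th ^+ n.

Lemma geo_K_ge0 c (K th : R) : geo c K th -> 0 <= K.
Proof. by move=> /(_ 0); rewrite expr0 mulr1; apply: le_trans; rewrite cabs_ge0. Qed.

Definition pser c z : C := csum (fun n => c n * z ^+ n).
Definition dser c n : C := n.+1%:R * c n.+1.

Lemma cabs_nat n : cabs (n%:R : C) = n%:R.
Proof.
have -> : n%:R = (n%:R : R)%:C :> C by rewrite rmorph_nat.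
by rewrite cabs_real ger0_norm.
Qed.

Lemma geo_dser c (K th th' : R) : geo c K th -> 0 <= th < th' ->
  exists K', geo (dser c) K' th'.
Proof.
move=> g h; have K0 := geo_K_ge0 g; have [t0 t1] := andP h.
exists (K * (th' / (th' - th)) * th') => n.
rewrite /dser cabsM cabs_nat.
apply: (@le_trans _ _ (n.+1%:R * (K * th ^+ n.+1))); first by rewrite ler_wpM2l.
by have := ler_wpM2l K0 (natr_geo h n.+1); rewrite exprS [X in _ <= _ * (_ * X) -> _]exprS; congr (_ <= _); ring.
Qed.

Lemma pser_cvg c (K th : R) z : 0 <= th -> geo c K th -> th * cabs z < 1 ->
  ccvg (fun N => \sum_(0 <= n < N) c n * z ^+ n) (pser c z).
Proof.
move=> t0 g tz; apply: (@csum_cvg _ (fun n => K * (th * cabs z) ^+ n)).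
  move=> n; rewrite cabsM cabsX exprMn mulrA ler_wpM2r//.
  by rewrite exprn_ge0// cabs_ge0.
apply: (@is_cvg_geometric_series _ K (th * cabs z)).
by rewrite ger0_norm// mulr_ge0// cabs_ge0.
Qed.

(** The first-order Taylor remainder of a monomial. Multiplying by [r ^+ 2] on the left avoids the
    exponent [n - 2] for small [n]. *)
Lemma pow_quad z w (r : R) n : 0 <= r -> cabs z <= r -> cabs w <= r ->
  r ^+ 2 * cabs (w ^+ n - z ^+ n - n%:R * z ^+ n.-1 * (w - z)) <=
  n%:R ^+ 2 * r ^+ n * cabs (w - z) ^+ 2.
Proof.
move=> r0 zr wr; elim: n => [|n IH].
  by rewrite !expr0 subrr mul0r mul0r subr0 cabs0 mulr0 expr0n /= !mul0r.
have -> : w ^+ n.+1 - z ^+ n.+1 - n.+1%:R * z ^+ n * (w - z) =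
   w * (w ^+ n - z ^+ n - n%:R * z ^+ n.-1 * (w - z)) + n%:R * z ^+ n.-1 * (w - z) ^+ 2.
  case: n {IH} => [|n] /=; first by rewrite !expr0 expr1 expr1; ring.
  by rewrite !exprS (natrD _ 1 n.+1); ring.
have d0 : 0 <= cabs (w - z) ^+ 2 by rewrite sqr_ge0.
apply: (@le_trans _ _ (r * (n%:R ^+ 2 * r ^+ n * cabs (w - z) ^+ 2) + n%:R * r ^+ n.+1 * cabs (w - z) ^+ 2)).
  apply: (@le_trans _ _ (r ^+ 2 * (r * cabs (w ^+ n - z ^+ n - n%:R * z ^+ n.-1 * (w - z)) + n%:R * r ^+ n.-1 * cabs (w - z) ^+ 2))).
    rewrite ler_wpM2l ?sqr_ge0// (le_trans (cabsD _ _))// !cabsM !cabsX cabs_nat.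
    apply: lerD; first by rewrite ler_wpM2r// cabs_ge0.
    by rewrite ler_wpM2r// ler_wpM2l// lerXn2r// nnegrE// cabs_ge0.
  rewrite mulrDr lerD//; first by rewrite mulrCA ler_wpM2l.
  case: n {IH} => [|n]; first by rewrite !mul0r mulr0.
  by rewrite le_eqVlt; apply/orP; left; apply/eqP; rewrite /= !exprS; ring.
have -> : r * (n%:R ^+ 2 * r ^+ n * cabs (w - z) ^+ 2) + n%:R * r ^+ n.+1 * cabs (w - z) ^+ 2 =
  (n%:R ^+ 2 + n%:R) * r ^+ n.+1 * cabs (w - z) ^+ 2 by rewrite ![r ^+ n.+1]exprS; ring.
rewrite ler_wpM2r// ler_wpM2r ?exprn_ge0// -[n.+1]add1n natrD.
have : 0 <= n%:R :> R by []. nra.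
Qed.

Lemma pser_cder c (K th : R) z : 0 < th -> geo c K th -> th * cabs z < 1 ->
  cder (pser c) z (pser (dser c) z).
Proof.
move=> t0 g tz; have K0 := geo_K_ge0 g.
pose r := (cabs z + th^-1) / 2.
have zt : cabs z < th^-1 by rewrite -[ltRHS]mul1r ltr_pdivlMr// mulrC.
have zr : cabs z < r by rewrite /r; lra.
have rt : r < th^-1 by rewrite /r; lra.
have r0 : 0 < r by rewrite (le_lt_trans _ zr)// cabs_ge0.
have tr : th * r < 1 by rewrite -ltr_pdivlMl// mulr1.
(* There is room between [x] and 1: passing from [x] to [y'] and from [y'] to [y] by [natr_geo]
   absorbs the factor [n ^ 2] of [pow_quad]. *)
pose x := th * r. have x0 : 0 <= x by rewrite mulr_ge0 ?ltW.
pose y := (1 + x) / 2. pose y' := (x + y) / 2.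
have xy : 0 <= x < y' by rewrite /y' /y x0/= -/x in tr *; lra.
have y'y : 0 <= y' < y by rewrite /y' /y -/x in tr *; apply/andP; split; lra.
have y1 : 0 <= y < 1 by rewrite /y -/x in tr *; apply/andP; split; lra.
pose A := y' / (y' - x); pose B := y / (y - y').
have A0 : 0 <= A by rewrite divr_ge0//; have := andP xy; lra.
have B0 : 0 <= B by rewrite divr_ge0//; have := andP y'y; have := andP y1; lra.
have n2 n : n%:R ^+ 2 * x ^+ n <= A * B * y ^+ n.
  rewrite expr2 -mulrA (le_trans (ler_wpM2l _ (natr_geo xy n)))//.
  rewrite -/A mulrCA -mulrA ler_wpM2l//; exact: natr_geo.
pose M := K * (A * B) * (1 - y)^-1 / r ^+ 2.
apply: (@cder_quad _ _ _ _ (r - cabs z) M); first by rewrite subr_gt0.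
move=> w wz.
have wr : cabs w < r by move: wz; rewrite ltrBrDr; apply: le_lt_trans; rewrite -{1}(subrK z w) cabsD.
have tw : th * cabs w < 1 by rewrite (lt_trans _ tr)// ltr_pM2l.
(* The coefficients [dser c] are controlled by a ratio above [th], and their series still has to
   converge at [z]. *)
have [th' tt' t'z] : exists2 th', th < th' & th' * cabs z < 1.
  have d0 : 0 < cabs z + 1 by rewrite ltr_wpDl// cabs_ge0.
  exists (th + (1 - th * cabs z) / 2 / (cabs z + 1)).
    by rewrite ltrDl !divr_gt0// subr_gt0.
  rewrite mulrDl -mulrA -mulrA.
  have h : (cabs z + 1)^-1 * cabs z <= 1.
    by rewrite mulrC ler_pdivrMr// mul1r lerDl.
  have : (1 - th * cabs z) / 2 * ((cabs z + 1)^-1 * cabs z) <= (1 - th * cabs z) / 2.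
    by rewrite -[leRHS]mulr1 ler_wpM2l// divr_ge0// subr_ge0 ltW.
  rewrite -mulrA => h2; lra.
have [K' g'] := geo_dser g (introT andP (conj (ltW t0) tt')).
have c1 := ccvgS (pser_cvg (ltW t0) g tw).
have c2 := ccvgS (pser_cvg (ltW t0) g tz).
have c3 := pser_cvg (ltW (lt_trans t0 tt')) g' t'z.
have := ccvg_le (b := 0) (ccvgB (ccvgB c1 c2) (ccvgM c3 (ccvg_cst (w - z)))).
rewrite subr0; apply; apply: nearW => N; rewrite subr0.
have E : \sum_(0 <= n < N.+1) c n * w ^+ n - \sum_(0 <= n < N.+1) c n * z ^+ n -
   \sum_(0 <= n < N) dser c n * z ^+ n * (w - z) =
   \sum_(0 <= n < N.+1) c n * (w ^+ n - z ^+ n - n%:R * z ^+ n.-1 * (w - z)).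
  elim: N => [|N IH].
    by rewrite !big_nat1 big_geq// !expr0 mulr0n; ring.
  rewrite !(@big_nat_recr _ _ _ N.+1 0)//= -IH.
  rewrite (@big_nat_recr _ _ _ N 0 (fun n => dser c n * z ^+ n * (w - z)))//= /dser.
  by rewrite !exprS; ring.
rewrite mulr_suml E.
apply: (@le_trans _ _ (\sum_(0 <= n < N.+1) K * (A * B) * cabs (w - z) ^+ 2 / r ^+ 2 * y ^+ n)); last first.
  rewrite -mulr_sumr (_ : M * _ = K * (A * B) * cabs (w - z) ^+ 2 / r ^+ 2 * (1 - y)^-1).
    apply: ler_wpM2l; last exact: geo_sum_le.
    exact: (divr_ge0 (mulr_ge0 (mulr_ge0 K0 (mulr_ge0 A0 B0)) (sqr_ge0 _)) (sqr_ge0 _)).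
  by rewrite /M; ring.
elim: N.+1 => [|n IH]; first by rewrite !big_geq// cabs0.
rewrite !big_nat_recr//= (le_trans (cabsD _ _))// lerD// cabsM.
rewrite -(@ler_pM2r _ (r ^+ 2)) ?exprn_gt0// mulrAC [leRHS]mulrAC.
have r2 : r ^+ 2 != 0 by rewrite gt_eqF// exprn_gt0.
rewrite divfK//.
apply: (@le_trans _ _ (K * th ^+ n * (n%:R ^+ 2 * r ^+ n * cabs (w - z) ^+ 2))).
  rewrite -mulrA; apply: ler_pM.
  - exact: cabs_ge0.
  - by apply: mulr_ge0; [exact: sqr_ge0|exact: cabs_ge0].
  - exact: g.
  - exact: (pow_quad _ (ltW r0) (ltW zr) (ltW wr)).
rewrite (_ : K * th ^+ n * _ = K * cabs (w - z) ^+ 2 * (n%:R ^+ 2 * x ^+ n)).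
  2: by rewrite (_ : x ^+ n = th ^+ n * r ^+ n); [ring|exact: exprMn].
rewrite (_ : K * (A * B) * _ * _ = K * cabs (w - z) ^+ 2 * (A * B * y ^+ n)); last by ring.
by rewrite ler_wpM2l// mulr_ge0// sqr_ge0.
Qed.

Lemma pser_hol c (K th : R) : 0 < th -> geo c K th ->
  hol1 (fun z => th * cabs z < 1) (pser c) (pser (dser c)).
Proof.
move=> t0 g z tz; split; first exact: pser_cder tz.
have [th' tt' t'z] : exists2 th', th < th' & th' * cabs z < 1.
  have d0 : 0 < cabs z + 1 by rewrite ltr_wpDl// cabs_ge0.
  exists (th + (1 - th * cabs z) / 2 / (cabs z + 1)).
    by rewrite ltrDl !divr_gt0// subr_gt0.
  rewrite mulrDl -mulrA -mulrA.
  have h : (cabs z + 1)^-1 * cabs z <= 1.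
    by rewrite mulrC ler_pdivrMr// mul1r lerDl.
  have : (1 - th * cabs z) / 2 * ((cabs z + 1)^-1 * cabs z) <= (1 - th * cabs z) / 2.
    by rewrite -[leRHS]mulr1 ler_wpM2l// divr_ge0// subr_ge0 ltW.
  rewrite -mulrA => h2; lra.
have [K' g'] := geo_dser g (introT andP (conj (ltW t0) tt')).
exact: cder_ccont (pser_cder (lt_trans t0 tt') g' t'z).
Qed.

Lemma ccontX (f : C -> C) z n : ccont f z -> ccont (fun w => f w ^+ n) z.
Proof.
move=> cf; elim: n => [|n IH]; first exact: ccont_cst.
by apply: (ccont_local ltr01 _ (ccontM cf IH)) => w _; rewrite exprS.
Qed.

Lemma ccont_sum (f : nat -> C -> C) z N : (forall n, ccont (f n) z) ->
  ccont (fun w => \sum_(0 <= n < N) f n w) z.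
Proof.
move=> cf; elim: N => [|n IH].
  by apply: (ccont_local ltr01 _ (ccont_cst 0 z)) => w _; rewrite big_geq.
by apply: (ccont_local ltr01 _ (ccontD IH (cf n))) => w _; rewrite big_nat_recr.
Qed.

Lemma sub_big_nat (V : zmodType) (f : nat -> V) N n : (N <= n)%N ->
  \sum_(0 <= i < n) f i - \sum_(0 <= i < N) f i = \sum_(N <= i < n) f i.
Proof. by move=> Nn; rewrite (@big_cat_nat _ _ _ N 0 n)//= addrAC subrr add0r. Qed.

(** Summable coefficients give uniform convergence on the closed disc, boundary included; this
    provides continuity up to the line for a series without geometric decay. *)
Lemma pser_closed_disc_cont c : cvgn (series (fun n => cabs (c n))) ->
  forall z, cabs z <= 1 -> forall e : R, 0 < e -> exists2 d : R, 0 < d &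
  forall w, cabs w <= 1 -> cabs (w - z) < d -> cabs (pser c w - pser c z) < e.
Proof.
move=> cc z z1 e e0.
have e3 : 0 < e / 3 by rewrite divr_gt0.
have cv w : cabs w <= 1 -> ccvg (fun N => \sum_(0 <= n < N) c n * w ^+ n) (pser c w).
  move=> w1; apply: csum_cvg cc => n.
  by rewrite cabsM cabsX -[leRHS]mulr1 ler_wpM2l ?cabs_ge0// exprn_ile1// cabs_ge0.
pose L := limn (series (fun n => cabs (c n))).
have [N _ /(_ N (leqnn _)) HN] : \forall N \near \oo, `|L - series (fun n => cabs (c n)) N| < e / 3.
  by move/cvgrPdist_lt : cc; apply.
have nd : nondecreasing_seq (series (fun n => cabs (c n))).
  by apply: nondecreasing_series => n _ _; exact: cabs_ge0.
have tail w : cabs w <= 1 -> cabs (pser c w - \sum_(0 <= n < N) c n * w ^+ n) <= e / 3.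
  move=> w1; apply: (ccvg_le (cv _ w1)); exists N => // n /= Nn.
  rewrite sub_big_nat//.
  apply: (@le_trans _ _ (series (fun n => cabs (c n)) n - series (fun n => cabs (c n)) N)).
    rewrite /series /= sub_big_nat// -(subnKC Nn).
    elim: (n - N)%N => [|k IH]; first by rewrite addn0 !big_geq// cabs0.
    rewrite addnS !big_nat_recr ?leq_addr//= (le_trans (cabsD _ _))// lerD//.
    by rewrite cabsM cabsX -[leRHS]mulr1 ler_wpM2l ?cabs_ge0// exprn_ile1// cabs_ge0.
  move: HN; rewrite ger0_norm ?subr_ge0; last by apply: nondecreasing_cvgn_le.
  move=> /ltW; apply: le_trans; rewrite lerD2r.
  exact: nondecreasing_cvgn_le.
have cS : ccont (fun w => \sum_(0 <= n < N) c n * w ^+ n) z.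
  by apply: ccont_sum => n; apply: ccontM (ccont_cst _ _) _; apply: ccontX; exact: ccont_id.
have [d d0 H] := cS _ e3.
exists d => // w w1 /H.
move=> {}H.
rewrite (le_lt_trans (cabsBtri (\sum_(0 <= n < N) c n * w ^+ n) _ _))//.
rewrite (le_lt_trans (lerD (tail _ w1) (cabsBtri (\sum_(0 <= n < N) c n * z ^+ n) _ _)))//.
have := tail _ z1; rewrite [X in _ -> _ + (_ + X) < _]cabsBC.
by move: H; lra.
Qed.

End PowerSeries.

(** * From geometric decay of coefficients to real analyticity *)

Section AnalyticFromDecay.
Context {R : realType}.
Local Notation C := R[i].
Implicit Types (c : nat -> C) (z w : C) (f g : R -> R) (t : R).

Lemma analytic_atD f g t : analytic_at f t -> analytic_at g t ->
  analytic_at (fun s => f s + g s) t.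
Proof.
move=> [a [r [r0 ha]]] [b [q [q0 hb]]].
exists (fun n => a n + b n), (Num.min r q); split; first by rewrite lt_min r0.
move=> s; rewrite lt_min => /andP[h1 h2].
rewrite (_ : pseries _ _ = pseries a (s - t) + pseries b (s - t)).
  exact: cvgD (ha _ h1) (hb _ h2).
apply/funext => n; rewrite /pseries /series /= -[RHS]big_split /=.
by apply: eq_bigr => i _; rewrite mulrDl.
Qed.

Lemma analytic_atZ f t (k : R) : analytic_at f t -> analytic_at (fun s => k * f s) t.
Proof.
move=> [a [r [r0 ha]]]; exists (fun n => k * a n), r; split => // s /ha h.
rewrite (_ : pseries _ _ = cst k \* pseries a (s - t)).
  exact: cvgM (cvg_cst k) h.
apply/funext => n; rewrite /pseries /series /= [RHS]mulr_sumr.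
by apply: eq_bigr => i _; rewrite mulrA.
Qed.

Lemma analytic_at_cst (k : R) t : analytic_at (fun=> k) t.
Proof.
exists (fun n => if n is 0 then k else 0), 1; split => // s _.
apply: (@cvg_near_cst); exists 1 => // n /= n1.
rewrite /pseries /series /=; elim: n n1 => // -[_ _|n IH _].
  by rewrite big_nat1 expr0 mulr1.
by rewrite big_nat_recr//= IH// mul0r addr0.
Qed.

Lemma cderX (h : C -> C) z (a : C) n : cder h z a ->
  cder (fun w => h w ^+ n.+1) z (n.+1%:R * h z ^+ n * a).
Proof.
move=> ha; elim: n => [|n IH].
  by rewrite expr0 !mul1r; apply: cder_local ltr01 _ ha => w _; rewrite expr1.
have := cderM ha IH; rewrite (_ : _ + _ = n.+2%:R * h z ^+ n.+1 * a).
  by apply: cder_local ltr01 _ => w _; rewrite -exprS.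
by rewrite -[n.+2%:R]natr1 [h z ^+ n.+1]exprS; ring.
Qed.

(** The remainder [T N.+1] vanishes at 0 and has derivative ['i * T N], so the bound for [N]
    integrates to the one for [N.+1]. The factor 2 adds the two components. *)
Lemma expi_taylor (y : R) N :
  cabs (ez y%:C - \sum_(0 <= k < N) ('i * y%:C) ^+ k / k`!%:R) <= 2 * (`|y| ^+ N / N`!%:R).
Proof.
pose T N (y : R) : C := ez y%:C - \sum_(0 <= k < N) ('i * y%:C) ^+ k / k`!%:R.
have dT N' (s : R) : rder (T N'.+1) s ('i * T N' s).
  pose S (n : nat) z : C := \sum_(0 <= k < n) ('i * z) ^+ k / k`!%:R.
  have dS n z : cder (S n.+1) z ('i * S n z).
    elim: n => [|n IH].
      rewrite /S big_geq// mulr0; apply: (cder_local ltr01 _ (cder_cst 1 z)) => w _.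
      by rewrite big_nat1 expr0 fact0 divr1.
    have di : cder (fun w => 'i * w) z 'i by have := cderZ 'i (cder_id z); rewrite mulr1.
    have := cderD IH (cderZ (n.+1`!%:R^-1) (cderX n di)).
    rewrite (_ : _ + _ = 'i * S n.+1 z).
      apply: cder_local ltr01 _ => w _; rewrite /S [RHS]big_nat_recr//=; congr (_ + _).
      by rewrite mulrC.
    rewrite /S [in RHS]big_nat_recr//= mulrDr; congr (_ + _).
    have f0 : (n`!%:R : C) != 0 by rewrite pnatr_eq0 -lt0n fact_gt0.
    have n0 : (n.+1%:R : C) != 0 by rewrite pnatr_eq0.
    have -> : ((n.+1)`!%:R : C) = (n.+1%:R : C) * (n`!%:R : C) by rewrite factS natrM.
    transitivity ('i * (('i * z) ^+ n * (n`!%:R : C)^-1)); last by [].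
    move: n0 f0; generalize (n.+1%:R : C) (n`!%:R : C) => p q p0 q0.
    by rewrite ?complexiE; field; rewrite p0 q0.
  by have := rder_horiz (cderB (cder_ez (s +i* 0)) (dS N' (s +i* 0))); rewrite -mulrBr.
have base s : `|re (T 0 s)| <= 1 /\ `|im (T 0 s)| <= 1.
  by rewrite /T big_geq// subr0 ez_real /= cos_max sin_max.
have T0 n : T n.+1 0 = 0.
  rewrite /T big_nat_recl//= expr0 fact0 divr1 big1_seq ?addr0.
    by rewrite /ez mulr0 cexp0 subrr.
  by move=> i _; rewrite mulr0 exprS !mul0r.
have pos n : forall s : R, 0 <= s -> `|re (T n s)| <= s ^+ n / n`!%:R /\ `|im (T n s)| <= s ^+ n / n`!%:R.
  elim: n => [|n IH] s s0; first by rewrite expr0 fact0 divr1; exact: base.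
  have [->|sn0] := eqVneq s 0.
    by rewrite T0 /= normr0 expr0n /= mul0r.
  have s1 : 0 < s by rewrite lt_neqAle eq_sym sn0.
  (* Comparison on [[0, s]]: the difference with [x ^ (n + 1) / (n + 1)!] has a non-positive
     derivative. *)
  have key (p : R -> R) (dp : R -> R) : p 0 = 0 -> (forall x : R, is_derive x (1 : R) p (dp x)) ->
     (forall x : R, 0 <= x -> dp x <= x ^+ n / n`!%:R) -> p s <= s ^+ n.+1 / n.+1`!%:R.
    move=> p0 Dp dple.
    have Dq (x : R) : is_derive x (1 : R) (fun x : R => p x - n.+1`!%:R^-1 * x ^+ n.+1) (dp x - x ^+ n / n`!%:R).
      have hx : is_derive x (1 : R) (fun x : R => x ^+ n.+1) (n.+1%:R * x ^+ n).
        apply: DeriveDef; first exact: exprn_derivable.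
        by rewrite exp_derive; exact: mulr1.
      have h := is_deriveB (Dp x) (is_deriveZ (n.+1`!%:R^-1) hx).
      apply: (is_derive_eq h); congr (_ - _); rewrite -[_ *: _]/(_ * _) factS natrM invfM.
      by rewrite mulrACA mulVf ?pnatr_eq0// mul1r mulrC.
    have cq : {within `[0, s], continuous (fun x : R => p x - n.+1`!%:R^-1 * x ^+ n.+1)}.
      by apply: derivable_within_continuous => x _; have [] := Dq x.
    have [x xs E] := MVT s1 (fun x _ => Dq x) cq.
    move: E; rewrite p0 expr0n /= mulr0 !subr0 => E.
    rewrite -subr_le0 [_ / _]mulrC E; rewrite mulr_le0_ge0// subr_le0 dple//.
    by move: xs; rewrite in_itv/= => /andP[/ltW].
  have D1 (x : R) : is_derive x (1 : R) (fun x => re (T n.+1 x)) (- im (T n x)).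
    by have [h _] := dT n x; move: h; rewrite reM /= mul0r mul1r sub0r.
  have D2 (x : R) : is_derive x (1 : R) (fun x => im (T n.+1 x)) (re (T n x)).
    by have [_ h] := dT n x; move: h; rewrite imM /= mul0r mul1r add0r.
  split; rewrite ler_norml; apply/andP; split.
  - rewrite lerNl; apply: (key (fun x => - re (T n.+1 x)) (fun x => im (T n x))).
    + by rewrite T0 oppr0.
    + by move=> x; have := is_deriveN (D1 x); rewrite opprK.
    + by move=> x /IH[_]; rewrite ler_norml => /andP[].
  - apply: (key _ (fun x => - im (T n x))) => //; first by rewrite T0.
    by move=> x /IH[_]; rewrite ler_norml => /andP[h _]; rewrite lerNl.
  - rewrite lerNl; apply: (key (fun x => - im (T n.+1 x)) (fun x => - re (T n x))).
    + by rewrite T0 oppr0.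
    + by move=> x /IH[+ _]; rewrite ler_norml => /andP[h _]; rewrite lerNl.
  - apply: (key _ (fun x => re (T n x))) => //; first by rewrite T0.
    by move=> x /IH[+ _]; rewrite ler_norml => /andP[_ h].
rewrite -/(T N y).
(* Negative arguments are reached by conjugation. *)
have conjT : cabs (T N y) = cabs (T N `|y|).
  have [y0|y0] := leP 0 y; first by rewrite ger0_norm.
  rewrite (ltr0_norm y0); suff -> : T N y = conjc (T N (- y)) by exact: cabs_conj.
  have -> : conjc (T N (- y)) = conjc (ez (- y)%:C) - \sum_(0 <= k < N) conjc (('i * (- y)%:C) ^+ k / k`!%:R).
    by rewrite /T conjcB -(rmorph_sum (@conjc R)).
  rewrite /T; have -> : conjc (ez (- y)%:C) = ez y%:C by rewrite rmorphN ezN conj_ezV_real.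
  have -> // : \sum_(0 <= k < N) conjc (('i * (- y)%:C) ^+ k / k`!%:R) = \sum_(0 <= k < N) ('i * y%:C) ^+ k / k`!%:R.
  apply: eq_bigr => k _; rewrite conjcM conjcX conjcM.
  have -> : conjc ('i : C) * conjc ((- y)%:C) = 'i * y%:C.
    by apply: complex_eq; rewrite !reimE /=; ring.
  by rewrite -(rmorph_nat (real_complex R)) -fmorphV conjc_real.
rewrite conjT (le_trans (cabs_le _))// mulr2n mulrDl mul1r.
by have [h1 h2] := pos N _ (normr_ge0 y); rewrite lerD.
Qed.

(** Each mode is expanded around [t0] and the two sums are exchanged; the remainders are summed over
    all modes before the order of the expansion grows. *)
Lemma pser_ez_analytic c (K th : R) t0 : 0 < th < 1 -> geo c K th ->
  analytic_at (fun t => re (pser c (ez t%:C))) t0.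
Proof.
move=> /andP[th0 th1] g; have K0 := geo_K_ge0 g.
(* Any ratio strictly between [th] and 1 would do; the surplus [q / th = expR d] determines the
   radius [d] of the expansion. *)
pose q := (1 + th) / 2.
have q1 : 0 <= q < 1 by rewrite /q; apply/andP; split; lra.
have [d d0 dq] : exists2 d : R, 0 < d & th * expR d = q.
  exists (ln (q / th)); last first.
    by rewrite lnK ?posrE ?divr_gt0//; [rewrite mulrC divfK// gt_eqF|rewrite /q; lra].
  by rewrite ln_gt0// ltr_pdivlMr// mul1r /q; lra.
clearbody q.
(* A single term of the exponential series of [d * n]. *)
have pw n k : (n%:R : R) ^+ k / k`!%:R <= expR d ^+ n / d ^+ k.
  rewrite -expRM_natl ler_pdivlMr ?exprn_gt0// mulrAC -exprMn.
  case: k => [|k].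
    by rewrite expr0 fact0 divr1 -expR0 ler_expR mulr_ge0// ltW.
  have := expR_ge1Dxn k (mulr_ge0 (ler0n R n) (ltW d0)).
  by apply: le_trans; rewrite lerDr.
pose A k := csum (fun n => c n * ez t0%:C ^+ n * ('i * n%:R) ^+ k / k`!%:R).
have cabsf k : cabs (k`!%:R^-1 : C) = k`!%:R^-1 by rewrite cabsV cabs_nat.
have cterm n k : cabs (c n * ez t0%:C ^+ n * ('i * n%:R) ^+ k / k`!%:R) <= K / d ^+ k * q ^+ n.
  rewrite !cabsM cabsf !cabsX cabs_ez_real expr1n mulr1 cabsM cabs_i mul1r cabs_nat.
  apply: (@le_trans _ _ (K * th ^+ n * (expR d ^+ n / d ^+ k))); last first.
    by rewrite -dq exprMn le_eqVlt; apply/orP; left; apply/eqP; ring.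
  rewrite -mulrA; apply: ler_pM.
  - exact: cabs_ge0.
  - by apply: divr_ge0; [apply: exprn_ge0|]; exact: ler0n.
  - exact: g.
  - exact: pw.
have cA k : ccvg (fun N => \sum_(0 <= n < N) c n * ez t0%:C ^+ n * ('i * n%:R) ^+ k / k`!%:R) (A k).
  apply: (@csum_cvg _ _ (fun n => K / d ^+ k * q ^+ n)) => //.
  by apply: (@is_cvg_geometric_series _ _ q); have /andP[? ?] := q1; rewrite ger0_norm.
clearbody A.
exists (fun k => re (A k)), d; split => // t td.
have cP : ccvg (fun N => \sum_(0 <= n < N) c n * ez t%:C ^+ n) (pser c (ez t%:C)).
  by apply: (pser_cvg (ltW th0) g); rewrite cabs_ez_real mulr1.
pose x := t - t0.
have bound N : cabs (pser c (ez t%:C) - \sum_(0 <= k < N) A k * x%:C ^+ k) <= 2 * K / (1 - q) * (`|x| / d) ^+ N.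
  have cS : ccvg (fun m => \sum_(0 <= k < N) ((\sum_(0 <= n < m) c n * ez t0%:C ^+ n * ('i * n%:R) ^+ k / k`!%:R) * x%:C ^+ k))
      (\sum_(0 <= k < N) A k * x%:C ^+ k).
    elim: N => [|N IH].
      by under [X in ccvg X _]eq_fun do rewrite big_geq//; rewrite big_geq//; exact: ccvg_cst.
    under [X in ccvg X _]eq_fun do rewrite big_nat_recr//=.
    rewrite big_nat_recr//=; apply: ccvgD => //; apply: ccvgM => //; exact: ccvg_cst.
  have := ccvg_le (b := 0) (ccvgB cP cS); rewrite subr0; apply; apply: nearW => m.
  rewrite subr0.
  have -> : \sum_(0 <= n < m) c n * ez t%:C ^+ n -
     \sum_(0 <= k < N) ((\sum_(0 <= n < m) c n * ez t0%:C ^+ n * ('i * n%:R) ^+ k / k`!%:R) * x%:C ^+ k) =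
     \sum_(0 <= n < m) c n * ez t0%:C ^+ n * (ez (n%:R * x)%:C - \sum_(0 <= k < N) ('i * (n%:R * x)%:C) ^+ k / k`!%:R).
    under [X in _ - X]eq_bigr do rewrite mulr_suml.
    rewrite exchange_big /= -sumrB; apply: eq_bigr => n _.
    rewrite mulrBr -mulrA; congr (_ - _).
      congr (_ * _); have -> : ez (n%:R * x)%:C = ez x%:C ^+ n :> C.
        by rewrite /ez rmorphM /= rmorph_nat mulrCA cexp_natM.
      by rewrite -exprMn -ezD -rmorphD /= /x addrC subrK.
    rewrite mulr_sumr; apply: eq_bigr => k _.
    by rewrite rmorphM /= rmorph_nat !exprMn; ring.
  apply: (@le_trans _ _ (\sum_(0 <= n < m) 2 * K * (`|x| / d) ^+ N * q ^+ n)); last first.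
    rewrite -mulr_sumr mulrAC; apply: ler_wpM2r; last first.
      rewrite ler_wpM2l ?mulr_ge0//; exact: geo_sum_le.
    by rewrite exprn_ge0// divr_ge0// ltW.
  elim: m => [|n IH]; first by rewrite !big_geq// cabs0.
  rewrite !big_nat_recr//= (le_trans (cabsD _ _))// lerD// !cabsM cabsX cabs_ez_real expr1n mulr1.
  apply: (@le_trans _ _ (K * th ^+ n * (2 * (`|n%:R * x| ^+ N / N`!%:R)))).
    by apply: ler_pM => //; [exact: cabs_ge0|exact: cabs_ge0|exact: expi_taylor].
  rewrite normrM exprMn (ger0_norm (ler0n _ n)) -dq !exprMn exprVn.
  have := ler_wpM2l (mulr_ge0 (mulr_ge0 K0 (exprn_ge0 n (ltW th0))) (mulr_ge0 (ler0n R 2) (exprn_ge0 N (normr_ge0 x)))) (pw n N).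
  by rewrite /=; congr (_ <= _); ring.
have xd : `|x| / d < 1 by rewrite ltr_pdivrMr// mul1r.
have lim0 : (2 * K / (1 - q) * (`|x| / d) ^+ N) @[N --> \oo] --> 0.
  rewrite -(mulr0 (2 * K / (1 - q))); apply: cvgM; first exact: cvg_cst.
  by apply: cvg_expr; rewrite ger0_norm// divr_ge0// ltW.
have pE N : pseries (fun k => re (A k)) x N = re (\sum_(0 <= k < N) A k * x%:C ^+ k).
  rewrite /pseries /series /=; elim: N => [|N IH]; first by rewrite !big_geq.
  by rewrite !big_nat_recr//= IH reD -rmorphXn /= reM /= mulr0 subr0.
apply/cvgrPdist_lt => e e0; move/cvgrPdist_lt : lim0 => /(_ _ e0).
apply: filterS => N; rewrite sub0r normrN; apply: le_lt_trans.
rewrite pE -reB (le_trans (re_le_cabs _))// (le_trans (bound N))//.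
exact: ler_norm.
Qed.

End AnalyticFromDecay.

(** * The exponential map on a period *)

Section EzGeometry.
Context {R : realType}.
Local Notation C := R[i].

Lemma cos_eq1 (x : R) : `|x| <= pi -> cos x = 1 -> x = 0.
Proof.
move=> xpi; rewrite -cos_norm -cos0 => /cos_inj h; apply/eqP; rewrite -normr_eq0; apply/eqP.
by apply: h; rewrite in_itv/= ?normr_ge0// lexx pi_ge0.
Qed.

Lemma ez_eq1 (z : C) : `|re z| <= pi -> ez z = 1 -> z = 0.
Proof.
move=> zpi h.
have i0 : im z = 0.
  have := f_equal (@cabs R) h; rewrite cabs_ez cabs1 -expR0 => /expR_inj/eqP.
  by rewrite oppr_eq0 => /eqP.
have zE : z = (re z)%:C by apply: complex_eq.
move: h; rewrite zE ez_real => -[/cos_eq1 -> //].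
Qed.

(** The quotient [(ez z - 1) / z], extended by its limit at 0, is continuous and has no zero on the
    rectangle, so its inverse is bounded there. *)
Lemma ez_lower : exists2 M : R, 0 < M & forall z : C, `|re z| <= pi -> `|im z| <= 1 ->
  cabs z <= M * cabs (ez z - 1).
Proof.
have [p [cp p0 hp]] := cder_ez (0 : C).
have e0 : ez (0 : C) = 1 by rewrite /ez mulr0 cexp0.
have hp' z : ez z - 1 = p z * z by rewrite -e0 hp subr0.
have p00 : p 0 != 0 by rewrite p0 e0 mulr1 -cabs_eq0 cabs_i oner_eq0.
(* The definition of [cder] gives continuity of [p] at 0 only; elsewhere [p] is the quotient
   itself. *)
have cpp z : ccont p z.
  have [->//|z0] := eqVneq z 0.
  have cz : 0 < cabs z by rewrite cabs_gt0.
  apply: (@ccont_local _ (fun w => (ez w - 1) / w) p z _ cz).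
    move=> w wz; have w0 : w != 0 by apply: contraTneq wz => ->; rewrite sub0r cabsN ltxx.
    by rewrite hp' mulfK.
  apply: ccontM; first by apply: ccontB (ccont_ez _) (ccont_cst _ _).
  by apply: ccontV => //; exact: ccont_id.
have pn0 z : `|re z| <= pi -> p z != 0.
  move=> zpi; have [->//|z0] := eqVneq z 0.
  apply: contra_neq z0 => pz; apply: ez_eq1 => //.
  by apply/eqP; rewrite -subr_eq0 hp' pz mul0r.
have [M HM] := @rect_bounded R (fun z => (p z)^-1) (- pi) pi (-1) 1
  (fun z h _ => ccontV (pn0 z (ltac:(by rewrite ler_norml))) (cpp z)).
exists (`|M| + 1); first by rewrite ltr_wpDl.
move=> z zr zi; rewrite hp' cabsM mulrA -[leLHS]mul1r ler_wpM2r ?cabs_ge0//.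
have pz : 0 < cabs (p z) by rewrite cabs_gt0 pn0.
rewrite -ler_pdivrMr// mul1r -cabsV (le_trans (HM _ _ _)) -?ler_norml//.
by rewrite (le_trans (ler_norm _))// lerDl.
Qed.

Lemma per_int (f : C -> C) : per f -> forall (m : int) z, f (z + (2 * pi * m%:~R)%:C) = f z.
Proof.
move=> pf.
have H (n : nat) z : f (z + (2 * pi * n%:R)%:C) = f z.
  elim: n => [|n IH]; first by rewrite mulr0 addr0.
  by rewrite -[n.+1%:R]natr1 mulrDr mulr1 rmorphD /= addrA pf.
case=> n z; first exact: H.
by rewrite NegzE mulrNz -pmulrn -[LHS](H n.+1) -addrA -rmorphD /= mulrN addNr addr0.
Qed.

Lemma per_reduce (x : R) : exists m : int, `|x + 2 * pi * m%:~R| <= pi.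
Proof.
pose y := (x + pi) / (2 * pi).
exists (- Num.floor y).
have p2 : 0 < 2 * pi :> R := pi2_gt0; have p0 := pi_ge0 R.
have := ge_floor y; have := floorD1_gt y.
rewrite intrD /= mulrNz => h1 h2.
have e : x = 2 * pi * y - pi by rewrite /y mulrC divfK ?gt_eqF// addrK.
have h3 : 2 * pi * (Num.floor y)%:~R <= 2 * pi * y by rewrite ler_pM2l.
have h4 : 2 * pi * y < 2 * pi * (Num.floor y)%:~R + 2 * pi by rewrite -[X in _ + X]mulr1 -mulrDr ltr_pM2l.
rewrite ler_norml; apply/andP; split; rewrite e mulrN; lra.
Qed.

End EzGeometry.

(** * Periodic holomorphic functions on half strips *)

Section Inversion.
Context {R : realType}.
Local Notation C := R[i].
Implicit Types (u du : R -> C) (z w : C) (f g : C -> C) (t s : R).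
Local Notation I0 := (@I0 R).
Local Notation finI0 := (@finI0 R).

Lemma ccvg_ext (S T : nat -> C) (a : C) : (forall n, S n = T n) -> ccvg S a -> ccvg T a.
Proof. by move=> /funext ->. Qed.

Lemma cabs_realB (s t : R) : cabs (s%:C - t%:C : C) = `|s - t|.
Proof. by rewrite -(cabs_real (s - t)) rmorphB. Qed.

(** Measuring regularity by the chord [|ez s - ez t|] instead of [|s - t|] treats points near 0 and
    near [2 * pi] alike; this bounds [(u s - u t) * kap] over a whole period. *)
Lemma lip_ez u du : (forall t, u (t + 2 * pi) = u t) -> (forall t, rder u t (du t)) ->
  rcont du -> exists2 L : R, 0 <= L & forall s t, cabs (u s - u t) <= L * cabs (ez s%:C - ez t%:C).
Proof.
move=> pu du_ cdu.
have [M0 M00 HM0] := @ez_lower R.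
have [_ [M HM]] := cbm_cont (- (2 * pi)) (2 * pi) cdu.
have pum (m : int) t : u (t + 2 * pi * m%:~R) = u t.
  have pp : per (fun z => u (re z)) by move=> z; rewrite reD /= pu.
  exact: (per_int pp m t%:C).
have ezm (m : int) t : ez (t + 2 * pi * m%:~R)%:C = ez t%:C :> C.
  by rewrite rmorphD /= (per_int (@ez_per R)).
have p0 : 0 <= pi :> R := pi_ge0 R.
have Mb s t : `|s| <= pi -> `|t - s| <= pi -> cabs (u s - u t) <= 2 * `|M| * cabs (s%:C - t%:C).
  move=> sp st.
  have B x : Num.min t s <= x <= Num.max t s -> x \in `[- (2 * pi), 2 * pi].
    rewrite in_itv/=; move: sp st; rewrite !ler_norml ge_min le_max.
    move=> /andP[? ?] /andP[? ?] /andP[/orP[] ? /orP[] ?]; apply/andP; split; lra.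
  have H1 : `|re (u s) - re (u t) - 0 * (s - t)| <= `|M| * `|s - t|.
    apply: (@mvt_dist R (fun x => re (u x)) (fun x => re (du x))) => x xb.
      by have [] := du_ x.
    by rewrite subr0 (le_trans (re_le_cabs _))// (le_trans (HM _ (B _ xb)))// ler_norm.
  have H2 : `|im (u s) - im (u t) - 0 * (s - t)| <= `|M| * `|s - t|.
    apply: (@mvt_dist R (fun x => im (u x)) (fun x => im (du x))) => x xb.
      by have [] := du_ x.
    by rewrite subr0 (le_trans (im_le_cabs _))// (le_trans (HM _ (B _ xb)))// ler_norm.
  rewrite cabs_realB (le_trans (cabs_le _))// reB imB.
  rewrite !mul0r !subr0 in H1 H2; lra.
exists (2 * `|M| * M0); first by rewrite !mulr_ge0// ltW.
move=> s t.
(* The two shifts bring [s] into [[- pi, pi]] and then [t] within [pi] of it, where [ez_lower]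
   applies. *)
have [m hm] := per_reduce s; set s' := s + _ in hm.
have [k hk] := per_reduce (t - s').
have -> : u s = u s' by rewrite pum.
have -> : ez s%:C = ez s'%:C :> C by rewrite ezm.
pose t' := t + 2 * pi * k%:~R.
have -> : u t = u t' by rewrite pum.
have -> : ez t%:C = ez t'%:C :> C by rewrite ezm.
have ht : `|t' - s'| <= pi by rewrite /t' addrAC.
clearbody s' t'.
apply: (le_trans (Mb _ _ hm ht)); rewrite -[leRHS]mulrA; apply: ler_wpM2l; first by rewrite mulr_ge0.
have ht' : `|re (s'%:C - t'%:C : C)| <= pi by rewrite reB /= distrC.
have i0 : `|im (s'%:C - t'%:C : C)| <= 1 by rewrite imB /= subrr normr0.
have h := HM0 _ ht' i0.
 apply: (le_trans h); apply: ler_wpM2l; first exact: ltW.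
have -> : ez s'%:C - ez t'%:C = ez t'%:C * (ez (s'%:C - t'%:C) - 1) :> C.
  by rewrite mulrBr -ezD mulr1 (addrC t'%:C) subrK.
by rewrite cabsM cabs_ez_real mul1r.
Qed.

Lemma mcf_rcont u : rcont u -> mcf I0 u.
Proof. by move=> cu; have [] := cbm_cont 0 (2 * pi) cu. Qed.

Lemma mcf_kap z : mcf I0 (kap z).
Proof.
apply: mcfM; first exact: mcf_cst.
by apply: mcfV; apply: mcfB (mcf_cst _ _) (mcf_rcont rcont_ez).
Qed.

Lemma cbm_kap u (L : R) t : rcont u -> 0 <= L ->
  (forall s, cabs (u s - u t) <= L * cabs (ez s%:C - ez t%:C)) ->
  cbm I0 (fun s => (u s - u t) * kap t%:C s).
Proof.
move=> cu L0 H; split.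
  by apply: mcfM (mcf_kap _); apply: mcfB (mcf_cst _ _); exact: mcf_rcont.
exists L => s _; rewrite cabsM /kap !cabsM cabs_i cabs_ez_real !mul1r cabsV.
have [->|ne] := eqVneq (ez s%:C : C) (ez t%:C); first by rewrite subrr cabs0 invr0 mulr0.
have h0 : 0 < cabs (ez t%:C - ez s%:C : C) by rewrite cabs_gt0 subr_eq0 eq_sym.
by rewrite ler_pdivrMr// (cabsBC (ez t%:C)) H.
Qed.

(** The singular parts of [kap] and of its conjugate agree, the cotangent being real on the line;
    the constant left over produces the term [2 * pi * u t] of the inversion formula. *)
Lemma kap_conj t s : ez s%:C != ez t%:C :> C -> kap t%:C s - conjc (kap t%:C s) = 'i.
Proof.
move=> ne.
have ni : conjc ('i : C) = - 'i by apply: complex_eq; rewrite /= ?oppr0.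
have E : conjc (kap t%:C s) = - 'i * (ez t%:C)^-1 / ((ez t%:C)^-1 - (ez s%:C)^-1).
  by rewrite /kap !conjcM ni conj_ez_real conjc_inv conjcB !conj_ez_real.
rewrite E /kap.
have h1 : ez t%:C - ez s%:C != 0 :> C by rewrite subr_eq0 eq_sym.
have := ez_neq0 (t%:C : C); have := ez_neq0 (s%:C : C); move: h1.
generalize (ez t%:C : C) (ez s%:C : C) => a b ab b0 a0.
have h2 : a^-1 - b^-1 != 0.
  by apply: contra ab; rewrite !subr_eq0 => /eqP/invr_inj ->.
have h3 : b - a != 0 by rewrite -oppr_eq0 opprB.
have -> : (a^-1 - b^-1) = (b - a) / (a * b) by field; rewrite a0 b0.
by rewrite ?complexiE; field; rewrite a0 b0 h3 ab.
Qed.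

(** The limits in [dini_plus] and [dini_minus] are integrals against [kap] and its conjugate; by
    [kap_conj] their sum reduces to the integral of [u s - u t]. *)
Lemma fourier_inversion u du t : (forall t, u (t + 2 * pi) = u t) ->
  (forall t, rder u t (du t)) -> rcont du ->
  ccvg (fun N => \sum_(1 <= n < N.+1) ez t%:C ^+ n * fcp u n + \sum_(1 <= n < N.+1) (ez t%:C)^-1 ^+ n * fcm u n)
       ((2 * pi)%:C * u t - fcp u 0).
Proof.
move=> pu hu cdu; have cu := rder_rcont hu; have bu := cbm_cont 0 (2 * pi) cu.
have [L L0 HL] := lip_ez pu hu cdu.
have e s : ez s%:C = ez t%:C :> C -> u s = u t.
  move=> h; have := HL s t; rewrite h subrr cabs0 mulr0 => h2.
  by apply/eqP; rewrite -subr_eq0 -cabs_eq0 eq_le h2 cabs_ge0.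
have bk := cbm_kap cu L0 (HL ^~ t).
have bk' : cbm I0 (fun s => (u s - u t) * conjc (kap t%:C s)).
  have [m [M HM]] := bk; split.
    apply: mcfM; first by apply: mcfB (mcf_cst _ _); exact: mcf_rcont.
    have [m1 m2] := mcf_kap t%:C; split.
      by under eq_fun do rewrite re_conj.
    by under eq_fun do rewrite im_conj; exact: measurable_funN.
  by exists M => x Dx; rewrite cabsM cabs_conj -cabsM HM.
have := ccvgD (dini_plus bu e bk) (dini_minus bu e bk').
rewrite mulNr -mulrBr -cintB//; [|exact: finI0].
rewrite (eq_cint (v := fun s => 'i * (u s - u t))); last first.
  move=> s _; rewrite -mulrBr; have [h|h] := eqVneq (ez s%:C : C) (ez t%:C).
    by rewrite (e _ h) subrr mul0r mulr0.
  by rewrite kap_conj// mulrC.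
rewrite cintZ; [|exact: finI0|by apply: cbmB bu (cbm_cst _ _)].
rewrite mulrA -expr2 sqrCi mulN1r cintB; [|exact: finI0|exact: bu|exact: cbm_cst].
rewrite opprB cint_cst; last exact: finI0.
rewrite muI0 mulrC.
have -> // : fcp u 0 = cint I0 u.
by apply: eq_cint => s _; rewrite expr0 mulr1.
Qed.

(** The reflection that carries results between the lower and the upper half strip. *)
Lemma cder_conj f z d : cder f (conjc z) d -> cder (fun w => conjc (f (conjc w))) z (conjc d).
Proof.
move=> [p [cp <- hp]]; exists (fun w => conjc (p (conjc w))); split => //.
  move=> e e0; have [r r0 H] := cp _ e0; exists r => // w wz.
  by rewrite -conjcB cabs_conj H// -conjcB cabs_conj.
by move=> w; rewrite -conjcB hp conjcM conjcB !conjcK.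
Qed.

Lemma ccont_conj f z : ccont f (conjc z) -> ccont (fun w => conjc (f (conjc w))) z.
Proof.
move=> cf e e0; have [r r0 H] := cf _ e0; exists r => // w wz.
by rewrite -conjcB cabs_conj H// -conjcB cabs_conj.
Qed.

Lemma hol1X (D : set C) f f' n : hol1 D f f' -> exists g, hol1 D (fun z => f z ^+ n) g.
Proof.
move=> hf; case: n => [|n].
  by exists (fun=> 0) => z _; split; [exact: cder_cst|exact: ccont_cst].
exists (fun z => n.+1%:R * f z ^+ n * f' z) => z /hf[h1 h2]; split; first exact: cderX.
apply: ccontM => //; apply: ccontM (ccont_cst _ _) _.
by apply: ccontX; exact: cder_ccont h1.
Qed.

Lemma hol1M (D : set C) f f' g g' : hol1 D f f' -> hol1 D g g' ->
  hol1 D (fun z => f z * g z) (fun z => f' z * g z + f z * g' z).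
Proof.
move=> hf hg z Dz; have [h1 h2] := hf z Dz; have [h3 h4] := hg z Dz.
have k1 := cder_ccont h1; have k2 := cder_ccont h3.
by split; [exact: cderM|apply: ccontD; exact: ccontM].
Qed.

Lemma hol1_ez (D : set C) : hol1 D ez (fun z => 'i * ez z).
Proof.
by move=> z _; split; [exact: cder_ez|apply: ccontM (ccont_cst _ _) (ccont_ez _)].
Qed.

Lemma hol1_ezN (D : set C) : hol1 D (fun z => (ez z)^-1) (fun z => - 'i * (ez z)^-1).
Proof.
move=> z _; split; last by apply: ccontM (ccont_cst _ _) _; apply: ccontV (ez_neq0 _) (ccont_ez _).
have := cderV (ez_neq0 z) (cder_ez z); congr cder.
by field; exact: ez_neq0.
Qed.

Definition below (d : R) : set C := fun z => - d < im z < 0.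
Definition above (d : R) : set C := fun z => 0 < im z < d.

(** Pointwise limits along verticals suffice, since boundedness turns them into convergence of the
    coefficients. *)
Definition limit_below f u := forall t (e : R), 0 < e -> exists2 r : R, 0 < r &
  forall y, - r < y < 0 -> cabs (f (t +i* y) - u t) < e.

Lemma ez_imag (t y : R) : ez (t +i* y) = ez t%:C * (expR (- y))%:C :> C.
Proof.
have -> : t +i* y = t%:C + 'i * y%:C :> C by apply: complex_eq; rewrite !reimE /=; ring.
rewrite ezD; congr (_ * _); rewrite /ez mulrA -expr2 sqrCi mulN1r.
by apply: complex_eq; rewrite /= oppr0 ?cos0 ?sin0 ?mulr1 ?mulr0.
Qed.

Section Below.
Variables (f f' : C -> C) (u : R -> C) (d M : R).
Hypotheses (d0 : 0 < d) (hf : hol1 (below d) f f') (pf : per f)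
  (bf : forall z, below d z -> cabs (f z) <= M) (bu : cbm I0 u) (lf : limit_below f u).

(** Heights tending to 0; [k.+2] keeps the first one strictly above [- d]. *)
Let y_ (k : nat) : R := - (d / k.+2%:R).

Lemma y_below k : - d < y_ k < 0.
Proof.
rewrite /y_ ltrN2 oppr_lt0 divr_gt0// andbT ltr_pdivrMr//.
by rewrite ltr_pMr// ltr1n.
Qed.

Lemma y_cvg : y_ k @[k --> \oo] --> 0.
Proof.
rewrite -oppr0 /y_; apply: cvgN; rewrite -(mulr0 d); apply: cvgM; first exact: cvg_cst.
by rewrite (cvg_shiftS (fun n : nat => (n.+1%:R : R)^-1)); exact: cvg_harmonic.
Qed.

Lemma y_lim t : ccvg (fun k => f (t +i* y_ k)) (u t).
Proof.
apply/cvgrPdist_lt => e e0; have [r r0 H] := lf t e0.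
have /cvgrPdist_lt/(_ _ r0) := y_cvg; apply: filterS => k.
rewrite !sub0r !normrN => h; rewrite ger0_norm ?cabs_ge0// H//.
have /andP[_ y0] := y_below k; rewrite y0 andbT.
by rewrite /y_ ltrN2 (le_lt_trans (ler_norm _) h).
Qed.

(** By [period_integral_const] the left side is the same at all heights [y_ k]; dominated
    convergence takes it to the boundary. *)
Lemma coeff_shift (g g' : C -> C) : hol1 setT g g' -> per g ->
  forall y, - d < y < 0 ->
  cint I0 (fun t => f (t +i* y) * g (t +i* y)) = cint I0 (fun t => u t * g t%:C).
Proof.
move=> hg pg y yd.
have hfg := hol1M hf (fun z (h : below d z) => hg z I).
have pfg : per (fun z => f z * g z) by move=> z; rewrite pf pg.
have cst k := period_integral_const hfg pfg yd (y_below k).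
have cg z : ccont g z by have [] := hg z I; move=> /cder_ccont.
have [Mg HMg] := @rect_bounded R g 0 (2 * pi) (- d) 0 (fun z _ _ => cg z).
have cgr : rcont (fun t : R => g t%:C) by apply: (@rcont_horiz _ _ 0) => t; exact: cg.
have bg := cbm_cont 0 (2 * pi) cgr.
have L : ccvg (fun k => cint I0 (fun t => f (t +i* y_ k) * g (t +i* y_ k)))
    (cint I0 (fun t => u t * g t%:C)).
  apply: (@cint_dct _ _ set0 _ _ (M * Mg)) => //; first exact: finI0.
  - move=> k; apply: mcf_rcont; apply: (@rcont_horiz R (fun z => f z * g z) (y_ k)) => t; have [h _] := hfg (t +i* y_ k) (y_below k).
    exact: cder_ccont h.
  - exact: cbmM.
  - move=> k t; rewrite /I0 /= in_itv /= => tI; rewrite cabsM ler_pM ?cabs_ge0//.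
      by apply: bf; exact: y_below.
    by apply: HMg => //=; have /andP[h1 h2] := y_below k; rewrite !ltW.
  - move=> t _ _; apply: ccvgM; first exact: y_lim.
    apply/cvgrPdist_lt => e e0; have [r r0 H] := cg t%:C _ e0.
    have /cvgrPdist_lt/(_ _ r0) := y_cvg; apply: filterS => k.
    rewrite !sub0r !normrN => h; rewrite ger0_norm ?cabs_ge0// H//.
    have -> : t +i* y_ k - t%:C = 'i * (y_ k)%:C by apply: complex_eq; rewrite !reimE /=; ring.
    by rewrite cabsM cabs_i mul1r cabs_real /y_ normrN.
apply: (ccvg_unique _ L).
rewrite (_ : (fun k => _) = (fun=> cint I0 (fun t => f (t +i* y) * g (t +i* y)))).
  exact: ccvg_cst.
by apply/funext => k; rewrite (cst k).
Qed.

Lemma fcp_below n y : - d < y < 0 ->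
  fcp (fun t => f (t +i* y)) n * ((expR (- y))%:C)^-1 ^+ n = fcp u n.
Proof.
move=> yd; have [g hg] := hol1X n (@hol1_ezN setT).
rewrite /fcp -(@coeff_shift (fun z => (ez z)^-1 ^+ n) g hg _ y yd); last first.
  by move=> z /=; rewrite ez_per.
rewrite mulrC -cintZ; [|exact: finI0| ].
  by apply: eq_cint => t _; rewrite ez_imag invfM exprMn; ring.
apply: cbmM (cbm_ezVX _); apply: cbm_cont; apply: rcont_horiz => t.
by have [h _] := hf (yd : below d (t +i* y)); exact: cder_ccont h.
Qed.

Lemma fcm_below n y : - d < y < 0 ->
  fcm (fun t => f (t +i* y)) n * ((expR (- y))%:C) ^+ n = fcm u n.
Proof.
move=> yd; have [g hg] := hol1X n (@hol1_ez setT).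
rewrite /fcm -(@coeff_shift (fun z => ez z ^+ n) g hg _ y yd); last first.
  by move=> z /=; rewrite ez_per.
rewrite mulrC -cintZ; [|exact: finI0| ].
  by apply: eq_cint => t _; rewrite ez_imag exprMn; ring.
apply: cbmM (cbm_ezX _); apply: cbm_cont; apply: rcont_horiz => t.
by have [h _] := hf (yd : below d (t +i* y)); exact: cder_ccont h.
Qed.

(* Shifting the contour to height [y < 0] multiplies the [n]-th coefficient by [expR (n * y)]. *)
Lemma decay_below : exists K th, 0 < th < 1 /\ geo (fcp u) K th.
Proof.
pose y := - (d / 2).
have yd : - d < y < 0.
  by rewrite /y ltrN2 oppr_lt0 divr_gt0// ltr_pdivrMr// ltr_pMr// ltr1n.
exists (2 * M * (2 * pi)), (expR y); split.
  by rewrite expR_gt0 expR_lt1; have /andP[] := yd.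
move=> n; rewrite -(fcp_below n yd) cabsM cabsX cabsV cabs_real ger0_norm ?expR_ge0// expRN invrK.
rewrite ler_wpM2r ?exprn_ge0 ?expR_ge0// -muI0; apply: cint_bound; first exact: finI0.
  apply: cbmM (cbm_ezVX _); apply: cbm_cont; apply: rcont_horiz => t.
  by have [h _] := hf (yd : below d (t +i* y)); exact: cder_ccont h.
move=> t _; rewrite cabsM cabsX cabsV cabs_ez_real invr1 expr1n mulr1.
exact: bf.
Qed.

(** The inversion formula is applied at a height [y < 0], where the function is differentiable, and
    both series are then continued to the line: [u] itself is only known to be bounded and
    measurable. *)
Lemma laurent_below (K1 th1 K2 th2 : R) : 0 < th1 < 1 -> 0 < th2 < 1 ->
  geo (fcp u) K1 th1 -> geo (fcm u) K2 th2 -> forall t,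
  (2 * pi)%:C * u t = pser (fcp u) (ez t%:C) + pser (fcm u) (ez t%:C)^-1 - fcp u 0.
Proof.
move=> /andP[a0 a1] /andP[b0 b1] g1 g2 t.
have cez : ccont (fun z => pser (fcp u) (ez z) + pser (fcm u) (ez z)^-1 - fcp u 0) t%:C.
  have h1 : cder (pser (fcp u)) (ez t%:C) (pser (dser (fcp u)) (ez t%:C)).
    by apply: pser_cder a0 g1 _; rewrite cabs_ez_real mulr1.
  have h2 : cder (pser (fcm u)) (ez t%:C)^-1 (pser (dser (fcm u)) (ez t%:C)^-1).
    by apply: pser_cder b0 g2 _; rewrite cabsV cabs_ez_real invr1 mulr1.
  apply: ccontB (ccont_cst _ _); apply: ccontD.
    exact: ccont_comp (ccont_ez _) (cder_ccont h1).
  apply: (@ccont_comp _ (fun w => (ez w)^-1) (pser (fcm u)) t%:C); last exact: cder_ccont h2.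
  exact: ccontV (ez_neq0 _) (ccont_ez _).
have yt : ccvg (fun k => t +i* y_ k) t%:C.
  apply/cvgrPdist_lt => e e0; have /cvgrPdist_lt/(_ _ e0) := y_cvg; apply: filterS => k.
  have -> : t +i* y_ k - t%:C = 'i * (y_ k)%:C by apply: complex_eq; rewrite !reimE /=; ring.
  by rewrite cabsM cabs_i mul1r cabs_real !sub0r !normrN normr_id.
have L1 := ccvg_comp cez yt.
have L2 := ccvgM (ccvg_cst (2 * pi)%:C) (y_lim t).
have E : \forall k \near \oo, (2 * pi)%:C * f (t +i* y_ k) =
    pser (fcp u) (ez (t +i* y_ k)) + pser (fcm u) (ez (t +i* y_ k))^-1 - fcp u 0.
  (* At depth less than [- ln th1] the series of [fcp u] converges, because
     [|ez (t +i* y)| = expR (- y)] stays below [th1^-1]. *)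
  have e0 : 0 < - ln th1 by rewrite oppr_gt0 ln_lt0// a0.
  have /cvgrPdist_lt/(_ _ e0) := y_cvg; apply: filterS => k.
  rewrite sub0r normrN => h; have /andP[_ yk0] := y_below k.
  have yd := y_below k; set y := y_ k in h yk0 yd *.
  have th1e : th1 * expR (- y) < 1.
    have -> : th1 = expR (ln th1) by rewrite lnK.
    rewrite -expRD expR_lt1; move: h; rewrite ltr0_norm//; lra.
  have cf s : ccont f (s +i* y) by have [h1 _] := hf (yd : below d (s +i* y)); exact: cder_ccont h1.
  have inv := @fourier_inversion (fun s => f (s +i* y)) (fun s => f' (s +i* y)) t.
  have {inv}inv : ccvg (fun N => \sum_(1 <= n < N.+1) ez t%:C ^+ n * fcp (fun s => f (s +i* y)) n +
      \sum_(1 <= n < N.+1) (ez t%:C)^-1 ^+ n * fcm (fun s => f (s +i* y)) n)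
       ((2 * pi)%:C * f (t +i* y) - fcp (fun s => f (s +i* y)) 0).
    apply: inv.
    - move=> s; rewrite -[RHS]pf; congr f; by apply: complex_eq; rewrite !reimE /= ?addr0.
    - by move=> s; apply: rder_horiz; have [] := hf (yd : below d (s +i* y)).
    - by apply: rcont_horiz => s; have [] := hf (yd : below d (s +i* y)).
  have X0 : (expR (- y))%:C != 0 :> C by rewrite -cabs_eq0 cabs_real normr_eq0 expR_eq0.
  have c1 : ccvg (fun N => \sum_(0 <= n < N.+1) fcp u n * ez (t +i* y) ^+ n) (pser (fcp u) (ez (t +i* y))).
    have h1 : th1 * cabs (ez (t +i* y)) < 1 by rewrite cabs_ez.
    exact: (ccvgS (pser_cvg (ltW a0) g1 h1)).
  have c2 : ccvg (fun N => \sum_(0 <= n < N.+1) fcm u n * (ez (t +i* y))^-1 ^+ n) (pser (fcm u) (ez (t +i* y))^-1).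
    have h2 : th2 * cabs (ez (t +i* y))^-1 < 1.
      rewrite cabsV cabs_ez -expRN opprK (le_lt_trans _ b1)// -[leRHS]mulr1.
      by rewrite ler_wpM2l ?ltW// expR_lt1.
    exact: (ccvgS (pser_cvg (ltW b0) g2 h2)).
  have F0 : fcp (fun s => f (s +i* y)) 0 = fcp u 0.
    by rewrite -(fcp_below 0 yd) expr0 mulr1.
  (* Both series contain the coefficient of index 0, hence the correction by [fcp u 0]. *)
  have Fm : fcm u 0 = fcp u 0.
    by apply: eq_cint => s _; rewrite !expr0.
  rewrite F0 in inv.
  have : (2 * pi)%:C * f (t +i* y) - fcp u 0 = pser (fcp u) (ez (t +i* y)) + pser (fcm u) (ez (t +i* y))^-1 - (fcp u 0 + fcm u 0).
    apply: (ccvg_unique inv).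
    have S1 N : \sum_(0 <= n < N.+1) fcp u n * ez (t +i* y) ^+ n = fcp u 0 +
        \sum_(1 <= n < N.+1) ez t%:C ^+ n * fcp (fun s => f (s +i* y)) n.
      rewrite (big_ltn (ltn0Sn N)) expr0 mulr1; congr (_ + _).
      apply: eq_bigr => n _; rewrite -(fcp_below n yd) ez_imag !exprMn exprVn.
      by field; rewrite expf_neq0.
    have S2 N : \sum_(0 <= n < N.+1) fcm u n * (ez (t +i* y))^-1 ^+ n = fcm u 0 +
        \sum_(1 <= n < N.+1) (ez t%:C)^-1 ^+ n * fcm (fun s => f (s +i* y)) n.
      rewrite (big_ltn (ltn0Sn N)) expr0 mulr1; congr (_ + _).
      apply: eq_bigr => n _; rewrite -(fcm_below n yd) ez_imag invfM !exprMn !exprVn.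
      by field; rewrite !expf_neq0// ez_neq0.
    have c3 := ccvgB (ccvgD (ccvg_ext S1 c1) (ccvg_ext S2 c2)) (ccvg_cst (fcp u 0 + fcm u 0)).
    apply: (ccvg_ext _ c3) => N.
    by rewrite addrACA (addrC (fcp u 0 + fcm u 0)) addrK.
  rewrite Fm => /(f_equal (fun x => x + fcp u 0)); rewrite subrK => ->; rewrite opprD addrA subrK; reflexivity.
apply: (ccvg_unique L2); move: L1; apply: cvg_trans.
by apply: near_eq_cvg; apply: filterS E => k ->.
Qed.

End Below.

End Inversion.

(** * Real analyticity and Fourier decay *)

Section AnalyticDecay.
Context {R : realType}.
Local Notation C := R[i].
Implicit Types (u v du : R -> C) (z w : C) (c : nat -> C) (t s : R).
Local Notation I0 := (@I0 R).
Local Notation finI0 := (@finI0 R).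

Lemma rderM u v t a b : rder u t a -> rder v t b ->
  rder (fun s => u s * v s) t (a * v t + u t * b).
Proof.
move=> [a1 a2] [b1 b2]; split.
  have h := is_deriveB (is_deriveM a1 b1) (is_deriveM a2 b2).
  rewrite (_ : (fun _ => _) = (fun s => re (u s)) * (fun s => re (v s)) - (fun s => im (u s)) * (fun s => im (v s))).
    apply: (is_derive_eq h); rewrite reD !reM -!/(_ * _); rewrite -![_ *: _]/(_ * _); ring.
  by apply/funext => s; rewrite reM.
have h := is_deriveD (is_deriveM a1 b2) (is_deriveM a2 b1).
rewrite (_ : (fun _ => _) = (fun s => re (u s)) * (fun s => im (v s)) + (fun s => im (u s)) * (fun s => re (v s))).
  apply: (is_derive_eq h); rewrite imD !imM -![_ *: _]/(_ * _); ring.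
by apply/funext => s; rewrite imM.
Qed.

Lemma rder_ezVX n t : rder (fun t : R => (ez t%:C)^-1 ^+ n) t (- ('i * n%:R) * (ez t%:C)^-1 ^+ n).
Proof.
have [h1 h2] := rder_ezX n t.
have E s : (ez s%:C)^-1 ^+ n = conjc (ez s%:C ^+ n) :> C by rewrite conjcX conj_ez_real.
have Ed : - ('i * n%:R) * (ez t%:C)^-1 ^+ n = conjc ('i * n%:R * ez t%:C ^+ n) :> C.
  rewrite E conjcM conjcM; congr (_ * _).
  have -> : conjc (n%:R : C) = n%:R by exact: conjc_nat.
  by rewrite -mulNr; congr (_ * _); apply: complex_eq; rewrite /= ?oppr0.
rewrite Ed; split.
  by rewrite re_conj; move: h1; congr (is_derive _ _ _ _); apply/funext => s; rewrite E re_conj.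
rewrite im_conj; have h3 := is_deriveN h2.
by move: h3; congr (is_derive _ _ _ _); apply/funext => s; rewrite E im_conj.
Qed.

Lemma rcontD u v : rcont u -> rcont v -> rcont (fun t => u t + v t).
Proof.
move=> [a b] [c d]; split.
  rewrite (_ : (fun _ => _) = (fun t => re (u t) + re (v t))).
    by move=> t; apply: cvgD; [exact: a|exact: c].
  by apply/funext => t; rewrite reD.
rewrite (_ : (fun _ => _) = (fun t => im (u t) + im (v t))).
  by move=> t; apply: cvgD; [exact: b|exact: d].
by apply/funext => t; rewrite imD.
Qed.

Lemma fcp_derive u du n : (forall t, rder u t (du t)) -> rcont du -> u (2 * pi) = u 0 ->
  fcp du n = 'i * n%:R * fcp u n.
Proof.
move=> hu cdu u0; have cu := rder_rcont hu.
have cE := rcontX n (@rcont_ezV R).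
pose g t := du t * (ez t%:C)^-1 ^+ n + u t * (- ('i * n%:R) * (ez t%:C)^-1 ^+ n).
have cg : rcont g.
  by apply: rcontD; apply: rcontM => //; apply: rcontM (rcont_cst _) cE.
have := @cint_FTC R (fun t => u t * (ez t%:C)^-1 ^+ n) g 0 (2 * pi) pi2_ge0
  (fun t => rderM (hu t) (rder_ezVX n t)) cg.
rewrite ez_2pi u0 [ez 0%:C](_ : _ = 1) ?subrr; last by rewrite /ez mulr0 cexp0.
have -> : cint `[0, 2 * pi] g = fcp du n - 'i * n%:R * fcp u n.
  rewrite /fcp -cintZ; [|exact: finI0|by apply: cbmM (cbm_cont _ _ cu) (cbm_ezVX _)].
  rewrite -cintB; [|exact: finI0|by apply: cbmM (cbm_cont _ _ cdu) (cbm_ezVX _)|].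
    by apply: eq_cint => t _; rewrite /g; ring.
  by apply: cbmM (cbm_cst _ _) _; apply: cbmM (cbm_cont _ _ cu) (cbm_ezVX _).
by move=> /eqP; rewrite subr_eq0 => /eqP.
Qed.

(** A coefficient of [u] is one of [du] divided by [n] in modulus, and [a * b <= a ^ 2 + b ^ 2]
    splits this into an inverse square and a term summable by Bessel's inequality. *)
Lemma fcp_summable u du : (forall t, rder u t (du t)) -> rcont du -> u (2 * pi) = u 0 ->
  cvgn (series (fun n => cabs (fcp u n))).
Proof.
move=> hu cdu u0.
have bdu : cbm I0 du by exact: cbm_cont.
have key n : cabs (fcp u n.+1) <= (n.+1%:R * n.+1%:R)^-1 + cabs (fcp du n.+1) ^+ 2.
  have n0 : 0 < (n.+1%:R : R) by [].
  have -> : cabs (fcp u n.+1) = n.+1%:R^-1 * cabs (fcp du n.+1).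
    by rewrite (fcp_derive _ hu cdu u0) !cabsM cabs_i cabs_nat mul1r mulrA mulVf ?mul1r ?gt_eqF.
  rewrite invfM; move: (n.+1%:R^-1) (cabs _) => a b; nra.
(* A telescoping bound for the sum of inverse squares. *)
have inv_sq N : \sum_(0 <= n < N) ((n.+1%:R : R) * n.+1%:R)^-1 <= 2 - 2 * (N.+1%:R)^-1.
  elim: N => [|N IH]; first by rewrite big_geq// invr1; lra.
  rewrite big_nat_recr//=; apply: (le_trans (lerD IH (lexx _))).
  have H (a : R) : 1 <= a -> 2 - 2 * a^-1 + (a * a)^-1 <= 2 - 2 * (a + 1)^-1.
    move=> a1; have a0 : a != 0 by rewrite gt_eqF//; lra.
    have b0 : a + 1 != 0 by rewrite gt_eqF//; lra.
    rewrite -subr_ge0.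
    have -> : 2 - 2 * (a + 1)^-1 - (2 - 2 * a^-1 + (a * a)^-1) = (a - 1) / (a * a * (a + 1)).
      by field; rewrite a0 b0.
    by rewrite divr_ge0 ?subr_ge0// !mulr_ge0//; lra.
  have -> : (N.+2%:R : R) = N.+1%:R + 1 by rewrite -[N.+2%:R]natr1.
  by apply: H; rewrite ler1n.
apply: nondecreasing_is_cvgn.
  by apply: nondecreasing_series => n _ _; exact: cabs_ge0.
exists (cabs (fcp u 0) + (2 + 2 * pi * sqint du)) => _ [n _ <-].
rewrite /series /=; case: n => [|n].
  rewrite big_geq// !addr_ge0 ?cabs_ge0//; rewrite mulr_ge0 ?pi2_ge0//.
  by apply: Rintegral_ge0 => s _; exact: sqr_ge0.
rewrite (big_ltn (ltn0Sn n)) lerD2l big_add1 /=.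
apply: (@le_trans _ _ (\sum_(0 <= i < n) ((i.+1%:R * i.+1%:R)^-1 + cabs (fcp du i.+1) ^+ 2))).
  by apply: ler_sum => i _; exact: key.
rewrite big_split /= lerD//.
  by rewrite (le_trans (inv_sq n))// lerBlDr lerDl mulr_ge0// invr_ge0.
apply: (le_trans _ (bessel n.+1 bdu)).
by rewrite (big_ltn (ltn0Sn n)) big_add1 /= lerDr sqr_ge0.
Qed.

Lemma binD_le n k : ('C(n, k) <= 2 ^ n)%N.
Proof.
elim: n k => [|n IH] [|k]; rewrite ?bin0 ?bin0n ?expn_gt0//.
by rewrite binS expnS mul2n -addnn leq_add.
Qed.

Lemma iter_dserE c k n : iter k dser c n = ((n + k)`!%:R / n`!%:R) * c (n + k)%N.
Proof.
have f0 m : (m`!%:R : C) != 0 by rewrite pnatr_eq0 -lt0n fact_gt0.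
elim: k n => [|k IH] n; first by rewrite addn0 divff// mul1r.
rewrite iterS /dser IH addSnnS mulrA; congr (_ * _).
rewrite (factS n) natrM invfM mulrCA mulrA mulrA -!mulrA; congr (_ * _).
by rewrite mulrA divff ?mul1r// pnatr_eq0.
Qed.

(** Here [(n + k)! / n! = 'C(n + k, k) * k!], and the binomial coefficient is at most [2 ^ (n + k)]:
    the ratio doubles once, whatever [k] is, and the rest goes into the constant. *)
Lemma geo_iter_dser c (K th : R) k : 0 <= th -> geo c K th ->
  geo (iter k dser c) (K * k`!%:R * (2 * th) ^+ k) (2 * th).
Proof.
move=> t0 g n; have K0 := geo_K_ge0 g; rewrite iter_dserE.
have -> : (n + k)`!%:R / n`!%:R = ('C(n + k, k) * k`!)%:R :> C.
  have := @bin_fact (n + k) k (leq_addl _ _); rewrite addnK => <-.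
  by rewrite mulnA natrM mulfK// pnatr_eq0 -lt0n fact_gt0.
rewrite cabsM cabs_nat natrM.
apply: (@le_trans _ _ ((2 ^ (n + k))%:R * k`!%:R * (K * th ^+ (n + k)))).
  apply: ler_pM.
  - by rewrite mulr_ge0.
  - exact: cabs_ge0.
  - by apply: ler_wpM2r => //; rewrite ler_nat binD_le.
  - exact: g.
by rewrite le_eqVlt; apply/orP; left; apply/eqP; rewrite natrX !exprD !exprMn; ring.
Qed.

Lemma pser_bound c (K th : R) z : 0 <= th -> geo c K th -> th * cabs z <= 2^-1 ->
  cabs (pser c z) <= 2 * K.
Proof.
move=> t0 g h; have K0 := geo_K_ge0 g.
have h1 : th * cabs z < 1 by apply: le_lt_trans h _; rewrite invf_lt1// ltr1n.
have := ccvg_le (b := 0) (pser_cvg t0 g h1); rewrite subr0; apply; apply: nearW => N.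
rewrite subr0; pose x := th * cabs z.
have x01 : 0 <= x < 1 by rewrite mulr_ge0 ?cabs_ge0.
apply: (@le_trans _ _ (K * \sum_(0 <= n < N) x ^+ n)).
  rewrite mulr_sumr; elim: N => [|N IH]; first by rewrite !big_geq// cabs0.
  rewrite !big_nat_recr//= (le_trans (cabsD _ _))// lerD// cabsM cabsX /x exprMn mulrA.
  by apply: ler_wpM2r; [rewrite exprn_ge0// cabs_ge0|exact: g].
rewrite mulrC; apply: ler_wpM2r => //; apply: (le_trans (geo_sum_le N x01)).
have hx : x <= 2^-1 by [].
rewrite -[leRHS]invrK lef_pV2 ?posrE ?invr_gt0//; last by have /andP[] := x01; rewrite subr_gt0.
by move: hx; clearbody x; lra.
Qed.

(** Cauchy-type estimates, with a single natural number [N] in both places so that compactness can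
    later take a maximum. *)
Lemma analytic_local_bounds (g : R -> R) t0 : analytic_at g t0 ->
  exists (r : R) (N : nat), 0 < r /\ forall t, `|t - t0| < r -> forall k,
   is_derive t (1 : R) (derive1n k g) (derive1n k.+1 g t) /\
   `|derive1n k g t| <= N%:R * k`!%:R * N%:R ^+ k.
Proof.
move=> [a [r [r0 ha]]].
pose c n : C := (a n)%:C.
pose th := (r / 2)^-1.
have th0 : 0 < th by rewrite invr_gt0 divr_gt0.
(* Convergence at distance [r / 2] bounds the terms of the series there. *)
have [K gK] : exists K, geo c K th.
  have hr : `|(t0 + r / 2) - t0| < r.
    by rewrite addrAC subrr add0r ger0_norm ?ltr_pdivrMr ?ltr_pMr// ?ltr1n// divr_ge0// ltW.
  have := ha _ hr; rewrite addrAC subrr add0r => cv.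
  have [M [_ HM]] := cvg_seq_bounded (cvgP _ (cvg_series_cvg_0 (cvgP _ cv))).
  exists (M + 1) => n; rewrite /c cabs_real /th exprVn ler_pdivlMr ?exprn_gt0 ?divr_gt0//.
  rewrite -[X in _ * X]ger0_norm ?exprn_ge0 ?divr_ge0 ?(ltW r0)// -normrM.
  by apply: (HM (M + 1)); rewrite ?ltrDl.
pose ck k := iter k dser c.
have gk k : geo (ck k) (K * k`!%:R * (2 * th) ^+ k) (2 * th) by apply: geo_iter_dser => //; exact: ltW.
have th2 : 0 < 2 * th by rewrite mulr_gt0.
(* Within [(4 * th)^-1] all the differentiated series, of ratio [2 * th], have sums at most twice
   their constants. *)
pose q := Num.min (r / 2) ((4 * th)^-1).
have q0 : 0 < q by rewrite lt_min divr_gt0//= invr_gt0 mulr_gt0.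
pose D k t := re (pser (ck k) (t - t0)%:C).
have small t : `|t - t0| < q -> 2 * th * cabs ((t - t0)%:C : C) <= 2^-1.
  rewrite lt_min cabs_real => /andP[_ h].
  have : 4 * th * `|t - t0| < 1 by rewrite -ltr_pdivlMl ?mulr1// mulr_gt0.
  by rewrite -(mulrA 4) -(mulrA 2); move: (th * _) => y; lra.
have small1 t : `|t - t0| < q -> 2 * th * cabs ((t - t0)%:C : C) < 1.
  by move=> /small h; apply: le_lt_trans h _; rewrite invf_lt1// ltr1n.
have dD k t : `|t - t0| < q -> is_derive t (1 : R) (D k) (D k.+1 t).
  move=> /small1 h.
  have h1 : cder (fun z => z - t0%:C) (t +i* 0) 1.
    by have := cderB (cder_id (t +i* 0 : C)) (cder_cst t0%:C (t +i* 0)); rewrite subr0.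
  have e s : s +i* 0 - t0%:C = (s - t0)%:C :> C by rewrite rmorphB.
  have h2 : cder (pser (ck k)) (t +i* 0 - t0%:C) (pser (ck k.+1) (t +i* 0 - t0%:C)).
    by apply: pser_cder th2 (gk k) _; rewrite e.
  have [h3 _] := rder_horiz (cder_comp h1 h2).
  have -> : D k = (fun s => re (pser (ck k) (s +i* 0 - t0%:C))).
    by apply/funext => s; rewrite e.
  by move: h3; rewrite mulr1 e.
have gD0 t : `|t - t0| < q -> g t = D 0 t.
  move=> tq; have tr : `|t - t0| < r.
    by apply: lt_le_trans tq _; rewrite ge_min ler_pdivrMr// ler_pMr// ler1n.
  have [h _] := (ccvgP _ _).1 (pser_cvg (ltW th2) (gk 0) (small1 _ tq)).
  apply: (cvg_unique _ (ha _ tr)) => //; move: h; apply: cvg_trans.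
  apply: near_eq_cvg; apply: nearW => N; rewrite /pseries /series /=.
  elim: N => [|N IH]; first by rewrite !big_geq.
  rewrite big_nat_recr// reD IH [RHS]big_nat_recr//; congr (_ + _).
  by rewrite -rmorphXn reM /= mulr0 subr0.
have dn k : forall t, `|t - t0| < q -> derive1n k g t = D k t.
  elim: k => [|k IH] t tq; first exact: gD0.
  rewrite derive1nS derive1E.
  have nearE : {near t, D k =1 derive1n k g}.
    exists (q - `|t - t0|); first by rewrite /= subr_gt0.
    move=> s /= hs; rewrite IH//.
    apply: le_lt_trans (ler_distD t _ _) _; rewrite distrC; move: hs; lra.
  have [_ <-] := dD k t tq; apply/esym; exact: near_eq_derive.
pose B := Num.max (2 * K) (2 * th).
have B0 : 0 <= B by rewrite le_max (ltW th2) orbT.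
exists q, (Num.bound B); split; first exact: q0.
move=> t tq k.
have NB : B <= (Num.bound B)%:R by rewrite ltW// archi_boundP.
split.
  have nearE : {near t, D k =1 derive1n k g}.
    exists (q - `|t - t0|); first by rewrite /= subr_gt0.
    move=> s /= hs; rewrite dn//.
    apply: le_lt_trans (ler_distD t _ _) _; rewrite distrC; move: hs; lra.
  have := dD k t tq; rewrite -(dn k.+1 t tq) => hD.
  exact: (near_eq_is_derive nearE hD).
rewrite dn// /D (le_trans (re_le_cabs _))// (le_trans (pser_bound (ltW th2) (gk k) (small _ tq)))//.
rewrite !mulrA; apply: ler_pM.
- by rewrite mulr_ge0// mulr_ge0// (geo_K_ge0 gK).
- by rewrite exprn_ge0// ltW.
- by apply: ler_wpM2r => //; apply: le_trans _ NB; rewrite le_max lexx.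
- apply: lerXn2r; rewrite ?nnegrE ?(ltW th2)//.
  by apply: le_trans _ NB; rewrite le_max lexx orbT.
Qed.

End AnalyticDecay.

(** * Fourier decay of periodic analytic functions *)

Section StripExtension.
Context {R : realType}.
Local Notation C := R[i].
Implicit Types (u v du : R -> C) (z w : C) (c : nat -> C) (t s : R) (g : R -> R).
Local Notation I0 := (@I0 R).
Local Notation finI0 := (@finI0 R).

Definition analytic_everywhere g := forall t, analytic_at g t.

Lemma analytic_is_derive g k t : analytic_everywhere g ->
  is_derive t (1 : R) (derive1n k g) (derive1n k.+1 g t).
Proof.
move=> ag; have [r [N [r0 H]]] := analytic_local_bounds (ag t).
have tr : `|t - t| < r by rewrite subrr normr0.
by have [] := H t tr k.
Qed.

Lemma is_derive_shift g t (a d : R) : is_derive (t + a) (1 : R) g d ->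
  is_derive t (1 : R) (fun s => g (s + a)) d.
Proof.
move=> h.
have h1 : is_derive t (1 : R) (fun s => s + a) (1 + 0).
  exact: (is_deriveD (is_derive_id _ _) (is_derive_cst _ _ _)).
have := @is_derive1_comp R g (fun s => s + a) t _ _ h h1.
by move=> h2; apply: (is_derive_eq h2); rewrite addr0 mulr1.
Qed.

Lemma derive1n_per g k t : analytic_everywhere g -> (forall t, g (t + 2 * pi) = g t) ->
  derive1n k g (t + 2 * pi) = derive1n k g t.
Proof.
move=> ag pg; elim: k t => [|k IH] t; first exact: pg.
have h1 := is_derive_shift (analytic_is_derive k (t + 2 * pi) ag).
have E : (fun s => derive1n k g (s + 2 * pi)) = derive1n k g by apply/funext => s; exact: IH.
rewrite E in h1.
have [_ <-] := h1; by have [_ <-] := analytic_is_derive k t ag.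
Qed.

Lemma analytic_uniform_bounds g (a b : R) : analytic_everywhere g ->
  exists N : nat, forall t, a <= t <= b -> forall k, `|derive1n k g t| <= N%:R * k`!%:R * N%:R ^+ k.
Proof.
move=> ag.
have /compact_near_coveringP /(_ nat \oo
  (fun N t => forall k, `|derive1n k g t| <= N%:R * k`!%:R * N%:R ^+ k) _) H := @segment_compact R a b.
have [t /= _|N _ HN] := H.
  have [r [N [r0 HN]]] := analytic_local_bounds (ag t).
  exists (ball t r, [set n | (N <= n)%N]); first by split; [exact: nbhsx_ballx|exists N].
  move=> [s n] [/= ts Nn] k.
  have st : `|s - t| < r by rewrite distrC.
  have [_ h] := HN s st k; apply: (le_trans h).
  have NR : (N%:R : R) <= n%:R by rewrite ler_nat.
  apply: ler_pM; rewrite ?mulr_ge0 ?exprn_ge0//; first by apply: ler_wpM2r.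
  by apply: lerXn2r; rewrite ?nnegrE.
by exists N => t tab; apply: (HN N (leqnn N) t); rewrite /= in_itv.
Qed.

Definition realC g : R -> C := fun t => (g t)%:C.

Lemma rder_realC g t d : is_derive t (1 : R) g d -> rder (realC g) t d%:C.
Proof. by move=> h; split => //=; exact: is_derive_cst. Qed.

Lemma rcont_realC g : continuous g -> rcont (realC g).
Proof. by move=> h; split => //= t; exact: cvg_cst. Qed.

Lemma analytic_cont g k : analytic_everywhere g -> continuous (derive1n k g).
Proof. by move=> ag t; apply: is_derive_cont (analytic_is_derive k t ag). Qed.

Lemma fact_le_exp k : (k`! <= k ^ k)%N.
Proof.
elim: k => // k IH; rewrite factS expnS leq_mul2l /=.
by apply: leq_trans IH _; case: k => // k; rewrite leq_exp2r.
Qed.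

(* Integrating by parts [k] times bounds the [n]-th coefficient by a multiple of [k! (N / n) ^ k]; then [k] is taken proportional to [n]. *)
Lemma analytic_decay g : analytic_everywhere g -> (forall t, g (t + 2 * pi) = g t) ->
  exists K th, 0 < th < 1 /\ geo (fcp (realC g)) K th.
Proof.
move=> ag pg; have [N0 HN0] := analytic_uniform_bounds 0 (2 * pi) ag.
pose N := N0.+1.
have HN t k : 0 <= t <= 2 * pi -> `|derive1n k g t| <= N%:R * k`!%:R * N%:R ^+ k.
  move=> ht; apply: (le_trans (HN0 t ht k)).
  have NR : (N0%:R : R) <= N%:R by rewrite ler_nat.
  apply: ler_pM; rewrite ?mulr_ge0 ?exprn_ge0//; first by apply: ler_wpM2r.
  by apply: lerXn2r; rewrite ?nnegrE.
pose G k := realC (derive1n k g).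
have dG k t : rder (G k) t (G k.+1 t) by apply: rder_realC; exact: analytic_is_derive.
have cG k : rcont (G k) by apply: rcont_realC; exact: analytic_cont.
have pG k : G k (2 * pi) = G k 0.
  by rewrite /G /realC -[2 * pi in LHS]add0r derive1n_per.
have N1 : 0 < (N%:R : R) by [].
have bG k n : cabs (fcp (G k) n) <= 4 * pi * N%:R * k`!%:R * N%:R ^+ k.
  have E : 4 * pi * N%:R * k`!%:R * N%:R ^+ k = 2 * (N%:R * k`!%:R * N%:R ^+ k) * fine (@lebesgue_measure R I0).
    by rewrite muI0; ring.
  rewrite E /fcp; apply: cint_bound; first exact: finI0.
    by apply: cbmM; [exact: cbm_cont|exact: cbm_ezVX].
  move=> s; rewrite /I0 /= in_itv /= => hs.
  by rewrite cabsM cabsX cabsV cabs_ez_real invr1 expr1n mulr1 /G /realC cabs_real; exact: HN.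
have iG k n : cabs (fcp (realC g) n) * n%:R ^+ k = cabs (fcp (G k) n).
  elim: k => [|k IH]; first by rewrite mulr1.
  rewrite (fcp_derive n (dG k) (cG k.+1) (pG k)) !cabsM cabs_i mul1r -IH exprS cabs_nat.
  by rewrite mulrCA.
(* As [k! <= k ^ k], the factor [k! * N ^ k / n ^ k] is at most [(k * N / n) ^ k], hence at most
   [2^-1 ^ k]. *)
have key n k : (2 * N * k <= n)%N -> cabs (fcp (realC g) n) <= 4 * pi * N%:R * (2^-1) ^+ k.
  move=> hk; have [->|k0] := posnP k.
    by have := bG 0 n; rewrite -iG !expr0 !mulr1.
  have n0 : (0 < n)%N by apply: leq_trans hk; rewrite !muln_gt0 k0.
  have nk : 0 < (n%:R : R) ^+ k by rewrite exprn_gt0// ltr0n.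
  rewrite -(ler_pM2r nk) iG; apply: (le_trans (bG k n)).
  rewrite -!mulrA ler_wpM2l// ler_wpM2l ?pi_ge0// ler_wpM2l//.
  have h1 : (k`!%:R : R) <= k%:R ^+ k by rewrite -natrX ler_nat fact_le_exp.
  apply: (@le_trans _ _ (k%:R ^+ k * N%:R ^+ k)); first by apply: ler_wpM2r => //; rewrite exprn_ge0.
  rewrite -!exprMn; apply: lerXn2r; rewrite ?nnegrE ?mulr_ge0 ?invr_ge0//.
  rewrite mulrC [leRHS]mulrC ler_pdivlMr//.
  by rewrite -!natrM ler_nat -mulnC mulnA.
(* Bernoulli's inequality gives [th ^ (2 * N) >= 1 / 2], so a factor [1 / 2] for each block of
   [2 * N] indices amounts to geometric decay of ratio [th]. *)
pose th : R := 1 - (4 * N%:R)^-1.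
have N4 : 0 < (4 * N%:R : R) by rewrite mulr_gt0.
have i4 : 0 < (4 * N%:R : R)^-1 by rewrite invr_gt0.
have i41 : (4 * N%:R : R)^-1 < 1.
  have h1N : 1 <= (N%:R : R) by rewrite ler1n.
  by rewrite invf_lt1//; move: h1N; clear; lra.
have th01 : 0 < th < 1 by rewrite /th; lra.
have /andP[th0 th1] := th01.
have bern m : 1 - m%:R * (4 * N%:R)^-1 <= th ^+ m.
  elim: m => [|m IH]; first by rewrite mul0r subr0 expr0.
  rewrite exprS; apply: (@le_trans _ _ (th * (1 - m%:R * (4 * N%:R)^-1))); last by rewrite ler_pM2l.
  rewrite /th -[m.+1%:R]natr1.
  have : 0 <= m%:R * (4 * N%:R)^-1 * (4 * N%:R : R)^-1 by rewrite !mulr_ge0 ?invr_ge0// ltW.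
  by move: (m%:R : R) (_^-1) => a b; nra.
have thP : 2^-1 <= th ^+ (2 * N).
  apply: le_trans (bern _).
  rewrite natrM invfM.
  have -> : 1 - 2 * N%:R * (4^-1 / N%:R) = 2^-1 :> R by field; rewrite gt_eqF.
  by [].
(* The final factor 2 pays for the incomplete last block. *)
exists (4 * pi * N%:R * 2), th; split => // n.
pose k := (n %/ (2 * N))%N.
have hk : (2 * N * k <= n)%N by rewrite mulnC leq_divM.
apply: (le_trans (key n k hk)); rewrite -(mulrA _ 2); apply: ler_wpM2l.
  by rewrite !mulr_ge0 ?pi_ge0.
have nk : (n <= 2 * N * k + 2 * N)%N.
  by rewrite addnC -mulnS mulnC ltnW// ltn_ceil.
have h1 : th ^+ (2 * N * k + 2 * N) <= th ^+ n.
  by apply: ler_wiXn2l => //; [exact: ltW|exact: ltW].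
have h2 : (2^-1) ^+ k <= th ^+ (2 * N * k).
  by rewrite exprM; apply: lerXn2r; rewrite ?nnegrE ?exprn_ge0 ?(ltW th0)// invr_ge0.
rewrite exprD in h1.
have h3 : 0 <= (2^-1 : R) ^+ k by rewrite exprn_ge0// invr_ge0.
move: h1 h2 h3 thP; move: (th ^+ _) (th ^+ _) (th ^+ _) ((2^-1 : R) ^+ k) => a b c x; nra.
Qed.

Lemma csum_conj (a : nat -> C) (b : nat -> R) : (forall n, cabs (a n) <= b n) -> cvgn (series b) ->
  csum (fun n => conjc (a n)) = conjc (csum a).
Proof.
move=> ab cb; have h := csum_cvg ab cb.
have h' : forall n, cabs (conjc (a n)) <= b n by move=> n; rewrite cabs_conj.
apply: ccvg_unique (csum_cvg h' cb) _.
rewrite /ccvg; move: h; rewrite /ccvg; apply: cvg_trans; apply: near_eq_cvg; apply: nearW => N.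
rewrite -[in RHS]cabs_conj; apply: f_equal; rewrite conjcB; apply: f_equal2; last by apply: f_equal; rewrite conjcK.
elim: N => [|N IH]; first by rewrite !big_geq// conjc0.
rewrite [LHS]big_nat_recr// IH [in RHS]big_nat_recr//.
by rewrite -{1}(conjcK (a N)); apply/esym; exact: rmorphD.
Qed.

Lemma pser_conj c (K th : R) z : 0 <= th -> geo c K th -> th * cabs z < 1 ->
  pser (fun n => conjc (c n)) (conjc z) = conjc (pser c z).
Proof.
move=> t0 g h.
have x0 : 0 <= th * cabs z by rewrite mulr_ge0 ?cabs_ge0.
have hb n : cabs (c n * z ^+ n) <= geometric K (th * cabs z) n.
  rewrite /geometric /= cabsM cabsX exprMn mulrA.
  by apply: ler_wpM2r; [rewrite exprn_ge0// cabs_ge0|exact: g].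
have cv : cvgn (series (geometric K (th * cabs z))).
  by apply: is_cvg_geometric_series; rewrite ger0_norm.
rewrite /pser -(csum_conj hb cv); apply: f_equal; apply/funext => n.
by rewrite conjcM conjcX.
Qed.

End StripExtension.

(** * Extension to a strip, functions holomorphic on both sides of the line *)

Section BoundaryValues.
Context {R : realType}.
Local Notation C := R[i].
Implicit Types (u v du : R -> C) (z w a : C) (c : nat -> C) (t s : R) (g h dh q : R -> R) (f e F : C -> C).
Local Notation I0 := (@I0 R).

Lemma hol1_comp (D E : set C) f f' F F' : hol1 D f f' -> hol1 E F F' -> (forall z, D z -> E (f z)) ->
  hol1 D (fun z => F (f z)) (fun z => F' (f z) * f' z).
Proof.
move=> hf hF DE z Dz; have [df cf'] := hf z Dz; have [dF cF'] := hF _ (DE z Dz).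
split; first exact: cder_comp.
by apply: ccontM => //; apply: (ccont_comp (cder_ccont df)).
Qed.

Lemma hol1D (D : set C) f f' F F' : hol1 D f f' -> hol1 D F F' -> hol1 D (fun z => f z + F z) (fun z => f' z + F' z).
Proof. by move=> hf hF z Dz; have [? ?] := hf z Dz; have [? ?] := hF z Dz; split; [exact: cderD|exact: ccontD]. Qed.

Lemma hol1Z (D : set C) a f f' : hol1 D f f' -> hol1 D (fun z => a * f z) (fun z => a * f' z).
Proof. by move=> hf z Dz; have [? ?] := hf z Dz; split; [exact: cderZ|apply: ccontM => //; exact: ccont_cst]. Qed.

Lemma hol1_cst (D : set C) a : hol1 D (fun=> a) (fun=> 0).
Proof. by move=> z _; split; [exact: cder_cst|exact: ccont_cst]. Qed.

Lemma hol1_cst1 (D : set C) : hol1 D (fun=> 0) (fun=> 0).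
Proof. exact: hol1_cst. Qed.

Lemma hol1_sub (D E : set C) f f' : E `<=` D -> hol1 D f f' -> hol1 E f f'.
Proof. by move=> ED hf z /ED; exact: hf. Qed.

Lemma geo_le c (K th th' : R) : 0 <= th <= th' -> geo c K th -> geo c K th'.
Proof.
move=> /andP[t0 tt] g n; apply: (le_trans (g n)); apply: ler_wpM2l; first exact: geo_K_ge0 g.
by apply: lerXn2r; rewrite ?nnegrE// (le_trans t0).
Qed.

Lemma hol1_pser_exp (D : set C) c (K th : R) a e : 0 < th < 1 -> geo c K th ->
  hol1 D e (fun z => a * e z) -> (forall z, D z -> (1 + th) / 2 * cabs (e z) < 1) ->
  exists F1 F2 : C -> C, hol1 D (fun z => pser c (e z)) (fun z => F1 (e z)) /\
    hol1 D (fun z => F1 (e z)) (fun z => F2 (e z)).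
Proof.
move=> /andP[t0 t1] g he hD; pose th' := (1 + th) / 2.
have tt : 0 <= th < th' by rewrite ltW//= /th'; lra.
have th0 : 0 < th' by rewrite /th'; lra.
have [K1 g1] := geo_dser g tt.
have gg : geo c K th' by apply: geo_le g; move: tt; lra.
have h1 := hol1_comp he (pser_hol th0 gg) hD.
have h2 := hol1_comp he (pser_hol th0 g1) hD.
exists (fun w => pser (dser c) w * (a * w)).
exists (fun w => pser (dser (dser c)) w * (a * w) * (a * w) + pser (dser c) w * (a * (a * w))).
split => //.
exact: hol1M h2 (hol1Z a he).
Qed.

Lemma sum_split0 c z N :
  \sum_(0 <= n < N.+1) c n * z ^+ n = c 0%N + \sum_(1 <= n < N.+1) z ^+ n * c n.
Proof.
rewrite (big_ltn (ltn0Sn N)) expr0 mulr1; congr (_ + _).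
by apply: eq_bigr => n _; rewrite mulrC.
Qed.

Definition strip (d : R) : set C := fun z => `|im z| < d.

(** As [g] is real, its coefficients of negative index are conjugates of the others, so both halves
    of the Fourier series converge on a strip. The second derivative is recorded for the kernel
    bounds. *)
Lemma strip_extension g : analytic_everywhere g -> (forall t, g (t + 2 * pi) = g t) ->
  exists (d : R) (U U' U'' : C -> C), [/\ 0 < d, hol1 (strip d) U U', hol1 (strip d) U' U'',
    per U /\ (per U' /\ per U'') & forall t, U t%:C = (g t)%:C].
Proof.
move=> ag pg; have [K [th [th01 gc]]] := analytic_decay ag pg.
have /andP[t0 t1] := th01.
pose c := fcp (realC g); pose c' n := conjc (c n).
have gcc : geo c K th := gc.
have gc' : geo c' K th by move=> n; rewrite /c' cabs_conj; exact: gc.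
pose th' := (1 + th) / 2.
have th0 : 0 < th' by rewrite /th'; lra.
have th1 : th' < 1 by rewrite /th'; lra.
pose d := - ln th'.
have d0 : 0 < d by rewrite oppr_gt0 ln_lt0// th0.
have ed : expR d = th'^-1 by rewrite expRN lnK// posrE.
have hD1 z : strip d z -> th' * cabs (ez z) < 1.
  rewrite /strip ltr_norml => /andP[h1 h2].
  by rewrite cabs_ez mulrC -ltr_pdivlMr// mul1r -ed ltr_expR -ltrNl.
have hD2 z : strip d z -> th' * cabs (ez z)^-1 < 1.
  rewrite /strip ltr_norml => /andP[h1 h2].
  by rewrite cabsV cabs_ez expRN invrK mulrC -ltr_pdivlMr// mul1r -ed ltr_expR.
have [A1 [A2 [hA hA']]] := hol1_pser_exp th01 gc (@hol1_ez R (strip d)) hD1.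
have [B1 [B2 [hB hB']]] := hol1_pser_exp th01 gc' (@hol1_ezN R (strip d)) hD2.
pose k : C := ((2 * pi)%:C)^-1.
exists d, (fun z => k * (pser c (ez z) + (pser c' (ez z)^-1 + - c 0%N))).
exists (fun z => k * (A1 (ez z) + (B1 (ez z)^-1 + 0))).
exists (fun z => k * (A2 (ez z) + (B2 (ez z)^-1 + 0))).
split; first exact: d0.
- exact: (hol1Z k (hol1D hA (hol1D hB (@hol1_cst (strip d) (- c 0%N))))).
- exact: (hol1Z k (hol1D hA' (hol1D hB' (@hol1_cst1 (strip d))))).
- by split=> [z|]; [rewrite ez_per|split=> z; rewrite ez_per].
move=> t; have pG s : realC g (s + 2 * pi) = realC g s by rewrite /realC pg.
have dG s : rder (realC g) s (realC (derive1n 1 g) s).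
  exact: rder_realC (analytic_is_derive 0 s ag).
have cG := rcont_realC (analytic_cont (k := 1) ag).
have cbG : cbm I0 (realC g) by exact: cbm_cont (rder_rcont dG).
have cm n : fcm (realC g) n = c' n.
  rewrite fcm_conj// /c' /c; apply: f_equal; apply: (f_equal (fun v => fcp v n)).
  by apply/funext => s; rewrite /realC conj_ez_real || apply: complex_eq; rewrite /= ?oppr0.
have e1 : cabs (ez t%:C : C) = 1 by exact: cabs_ez_real.
have h1 : th * cabs (ez t%:C : C) < 1 by rewrite e1 mulr1.
have h2 : th * cabs (ez t%:C : C)^-1 < 1 by rewrite cabsV e1 invr1 mulr1.
have c0 : c' 0%N = c 0%N by rewrite -cm; apply: eq_cint => s _; rewrite !expr0.
have E := ccvgD (ccvgS (pser_cvg (ltW t0) gcc h1)) (ccvgS (pser_cvg (ltW t0) gc' h2)).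
have FI : ccvg (fun N => \sum_(1 <= n < N.+1) ez t%:C ^+ n * c n +
    \sum_(1 <= n < N.+1) (ez t%:C)^-1 ^+ n * c' n) ((2 * pi)%:C * realC g t - c 0%N).
  apply: ccvg_ext (fourier_inversion t pG dG cG) => N; apply: f_equal2; first by [].
  by apply: eq_bigr => n _; rewrite -cm.
clear gc' hA hA' hB hB' gc gcc cm; clearbody c'; clearbody c; clear hD1 hD2 h1 h2.
have L : (2 * pi)%:C * realC g t - c 0%N + (c 0%N + c 0%N) = pser c (ez t%:C) + pser c' (ez t%:C)^-1.
  apply: ccvg_unique E; apply: ccvg_ext (ccvgD FI (ccvg_cst (c 0%N + c 0%N))) => N.
  have alg (x y a : C) : x + y + (a + a) = a + x + (a + y) by ring.
  by rewrite (sum_split0 c) (sum_split0 c') c0 alg.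
rewrite addrA -L.
have alg2 (x a : C) : x - a + (a + a) - a = x by ring.
rewrite alg2 mulrA mulVf ?mul1r; [reflexivity|exact: pi2C_neq0].
Qed.

Definition limit_above f u := forall t (e : R), 0 < e -> exists2 r : R, 0 < r &
  forall y, 0 < y < r -> cabs (f (t +i* y) - u t) < e.

Lemma cdiv_conj (d : R) f f' : hol1 (above d) f f' ->
  hol1 (below d) (fun z => conjc (f (conjc z))) (fun z => conjc (f' (conjc z))).
Proof.
move=> hf z; rewrite /below /= => hz.
have hz' : above d (conjc z) by rewrite /above /= im_conj; lra.
have [h1 h2] := hf _ hz'; split; first exact: cder_conj.
exact: ccont_conj.
Qed.

Lemma reC (x : R) : re x%:C = x. Proof. by []. Qed.

Lemma imC (x : R) : im x%:C = 0. Proof. by []. Qed.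

(* The decay of the positive coefficients comes from [f], that of the negative ones from [F]. *)
Lemma boundary_analytic (f f' F F' : C -> C) u (d M : R) : 0 < d ->
  hol1 (below d) f f' -> per f -> (forall z, below d z -> cabs (f z) <= M) -> limit_below f u ->
  hol1 (above d) F F' -> per F -> (forall z, above d z -> cabs (F z) <= M) -> limit_above F u ->
  cbm I0 u -> analytic_everywhere (fun t => re (u t)) /\ analytic_everywhere (fun t => im (u t)).
Proof.
move=> d0 hf pf bf lf hF pF bF lF bu.
have [K1 [th1 [th11 g1]]] := decay_below d0 hf pf bf bu lf.
have pFc : per (fun z => conjc (F (conjc z))).
  move=> z; rewrite -(pF (conjc z)); do 2 apply: f_equal.
  by case: z => x y; apply: complex_eq; rewrite /= ?addr0.
have bFc z : below d z -> cabs (conjc (F (conjc z))) <= M.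
  by move=> hz; rewrite cabs_conj; apply: bF; move: hz; rewrite /below /above /= im_conj; lra.
have lFc : limit_below (fun z => conjc (F (conjc z))) (fun s => conjc (u s)).
  move=> t e e0; have [r r0 hr] := lF t e e0; exists r => // y yr.
  by rewrite -conjcB cabs_conj; apply: hr; lra.
have [K2 [th2 [th22 g2]]] := decay_below d0 (cdiv_conj hF) pFc bFc (cbm_conj bu) lFc.
have g3 : geo (fcm u) K2 th2 by move=> n; rewrite fcm_conj// cabs_conj; exact: g2.
have L t := laurent_below d0 hf pf bf bu lf th11 th22 g1 g3 t.
have [[a0 a1] [b0 b1]] : (0 < th1 /\ th1 < 1) /\ (0 < th2 /\ th2 < 1).
  by move/andP: th11 => ?; move/andP: th22 => ?.
pose c' n := conjc (fcm u n).
have g4 : geo c' K2 th2 by move=> n; rewrite /c' cabs_conj; exact: g3.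
have LC t : pser (fcm u) (ez t%:C)^-1 = conjc (pser c' (ez t%:C)).
  have h : th2 * cabs (ez t%:C : C) < 1 by rewrite cabs_ez_real mulr1.
  rewrite -(pser_conj (ltW b0) g4 h) conj_ez_real; apply: (f_equal (fun c => pser c _)).
  by apply/funext => n; rewrite /c' conjcK.
have p2 : (2 * pi : R) != 0 by rewrite gt_eqF// pi2_gt0.
(* Since [im z = re (- 'i * z)], imaginary parts reduce to a series with rotated coefficients. *)
have anim c (K th : R) : 0 < th < 1 -> geo c K th -> analytic_everywhere (fun t => im (pser c (ez t%:C))).
  move=> tt g t.
  have g' : geo (fun n => - 'i * c n) K th by move=> n; rewrite cabsM cabsN cabs_i mul1r; exact: g.
  have := pser_ez_analytic t tt g'; congr analytic_at; apply/funext => s.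
  have /andP[s0 s1] := tt.
  have h : th * cabs (ez s%:C : C) < 1 by rewrite cabs_ez_real mulr1.
  have -> : pser (fun n => - 'i * c n) (ez s%:C) = - 'i * pser c (ez s%:C).
    apply: ccvg_unique (pser_cvg (ltW s0) g' h) _.
    apply: ccvg_ext (ccvgM (ccvg_cst (- 'i)) (pser_cvg (ltW s0) g h)) => N.
    by rewrite mulr_sumr; apply: eq_bigr => n _; rewrite mulrA.
  by rewrite reM /= !oppr0; ring.
have key (x A B a : C) : (2 * pi)%:C * x = A + conjc B - a ->
    re x = (2 * pi)^-1 * (re A + re B + - re a) /\ im x = (2 * pi)^-1 * (im A + - 1 * im B + - im a).
  move=> e; split.
    have := f_equal (@complex.Re R) e; rewrite reM reB reD re_conj reC imC mul0r subr0 => <-.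
    by rewrite mulKf.
  have := f_equal (@complex.Im R) e; rewrite imM imB imD im_conj reC imC mul0r addr0 mulN1r => <-.
  by rewrite mulKf.
have keyL s := key _ _ _ _ (etrans (L s) (f_equal (fun x => pser (fcp u) (ez s%:C) + x - fcp u 0) (LC s))).
split => t.
  have := analytic_atZ (2 * pi)^-1 (analytic_atD (analytic_atD (pser_ez_analytic t th11 g1) (pser_ez_analytic t th22 g4))
    (analytic_at_cst (- re (fcp u 0)) t)).
  have -> : (fun s => re (u s)) = (fun s => (2 * pi)^-1 * (re (pser (fcp u) (ez s%:C)) + re (pser c' (ez s%:C)) + - re (fcp u 0))).
    by apply/funext => s; exact: (keyL s).1.
  exact.
have := analytic_atZ (2 * pi)^-1 (analytic_atD (analytic_atD (anim _ _ _ th11 g1 t) (analytic_atZ (- 1) (anim _ _ _ th22 g4 t)))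
    (analytic_at_cst (- im (fcp u 0)) t)).
have -> : (fun s => im (u s)) = (fun s => (2 * pi)^-1 * (im (pser (fcp u) (ez s%:C)) + - 1 * im (pser c' (ez s%:C)) + - im (fcp u 0))).
  by apply/funext => s; exact: (keyL s).2.
exact.
Qed.

End BoundaryValues.

(** * The transform on the circle *)

Section CircleTransform.
Context {R : realType}.
Local Notation C := R[i].
Local Notation mu := (@lebesgue_measure R).
Implicit Types (u v du : R -> C) (z w a : C) (c : nat -> C) (t s : R) (f df g h dh q : R -> R).
Local Notation I0 := (@I0 R).
Local Notation finI0 := (@finI0 R).

Definition C1per h dh := [/\ forall t, h (t + 2 * pi) = h t,
  forall t, is_derive t (1 : R) h (dh t) & continuous dh].

(* The conjugate function, with the singularity removed by subtracting [h t]. *)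
Definition circle_transform h t : R :=
  pi^-1 * \int[mu]_(s in I0) ((h s - h t) * re (kap t%:C s)).

Lemma C1per_lip h dh : C1per h dh -> exists2 L : R, 0 <= L &
  forall s t, `|h s - h t| <= L * cabs (ez s%:C - ez t%:C : C).
Proof.
move=> [ph dh1 cdh].
have [L L0 H] := @lip_ez R (realC h) (realC dh) (fun t => f_equal (fun x => x%:C) (ph t))
  (fun t => rder_realC (dh1 t)) (rcont_realC cdh).
exists L => // s t; have := H s t; by rewrite /realC cabs_realB.
Qed.

Lemma C1per_cont h dh : C1per h dh -> continuous h.
Proof. by move=> [_ d _] t; exact: is_derive_cont (d t). Qed.

Lemma C1per_cbm_kap h dh t : C1per h dh -> cbm I0 (fun s => (realC h s - realC h t) * kap t%:C s).
Proof.
move=> H; have [L L0 HL] := C1per_lip H; apply: (cbm_kap _ L0).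
  exact: rcont_realC (C1per_cont H).
by move=> s; rewrite /realC cabs_realB; exact: HL.
Qed.

Lemma C1per_ez h dh s t : C1per h dh -> ez s%:C = ez t%:C :> C -> h s = h t.
Proof.
move=> H e; have [L L0 HL] := C1per_lip H; have := HL s t.
by rewrite e subrr cabs0 mulr0 normr_le0 subr_eq0 => /eqP.
Qed.

Lemma im_kap t s : ez s%:C != ez t%:C :> C -> im (kap t%:C s) = 2^-1.
Proof.
move=> /kap_conj; move: (kap _ _) => x /(f_equal (@complex.Im R)); rewrite imB im_conj opprK /=.
by move: (im x) => y; lra.
Qed.

Lemma reCI (x y : R) : re (x +i* y) = x. Proof. by []. Qed.

Lemma imCI (x y : R) : im (x +i* y) = y. Proof. by []. Qed.

Lemma fcp0_real h : im (fcp (realC h) 0) = 0.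
Proof.
rewrite /fcp im_cint.
rewrite (_ : (fun _ => _) = (fun=> 0)); first by rewrite /Rintegral integral0.
by apply/funext => s; rewrite expr0 mulr1.
Qed.

(** The real part is the transform by definition; the imaginary part of [kap] is constant off the
    diagonal, so there only the mean of [h] and the value [h t] remain. *)
Lemma cint_kap_C1 h dh t : C1per h dh ->
  cint I0 (fun s => (realC h s - realC h t) * kap t%:C s) =
  (pi * circle_transform h t) +i* (2^-1 * re (fcp (realC h) 0) - pi * h t).
Proof.
move=> H; have bK := C1per_cbm_kap t H; apply: complex_eq.
  rewrite re_cint reCI /circle_transform mulrA divff ?mul1r ?gt_eqF ?pi_gt0//.
  apply: eq_Rintegral => s _; by rewrite /realC -rmorphB reM imC mul0r subr0.
rewrite im_cint imCI.
pose k : C := 2^-1%:C.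
have bh : cbm I0 (realC h) := cbm_cont 0 (2 * pi) (rcont_realC (C1per_cont H)).
have b1 : cbm I0 (fun s => realC h s - realC h t) by apply: cbmB => //; exact: cbm_cst.
have -> : 2^-1 * re (fcp (realC h) 0) - pi * h t = re (k * cint I0 (fun s => realC h s - realC h t)).
  rewrite cintB//; [|exact: finI0|exact: cbm_cst].
  rewrite cint_cst; last exact: finI0.
  have -> : cint I0 (realC h) = fcp (realC h) 0 by apply: eq_cint => s _; rewrite expr0 mulr1.
  rewrite muI0 /k reM imC mul0r subr0 reC reB /realC reM !imC !reC mul0r subr0.
  by field.
rewrite -cintZ//; last exact: finI0.
rewrite re_cint; apply: eq_Rintegral => s _.
rewrite /realC -rmorphB imM imC mul0r addr0 reC /k reM !imC !reC mul0r subr0.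
have [e|e] := eqVneq (ez s%:C : C) (ez t%:C).
  by rewrite (C1per_ez H e) subrr mul0r mulr0.
by rewrite im_kap// mulrC.
Qed.

Lemma C1per_rder h dh t : C1per h dh -> rder (realC h) t (realC dh t).
Proof. by move=> [_ d _]; exact: rder_realC. Qed.

Lemma C1per_cbm h dh : C1per h dh -> cbm I0 (realC h).
Proof. by move=> H; exact: cbm_cont (rcont_realC (C1per_cont H)). Qed.

(** The positive part of the Fourier series of [u = f + i h] has an analytic real part by
    [decay_below]; by [dini_plus] this is [pi * (f - circle_transform h)] up to a constant, the
    imaginary part of [kap] acting on [f] and its real part on [h]. *)
Lemma circle_transform_analytic f df h dh Phi Phi' (d M : R) :
  C1per f df -> C1per h dh -> 0 < d -> hol1 (below d) Phi Phi' -> per Phi ->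
  (forall z, below d z -> cabs (Phi z) <= M) -> limit_below Phi (fun t => f t +i* h t) ->
  analytic_everywhere (fun t => f t - circle_transform h t).
Proof.
move=> Hf Hh d0 hP pP bP lP; pose u t := f t +i* h t.
have uE t : u t = realC f t + 'i * realC h t.
  by apply: complex_eq; rewrite /u /realC /= ?(mul0r, mul1r, mulr0, subr0, addr0, add0r).
have cu : cbm I0 u.
  rewrite (_ : u = fun t => realC f t + 'i * realC h t); last by apply/funext => t; exact: uE.
  by apply: cbmD (C1per_cbm Hf) _; apply: cbmM (cbm_cst _ _) (C1per_cbm Hh).
have [K [th [th01 g]]] := decay_below d0 hP pP bP cu lP.
have /andP[t0 t1] := th01.
have key t : f t - circle_transform h t =
    pi^-1 * (re (pser (fcp u) (ez t%:C)) + (2^-1 * re (fcp (realC f) 0) - re (fcp u 0))).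
  have uB s : (u s - u t) * kap t%:C s = (realC f s - realC f t) * kap t%:C s + 'i * ((realC h s - realC h t) * kap t%:C s).
    by rewrite !uE; move: (kap _ _) (realC f s) (realC f t) (realC h s) (realC h t) => x a b e k; ring.
  have bf := C1per_cbm_kap t Hf. have bh := C1per_cbm_kap t Hh.
  have bi : cbm I0 (fun s => 'i * ((realC h s - realC h t) * kap t%:C s)) by exact: cbmM (cbm_cst _ _) bh.
  have fB : (fun s => (u s - u t) * kap t%:C s) =
      (fun s => (realC f s - realC f t) * kap t%:C s + 'i * ((realC h s - realC h t) * kap t%:C s)).
    by apply/funext => s; exact: uB.
  have bu : cbm I0 (fun s => (u s - u t) * kap t%:C s) by rewrite fB; exact: cbmD.
  have ue s : ez s%:C = ez t%:C :> C -> u s = u t.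
    by move=> e; rewrite /u (C1per_ez Hf e) (C1per_ez Hh e).
  have D := dini_plus cu ue bu.
  have e1 : th * cabs (ez t%:C : C) < 1 by rewrite cabs_ez_real mulr1.
  have E := ccvgB (ccvgS (pser_cvg (ltW t0) g e1)) (ccvg_cst (fcp u 0)).
  have {E}E : ccvg (fun N => \sum_(1 <= n < N.+1) ez t%:C ^+ n * fcp u n) (pser (fcp u) (ez t%:C) - fcp u 0).
    apply: ccvg_ext E => N.
    have alg (x y a : C) : x = a + y -> x - a = y by move=> ->; ring.
    exact: alg (sum_split0 _ _ _).
  have := ccvg_unique E D.
  have -> : cint I0 (fun s => (u s - u t) * kap t%:C s) =
      cint I0 (fun s => (realC f s - realC f t) * kap t%:C s) +
      'i * cint I0 (fun s => (realC h s - realC h t) * kap t%:C s).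
    by rewrite fB (cintD finI0 bf bi) (cintZ _ finI0 bh).
  rewrite (cint_kap_C1 t Hf) (cint_kap_C1 t Hh).
  move: (pser (fcp u) _) (circle_transform h t) (circle_transform f t) (fcp u 0)
    (re (fcp (realC f) 0)) (re (fcp (realC h) 0)) (f t) (h t) => A X Y B a b x y.
  move=> /(f_equal (@complex.Re R)); rewrite reB /= ?(mul0r, mul1r, sub0r, add0r, subr0, addr0) => e.
  have p0 : pi != 0 :> R by rewrite gt_eqF// pi_gt0.
  have -> : re A = re B + pi * x - 2^-1 * a - pi * X by move: e; lra.
  have -> : re B + pi * x - 2^-1 * a - pi * X + (2^-1 * a - re B) = pi * (x - X) by ring.
  by rewrite mulKf.
move=> t; rewrite (_ : (fun _ => _) = (fun t => pi^-1 * (re (pser (fcp u) (ez t%:C)) + (2^-1 * re (fcp (realC f) 0) - re (fcp u 0))))).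
  apply: analytic_atZ; apply: analytic_atD (analytic_at_cst _ _).
  exact: pser_ez_analytic th01 g.
by apply/funext => s; exact: key.
Qed.

Lemma circle_transform_per h dh t : C1per h dh ->
  circle_transform h (t + 2 * pi) = circle_transform h t.
Proof.
move=> [p _ _]; rewrite /circle_transform; congr (_ * _).
apply: eq_Rintegral => s _; rewrite p.
suff -> : kap (t + 2 * pi)%:C s = kap t%:C s by [].
by rewrite /kap rmorphD ez_per.
Qed.

(* With [q := f - circle_transform h], the function is the extension of [q] plus a power series in [(ez z)^-1] built from the coefficients of [h]. *)
Lemma circle_transform_extension f h dh : (forall t, f (t + 2 * pi) = f t) -> C1per h dh ->
  analytic_everywhere (fun t => f t - circle_transform h t) ->
  exists (d : R) (Phi Phi' : C -> C), [/\ 0 < d, hol1 (below d) Phi Phi', per Phi &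
    forall t (e : R), 0 < e -> exists2 r : R, 0 < r &
      forall z, im z < 0 -> cabs (z - t%:C) < r -> cabs (Phi z - (f t +i* h t)) < e].
Proof.
move=> pf Hh aq; pose q t := f t - circle_transform h t.
have pq t : q (t + 2 * pi) = q t by rewrite /q pf (circle_transform_per _ Hh).
have [d [U [U' [U'' [d0 hU _ [pU _] Uq]]]]] := strip_extension aq pq.
pose c := fcp (realC h); pose c' n := conjc (c n).
have [M HM] := (C1per_cbm Hh).2.
(* Ratio 1, that is, mere boundedness: the series in [(ez z)^-1] converges below the real line. *)
have gc' : geo c' (2 * M * fine (mu I0)) 1.
  move=> n; rewrite expr1n mulr1 /c' cabs_conj /c /fcp; apply: cint_bound.
  - exact: finI0.
  - exact: cbmM (C1per_cbm Hh) (cbm_ezVX _).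
  - by move=> s Is; rewrite cabsM cabsX cabsV cabs_ez_real invr1 expr1n mulr1; exact: HM.
have p0 : pi != 0 :> R by rewrite gt_eqF// pi_gt0.
(* With this factor, and half of [c 0] removed, the series has the boundary value
   [circle_transform h t +i* h t]. *)
pose k : C := 'i / pi%:C.
have hD z : below d z -> 1 * cabs (ez z)^-1 < 1.
  move=> /andP[_ h2]; by rewrite mul1r cabsV cabs_ez expRN invrK expR_lt1.
have h1 := hol1_comp (@hol1_ezN R (below d)) (pser_hol ltr01 gc') hD.
have hU1 : hol1 (below d) U U'.
  by apply: hol1_sub hU => z; rewrite /below /strip /= ltr_norml => /andP[? ?]; apply/andP; split => //; lra.
pose P z := pser c' (ez z)^-1.
exists d, (fun z => U z + k * (P z + - (c 0%N / 2))).
exists (fun z => U' z + k * (pser (dser c') (ez z)^-1 * (- 'i * (ez z)^-1) + 0)).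
split; first exact: d0.
- exact: (hol1D hU1 (hol1Z k (hol1D h1 (@hol1_cst R (below d) (- (c 0%N / 2)))))).
- by move=> z; rewrite /P ez_per pU.
move=> t e e0.
have cG : (realC h) (2 * pi) = realC h 0 by have [p _ _] := Hh; rewrite /realC -[2 * pi in LHS]add0r p.
have cdh : rcont (realC dh) by have [_ _ cc] := Hh; exact: rcont_realC.
(* Continuity up to the line comes from the regularity of [h], through summable coefficients. *)
have sum1 : cvgn (series (fun n => cabs (c n))) := fcp_summable (fun t => C1per_rder t Hh) cdh cG.
have sum2 : cvgn (series (fun n => cabs (c' n))).
  by move: sum1; congr (cvgn (series _)); apply/funext => n; rewrite /c' cabs_conj.
have xt : cabs (ez t%:C : C)^-1 <= 1 by rewrite cabsV cabs_ez_real invr1.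
have val : U t%:C + k * (pser c' (ez t%:C)^-1 + - (c 0%N / 2)) = f t +i* h t.
  have bn n : cabs (c n * ez t%:C ^+ n) <= cabs (c n) by rewrite cabsM cabsX cabs_ez_real expr1n mulr1.
  have cE : pser c' (ez t%:C)^-1 = conjc (pser c (ez t%:C)).
    rewrite /pser -(csum_conj bn sum1); apply: f_equal; apply/funext => n.
    by rewrite conjcM conjcX conj_ez_real.
  have D := dini_plus (C1per_cbm Hh) (fun s e => f_equal (fun x => x%:C) (C1per_ez Hh e)) (C1per_cbm_kap t Hh).
  have E := ccvgB (ccvgS (csum_cvg bn sum1)) (ccvg_cst (c 0%N)).
  have {E}E : ccvg (fun N => \sum_(1 <= n < N.+1) ez t%:C ^+ n * c n) (pser c (ez t%:C) - c 0%N).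
    apply: ccvg_ext E => N.
    have alg (x y a : C) : x = a + y -> x - a = y by move=> ->; ring.
    exact: alg (sum_split0 _ _ _).
  have := ccvg_unique E D; rewrite (cint_kap_C1 t Hh) cE Uq /q -/(c 0%N).
  have c0 : im (c 0%N) = 0 := fcp0_real h.
  clear - p0 c0; rewrite /k.
  move: (pser c _) (circle_transform h t) (c 0%N) c0 (f t) (h t) => A X B B0 x y e.
  have {A e}-> : A = (2^-1 * re B + pi * y) +i* (pi * X).
    rewrite -[A](subrK B) e; by apply: complex_eq; rewrite !reimE [LHS]/= [RHS]/= ?B0; field.
  have -> : 'i / pi%:C = 0 +i* pi^-1 :> C.
    have p1 : (pi%:C : C) != 0 by rewrite -cabs_eq0 cabs_real normr_eq0.
    rewrite -[RHS](mulfK p1); apply: (f_equal (fun x => x / _)).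
    by apply: complex_eq; rewrite !reimE /= !(mulr0, mul0r) ?subr0// add0r mulVf.
  have -> : B / 2 = (re B / 2)%:C.
    rewrite rmorphM fmorphV rmorph_nat; apply: (f_equal (fun x => x / _)).
    exact: complex_eq.
  move: (re B) => b.
  have E (v w : R) : (x - X)%:C + (0 +i* pi^-1) * (conjc (v +i* (pi * X)) - w%:C) = x +i* (pi^-1 * (v - w)).
    apply: complex_eq; rewrite !reimE re_conj im_conj !(reC, imC, reCI, imCI).
      by rewrite mul0r subr0 sub0r mulrN opprK mulKf// subrK.
    by rewrite mul0r !add0r.
  rewrite E; congr (_ +i* _).
  have -> : 2^-1 * b + pi * y - b / 2 = pi * y by ring.
  by rewrite mulKf.
have st : strip d t%:C by rewrite /strip imC normr0.
have [r1 r10 H1] := cder_ccont (hU t%:C st).1 (divr_gt0 e0 (ltr0n R 2)).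
have k0 : 0 < cabs k.
  rewrite cabs_gt0 /k mulf_neq0//; last by rewrite invr_eq0 -cabs_eq0 cabs_real normr_eq0.
  by rewrite -cabs_gt0 cabs_i.
have ek : 0 < e / 2 / cabs k by rewrite !divr_gt0.
have [r2 r20 H2] := pser_closed_disc_cont sum2 xt ek.
have cez : ccont (fun z => (ez z)^-1) t%:C by apply: ccontV; [exact: ez_neq0|exact: ccont_ez].
have [r3 r30 H3] := cez r2 r20.
exists (Num.min r1 r3); first by rewrite lt_min r10.
move=> z z0; rewrite lt_min => /andP[z1 z3].
have {}H1 := H1 z z1.
have z1' : cabs (ez z)^-1 <= 1 by rewrite cabsV cabs_ez expRN invrK expR_le1 ltW.
have {}H2 := H2 _ z1' (H3 z z3).
have {}H2 : cabs (k * (P z - pser c' (ez t%:C)^-1)) < e / 2.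
  by rewrite cabsM mulrC -ltr_pdivlMr.
rewrite -val.
have alg (a b x y w : C) : a + k * (x + w) - (b + k * (y + w)) = (a - b) + k * (x - y) by ring.
rewrite alg; apply: (le_lt_trans (cabsD _ _)).
have -> : e = e / 2 + e / 2 by field.
exact: ltrD.
Qed.

End CircleTransform.

(** * Operations on periodic analytic functions *)

Section AnalyticClosure.
Context {R : realType}.
Local Notation C := R[i].
Implicit Types (z w a : C) (t s : R) (g h : R -> R) (U V f : C -> C).

(** Compactness of one period turns neighbourhoods of the real points into a strip of uniform width;
    invariance under the period does the rest. *)
Lemma strip_open (P : C -> Prop) : (forall t, exists2 r : R, 0 < r & forall w, cabs (w - t%:C) < r -> P w) ->
  (forall z (m : int), P (z + (2 * pi * m%:~R)%:C) -> P z) ->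
  exists2 d : R, 0 < d & forall z, strip d z -> P z.
Proof.
move=> loc pP.
have /compact_near_coveringP /(_ R (nbhs (0 : R)) (fun y t => P (t +i* y)) _) H := @segment_compact R (- pi) pi.
have [t _|d /= d0 Hd] := H.
  have [r r0 Hr] := loc t.
  exists (ball t (r / 2), ball (0 : R) (r / 2)).
    by split; apply: nbhsx_ballx; rewrite divr_gt0.
  move=> [s y] [/= ts ys]; apply: Hr.
  apply: (le_lt_trans (cabs_le _)); rewrite !reimE /= subr0.
  move: ts ys; rewrite /ball /= (distrC t) sub0r normrN; lra.
exists d => // z hz; have [m hm] := per_reduce (re z).
apply: (pP z m).
have := Hd (im z); rewrite /ball_ /= sub0r normrN => /(_ hz (re z + 2 * pi * m%:~R)).
rewrite /= in_itv /= -ler_norml => /(_ hm).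
congr P; apply: complex_eq => /=; [by rewrite reD|by rewrite imD /= addr0].
Qed.

Lemma per_bounded f (d : R) : 0 < d -> (forall z, strip d z -> ccont f z) -> per f ->
  exists M : R, forall z, `|im z| <= d / 2 -> cabs (f z) <= M.
Proof.
move=> d0 cf pf.
have [z _ hz|M HM] := @rect_bounded R f (- pi) pi (- (d / 2)) (d / 2).
  by apply: cf; rewrite /strip ltr_norml; lra.
exists M => z; rewrite ler_norml => hz; have [m hm] := per_reduce (re z).
rewrite -(per_int pf m z); apply: HM.
  by rewrite reD -ler_norml.
by rewrite imD imC addr0.
Qed.

Definition extends g (d : R) U U' := [/\ 0 < d, hol1 (strip d) U U', per U & forall t, U t%:C = (g t)%:C].

(** Another form of real analyticity for periodic functions, by [strip_ext_analytic] and
    [analytic_strip_ext]: products, inverses and square roots are easier to form on holomorphic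
    extensions than on power series. *)
Definition strip_ext g := exists d U U', extends g d U U'.

Lemma strip_real (d t : R) : 0 < d -> strip d t%:C.
Proof. by move=> d0; rewrite /strip imC normr0. Qed.

Lemma strip_ext_per g : strip_ext g -> forall t, g (t + 2 * pi) = g t.
Proof.
move=> [d [U [U' [d0 _ pU e]]]] t.
by have /(f_equal (@complex.Re R)) := e (t + 2 * pi); rewrite rmorphD pU e !reC.
Qed.

Lemma strip_ext_analytic g : strip_ext g -> analytic_everywhere g.
Proof.
move=> [d [U [U' [d0 hU pU e]]]].
have cU z : strip d z -> ccont U z by move=> /hU [h _]; exact: cder_ccont h.
have [M HM] := per_bounded d0 cU pU.
have lim t (x : R) : 0 < x -> exists2 r : R, 0 < r & forall y, `|y| < r -> cabs (U (t +i* y) - U t%:C) < x.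
  move=> x0; have [r r0 H] := cU _ (strip_real t d0) x x0.
  exists r => // y yr; apply: H; apply: le_lt_trans (cabs_le _) _.
  by rewrite !reimE /= subrr subr0 normr0 add0r.
have [] := @boundary_analytic R U U' U U' (fun t => U t%:C) (d / 2) M.
- by rewrite divr_gt0.
- by apply: hol1_sub hU => z; rewrite /below /strip /= ltr_norml; lra.
- exact: pU.
- by move=> z; rewrite /below /= => hz; apply: HM; rewrite ler_norml; lra.
- move=> t x x0; have [r r0 H] := lim t x x0; exists r => // y hy; apply: H.
  by rewrite ltr_norml; lra.
- by apply: hol1_sub hU => z; rewrite /above /strip /= ltr_norml; lra.
- exact: pU.
- by move=> z; rewrite /above /= => hz; apply: HM; rewrite ler_norml; lra.
- move=> t x x0; have [r r0 H] := lim t x x0; exists r => // y hy; apply: H.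
  by rewrite ltr_norml; lra.
- by apply: cbm_cont; apply: rcont_horiz => t; apply: cU; exact: strip_real.
move=> h _ t; have := h t; congr analytic_at; apply/funext => s; by rewrite e.
Qed.

Lemma analytic_strip_ext g : analytic_everywhere g -> (forall t, g (t + 2 * pi) = g t) -> strip_ext g.
Proof.
move=> ag pg; have [d [U [U' [_ [d0 hU _ [pU _] e]]]]] := strip_extension ag pg.
by exists d, U, U'.
Qed.

Lemma strip_minl (d d' : R) : strip (Num.min d d') `<=` strip d.
Proof. by move=> z; rewrite /strip lt_min => /andP[]. Qed.

Lemma strip_minr (d d' : R) : strip (Num.min d d') `<=` strip d'.
Proof. by move=> z; rewrite /strip lt_min => /andP[]. Qed.

Lemma strip_extM g h : strip_ext g -> strip_ext h -> strip_ext (fun t => g t * h t).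
Proof.
move=> [d [U [U' [d0 hU pU e]]]] [d' [V [V' [d'0 hV pV e']]]].
exists (Num.min d d'), (fun z => U z * V z), (fun z => U' z * V z + U z * V' z); split.
- by rewrite lt_min d0.
- apply: hol1M; [exact: hol1_sub (@strip_minl _ _) hU|exact: hol1_sub (@strip_minr _ _) hV].
- by move=> z; rewrite pU pV.
- by move=> t; rewrite e e' rmorphM.
Qed.

Lemma strip_extD g h : strip_ext g -> strip_ext h -> strip_ext (fun t => g t + h t).
Proof.
move=> [d [U [U' [d0 hU pU e]]]] [d' [V [V' [d'0 hV pV e']]]].
exists (Num.min d d'), (fun z => U z + V z), (fun z => U' z + V' z); split.
- by rewrite lt_min d0.
- apply: hol1D; [exact: hol1_sub (@strip_minl _ _) hU|exact: hol1_sub (@strip_minr _ _) hV].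
- by move=> z; rewrite pU pV.
- by move=> t; rewrite e e' rmorphD.
Qed.

Lemma strip_extV g : strip_ext g -> (forall t, g t != 0) -> strip_ext (fun t => (g t)^-1).
Proof.
move=> [d [U [U' [d0 hU pU e]]]] g0.
have [t|z m|d' d'0 Hd] := @strip_open (fun z => strip d z /\ U z != 0).
- have [h _] := hU _ (strip_real t d0).
  have U0 : 0 < cabs (U t%:C) by rewrite cabs_gt0 e -cabs_eq0 cabs_real normr_eq0.
  have [r r0 H] := cder_ccont h U0.
  exists (Num.min r d); first by rewrite lt_min r0.
  move=> w; rewrite lt_min => /andP[wr wd]; split.
    rewrite /strip; apply: le_lt_trans wd; apply: le_trans (im_le_cabs _).
    by rewrite imB imC subr0.
  apply/eqP => w0; have := H w wr; by rewrite w0 sub0r cabsN ltxx.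
- by rewrite /strip imD imC addr0 (per_int pU).
exists d', (fun z => (U z)^-1), (fun z => - U' z / U z ^+ 2); split=> //.
- move=> z /Hd [zd Uz]; have [h1 h2] := hU z zd; split; first exact: cderV.
  apply: ccontM; first exact: ccontN.
  apply: ccontV; first by rewrite expf_neq0.
  by apply: ccontX; exact: cder_ccont h1.
- by move=> z; rewrite pU.
- by move=> t; rewrite e fmorphV.
Qed.

(* The branch of the square root on the right half-plane. *)
Definition csqrt z : C :=
  let x := Num.sqrt ((cabs z + re z) / 2) in x +i* (im z / (2 * x)).

Lemma csqrt_gt0 z : 0 < re z -> 0 < re (csqrt z).
Proof. by move=> z0; rewrite sqrtr_gt0 divr_gt0// ltr_wpDl// cabs_ge0. Qed.

Lemma csqrt_sqr z : 0 < re z -> csqrt z ^+ 2 = z.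
Proof.
move=> z0; have := csqrt_gt0 z0; rewrite /csqrt reCI.
set x := Num.sqrt _ => x0.
have xx : x ^+ 2 = (cabs z + re z) / 2.
  by rewrite sqr_sqrtr// divr_ge0// addr_ge0 ?cabs_ge0// ltW.
have cz := cabs_sqr z.
clearbody x; rewrite expr2; apply: complex_eq; rewrite !reimE !(reCI, imCI).
  have q : cabs z + re z != 0 by rewrite gt_eqF// ltr_wpDl// cabs_ge0.
  have xn : x != 0 by rewrite gt_eqF.
  have -> : im z / (2 * x) * (im z / (2 * x)) = im z ^+ 2 / (4 * x ^+ 2) by field.
  rewrite -expr2 xx.
  have -> : im z ^+ 2 = cabs z ^+ 2 - re z ^+ 2 by rewrite cz addrC addKr.
  by field.
by field; rewrite gt_eqF.
Qed.

(** As the roots have positive real parts, [W w + W z] never vanishes, and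
    [W w - W z = (U w - U z) / (W w + W z)] yields both the continuity and the derivative of the
    root. *)
Lemma strip_ext_sqrt g : strip_ext g -> (forall t, 0 < g t) -> strip_ext (fun t => Num.sqrt (g t)).
Proof.
move=> [d [U [U' [d0 hU pU e]]]] g0.
have [t|z m|d' d'0 Hd] := @strip_open (fun z => strip d z /\ 0 < re (U z)).
- have [h _] := hU _ (strip_real t d0).
  have [r r0 H] := cder_ccont h (g0 t).
  exists (Num.min r d); first by rewrite lt_min r0.
  move=> w; rewrite lt_min => /andP[wr wd]; split.
    rewrite /strip; apply: le_lt_trans wd; apply: le_trans (im_le_cabs _).
    by rewrite imB imC subr0.
  have := le_lt_trans (re_le_cabs _) (H w wr); rewrite e reB reC ltr_norml; lra.
- by rewrite /strip imD imC addr0 (per_int pU).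
pose W z := csqrt (U z).
have Wr z : strip d' z -> 0 < re (W z) by move=> /Hd [_]; exact: csqrt_gt0.
have WW z : strip d' z -> W z * W z = U z by move=> /Hd [_ h]; rewrite -expr2 csqrt_sqr.
have W0 z w : strip d' z -> strip d' w -> re (W z) <= cabs (W w + W z).
  move=> zd wd; apply: le_trans (re_le_cabs _); rewrite reD ger0_norm ?addr_ge0// ?ltW ?Wr//.
  by rewrite ltrDr Wr.
have Wn z w : strip d' z -> strip d' w -> W w + W z != 0.
  by move=> zd wd; rewrite -cabs_gt0; apply: lt_le_trans (W0 z w zd wd); exact: Wr.
have dW z w : strip d' z -> strip d' w -> W w - W z = (U w - U z) / (W w + W z).
  move=> zd wd; rewrite -(WW z zd) -(WW w wd).
  have := Wn z w zd wd; move: (W w) (W z) => a b ab; apply: (mulIf ab).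
  by rewrite divfK//; ring.
have loc z : strip d' z -> exists2 r : R, 0 < r & forall w, cabs (w - z) < r -> strip d' w.
  move=> zd; exists (d' - `|im z|); first by rewrite subr_gt0.
  move=> w h; rewrite /strip -[im w](subrK (im z)).
  apply: le_lt_trans (ler_normD _ _) _; rewrite -imB -ltrBrDr.
  exact: le_lt_trans (im_le_cabs _) h.
have cW z : strip d' z -> ccont W z.
  move=> zd x x0; have [zd' _] := Hd z zd; have [h _] := hU z zd'.
  have [r r0 H] := cder_ccont h (mulr_gt0 x0 (Wr z zd)).
  have [r' r'0 H'] := loc z zd.
  exists (Num.min r r'); first by rewrite lt_min r0.
  move=> w; rewrite lt_min => /andP[wr wr'].
  have wd := H' w wr'.
  rewrite dW// cabsM cabsV ltr_pdivrMr; last by rewrite cabs_gt0 Wn.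
  by apply: lt_le_trans (H w wr) _; rewrite ler_pM2l// W0.
exists d', W, (fun z => U' z / (W z + W z)); split=> //.
- move=> z zd; have [zd' _] := Hd z zd; have [h cU'] := hU z zd'.
  have cS : ccont (fun w => (W w + W z)^-1) z.
    apply: ccontV; first exact: Wn.
    by apply: ccontD; [exact: cW|exact: ccont_cst].
  split.
    have [p [cp pz pe]] := h.
    have [r' r'0 H'] := loc z zd.
    have q : cder (fun w => W z + (U w - U z) / (W w + W z)) z (U' z / (W z + W z)).
      exists (fun w => p w / (W w + W z)); split.
      - exact: ccontM.
      - by rewrite pz.
      - by move=> w; rewrite subrr mul0r addr0 addrC addKr pe mulrAC.
    apply: cder_local r'0 _ q => w /H' wd.
    by rewrite -dW// addrC subrK.
  apply: ccontM => //; apply: ccontV; first exact: Wn.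
  by apply: ccontD; exact: cW.
- by move=> z; rewrite /W pU.
- move=> t; rewrite /W e /csqrt cabs_real reC imC gtr0_norm//.
  have -> : (g t + g t) / 2 = g t by field.
  by rewrite mul0r.
Qed.

End AnalyticClosure.

(** * The complexified curve *)

Section OpenMapping.
Context {R : realType}.
Local Notation C := R[i].
Implicit Types (z w a : C) (t s : R) (f : C -> C).

Lemma segment_mvt f f' z w c (B : R) :
  (forall x : R, 0 <= x <= 1 -> cder f (w + x%:C * (z - w)) (f' (w + x%:C * (z - w)))) ->
  (forall x : R, 0 <= x <= 1 -> cabs (f' (w + x%:C * (z - w)) - c) <= B) ->
  cabs (f z - f w - c * (z - w)) <= 2 * B * cabs (z - w).
Proof.
set h := z - w => dl bB.
have m01 (x : R) : Num.min 0 1 <= x <= Num.max 0 1 -> 0 <= x <= 1.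
  by rewrite (min_idPl ler01) (max_idPr ler01).
have bd (x : R) : 0 <= x <= 1 -> cabs (f' (w + x%:C * h) * h - c * h) <= B * cabs h.
  by move=> /bB h1; rewrite -mulrBl cabsM ler_wpM2r ?cabs_ge0.
have Hre := @mvt_dist R (fun x => re (f (w + x%:C * h))) (fun x => re (f' (w + x%:C * h) * h)) 0 1 (re (c * h)) (B * cabs h).
have Him := @mvt_dist R (fun x => im (f (w + x%:C * h))) (fun x => im (f' (w + x%:C * h) * h)) 0 1 (im (c * h)) (B * cabs h).
have {}Hre := Hre (fun x hx => (cder_line (dl x (m01 x hx))).1).
have {}Him := Him (fun x hx => (cder_line (dl x (m01 x hx))).2).
have bre (x : R) : Num.min 0 1 <= x <= Num.max 0 1 ->
    `|re (f' (w + x%:C * h) * h) - re (c * h)| <= B * cabs h.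
  by move=> /m01 /bd; apply: le_trans; rewrite -reB re_le_cabs.
have bim (x : R) : Num.min 0 1 <= x <= Num.max 0 1 ->
    `|im (f' (w + x%:C * h) * h) - im (c * h)| <= B * cabs h.
  by move=> /m01 /bd; apply: le_trans; rewrite -imB im_le_cabs.
have {bre}Hre := Hre bre; have {bim}Him := Him bim.
have e1 : w + 1%:C * h = z by rewrite /h mul1r addrC subrK.
have e2 : w + 0%:C * h = w by rewrite mul0r addr0.
move: Hre Him; rewrite e1 e2 subr0 !mulr1 normr1 mulr1 -!reB -!imB => Hre Him.
apply: le_trans (cabs_le _) _.
by rewrite (_ : 2 * B * cabs h = B * cabs h + B * cabs h); [exact: lerD|ring].
Qed.

Lemma segment_ball z w z0 (r x : R) : 0 <= x <= 1 -> cabs (z - z0) < r -> cabs (w - z0) < r ->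
  cabs (w + x%:C * (z - w) - z0) < r.
Proof.
move=> /andP[x0 x1] zm wm.
have -> : w + x%:C * (z - w) - z0 = (1 - x)%:C * (w - z0) + x%:C * (z - z0).
  by rewrite rmorphB /=; ring.
apply: le_lt_trans (cabsD _ _) _; rewrite !cabsM !cabs_real !ger0_norm ?subr_ge0//.
move: wm zm; move: (cabs _) (cabs _) => a b ac bc.
have mc : Num.max a b < r by rewrite gt_max ac bc.
apply: le_lt_trans mc; have am : a <= Num.max a b by rewrite le_max lexx.
have bm : b <= Num.max a b by rewrite le_max lexx orbT.
by move: (Num.max a b) am bm => m am bm; nra.
Qed.

(** Strict differentiability: both points vary. It makes the iteration in [open_mapping] contract
    and bounds the chords of the curve from below near the diagonal. *)
Lemma strong_diff (D : set C) f f' z0 (r0 : R) : 0 < r0 -> (forall z, cabs (z - z0) < r0 -> D z) ->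
  hol1 D f f' -> forall e : R, 0 < e -> exists2 r : R, 0 < r <= r0 &
  forall z w, cabs (z - z0) < r -> cabs (w - z0) < r ->
    cabs (f z - f w - f' z0 * (z - w)) <= e * cabs (z - w).
Proof.
move=> r00 rD hf e e0.
have Dz0 : D z0 by apply: rD; rewrite subrr cabs0.
have e20 : 0 < e / 2 by rewrite divr_gt0.
have [r1 r10 H1] := (hf z0 Dz0).2 _ e20.
exists (Num.min r1 r0); first by rewrite lt_min r10 r00 ge_min lexx orbT.
move=> z w hz hw.
have seg (x : R) : 0 <= x <= 1 -> cabs (w + x%:C * (z - w) - z0) < Num.min r1 r0.
  by move=> hx; exact: segment_ball.
rewrite [e in leRHS](_ : e = 2 * (e / 2)); last by rewrite mulrC divfK.
apply: (@segment_mvt f f').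
  by move=> x /seg; rewrite lt_min => /andP[_ h2]; have [] := hf _ (rD _ h2).
by move=> x /seg; rewrite lt_min => /andP[h1 _]; rewrite ltW// H1.
Qed.

(* Newton's iteration with the derivative frozen at [z0] contracts by a factor [1/2]. *)
Lemma open_mapping (D : set C) f f' z0 (r0 : R) : 0 < r0 -> (forall z, cabs (z - z0) < r0 -> D z) ->
  hol1 D f f' -> f' z0 != 0 -> forall r : R, 0 < r -> exists2 rho : R, 0 < rho &
  forall p, cabs (p - f z0) < rho -> exists z, [/\ cabs (z - z0) < r, f z = p &
    cabs (z - z0) <= 2 / cabs (f' z0) * cabs (p - f z0)].
Proof.
move=> r00 rD hf f0 r rpos.
have m0 : 0 < cabs (f' z0) by rewrite cabs_gt0.
have m2 : 0 < cabs (f' z0) / 2 by rewrite divr_gt0.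
have [r1 /andP[r10 r1r0] H] := strong_diff r00 rD hf m2.
pose q := Num.min r1 r.
have q0 : 0 < q by rewrite lt_min r10.
exists (q * cabs (f' z0) / 4); first by rewrite !mulr_gt0 ?invr_gt0.
(* The first step has length at most [eta]; halving at each step keeps the iterates within [2 * eta]
   of [z0]. *)
move=> p hp; pose eta := cabs (p - f z0) / cabs (f' z0).
have eta0 : 0 <= eta by rewrite divr_ge0 ?cabs_ge0.
have etaq : 2 * eta < q.
  rewrite /eta mulrA ltr_pdivrMr// -ltr_pdivlMl//.
  apply: lt_le_trans hp _.
  have : 0 < q * cabs (f' z0) by rewrite mulr_gt0.
  by move: (q * _) => x; lra.
pose T z := z - (f z - p) / f' z0.
pose Z n := iter n T z0.
pose A n := Z n.+1 - Z n.
have inv n : cabs (A n) <= eta * 2^-1 ^+ n /\ cabs (Z n - z0) <= 2 * eta - 2 * eta * 2^-1 ^+ n.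
  elim: n => [|n [IH1 IH2]].
    rewrite /A /Z /= /T expr0 !mulr1 subrr subrr cabs0; split => //.
    by rewrite addrAC subrr add0r cabsN cabsM cabsV cabsBC.
  have x0 : 0 <= (2^-1 : R) ^+ n by rewrite exprn_ge0// invr_ge0.
  have ZS : cabs (Z n.+1 - z0) <= 2 * eta - 2 * eta * 2^-1 ^+ n.+1.
    have -> : Z n.+1 - z0 = A n + (Z n - z0) by rewrite /A addrA subrK.
    apply: le_trans (cabsD _ _) _; rewrite exprS.
    move: IH1 IH2; move: (cabs _) (cabs _) (2^-1 ^+ n) => a b c; lra.
  split => //.
  have l1 : cabs (Z n.+1 - z0) < r1.
    apply: le_lt_trans ZS _; apply: (@lt_le_trans _ _ q); last by rewrite ge_min lexx.
    by apply: le_lt_trans etaq; rewrite lerBlDr lerDl !mulr_ge0 ?exprn_ge0// invr_ge0.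
  have l2 : cabs (Z n - z0) < r1.
    apply: le_lt_trans IH2 _; apply: (@lt_le_trans _ _ q); last by rewrite ge_min lexx.
    by apply: le_lt_trans etaq; rewrite lerBlDr lerDl !mulr_ge0 ?exprn_ge0// invr_ge0.
  have -> : A n.+1 = - ((f (Z n.+1) - f (Z n) - f' z0 * (Z n.+1 - Z n)) / f' z0).
    have Z2 : Z n.+2 = Z n.+1 - (f (Z n.+1) - p) / f' z0 by [].
    have Z1 : Z n.+1 = Z n - (f (Z n) - p) / f' z0 by [].
    rewrite /A Z2.
    have -> : f' z0 * (Z n.+1 - Z n) = - (f (Z n) - p).
      by rewrite [X in X - Z n]Z1 addrAC subrr add0r mulrN mulrC divfK.
    by move: (f (Z n.+1)) (f (Z n)) (Z n.+1) => x y z; field.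
  rewrite cabsN cabsM cabsV ler_pdivrMr//.
  apply: le_trans (H _ _ l1 l2) _; rewrite -/(A n) exprS.
  move: IH1 m0; move: (cabs (A n)) (cabs _) (2^-1 ^+ n) => a b c; nra.
have A2 n : cabs (A n) <= geometric eta 2^-1 n by have [] := inv n.
have cg : cvgn (series (geometric eta (2^-1 : R))).
  by apply: is_cvg_geometric_series; rewrite ger0_norm ?invr_ge0// invf_lt1// ltr1n.
have cA := csum_cvg A2 cg.
pose z := z0 + csum A.
have cZ : ccvg Z z.
  apply: ccvg_ext (ccvgD (ccvg_cst z0) cA) => n.
  by rewrite /A telescope_sumr// addrC subrK.
have zb : cabs (z - z0) <= 2 * eta.
  apply: (ccvg_le cZ); apply: nearW => n; apply: le_trans (inv n).2 _.
  by rewrite lerBlDr lerDl !mulr_ge0 ?exprn_ge0// invr_ge0.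
have zq : cabs (z - z0) < q by exact: le_lt_trans zb etaq.
exists z; split.
- by apply: lt_le_trans zq _; rewrite ge_min lexx orbT.
- have zr0 : cabs (z - z0) < r0.
    by apply: lt_le_trans zq _; rewrite ge_min r1r0.
  have cf : ccont f z by have [h _] := hf z (rD z zr0); exact: cder_ccont h.
  have c1 := ccvgB (ccvg_comp cf cZ) (ccvg_cst p).
  have c2 : ccvg (fun n => f (Z n) - p) (- f' z0 * (z - z)).
    apply: ccvg_ext (ccvgM (ccvg_cst (- f' z0)) (ccvgB (ccvgS cZ) cZ)) => n.
    have -> : Z n.+1 = Z n - (f (Z n) - p) / f' z0 by [].
    by rewrite addrAC subrr add0r mulrNN mulrC divfK.
  by have /eqP := ccvg_unique c1 c2; rewrite subrr mulr0 subr_eq0 => /eqP.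
- by apply: le_trans zb _; rewrite /eta -mulrA [_^-1 * _]mulrC.
Qed.

End OpenMapping.

(** * Chords of the extended curve *)

Section StripCurve.
Context {R : realType}.
Local Notation C := R[i].
Implicit Types (z w a : C) (t s : R) (f : C -> C).

Lemma ez_eq_shift z w : ez z = ez w -> exists m : int, z = w + (2 * pi * m%:~R)%:C.
Proof.
move=> e; have [m hm] := per_reduce (re (z - w)).
have pe : per (@ez R) by exact: ez_per.
have E : ez (z - w + (2 * pi * m%:~R)%:C) = 1.
  by rewrite (per_int pe) ezD ezN e divff// ez_neq0.
have hm' : `|re (z - w + (2 * pi * m%:~R)%:C)| <= pi by rewrite reD reC.
have H := ez_eq1 hm' E.
exists (- m); rewrite mulrNz mulrN rmorphN /=; apply/eqP; rewrite -subr_eq0; apply/eqP.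
by rewrite -[RHS]H; ring.
Qed.

Lemma strip_ball (d t : R) z : 0 < d -> cabs (z - t%:C) < d -> strip d z.
Proof.
move=> d0; apply: le_lt_trans; apply: le_trans (im_le_cabs _).
by rewrite imB imC subr0.
Qed.

Lemma strip_nbhs (d : R) z0 : strip d z0 -> exists2 r : R, 0 < r & forall z, cabs (z - z0) < r -> strip d z.
Proof.
move=> zd; exists (d - `|im z0|); first by rewrite subr_gt0.
move=> w h; rewrite /strip -[im w](subrK (im z0)).
apply: le_lt_trans (ler_normD _ _) _; rewrite -imB -ltrBrDr.
exact: le_lt_trans (im_le_cabs _) h.
Qed.

Variables (G G' : C -> C) (d : R).
Hypotheses (d0 : 0 < d) (hG : hol1 (strip d) G G') (pG : per G)
  (iG : forall t s, G t%:C = G s%:C -> ez t%:C = ez s%:C :> C) (nzG : forall t, G' t%:C != 0).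

(** On the diagonal modulo the period, strict differentiability compares both chords with [z - w];
    elsewhere [G t] and [G s] are distinct and continuity keeps the right side away from 0. *)
Lemma chord_local t s : exists r N : R, 0 < r /\ forall z w, cabs (z - t%:C) < r -> cabs (w - s%:C) < r ->
  cabs (ez z - ez w) <= N * cabs (G z - G w).
Proof.
have [e|ne] := eqVneq (ez t%:C : C) (ez s%:C).
  have [m ts] := ez_eq_shift e.
  have m0 : 0 < cabs (G' t%:C) by rewrite cabs_gt0 nzG.
  have [r1 /andP[r10 _] H1] := strong_diff d0 (fun z => @strip_ball d t z d0) hG (divr_gt0 m0 (ltr0n R 2)).
  have [r2 /andP[r20 _] H2] := strong_diff d0 (fun z => @strip_ball d t z d0) (@hol1_ez R _) ltr01.
  exists (Num.min r1 r2), (4 / cabs (G' t%:C)); split; first by rewrite lt_min r10.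
  move=> z w; rewrite !lt_min => /andP[z1 z2] hw.
  pose w' := w + (2 * pi * m%:~R)%:C.
  have Ew : ez w = ez w' by rewrite /w' (per_int (@ez_per R)).
  have Gw : G w = G w' by rewrite /w' (per_int pG).
  have w't : w' - t%:C = w - s%:C by rewrite ts /w'; ring.
  rewrite Ew Gw; move: hw; rewrite -w't => /andP[w1 w2].
  have {}H1 := H1 z w' z1 w1; have {}H2 := H2 z w' z2 w2.
  have ub : cabs (ez z - ez w') <= 2 * cabs (z - w').
    rewrite -(subrK ('i * ez t%:C * (z - w')) (ez z - ez w')).
    apply: le_trans (cabsD _ _) _; rewrite [X in _ + X]cabsM cabsM cabs_i cabs_ez_real !mul1r.
    by move: H2; rewrite mul1r; lra.
  have lb : cabs (G' t%:C) / 2 * cabs (z - w') <= cabs (G z - G w').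
    have := cabs_subr (G' t%:C * (z - w')) (G' t%:C * (z - w') - (G z - G w')).
    rewrite subKr cabsM [cabs (_ - (G z - _))]cabsBC.
    by move: H1; lra.
  apply: le_trans ub _; rewrite mulrAC ler_pdivlMr//.
  by move: lb; move: (cabs (z - w')) (cabs (G z - _)) => x y; lra.
have Gts : G t%:C - G s%:C != 0.
  by rewrite subr_eq0; apply: contra ne => /eqP /iG ->.
have m0 : 0 < cabs (G t%:C - G s%:C) by rewrite cabs_gt0.
have m4 : 0 < cabs (G t%:C - G s%:C) / 4 by rewrite divr_gt0.
have [r1 r10 H1] := cder_ccont (hG (strip_real t d0)).1 m4.
have [r2 r20 H2] := cder_ccont (hG (strip_real s d0)).1 m4.
have [r3 r30 H3] := ccont_ez t%:C (@ltr01 R).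
have [r4 r40 H4] := ccont_ez s%:C (@ltr01 R).
exists (Num.min (Num.min r1 r2) (Num.min r3 r4)), (8 / cabs (G t%:C - G s%:C)).
split; first by rewrite !lt_min r10 r20 r30.
move=> z w; rewrite !lt_min => /andP[/andP[z1 _] /andP[z3 _]] /andP[/andP[_ w2] /andP[_ w4]].
have {}H1 := H1 z z1; have {}H2 := H2 w w2; have {}H3 := H3 z z3; have {}H4 := H4 w w4.
have ub : cabs (ez z - ez w) <= 4.
  have E : ez z - ez w = (ez z - ez t%:C) - (ez w - ez s%:C) + (ez t%:C - ez s%:C) by ring.
  rewrite E; apply: le_trans (cabsD _ _) _.
  have := cabsB (ez z - ez t%:C) (ez w - ez s%:C).
  have := cabsB (ez t%:C : C) (ez s%:C); rewrite !cabs_ez_real.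
  by move: H3 H4; lra.
have lb : cabs (G t%:C - G s%:C) / 2 <= cabs (G z - G w).
  have E : G t%:C - G s%:C = (G z - G w) - ((G z - G t%:C) - (G w - G s%:C)) by ring.
  have := cabsB (G z - G w) ((G z - G t%:C) - (G w - G s%:C)); rewrite -E.
  have := cabsB (G z - G t%:C) (G w - G s%:C).
  by move: H1 H2; lra.
apply: le_trans ub _; rewrite mulrAC ler_pdivlMr//.
by move: lb; move: (cabs _) (cabs _) => x y; lra.
Qed.

(** Compactness of the square of a period. One integer provides both the constant and, through its
    inverse, the width of the strip. In particular [G] is injective on the strip modulo the
    period. *)
Lemma chord_lower : exists N e : R, [/\ 0 < e, e <= d, 0 < N & forall z w, strip e z -> strip e w ->
  cabs (ez z - ez w) <= N * cabs (G z - G w)].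
Proof.
pose K : set (R * R) := `[- pi, pi] `*` `[- pi, pi].
have cK : compact K by apply: compact_setX; exact: segment_compact.
move: cK => /compact_near_coveringP /(_ nat \oo (fun n q => forall y1 y2,
  `|y1| < n.+1%:R^-1 -> `|y2| < n.+1%:R^-1 ->
  cabs (ez (q.1 +i* y1) - ez (q.2 +i* y2)) <= n%:R * cabs (G (q.1 +i* y1) - G (q.2 +i* y2))) _) H.
have [[t s] _|n0 _ Hn] := H.
  have [r [N [r0 HN]]] := chord_local t s.
  pose n1 := Num.bound (2 / r); pose n2 := Num.bound N.
  exists (ball (t, s) (r / 2), [set n | (maxn n1 n2 <= n)%N]).
    by split; [apply: nbhsx_ballx; rewrite divr_gt0|exists (maxn n1 n2)].
  move=> [[t' s'] n] [/= [ts1 ts2]]; rewrite geq_max => /andP[nn1 nn2] y1 y2.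
  have nr : n.+1%:R^-1 < r / 2.
    rewrite -[r / 2]invrK ltf_pV2 ?posrE// ?invr_gt0 ?divr_gt0// invf_div.
    apply: lt_le_trans (archi_boundP _) _; first by rewrite divr_ge0// ltW.
    by rewrite ler_nat ltnW// ltnS.
  have nN : N <= n%:R.
    have [N0|N0] := leP 0 N; last by rewrite (le_trans (ltW N0)).
    by apply: le_trans (ltW (archi_boundP N0)) _; rewrite ler_nat.
  move=> hy1 hy2; move: ts1 ts2; rewrite /ball /= => ts1 ts2.
  have hz : cabs (t' +i* y1 - t%:C) < r.
    apply: le_lt_trans (cabs_le _) _; rewrite reB imB reC imC [re _]/= [im _]/= subr0 distrC.
    by rewrite [ltRHS]splitr; apply: ltrD; [exact: ts1|exact: lt_trans hy1 nr].
  have hw : cabs (s' +i* y2 - s%:C) < r.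
    apply: le_lt_trans (cabs_le _) _; rewrite reB imB reC imC [re _]/= [im _]/= subr0 distrC.
    by rewrite [ltRHS]splitr; apply: ltrD; [exact: ts2|exact: lt_trans hy2 nr].
  have {}HN := HN _ _ hz hw; apply: (le_trans HN).
  by apply: ler_wpM2r => //; exact: cabs_ge0.
exists n0.+1%:R, (Num.min d n0.+2%:R^-1); split => //.
- by rewrite lt_min d0/= invr_gt0 ltr0n.
- by rewrite ge_min lexx.
move=> z w; rewrite /strip !lt_min => /andP[_ zn] /andP[_ wn].
have [m1 h1] := per_reduce (re z); have [m2 h2] := per_reduce (re w).
pose x1 := re z + 2 * pi * m1%:~R; pose x2 := re w + 2 * pi * m2%:~R.
have Kq : K (x1, x2) by rewrite /K /= !in_itv /= -!ler_norml.
have h : cabs (ez (x1 +i* im z) - ez (x2 +i* im w)) <= n0.+1%:R * cabs (G (x1 +i* im z) - G (x2 +i* im w)) :=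
  Hn n0.+1 (leqnSn _) (x1, x2) Kq (im z) (im w) zn wn.
have E (x : C) (m : int) : (re x + 2 * pi * m%:~R) +i* im x = x + (2 * pi * m%:~R)%:C.
  by apply: complex_eq; rewrite !reimE /= ?addr0.
move: h; rewrite /x1 /x2 !E !(per_int pG) !(per_int (@ez_per R)); exact.
Qed.

End StripCurve.

(** * Kernels of the curve *)

Section CauchyKernels.
Context {R : realType}.
Local Notation C := R[i].
Local Notation mu := (@lebesgue_measure R).
Implicit Types (z w a : C) (t s : R) (f g u v : R -> C) (h : R -> R).
Local Notation I0 := (@I0 R).
Local Notation finI0 := (@finI0 R).

Lemma cbm_le D u v (M : R) : cbm D u -> mcf D v -> (forall s, D s -> cabs (v s) <= M * cabs (u s)) -> 0 <= M -> cbm D v.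
Proof.
move=> [_ [B HB]] mv H M0; split => //; exists (M * B) => s Ds.
by apply: le_trans (H s Ds) _; rewrite ler_wpM2l// HB.
Qed.

Lemma ccont_lip (F : C -> C) z (r L : R) : 0 < r ->
  (forall w, cabs (w - z) < r -> cabs (F w - F z) <= L * cabs (w - z)) -> ccont F z.
Proof.
move=> r0 H e e0; pose L' := `|L| + 1.
have L0 : 0 < L' by rewrite ltr_wpDl.
exists (Num.min r (e / L')); first by rewrite lt_min r0 divr_gt0.
move=> w; rewrite lt_min => /andP[w1 w2]; apply: le_lt_trans (H w w1) _.
move: w2; rewrite ltr_pdivlMr// mulrC; apply: le_lt_trans.
by apply: ler_wpM2r; [exact: cabs_ge0|rewrite (le_trans (ler_norm _))// lerDl].
Qed.

Definition cauchy_int u g w : C := cint I0 (fun s => u s / (w - g s)).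

Definition cauchy_int' u g w : C := - cint I0 (fun s => u s / (w - g s) ^+ 2).

(** A uniform distance bounds the integrands directly. *)
Definition off_curve g : set C := fun w => exists2 m : R, 0 < m & forall s, m <= cabs (w - g s).

Lemma mcfX D u n : mcf D u -> mcf D (fun s => u s ^+ n).
Proof.
move=> mu_; elim: n => [|n IH].
  by rewrite (_ : (fun _ => _) = (fun=> 1)); [exact: mcf_cst|apply/funext => s; rewrite expr0].
rewrite (_ : (fun _ => _) = (fun s => u s * u s ^+ n)); first exact: mcfM.
by apply/funext => s; rewrite exprS.
Qed.

Lemma cbm_cauchy u g w n : cbm I0 u -> rcont g -> off_curve g w -> cbm I0 (fun s => u s / (w - g s) ^+ n).
Proof.
move=> bu cg [m m0 Hm].
have mv : mcf I0 (fun s => (w - g s) ^+ n) by apply: mcfX; apply: mcfB; [exact: mcf_cst|exact: mcf_rcont].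
apply: (@cbm_le _ u _ ((m ^+ n)^-1)) => //; first by apply: mcfM; [exact: bu.1|exact: mcfV].
  move=> s _; rewrite cabsM cabsV cabsX mulrC ler_wpM2r ?cabs_ge0//.
  rewrite lef_pV2 ?posrE ?exprn_gt0//; last exact: lt_le_trans m0 (Hm s).
  by apply: lerXn2r; rewrite ?nnegrE ?(ltW m0)// (le_trans (ltW m0)).
by rewrite invr_ge0 exprn_ge0// ltW.
Qed.

Lemma cauchy_hol u g : cbm I0 u -> rcont g -> hol1 (off_curve g) (cauchy_int u g) (cauchy_int' u g).
Proof.
move=> bu cg w ow; have [m m0 Hm] := ow; have [B HB] := bu.2.
have near_off z : cabs (z - w) < m / 2 -> forall s, m / 2 <= cabs (z - g s).
  move=> zw s; have := Hm s; have := cabsBtri z w (g s); rewrite [cabs (w - z)]cabsBC.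
  by move: zw; lra.
have m2 : 0 < m / 2 by rewrite divr_gt0.
have near_off' z : cabs (z - w) < m / 2 -> off_curve g z by move=> /near_off h; exists (m / 2).
have B0 : 0 <= B by apply: le_trans (cabs_ge0 _) (HB 0 _); rewrite /I0 /= in_itv /= lexx pi2_ge0.
have wg s : w - g s != 0 by rewrite -cabs_gt0 (lt_le_trans m0).
have zg z s : cabs (z - w) < m / 2 -> z - g s != 0.
  by move=> /near_off h; rewrite -cabs_gt0 (lt_le_trans m2).
have c1 x : off_curve g x -> cbm I0 (fun s => u s / (x - g s)).
  by move=> ox; have := cbm_cauchy 1 bu cg ox.
have c2 x : off_curve g x -> cbm I0 (fun s => u s / (x - g s) ^+ 2) by exact: cbm_cauchy.
have iV (x y : R) : 0 < y -> y <= x -> x^-1 <= y^-1.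
  by move=> y0 yx; rewrite lef_pV2 ?posrE// (lt_le_trans y0).
split.
  apply: (@cder_quad _ _ _ _ (m / 2) (2 * (B * ((m / 2)^-1 * (m ^+ 2)^-1)) * fine (mu I0))) => // z zw.
  have oz := near_off' z zw.
  have cz : cbm I0 (fun s => (z - w) * (u s / (w - g s) ^+ 2)) by apply: cbmM (cbm_cst _ _) (c2 w ow).
  rewrite /cauchy_int /cauchy_int' mulNr opprK [X in _ + X]mulrC -(cintZ _ finI0 (c2 w ow)).
  rewrite -(cintB finI0 (c1 z oz) (c1 w ow)) -(cintD finI0 (cbmB (c1 z oz) (c1 w ow)) cz).
  have E s : u s / (z - g s) - u s / (w - g s) + (z - w) * (u s / (w - g s) ^+ 2) =
      (z - w) ^+ 2 * (u s * ((z - g s)^-1 * ((w - g s) ^+ 2)^-1)).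
    by have := wg s; have := zg z s zw; move: (g s) (u s) => x y; clear; move=> *; field; apply/andP; split.
  have bb := cbmD (cbmB (c1 z oz) (c1 w ow)) cz.
  have -> : 2 * (B * ((m / 2)^-1 * (m ^+ 2)^-1)) * fine (mu I0) * cabs (z - w) ^+ 2 =
     2 * (cabs (z - w) ^+ 2 * (B * ((m / 2)^-1 * (m ^+ 2)^-1))) * fine (mu I0) by ring.
  apply: (cint_bound finI0 bb) => s Is; rewrite E cabsM cabsX.
  apply: ler_wpM2l; first by rewrite exprn_ge0// cabs_ge0.
  rewrite !cabsM !cabsV cabsX; apply: ler_pM; rewrite ?mulr_ge0 ?invr_ge0 ?exprn_ge0 ?cabs_ge0//; first exact: HB.
  apply: ler_pM; rewrite ?invr_ge0 ?exprn_ge0 ?cabs_ge0//; first exact: iV (near_off z zw s).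
  apply: iV; first by rewrite exprn_gt0.
  by apply: lerXn2r; rewrite ?nnegrE ?(ltW m0) ?cabs_ge0.
apply: (@ccont_lip _ _ (m / 2) (2 * (B * (2 * ((m / 2) ^+ 3)^-1)) * fine (mu I0))) => // z zw.
have oz := near_off' z zw.
rewrite /cauchy_int' opprK addrC -(cintB finI0 (c2 w ow) (c2 z oz)).
have E s : u s / (w - g s) ^+ 2 - u s / (z - g s) ^+ 2 =
    (z - w) * (u s * ((z - g s)^-1 * ((w - g s) ^+ 2)^-1 + ((z - g s) ^+ 2)^-1 * (w - g s)^-1)).
  by have := wg s; have := zg z s zw; move: (g s) (u s) => x y; clear; move=> *; field; apply/andP; split.
have bb := cbmB (c2 w ow) (c2 z oz).
have -> : 2 * (B * (2 * ((m / 2) ^+ 3)^-1)) * fine (mu I0) * cabs (z - w) =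
   2 * (cabs (z - w) * (B * (2 * ((m / 2) ^+ 3)^-1))) * fine (mu I0) by ring.
apply: (cint_bound finI0 bb) => s Is; rewrite E cabsM.
apply: ler_wpM2l; first exact: cabs_ge0.
rewrite cabsM; apply: ler_pM; [exact: cabs_ge0|exact: cabs_ge0|exact: HB|].
have v1 : cabs (z - g s)^-1 <= (m / 2)^-1 by rewrite cabsV; exact: iV (near_off z zw s).
have v2 : cabs (w - g s)^-1 <= (m / 2)^-1.
  by rewrite cabsV; apply: iV => //; have := Hm s; move: m0; clear; lra.
apply: le_trans (cabsD _ _) _; rewrite !cabsM -!exprVn !cabsX.
have p0 : 0 <= (m / 2)^-1 by rewrite invr_ge0 ltW.
have a0 := cabs_ge0 (z - g s)^-1. have b0 := cabs_ge0 (w - g s)^-1.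
move: (cabs (z - g s)^-1) (cabs (w - g s)^-1) ((m / 2)^-1) p0 a0 b0 v1 v2 => a b p p0 a0 b0 ap bp.
rewrite mulr2n mulrDl mul1r; apply: lerD; rewrite !exprS !expr0 !mulr1.
  by apply: ler_pM => //; [rewrite mulr_ge0|apply: ler_pM].
by rewrite -mulrA; apply: ler_pM => //; [rewrite mulr_ge0|apply: ler_pM].
Qed.

Definition sqdist w g s : R := cabs (w - g s) ^+ 2.

Lemma sqdist_deriv w g (dg : R -> C) s : rder g s (dg s) ->
  is_derive s (1 : R) (sqdist w g) (- 2 * (re (w - g s) * re (dg s) + im (w - g s) * im (dg s))).
Proof.
move=> [h1 h2].
have k1 := is_deriveB (is_derive_cst (re w) s (1 : R)) h1.
have k2 := is_deriveB (is_derive_cst (im w) s (1 : R)) h2.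
have k := is_deriveD (is_deriveM k1 k1) (is_deriveM k2 k2).
rewrite (_ : sqdist w g = (cst (re w) - (fun s => re (g s))) * (cst (re w) - (fun s => re (g s))) +
  (cst (im w) - (fun s => im (g s))) * (cst (im w) - (fun s => im (g s)))).
  apply: (is_derive_eq k); rewrite reB imB -![_ *: _]/(_ * _) /=.
  rewrite -![(cst _ - _) s]/(_ - _); ring.
by apply/funext => t; rewrite /sqdist cabs_sqr reB imB.
Qed.

Lemma sqdist_deriv_re w g (dg : R -> C) s : w - g s != 0 ->
  - 2 * (re (w - g s) * re (dg s) + im (w - g s) * im (dg s)) / sqdist w g s = - 2 * re (dg s / (w - g s)).
Proof.
move=> n0; rewrite /sqdist.
have n : cabs (w - g s) ^+ 2 != 0 by rewrite expf_neq0// cabs_eq0.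
apply: (mulIf n); rewrite divfK// -mulrA; congr (_ * _).
have E : dg s / (w - g s) * (cabs (w - g s) ^+ 2)%:C = dg s * conjc (w - g s).
  by rewrite cabs_sqr_conj mulrA divfK.
have alg (x y : C) (q : R) : x * q%:C = y -> re x * q = re y by move=> <-; rewrite reM /= mulr0 subr0.
rewrite (alg _ _ _ E).
by rewrite reM re_conj im_conj; ring.
Qed.

Lemma rcontV g : rcont g -> (forall s, g s != 0) -> rcont (fun s => (g s)^-1).
Proof.
move=> [a b] n0; split => s;
  by have [] := @ccont_comp_cont R _ g s (fun z => z^-1) (a s) (b s) (@ccontV R id (g s) (n0 s) (ccont_id _)).
Qed.

Lemma rcontB u v : rcont u -> rcont v -> rcont (fun s => u s - v s).
Proof.
move=> cu cv; rewrite (_ : (fun _ => _) = (fun s => u s + -1 * v s)).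
  by apply: rcontD => //; apply: rcontM => //; exact: rcont_cst.
by apply/funext => s; rewrite mulN1r.
Qed.

(* The real part of the integrand is [- 1 / 2] times the derivative of [ln (sqdist w g s)], which is periodic. *)
Lemma log_period_integral w g (dg : R -> C) : (forall s, rder g s (dg s)) -> rcont dg -> g (2 * pi) = g 0 ->
  off_curve g w -> re (cint I0 (fun s => dg s / (w - g s))) = 0.
Proof.
move=> hg cdg g0 ow; have [m m0 Hm] := ow.
have cg := rder_rcont hg.
have n0 s : w - g s != 0 by rewrite -cabs_gt0 (lt_le_trans m0).
pose q s := dg s / (w - g s).
have cq : rcont q by apply: rcontM => //; apply: rcontV => //; apply: rcontB => //; exact: rcont_cst.
pose L s := ln (sqdist w g s).
have dL s : is_derive s (1 : R) L (- 2 * re (q s)).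
  have l0 : 0 < sqdist w g s by rewrite exprn_gt0// cabs_gt0.
  have := is_derive1_comp (is_derive1_ln l0) (sqdist_deriv w (hg s)).
  by rewrite mulrC sqdist_deriv_re.
have cL : continuous (fun s => - 2 * re (q s)).
  by move=> s; apply: cvgM; [exact: cvg_cst|exact: cq.1].
have F := cint_FTC pi2_ge0 (fun s => rder_realC (dL s)) (rcont_realC cL).
have alg (k : R) (z : C) : k * re z = re (k%:C * z) by rewrite reM /= mul0r subr0.
have := f_equal (@complex.Re R) F; rewrite /realC /L /sqdist g0 subrr re_cint.
have -> : \int[mu]_(x in `[0, 2 * pi]) re (- 2 * re (q x))%:C = re (cint I0 (fun s => (- 2)%:C * q s)).
  rewrite re_cint; apply: eq_Rintegral => s _; exact: alg.
rewrite (cintZ _ finI0 (cbm_cont _ _ cq)) -alg /q.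
move=> /eqP; rewrite mulf_eq0 oppr_eq0 pnatr_eq0 /= => /eqP; exact.
Qed.

End CauchyKernels.

(** * Bounds for the kernels near the diagonal *)

Section KernelBounds.
Context {R : realType}.
Local Notation C := R[i].
Implicit Types (z w a : C) (t s : R).

Section Taylor.
Variables (f f' f'' : C -> C) (d e M : R).
Hypotheses (ed : e < d) (hf : hol1 (strip d) f f') (hf' : hol1 (strip d) f' f'')
  (bf : forall z, `|im z| <= e -> cabs (f'' z) <= M).

Lemma segment_strip z w (x : R) : `|im z| <= e -> `|im w| <= e -> 0 <= x <= 1 ->
  `|im (w + x%:C * (z - w))| <= e.
Proof.
move=> hz hw /andP[x0 x1]; rewrite imD imM imB imC reC mul0r addr0.
have -> : im w + x * (im z - im w) = (1 - x) * im w + x * im z by ring.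
have x1' : 0 <= 1 - x by rewrite subr_ge0.
apply: le_trans (ler_normD _ _) _; rewrite !normrM (ger0_norm x0) (ger0_norm x1').
move: hz hw; move: (`|im z|) (`|im w|) => a b; nra.
Qed.

Lemma deriv_lipschitz z w : `|im z| <= e -> `|im w| <= e -> cabs (f' z - f' w) <= 2 * M * cabs (z - w).
Proof.
move=> hz hw; have -> : f' z - f' w = f' z - f' w - 0 * (z - w) by ring.
apply: (@segment_mvt _ f' f'') => x hx; have h := segment_strip hz hw hx.
  by have [] := hf' (le_lt_trans h ed : strip d _).
by rewrite subr0; exact: bf.
Qed.

Lemma taylor_quad z w : `|im z| <= e -> `|im w| <= e ->
  cabs (f' z * (z - w) - (f z - f w)) <= 4 * M * cabs (z - w) ^+ 2.
Proof.
move=> hz hw; rewrite [leLHS]cabsBC.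
have M0 : 0 <= M by exact: le_trans (cabs_ge0 _) (bf hz).
have -> : 4 * M * cabs (z - w) ^+ 2 = 2 * (2 * M * cabs (z - w)) * cabs (z - w) by ring.
apply: (@segment_mvt _ f f') => x hx; have h := segment_strip hz hw hx.
  by have [] := hf (le_lt_trans h ed : strip d _).
apply: le_trans (deriv_lipschitz h hz) _.
apply: ler_wpM2l; first by rewrite mulr_ge0.
have -> : w + x%:C * (z - w) - z = - (1 - x)%:C * (z - w) by rewrite rmorphB /=; ring.
rewrite cabsM cabsN cabs_real -[leRHS]mul1r ler_wpM2r ?cabs_ge0//.
by move/andP: hx => [x0 x1]; rewrite ger0_norm ?subr_ge0// lerBlDr lerDl.
Qed.

(** The singular part of [f' z / (f z - f w)] is [1 / (z - w)] whatever [f] is, provided that chords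
    are bounded below; applied to [G] and to [ez], this makes the singular parts cancel. *)
Lemma quotient_bounds (c : R) z w : 0 < c -> `|im z| <= e -> `|im w| <= e ->
  c * cabs (z - w) <= cabs (f z - f w) ->
  cabs (f' z / (f z - f w) - (z - w)^-1) <= 4 * M / c /\ cabs ((f' z - f' w) / (f z - f w)) <= 2 * M / c.
Proof.
move=> c0 hz hw low.
have M0 : 0 <= M by exact: le_trans (cabs_ge0 _) (bf hz).
(* At [z = w] every inverse in the statement is 0. *)
have [->|zw] := eqVneq z w.
  by rewrite !subrr !invr0 !mulr0 subrr cabs0 !mulr_ge0// ?invr_ge0 ltW.
have x0 : 0 < cabs (z - w) by rewrite cabs_gt0 subr_eq0.
have y0 : 0 < cabs (f z - f w) by apply: lt_le_trans low; rewrite mulr_gt0.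
have fz : f z - f w != 0 by rewrite -cabs_gt0.
have zw' : z - w != 0 by rewrite subr_eq0.
have hx : cabs (z - w) <= cabs (f z - f w) / c by rewrite ler_pdivlMr// mulrC.
split; last first.
  rewrite cabsM cabsV ler_pdivrMr//; apply: le_trans (deriv_lipschitz hz hw) _.
  have -> : 2 * M / c * cabs (f z - f w) = 2 * M * (cabs (f z - f w) / c) by ring.
  by apply: ler_wpM2l => //; rewrite mulr_ge0.
have -> : f' z / (f z - f w) - (z - w)^-1 = (f' z * (z - w) - (f z - f w)) / ((f z - f w) * (z - w)).
  by field; apply/andP; split.
rewrite cabsM cabsV cabsM ler_pdivrMr ?mulr_gt0//.
apply: le_trans (taylor_quad hz hw) _.
have -> : 4 * M / c * (cabs (f z - f w) * cabs (z - w)) = 4 * M * (cabs (f z - f w) / c * cabs (z - w)) by ring.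
rewrite expr2; apply: ler_wpM2l; first by rewrite mulr_ge0.
by apply: ler_wpM2r => //; exact: ltW.
Qed.

End Taylor.

Variables (G G' G'' : C -> C) (d : R).
Hypotheses (d0 : 0 < d) (hG : hol1 (strip d) G G') (hG' : hol1 (strip d) G' G'')
  (pG : per G) (pG' : per G') (pG'' : per G'')
  (iG : forall t s, G t%:C = G s%:C -> ez t%:C = ez s%:C :> C) (nzG : forall t, G' t%:C != 0).

(* Both [kerG] and [kap] have the singular part [1 / (z - s)], so [kerA] is bounded up to the diagonal; [kerT] is minus the derivative in [s] of the logarithm of [G z - G s]. *)
Definition kerG z s : C := G' z / (G z - G s%:C).
Definition kerT z s : C := G' s%:C / (G z - G s%:C).
Definition kerA z s : C := kerG z s - kap z s.

(** [quotient_bounds] is applied to the curve and to the circle; [z] is first moved by a multiple of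
    the period so that its real part is within [pi] of [s], where the chord on the circle controls
    [|z - s|]. *)
Lemma kernel_bounds : exists e B N : R, [/\ 0 < e, e < d, 0 < N &
  [/\ forall z w, strip e z -> strip e w -> cabs (ez z - ez w) <= N * cabs (G z - G w),
      forall z s, strip e z -> cabs (kerA z s) <= B &
      forall z s, strip e z -> cabs (kerG z s - kerT z s) <= B]].
Proof.
have [N [e [e0 ed N0 HN]]] := chord_lower d0 hG pG iG nzG.
have [M0 M00 HM0] := @ez_lower R.
have [M1 HM1] := per_bounded d0 (fun z hz => (hG' hz).2) pG''.
pose e1 := Num.min (Num.min (e / 2) (d / 2)) 2^-1.
have e10 : 0 < e1 by rewrite !lt_min !divr_gt0//= invr_gt0.
have e1e : e1 < e by rewrite !gt_min ltr_pdivrMr// ltr_pMr// ltr1n.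
have e1d2 : e1 <= d / 2 by rewrite !ge_min lexx orbT.
have e1d : e1 < d by apply: le_lt_trans e1d2 _; rewrite ltr_pdivrMr// ltr_pMr// ltr1n.
have e11 : e1 <= 1 by rewrite !ge_min [X in _ || X](_ : _ = true) ?orbT// invf_le1// ler1n.
pose M2 : R := expR 1.
have b2 z : `|im z| <= e1 -> cabs ('i * ('i * ez z)) <= M2.
  move=> h; rewrite !cabsM cabs_i !mul1r cabs_ez ler_expR.
  by move: h; rewrite ler_norml => /andP[h _]; move: h e11; lra.
have b1 z : `|im z| <= e1 -> cabs (G'' z) <= M1.
  by move=> h; apply: HM1; exact: le_trans h e1d2.
have chN z w : strip e1 z -> strip e1 w -> cabs (ez z - ez w) <= N * cabs (G z - G w).
  by move=> hz hw; apply: HN; [exact: lt_trans hz e1e|exact: lt_trans hw e1e].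
pose c2 := M0^-1; pose c1 := (N * M0)^-1.
have c20 : 0 < c2 by rewrite invr_gt0.
have c10 : 0 < c1 by rewrite invr_gt0 mulr_gt0.
have real_e s : `|im (s%:C : C)| <= e1 by rewrite imC normr0 ltW.
pose B := Num.max (4 * M1 / c1 + 4 * M2 / c2) (2 * M1 / c1).
have key z s : strip e1 z -> `|re (z - s%:C)| <= pi -> cabs (kerA z s) <= B /\ cabs (kerG z s - kerT z s) <= B.
  move=> hz hr.
  have hz' : `|im z| <= e1 by exact: ltW.
  have low2 : c2 * cabs (z - s%:C) <= cabs (ez z - ez s%:C).
    rewrite /c2 mulrC ler_pdivrMr// mulrC.
    have h1 : `|im (z - s%:C)| <= 1 by rewrite imB imC subr0 (le_trans hz').
    apply: le_trans (HM0 _ hr h1) _; rewrite ler_wpM2l ?(ltW M00)//.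
    have -> : ez (z - s%:C) - 1 = (ez z - ez s%:C) / ez s%:C.
      by rewrite ezD ezN mulrBl divff// ez_neq0.
    by rewrite cabsM cabsV cabs_ez_real invr1 mulr1.
  have low1 : c1 * cabs (z - s%:C) <= cabs (G z - G s%:C).
    rewrite /c1 mulrC ler_pdivrMr ?mulr_gt0// mulrA.
    have := chN z s%:C hz (strip_real s e10); rewrite mulrC => h.
    move: low2; rewrite /c2 mulrC ler_pdivrMr// => h2.
    apply: le_trans h2 _; by apply: ler_wpM2r => //; exact: ltW.
  have [q1 q2] := quotient_bounds e1d hG hG' b1 c10 hz' (real_e s) low1.
  have [q3 _] := quotient_bounds e1d (@hol1_ez R _) (hol1Z 'i (@hol1_ez R _)) b2 c20 hz' (real_e s) low2.
  split; last first.
    rewrite /kerG /kerT -mulrBl; apply: le_trans q2 _; by rewrite le_max lexx orbT.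
  rewrite /kerA /kerG /kap.
  have -> : G' z / (G z - G s%:C) - 'i * ez z / (ez z - ez s%:C) =
    (G' z / (G z - G s%:C) - (z - s%:C)^-1) - ('i * ez z / (ez z - ez s%:C) - (z - s%:C)^-1) by ring.
  apply: le_trans (cabsB _ _) _; apply: (le_trans (lerD q1 q3)); by rewrite le_max lexx.
have key2 z s : strip e1 z -> cabs (kerA z s) <= B /\ cabs (kerG z s - kerT z s) <= B.
  move=> hz; have [m hm] := per_reduce (re z - s).
  pose z' := z + (2 * pi * m%:~R)%:C.
  have hz' : strip e1 z' by rewrite /strip /z' imD imC addr0.
  have hr : `|re (z' - s%:C)| <= pi by rewrite /z' reB reD !reC addrAC.
  have := key z' s hz' hr.
  by rewrite /kerA /kerG /kerT /kap /z' (per_int pG) (per_int pG') (per_int (@ez_per R)).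
exists e1, B, N; split => //; split => //.
  by move=> z s /(key2 z s) [].
by move=> z s /(key2 z s) [].
Qed.

End KernelBounds.

(** * Integrals against the kernels *)

Section KernelIntegrals.
Context {R : realType}.
Local Notation C := R[i].
Local Notation mu := (@lebesgue_measure R).
Implicit Types (z w a : C) (t s : R) (u : R -> C).
Local Notation I0 := (@I0 R).
Local Notation finI0 := (@finI0 R).

(** Dominated convergence speaks of sequences; if the conclusion failed, a sequence of heights
    tending to 0 would witness it. *)
Lemma seq_to_eps (P : R -> Prop) (F : R -> C) (L : C) :
  (forall y_ : nat -> R, (forall n, P (y_ n)) -> y_ n @[n --> \oo] --> 0 -> ccvg (fun n => F (y_ n)) L) ->
  forall e : R, 0 < e -> exists2 r : R, 0 < r & forall y, P y -> `|y| < r -> cabs (F y - L) < e.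
Proof.
move=> H e e0; apply: contrapT => nr.
have ex n : exists y, [/\ P y, `|y| < n.+1%:R^-1 & e <= cabs (F y - L)].
  apply: contrapT => ny; apply: nr; exists n.+1%:R^-1; first by rewrite invr_gt0.
  move=> y Py yn; rewrite ltNge; apply/negP => h; apply: ny; by exists y.
have [y_ Hy] := choice ex.
have y0 : y_ n @[n --> \oo] --> 0.
  apply/cvgrPdist_lt => k k0; near=> n.
  rewrite sub0r normrN; have [_ h _] := Hy n; apply: lt_trans h _.
  near: n; exact: near_infty_natSinv_lt (PosNum k0).
have /cvgrPdist_lt/(_ _ e0) := H y_ (fun n => let: And3 h _ _ := Hy n in h) y0.
case=> n _ /(_ n (leqnn n)); have [_ _] := Hy n.
by rewrite /= sub0r normrN ger0_norm ?cabs_ge0// leNgt => /negP h /h.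
Unshelve. all: by end_near. Qed.

Lemma cabs_dist z w : `|cabs z - cabs w| <= cabs (z - w).
Proof.
have h1 := cabs_subr z w; have h2 := cabs_subr w z; rewrite [cabs (w - z)]cabsBC in h2.
by rewrite ler_norml; move: h1 h2; move: (cabs _) (cabs _) (cabs _) => a b c; lra.
Qed.

Lemma ez_fiber_countable t : countable [set s | ez s%:C = ez t%:C :> C].
Proof.
apply: (@sub_countable _ _ _ (range (fun m : int => t + 2 * pi * m%:~R))).
  apply: subset_card_le => s /= e; have [m em] := ez_eq_shift e; exists m => //.
  by have := f_equal (@complex.Re R) em; rewrite reD !reC => ->.
apply: sub_countable (card_image_le _ _) _; exact: countableP.
Qed.

Variables (G G' G'' : C -> C) (d e B N : R).
Hypotheses (hG : hol1 (strip d) G G') (hG' : hol1 (strip d) G' G'')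
  (pG : per G) (pG' : per G') (e0 : 0 < e) (ed : e < d) (N0 : 0 < N)
  (chord : forall z w, strip e z -> strip e w -> cabs (ez z - ez w) <= N * cabs (G z - G w))
  (bA : forall z s, strip e z -> cabs (kerA G G' z s) <= B)
  (bT : forall z s, strip e z -> cabs (kerG G G' z s - kerT G G' z s) <= B).

Let cG' z (hz : strip d z) : ccont G' z := (hG hz).2.

Lemma strip_sub z : strip e z -> strip d z.
Proof. by move=> h; exact: lt_trans h ed. Qed.

Lemma curve_rder s : rder (fun s => G s%:C) s (G' s%:C).
Proof.
have h : cder G (s +i* 0) (G' (s +i* 0)) by have [] := hG (strip_real s (lt_trans e0 ed)).
exact: rder_horiz h.
Qed.

Lemma curve_rcont' : rcont (fun s => G' s%:C).
Proof. by apply: (@rcont_horiz R G' 0) => t; apply: cG'; apply: (strip_real t (lt_trans e0 ed)). Qed.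

Lemma curve_rcont : rcont (fun s => G s%:C).
Proof. exact: rder_rcont curve_rder. Qed.

Lemma mcf_kerG z : mcf I0 (kerG G G' z).
Proof.
apply: mcfM; first exact: mcf_cst.
by apply: mcfV; apply: mcfB; [exact: mcf_cst|apply: mcf_rcont; exact: curve_rcont].
Qed.

Lemma mcf_kerT z : mcf I0 (kerT G G' z).
Proof.
apply: mcfM; first by apply: mcf_rcont; exact: curve_rcont'.
by apply: mcfV; apply: mcfB; [exact: mcf_cst|apply: mcf_rcont; exact: curve_rcont].
Qed.

Lemma cbm_kerA z : strip e z -> cbm I0 (kerA G G' z).
Proof.
move=> hz; split; last by exists B => s _; exact: bA.
by apply: mcfB; [exact: mcf_kerG|exact: mcf_kap].
Qed.

Lemma cbm_kerGT z : strip e z -> cbm I0 (fun s => kerG G G' z s - kerT G G' z s).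
Proof.
move=> hz; split; last by exists B => s _; exact: bT.
by apply: mcfB; [exact: mcf_kerG|exact: mcf_kerT].
Qed.

Lemma off_real z s : strip e z -> im z != 0 -> `|expR (- im z) - 1| <= N * cabs (G z - G s%:C).
Proof.
move=> hz iz; apply: le_trans (chord hz (strip_real s e0)).
by have := cabs_dist (ez z) (ez s%:C); rewrite cabs_ez cabs_ez_real.
Qed.

Lemma off_curve_strip z : strip e z -> im z != 0 -> off_curve (fun s => G s%:C) (G z).
Proof.
move=> hz iz; exists (`|expR (- im z) - 1| / N).
  rewrite divr_gt0// normr_gt0 subr_eq0; apply: contra iz => /eqP h.
  by rewrite -oppr_eq0 -[X in X == _]expRK h ln1.
by move=> s; rewrite ler_pdivrMr// mulrC; exact: off_real.
Qed.

Lemma off_curve_circle z : im z != 0 -> off_curve (fun s => ez s%:C) (ez z).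
Proof.
move=> iz; exists (`|expR (- im z) - 1|).
  rewrite normr_gt0 subr_eq0; apply: contra iz => /eqP h.
  by rewrite -oppr_eq0 -[X in X == _]expRK h ln1.
by move=> s; have := cabs_dist (ez z) (ez s%:C); rewrite cabs_ez cabs_ez_real.
Qed.

Lemma ker_ccont t s : ez s%:C != ez t%:C :> C ->
  [/\ ccont (kerG G G' ^~ s) t%:C, ccont (kerT G G' ^~ s) t%:C & ccont (kap ^~ s) t%:C].
Proof.
move=> ne; have st := strip_real t e0; have ss := strip_real s e0.
have ne1 : ez t%:C - ez s%:C != 0 :> C by rewrite subr_eq0 eq_sym.
have ne2 : G t%:C - G s%:C != 0.
  rewrite -cabs_gt0; have := chord st ss; rewrite -(ler_pdivrMl _ _ N0) => h.
  by apply: lt_le_trans h; rewrite mulr_gt0 ?invr_gt0// cabs_gt0.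
have cG : ccont G t%:C by have [h _] := hG (strip_sub st); exact: cder_ccont h.
have cI : ccont (fun z => (G z - G s%:C)^-1) t%:C.
  by apply: ccontV => //; apply: ccontB => //; exact: ccont_cst.
split.
- by apply: ccontM => //; apply: cG'; exact: strip_sub.
- by apply: ccontM => //; exact: ccont_cst.
- apply: ccontM; first by apply: ccontM; [exact: ccont_cst|exact: ccont_ez].
  by apply: ccontV => //; apply: ccontB; [exact: ccont_ez|exact: ccont_cst].
Qed.

Lemma vert_cvg t (y_ : nat -> R) : y_ n @[n --> \oo] --> 0 -> ccvg (fun n => t +i* y_ n) t%:C.
Proof.
move=> y0; apply/cvgrPdist_lt => k k0; have /cvgrPdist_lt/(_ _ k0) := y0; apply: filterS => n.
have -> : t +i* y_ n - t%:C = 'i * (y_ n)%:C by apply: complex_eq; rewrite !reimE /=; ring.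
by rewrite cabsM cabs_i mul1r cabs_real !sub0r !normrN normr_id.
Qed.

Lemma vert_limit u (k : C -> R -> C) (P : R -> Prop) t (M : R) : cbm I0 u ->
  (forall y, P y -> strip e (t +i* y)) -> (forall z, strip e z -> mcf I0 (k z)) ->
  (forall z s, strip e z -> cabs (k z s) <= M) ->
  (forall s, ez s%:C != ez t%:C :> C -> ccont (k ^~ s) t%:C) ->
  forall x : R, 0 < x -> exists2 r : R, 0 < r & forall y, P y -> `|y| < r ->
    cabs (cint I0 (fun s => u s * k (t +i* y) s) - cint I0 (fun s => u s * k t%:C s)) < x.
Proof.
move=> bu Ps mk bk ck x x0; apply: seq_to_eps x0 => y_ Py y0.
have [Mu HMu] := bu.2.
apply: (@cint_dct R I0 [set s | ez s%:C = ez t%:C :> C] _ _ (Mu * M)).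
- exact: finI0.
- exact: ez_fiber_countable.
- by move=> n; apply: mcfM; [exact: bu.1|apply: mk; exact: Ps].
- apply: cbmM => //; split; first by apply: mk; exact: strip_real.
  by exists M => s _; apply: bk; exact: strip_real.
- move=> n s Is; rewrite cabsM; apply: ler_pM; rewrite ?cabs_ge0//; first exact: HMu.
  by apply: bk; exact: Ps.
- move=> s Is ns; apply: ccvgM (ccvg_cst _) _.
  apply: (@ccvg_comp R (k ^~ s) (fun n => t +i* y_ n) t%:C); last exact: vert_cvg.
  by apply: ck; apply/eqP.
Qed.

(* The integral vanishes with [z] off the real line by [log_period_integral], and the kernel stays bounded as [z] tends to [t]. *)
Lemma circle_kernel_balance t : re (cint I0 (fun s => kap t%:C s - kerT G G' t%:C s)) = 0.
Proof.
pose k z s := kap z s - kerT G G' z s.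
have kE z s : k z s = (kerG G G' z s - kerT G G' z s) - kerA G G' z s.
  by rewrite /k /kerA; ring.
have bk z s : strip e z -> cabs (k z s) <= B + B.
  by move=> hz; rewrite kE; apply: le_trans (cabsB _ _) _; apply: lerD; [exact: bT|exact: bA].
have mk z : strip e z -> mcf I0 (k z) by move=> _; apply: mcfB; [exact: mcf_kap|exact: mcf_kerT].
have ck s : ez s%:C != ez t%:C :> C -> ccont (k ^~ s) t%:C.
  by move=> /ker_ccont [_ h1 h2]; exact: ccontB.
have k0 z : strip e z -> im z != 0 -> re (cint I0 (k z)) = 0.
  move=> hz iz.
  have o1 := off_curve_strip hz iz; have o2 := off_curve_circle iz.
  have per1 : G (2 * pi)%:C = G 0%:C by rewrite -(pG 0%:C) add0r.
  have L1 := log_period_integral curve_rder curve_rcont' per1 o1.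
  have dez s : rder (fun s => ez s%:C : C) s ('i * ez s%:C).
    by have := rder_ezX 1 s; rewrite mulr1.
  have cez : rcont (fun s : R => 'i * ez s%:C : C) by apply: rcontM (rcont_cst _) rcont_ez.
  have per2 : ez (2 * pi)%:C = ez 0%:C :> C by rewrite ez_2pi /ez mulr0 cexp0.
  have L2 := log_period_integral dez cez per2 o2.
  have c1 : cbm I0 (fun s => G' s%:C / (G z - G s%:C)).
    by have := cbm_cauchy 1 (cbm_cont _ _ curve_rcont') curve_rcont o1.
  have c2 : cbm I0 (fun s => 'i * ez s%:C / (ez z - ez s%:C)).
    by have := cbm_cauchy 1 (cbm_cont _ _ cez) rcont_ez o2.
  (* [kap] is rewritten with the derivative ['i * ez s] of [ez] in the numerator, so that
     [log_period_integral] applies; the constant ['i] has no real part. *)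
  have E s : k z s = 'i + 'i * ez s%:C / (ez z - ez s%:C) - G' s%:C / (G z - G s%:C).
    have [m m0 Hm] := o2.
    have nz : ez z - ez s%:C != 0 by rewrite -cabs_gt0 (lt_le_trans m0).
    by rewrite /k /kap /kerT; congr (_ - _); rewrite ?complexiE; field.
  have ci : cbm I0 (fun=> 'i : C) by exact: cbm_cst.
  rewrite (eq_cint (fun s _ => E s)) (cintB finI0 (cbmD ci c2) c1) (cintD finI0 ci c2).
  rewrite reB L1 reD L2 (cint_cst _ finI0) subr0 addr0 reM reC imC mulr0 subr0.
  by rewrite [X in X * _](_ : _ = 0) ?mul0r.
have lim (x : R) : 0 < x -> exists2 r : R, 0 < r & forall y, 0 < y < e -> `|y| < r ->
    cabs (cint I0 (fun s => 1 * k (t +i* y) s) - cint I0 (fun s => 1 * k t%:C s)) < x.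
  apply: (@vert_limit (fun=> 1) k (fun y => 0 < y < e) t (B + B)) => //; first exact: cbm_cst.
  by move=> y /andP[y1 y2]; rewrite /strip imCI gtr0_norm.
apply/eqP; rewrite -normr_le0; apply/ler_addgt0Pl => x x0; rewrite addr0.
have [r r0 Hr] := lim x x0.
pose y := Num.min (e / 2) (r / 2).
have y0 : 0 < y by rewrite lt_min !divr_gt0.
have ye : y < e by rewrite gt_min ltr_pdivrMr// ltr_pMr// ltr1n.
have yr : y < r by rewrite gt_min [X in _ || X]ltr_pdivrMr// ltr_pMr// ltr1n orbT.
have := Hr y; rewrite y0 ye gtr0_norm// => /(_ isT yr).
have one z : cint I0 (fun s => 1 * k z s) = cint I0 (k z) by apply: eq_cint => s _; rewrite mul1r.
rewrite !one => h; have := re_le_cabs (cint I0 (k (t +i* y)) - cint I0 (k t%:C)).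
have hz : strip e (t +i* y) by rewrite /strip imCI gtr0_norm.
rewrite reB k0//; last by rewrite imCI gt_eqF.
by rewrite sub0r normrN => h2; apply: le_trans h2 (ltW h).
Qed.

Definition kerA_int u z : C := cint I0 (fun s => u s * kerA G G' z s).

Lemma hol1_eq (D : set C) f g f' : (forall z, D z -> exists2 r : R, 0 < r & forall w, cabs (w - z) < r -> D w) ->
  (forall z, D z -> f z = g z) -> hol1 D f f' -> hol1 D g f'.
Proof.
move=> oD fg hf z Dz; have [r r0 Hr] := oD z Dz; have [h1 h2] := hf z Dz; split => //.
by apply: cder_local r0 _ h1 => w /Hr; exact: fg.
Qed.

Lemma kerA_int_hol u (D : set C) : cbm I0 u ->
  (forall z, D z -> exists2 r : R, 0 < r & forall w, cabs (w - z) < r -> D w) ->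
  (forall z, D z -> strip e z /\ im z != 0) -> exists g, hol1 D (kerA_int u) g.
Proof.
move=> bu oD HD.
have hGD : hol1 D G G' by apply: hol1_sub hG => z /HD [h _]; exact: strip_sub.
have h1 := hol1_comp hGD (cauchy_hol bu curve_rcont) (fun z Dz => off_curve_strip (HD z Dz).1 (HD z Dz).2).
have h2 := hol1_comp (@hol1_ez R D) (cauchy_hol bu (@rcont_ez R)) (fun z Dz => off_curve_circle (HD z Dz).2).
have hG'D : hol1 D G' G'' by apply: hol1_sub hG' => z /HD [h _]; exact: strip_sub.
have h := hol1D (hol1M hG'D h1) (hol1Z (-1) (hol1M (hol1Z 'i (@hol1_ez R D)) h2)).
eexists; apply: (hol1_eq oD _ h) => z Dz; have [hz iz] := HD z Dz.
have o1 := off_curve_strip hz iz; have o2 := off_curve_circle iz.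
have c1 : cbm I0 (fun s => u s / (G z - G s%:C)) by have := cbm_cauchy 1 bu curve_rcont o1.
have c2 : cbm I0 (fun s => u s / (ez z - ez s%:C)) by have := cbm_cauchy 1 bu (@rcont_ez R) o2.
have d1 : cbm I0 (fun s => G' z * (u s / (G z - G s%:C))) by apply: cbmM (cbm_cst _ _) c1.
have d2 : cbm I0 (fun s => 'i * ez z * (u s / (ez z - ez s%:C))) by apply: cbmM (cbm_cst _ _) c2.
rewrite mulN1r /cauchy_int -(cintZ _ finI0 c1) -(cintZ _ finI0 c2) -(cintB finI0 d1 d2) /kerA_int.
apply: eq_cint => s _; rewrite /kerA /kerG /kap.
by move: ((G z - G s%:C)^-1) ((ez z - ez s%:C)^-1) => x y; ring.
Qed.

(* Off the real line [kerA_int u] is a difference of two Cauchy integrals, hence holomorphic; it has the same boundary values from both sides. *)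
Lemma kerA_int_analytic u : cbm I0 u -> analytic_everywhere (fun t => re (kerA_int u t%:C)).
Proof.
move=> bu; have [M HM] := bu.2.
have pa : per (kerA_int u).
  move=> z; apply: eq_cint => s _; apply: f_equal.
  by rewrite /kerA /kerG /kap pG pG' ez_per.
have ba z : strip e z -> cabs (kerA_int u z) <= 2 * (M * B) * fine (mu I0).
  move=> hz; apply: cint_bound; [exact: finI0|exact: cbmM bu (cbm_kerA hz)|].
  move=> s Is; rewrite cabsM; apply: ler_pM; rewrite ?cabs_ge0//; first exact: HM.
  exact: bA.
have bs z : below e z -> strip e z /\ im z != 0.
  by move=> /andP[h1 h2]; rewrite lt_eqF// /strip ltr_norml h1 (lt_trans h2 e0).
have as_ z : above e z -> strip e z /\ im z != 0.
  by move=> /andP[h1 h2]; rewrite gt_eqF// /strip ltr_norml h2 (lt_trans _ h1) ?oppr_lt0.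
have ob z : below e z -> exists2 r : R, 0 < r & forall w, cabs (w - z) < r -> below e w.
  move=> /andP[h1 h2]; exists (Num.min (- im z) (im z + e)); first by rewrite lt_min; lra.
  move=> w; rewrite lt_min => /andP[h3 h4]; have := im_le_cabs (w - z).
  by rewrite imB ler_norml /below /=; move: h3 h4; lra.
have oa z : above e z -> exists2 r : R, 0 < r & forall w, cabs (w - z) < r -> above e w.
  move=> /andP[h1 h2]; exists (Num.min (im z) (e - im z)); first by rewrite lt_min; lra.
  move=> w; rewrite lt_min => /andP[h3 h4]; have := im_le_cabs (w - z).
  by rewrite imB ler_norml /above /=; move: h3 h4; lra.
have [g1 hg1] := kerA_int_hol bu ob bs.
have [g2 hg2] := kerA_int_hol bu oa as_.
have lim (P : R -> Prop) t : (forall y, P y -> strip e (t +i* y)) ->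
    forall x : R, 0 < x -> exists2 r : R, 0 < r & forall y, P y -> `|y| < r ->
    cabs (kerA_int u (t +i* y) - kerA_int u t%:C) < x.
  move=> Ps; apply: (@vert_limit u (kerA G G') P t B bu Ps).
  - by move=> z hz; have [] := cbm_kerA hz.
  - exact: bA.
  - by move=> s /ker_ccont [h1 _ h3]; exact: ccontB.
have [] := @boundary_analytic R (kerA_int u) g1 (kerA_int u) g2 (fun t => kerA_int u t%:C) e
  (2 * (M * B) * fine (mu I0)) e0 hg1 pa _ _ hg2 pa _ _ _.
- by move=> z /bs [h _]; exact: ba.
- move=> t x x0; have [|r r0 H] := lim (fun y => - e < y < 0) t _ x x0.
    by move=> y hy; apply: (bs (t +i* y) _).1.
  exists (Num.min r e); first by rewrite lt_min r0.
  move=> y /andP[y1 y2]; apply: H.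
    by rewrite y2 andbT; apply: le_lt_trans y1; rewrite lerN2 ge_min lexx orbT.
  by rewrite ltr0_norm// ltrNl; apply: le_lt_trans y1; rewrite lerN2 ge_min lexx.
- by move=> z /as_ [h _]; exact: ba.
- move=> t x x0; have [|r r0 H] := lim (fun y => 0 < y < e) t _ x x0.
    by move=> y hy; apply: (as_ (t +i* y) _).1.
  exists (Num.min r e); first by rewrite lt_min r0.
  move=> y /andP[y1]; rewrite lt_min => /andP[y2 y3]; apply: H; first by rewrite y1.
  by rewrite gtr0_norm.
(* The restriction to the line is measurable as a pointwise limit of the continuous restrictions to
   heights above it. *)
- split; last by exists (2 * (M * B) * fine (mu I0)) => s _; apply: ba; exact: strip_real.
  pose y_ (n : nat) : R := e / n.+2%:R.
  have yn n : 0 < y_ n < e by rewrite /y_ divr_gt0//= ltr_pdivrMr// ltr_pMr// ltr1n.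
  have y0 : y_ n @[n --> \oo] --> 0.
    rewrite (_ : 0 = e * 0); last by rewrite mulr0.
    apply: cvgM; first exact: cvg_cst.
    by rewrite (cvg_shiftS (fun n : nat => (n.+1%:R : R)^-1)); exact: cvg_harmonic.
  have cv t : ccvg (fun n => kerA_int u (t +i* y_ n)) (kerA_int u t%:C).
    apply/cvgrPdist_lt => x x0.
    have [|r r0 H] := lim (fun y => 0 < y < e) t _ x x0.
      by move=> y hy; apply: (as_ (t +i* y) _).1.
    have /cvgrPdist_lt/(_ _ r0) := y0; apply: filterS => n; rewrite sub0r normrN => h.
    by rewrite sub0r normrN ger0_norm ?cabs_ge0//; apply: H.
  have cn n : rcont (fun t => kerA_int u (t +i* y_ n)).
    apply: rcont_horiz => t; have [h _] := hg2 (t +i* y_ n) (yn n); exact: cder_ccont h.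
  have mn n := mcf_rcont (cn n).
  split.
    apply: (@measurable_fun_cvg _ _ R I0 (fun n t => re (kerA_int u (t +i* y_ n)))).
      by move=> n; exact: (mn n).1.
    by move=> t _; have [h _] := (ccvgP _ _).1 (cv t).
  apply: (@measurable_fun_cvg _ _ R I0 (fun n t => im (kerA_int u (t +i* y_ n)))).
    by move=> n; exact: (mn n).2.
  by move=> t _; have [_ h] := (ccvgP _ _).1 (cv t).
by move=> h _.
Qed.

End KernelIntegrals.

(** * Principal values *)

Section Cutoff.
Context {R : realType}.
Local Notation C := R[i].
Local Notation mu := (@lebesgue_measure R).
Implicit Types (t s : R).
Local Notation I0 := (@I0 R).
Local Notation finI0 := (@finI0 R).

Variables (w : C) (g dg : R -> C) (eps : R).
Hypotheses (e0 : 0 < eps) (hg : forall s, rder g s (dg s)) (cdg : rcont dg) (g2pi : g (2 * pi) = g 0).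

Let ratio s : R := sqdist w g s / eps ^+ 2.

(* A smooth cutoff for which [soft_cut n s * re (dg s / (w - g s))] is, up to a constant, the derivative of [ln (n.+1%:R^-1 + ratio s ^+ n.+1)]. *)
Definition soft_cut n s : R := ratio s ^+ n.+1 / (n.+1%:R^-1 + ratio s ^+ n.+1).

Definition sharp_cut s : R := if eps <= cabs (w - g s) then 1 else 0.

Let ratio_ge0 s : 0 <= ratio s.
Proof. by rewrite divr_ge0// exprn_ge0// ?cabs_ge0// ltW. Qed.

Let den_gt0 n s : 0 < n.+1%:R^-1 + ratio s ^+ n.+1.
Proof. by rewrite ltr_pwDl ?invr_gt0// exprn_ge0. Qed.

Lemma soft_cut_bound n s : 0 <= soft_cut n s <= 1.
Proof.
rewrite divr_ge0 ?exprn_ge0//= ?(ltW (den_gt0 _ _))//.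
by rewrite ler_pdivrMr// mul1r lerDr invr_ge0.
Qed.

(** At [ratio s = 1] the limit must be 1 to match the closed condition in [sharp_cut]; the summand
    [n.+1%:R^-1], which tends to 0, achieves this where a constant 1 would give [1 / 2]. *)
Lemma soft_cut_cvg s : soft_cut n s @[n --> \oo] --> sharp_cut s.
Proof.
have r2 : ratio s = (cabs (w - g s) / eps) ^+ 2 by rewrite /ratio /sqdist expr_div_n.
rewrite /sharp_cut; have [h|h] := leP eps (cabs (w - g s)).
  have r1 : 1 <= ratio s by rewrite r2 exprn_ege1// ler_pdivlMr// mul1r.
  apply: (@squeeze_cvgr _ _ _ _ (fun n => 1 - n.+1%:R^-1) (fun=> 1)).
  - apply: nearW => n; have /andP[_ ->] := soft_cut_bound n s; rewrite andbT.
    have p1 : 1 <= ratio s ^+ n.+1 by rewrite exprn_ege1.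
    rewrite lerBlDr -lerBlDl.
    have -> : 1 - soft_cut n s = n.+1%:R^-1 / (n.+1%:R^-1 + ratio s ^+ n.+1).
      by rewrite /soft_cut -{1}(divff (lt0r_neq0 (den_gt0 n s))) -mulrBl addrK.
    rewrite ler_pdivrMr// ler_peMr ?invr_ge0//.
    by rewrite (le_trans p1)// lerDr invr_ge0.
  - rewrite -[X in _ --> X]subr0; apply: cvgB; [exact: cvg_cst|exact: cvg_harmonic].
  - exact: cvg_cst.
have r1 : ratio s < 1.
  by rewrite r2 exprn_ilt1// ?divr_ge0 ?cabs_ge0 ?(ltW e0)// ltr_pdivrMr// mul1r.
pose y := (1 + ratio s) / 2.
have ry : 0 <= ratio s < y by rewrite ratio_ge0 /y; lra.
have y01 : `|y| < 1 by rewrite ger0_norm /y; have := ratio_ge0 s; lra.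
pose K := y / (y - ratio s).
apply: (@squeeze_cvgr _ _ _ _ (fun=> 0) (fun n => K * y ^+ n.+1)).
- apply: nearW => n; have /andP[-> _] /= := soft_cut_bound n s.
  apply: le_trans (natr_geo ry n.+1).
  rewrite /soft_cut ler_pdivrMr// [leRHS]mulrC mulrA.
  rewrite -[leLHS]mul1r ler_wpM2r ?exprn_ge0//.
  rewrite mulrDl mulVf ?pnatr_eq0// lerDl mulr_ge0// exprn_ge0//.
- exact: cvg_cst.
- rewrite -[X in _ --> X](mulr0 K); apply: cvgM; first exact: cvg_cst.
  rewrite (cvg_shiftS (fun n : nat => y ^+ n)); exact: cvg_expr.
Qed.

Let ratio_cont : continuous ratio.
Proof.
move=> s; apply: cvgM; last exact: cvg_cst.
exact: is_derive_cont (sqdist_deriv w (hg s)).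
Qed.

Lemma contX (f : R -> R) n : continuous f -> continuous (fun s => f s ^+ n).
Proof.
move=> cf s; elim: n => [|n IH]; first by under eq_fun do rewrite expr0; exact: cvg_cst.
by under eq_fun do rewrite exprS; apply: cvgM; [exact: cf|exact: IH].
Qed.

Lemma soft_cut_cont n : continuous (soft_cut n).
Proof.
move=> s; apply: cvgM; first exact: contX.
apply: cvgV; first exact: lt0r_neq0.
by apply: cvgD; [exact: cvg_cst|exact: contX].
Qed.

Lemma cont_measurable (f : R -> R) : continuous f -> measurable_fun I0 f.
Proof.
by move=> cf; apply: measurable_funTS; exact: continuous_measurable_fun.
Qed.

Lemma sharp_cut_bmf : bmf I0 sharp_cut.
Proof.
split; last by exists 1 => s _; rewrite /sharp_cut; case: ifP => _; rewrite ?normr1 ?normr0.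
apply: (@measurable_fun_cvg _ _ R I0 soft_cut).
  by move=> n; apply: cont_measurable; exact: soft_cut_cont.
by move=> s _; exact: soft_cut_cvg.
Qed.

Let q s : R := re (dg s / (w - g s)).

Lemma kernel_measurable (u : R -> C) : rcont u -> measurable_fun I0 (fun s => re (u s / (w - g s))).
Proof.
move=> cu; have [h _] : mcf I0 (fun s => u s / (w - g s)).
  apply: mcfM; first exact: mcf_rcont.
  by apply: mcfV; apply: mcfB; [exact: mcf_cst|apply: mcf_rcont; exact: rder_rcont hg].
exact: h.
Qed.

(** Uniform in [n], for dominated convergence: the cutoff is at most [2 * |w - g s| / eps], which
    cancels the singularity of the kernel. *)
Lemma soft_cut_kernel_bound (D : R) n s : cabs (dg s) <= D -> `|soft_cut n s * q s| <= 2 * D / eps.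
Proof.
move=> hD; have D0 : 0 <= D by exact: le_trans (cabs_ge0 _) hD.
pose y := cabs (w - g s) / eps.
have y0 : 0 <= y by rewrite divr_ge0 ?cabs_ge0// ltW.
have ry : ratio s = y ^+ 2 by rewrite /ratio /sqdist expr_div_n.
have key : soft_cut n s <= 2 * y.
  have [y1|y1] := leP 2^-1 y.
    by have /andP[_ h] := soft_cut_bound n s; apply: le_trans h _; move: y1; lra.
  (* For [y] below [1 / 2], the power of exponent [2 * n + 1] is at most [1 / 2 ^ (n + 1)], hence at
     most the summand [n.+1%:R^-1] of the denominator. *)
  rewrite /soft_cut ler_pdivrMr// ry -exprM.
  have -> : y ^+ (2 * n.+1) = y * y ^+ (n + n).+1.
    by rewrite -exprS; congr (_ ^+ _); rewrite mul2n -addnn addnS addSn.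
  have h1 : y ^+ (n + n).+1 <= (2^-1) ^+ n.+1.
    apply: (@le_trans _ _ (y ^+ n.+1)); last by apply: lerXn2r; rewrite ?nnegrE ?invr_ge0// ltW.
    apply: ler_wiXn2l => //; first by apply: le_trans (ltW y1) _; rewrite invf_le1// ler1n.
    by rewrite ltnS leq_addr.
  have h2 : (2^-1 : R) ^+ n.+1 <= n.+1%:R^-1.
    by rewrite exprVn lef_pV2 ?posrE ?exprn_gt0// -natrX ler_nat ltnW// ltn_expl.
  have := le_trans h1 h2.
  have : 0 <= y ^+ (n + n).+1 by rewrite exprn_ge0.
  have : 0 < (n.+1%:R : R)^-1 by rewrite invr_gt0.
  have alg (x a b : R) : 0 <= x -> x < 2^-1 -> 0 < a -> 0 <= b -> b <= a -> x * b <= 2 * x * (a + x * b).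
    by move=> *; nra.
  by move=> *; apply: alg.
have [/eqP yz|yn] := eqVneq (w - g s) 0.
  rewrite /q; move/eqP: yz => ->; rewrite invr0 mulr0 mulr0 normr0 !mulr_ge0// invr_ge0; exact: ltW.
have y1 : 0 < cabs (w - g s) by rewrite cabs_gt0.
have /andP[s0 _] := soft_cut_bound n s.
rewrite normrM (ger0_norm s0); apply: (@le_trans _ _ (2 * y * (D / cabs (w - g s)))).
  apply: ler_pM => //; apply: le_trans (re_le_cabs _) _.
  by rewrite cabsM cabsV ler_wpM2r// invr_ge0 ltW.
rewrite /y le_eqVlt; apply/orP; left; apply/eqP; field.
by rewrite gt_eqF//= gt_eqF.
Qed.

Lemma soft_cut_integral n : \int[mu]_(s in I0) (soft_cut n s * q s) = 0.
Proof.
pose P s := re (w - g s) * re (dg s) + im (w - g s) * im (dg s).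
pose L s := ln (n.+1%:R^-1 + ratio s ^+ n.+1).
pose dL s : R := (n.+1%:R^-1 + ratio s ^+ n.+1)^-1 * (n.+1%:R * ratio s ^+ n * (- 2 * P s * (eps ^+ 2)^-1)).
have en : eps ^+ 2 != 0 by rewrite expf_neq0// gt_eqF.
have hL s : is_derive s (1 : R) L (dL s).
  have h1 : is_derive s (1 : R) ratio (- 2 * P s * (eps ^+ 2)^-1).
    have := is_deriveM (sqdist_deriv w (hg s)) (is_derive_cst ((eps ^+ 2)^-1) s (1 : R)).
    move=> h; apply: (is_derive_eq h).
    by rewrite scaler0 add0r /cst /= -![_ *: _]/(_ * _) mulrC.
  have h2 := is_deriveD (is_derive_cst (n.+1%:R^-1 : R) s (1 : R)) (is_deriveX n.+1 h1).
  have fE : (cst (n.+1%:R^-1 : R) + ratio ^+ n.+1) = (fun s => n.+1%:R^-1 + ratio s ^+ n.+1).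
    by apply/funext => x; rewrite fctE exprfctE.
  rewrite fE in h2.
  pose den s := n.+1%:R^-1 + ratio s ^+ n.+1.
  have h3 := @is_derive1_comp R (@ln R) den s _ _ (is_derive1_ln (den_gt0 n s : 0 < den s)) h2.
  rewrite /L; apply: (is_derive_eq h3); rewrite /dL add0r -![_ *: _]/(_ * _) mulrC.
  by rewrite -mulr_natl.
have cP : continuous P.
  have [c1 c2] := rder_rcont hg; have [c3 c4] := cdg.
  move=> s; rewrite /P; under eq_fun do rewrite reB imB.
  by apply: cvgD; apply: cvgM; [apply: cvgB; [exact: cvg_cst|]|..]; [exact: c1|exact: c3|apply: cvgB; [exact: cvg_cst|exact: c2]|exact: c4].
have cdL : continuous dL.
  move=> s; apply: cvgM.
    apply: cvgV; first exact: lt0r_neq0.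
    by apply: cvgD; [exact: cvg_cst|exact: contX].
  apply: cvgM; first by apply: cvgM; [exact: cvg_cst|exact: contX].
  by apply: cvgM; last exact: cvg_cst; apply: cvgM; [exact: cvg_cst|exact: cP].
have F := cint_FTC pi2_ge0 (fun s => rder_realC (hL s)) (rcont_realC cdL).
have := f_equal (@complex.Re R) F; rewrite /realC /L /ratio /sqdist g2pi subrr re_cint.
(* The constant relating [dL] to the cut kernel, from the exponent [n.+1] and the factor [- 2] in
   [sqdist_deriv_re]. *)
pose k : R := - 2 * n.+1%:R.
have kn : k != 0 by rewrite mulf_neq0// ?oppr_eq0 pnatr_eq0.
have dE s : soft_cut n s * q s = k^-1 * dL s.
  apply: (mulfI kn); rewrite mulVKf//.
  have [z0|zn] := eqVneq (w - g s) 0.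
    by rewrite /dL /q /P z0 invr0 mulr0 !mul0r addr0 !(mulr0, mul0r).
  have := sqdist_deriv_re dg zn; rewrite -/(P s) -/(q s) => E.
  have ln0 : sqdist w g s != 0 by rewrite expf_neq0// cabs_eq0.
  have -> : dL s = n.+1%:R * soft_cut n s * (- 2 * P s / sqdist w g s).
    rewrite /dL /soft_cut.
    have := lt0r_neq0 (den_gt0 n s); move: (n.+1%:R^-1 + _) => D Dn.
    have alg (M a l x p : R) : l != 0 -> x != 0 ->
        D^-1 * (M * a * (- 2 * p / x)) = M * (l / x * a / D) * (- 2 * p / l).
      by move=> l0 x0; field; rewrite Dn l0 x0.
    rewrite (exprS (ratio s)); exact: alg.
  by rewrite E /k; ring.
have -> : \int[mu]_(x in `[0, 2 * pi]) re (dL x)%:C = k * \int[mu]_(s in I0) (soft_cut n s * q s).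
  have E : \int[mu]_(x in `[0, 2 * pi]) re (dL x)%:C = re (cint I0 (fun s => k%:C * (soft_cut n s * q s)%:C)).
    rewrite re_cint; apply: eq_Rintegral => s _; rewrite -rmorphM reC dE mulVKf//.
  have b : cbm I0 (realC (fun s => soft_cut n s * q s)).
    apply: cbm_cont; rewrite (_ : (fun _ => _) = (fun s => k^-1 * dL s)); last by apply/funext => s; exact: dE.
    by apply: rcont_realC => s; apply: cvgM; [exact: cvg_cst|exact: cdL].
  rewrite E (cintZ _ finI0 b) reM imC mul0r subr0 reC re_cint; apply: f_equal.
  exact.
by move=> /eqP; rewrite mulf_eq0 (negPf kn) => /eqP.
Qed.

Lemma sharp_cut_kernel_bmf (u : R -> C) : rcont u -> bmf I0 (fun s => sharp_cut s * re (u s / (w - g s))).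
Proof.
move=> cu; have kern_meas := kernel_measurable cu; have [m1 _] := sharp_cut_bmf.
split; first exact: measurable_funM.
have [_ [D HD]] : cbm I0 u by exact: cbm_cont.
exists (D / eps) => s Is; have D0 : 0 <= D by exact: le_trans (cabs_ge0 _) (HD s Is).
rewrite /sharp_cut; case: ifP => h; last by rewrite mul0r normr0 divr_ge0// ltW.
rewrite mul1r; apply: le_trans (re_le_cabs _) _; rewrite cabsM cabsV.
apply: ler_pM; rewrite ?invr_ge0 ?cabs_ge0//; first exact: HD.
by rewrite lef_pV2 ?posrE// (lt_le_trans e0).
Qed.

(** Exact for every radius, so a multiple of this kernel can be subtracted from a truncated integral
    at no cost before the radius tends to 0. *)
Lemma sharp_cut_integral : \int[mu]_(s in I0) (sharp_cut s * q s) = 0.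
Proof.
have [_ [D HD]] : cbm I0 dg by exact: cbm_cont.
have := @Rint_dct R I0 set0 (fun n s => soft_cut n s * q s) (fun s => sharp_cut s * q s) (2 * D / eps) finI0
  (@countable0 _) _ (sharp_cut_kernel_bmf cdg) _ _.
move=> H; have {}H : \int[mu]_(s in I0) (soft_cut n s * q s) @[n --> \oo] --> \int[mu]_(s in I0) (sharp_cut s * q s).
  apply: H.
  - move=> n; apply: measurable_funM; last exact: kernel_measurable.
    by apply: cont_measurable; exact: soft_cut_cont.
  - by move=> n s Is; apply: soft_cut_kernel_bound; exact: HD.
  - by move=> s _ _; apply: cvgM; [exact: soft_cut_cvg|exact: cvg_cst].
have E : (fun n => \int[mu]_(s in I0) (soft_cut n s * q s)) = (fun=> 0) by apply/funext => n; exact: soft_cut_integral.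
by apply: (cvg_unique _ H) => //; rewrite E; exact: cvg_cst.
Qed.

End Cutoff.

(** * Limit of the truncated integrals *)

Section PrincipalValue.
Context {R : realType}.
Local Notation C := R[i].
Local Notation mu := (@lebesgue_measure R).
Implicit Types (z w a : C) (t s : R) (h dh : R -> R).
Local Notation I0 := (@I0 R).
Local Notation finI0 := (@finI0 R).

Variables (G G' G'' : C -> C) (d e B N : R).
Hypotheses (hG : hol1 (strip d) G G') (hG' : hol1 (strip d) G' G'')
  (pG : per G) (pG' : per G') (e0 : 0 < e) (ed : e < d) (N0 : 0 < N)
  (chord : forall z w, strip e z -> strip e w -> cabs (ez z - ez w) <= N * cabs (G z - G w))
  (bA : forall z s, strip e z -> cabs (kerA G G' z s) <= B)
  (bT : forall z s, strip e z -> cabs (kerG G G' z s - kerT G G' z s) <= B).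

Let crv s := G s%:C.

Lemma re_realM (x : R) z : re (x%:C * z) = x * re z.
Proof. by rewrite reM imC mul0r subr0. Qed.

(** The integrand is [re (X s)] plus a multiple of [re (T s)]: the latter integrates to 0 under
    every truncation, and [X] is bounded, so its truncated integrals tend to the full one. *)
Lemma pv_limit h dh t : C1per h dh ->
  \int[mu]_(s in I0) (sharp_cut (crv t) crv eps s * (h s * re (kerG G G' t%:C s))) @[eps --> 0^'+] -->
  pi * circle_transform h t + re (kerA_int G G' (realC h) t%:C).
Proof.
move=> Hh; have st := strip_real t e0.
have hrd := curve_rder hG e0 ed.
have crc' := curve_rcont' hG e0 ed.
have crc := curve_rcont hG e0 ed.
have bAt := cbm_kerA hG e0 ed bA st.
have bTt := cbm_kerGT hG e0 ed bT st.
have bh := C1per_cbm Hh.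
have bk := C1per_cbm_kap t Hh.
pose K s := kerG G G' t%:C s; pose A s := kerA G G' t%:C s; pose T s := kerT G G' t%:C s.
(* The last bracket equals [kap - T], whose integral has real part 0 by [circle_kernel_balance]; the
   first two terms give the transform on the circle and the correction by [kerA]. *)
pose X s := (realC h s - realC h t) * kap t%:C s + realC h s * A s + (h t)%:C * (K s - T s - A s).
have bX1 : cbm I0 (fun s => (realC h s - realC h t) * kap t%:C s + realC h s * A s).
  by apply: cbmD => //; exact: cbmM.
have bX2 : cbm I0 (fun s => K s - T s - A s) by exact: cbmB.
have bX3 : cbm I0 (fun s => (h t)%:C * (K s - T s - A s)) by apply: cbmM (cbm_cst _ _) bX2.
have bX : cbm I0 X by exact: cbmD.
have XE s : h s * re (K s) = re (X s) + h t * re (T s).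
  rewrite -!re_realM -reD; apply: f_equal; rewrite /X /realC /A /kerA -/(K s).
  by move: (kap _ _) (K s) (T s) => x y z; ring.
have intX : re (cint I0 X) = pi * circle_transform h t + re (kerA_int G G' (realC h) t%:C).
  rewrite /X (cintD finI0 bX1 bX3) (cintD finI0 bk) ?(cintZ _ finI0 bX2); last exact: cbmM.
  rewrite reD reD (cint_kap_C1 t Hh) reCI re_realM.
  have -> : cint I0 (fun s => K s - T s - A s) = cint I0 (fun s => kap t%:C s - kerT G G' t%:C s).
    by apply: eq_cint => s _; rewrite /A /kerA -/(K s) /T; ring.
  by rewrite (circle_kernel_balance hG pG e0 ed N0 chord bA bT) mulr0 addr0.
have cutE (eps : R) : 0 < eps -> \int[mu]_(s in I0) (sharp_cut (crv t) crv eps s * (h s * re (K s))) =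
    \int[mu]_(s in I0) (sharp_cut (crv t) crv eps s * re (X s)).
  move=> eps0.
  have g2 : crv (2 * pi) = crv 0 by rewrite /crv -(pG 0%:C) add0r.
  have bc := sharp_cut_bmf (crv t) eps0 hrd.
  have b1 : bmf I0 (fun s => sharp_cut (crv t) crv eps s * re (X s)).
    by apply: bmfM => //; have [] := cbm_bmf bX.
  have b2 := sharp_cut_kernel_bmf (crv t) eps0 hrd crc'.
  have b3 : bmf I0 (fun s => h t * (sharp_cut (crv t) crv eps s * re (T s))).
    by apply: bmfM b2; apply: bmf_cst; exact: (finI0.1).
  have -> : (fun s => sharp_cut (crv t) crv eps s * (h s * re (K s))) =
      (fun s => sharp_cut (crv t) crv eps s * re (X s) + h t * (sharp_cut (crv t) crv eps s * re (T s))).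
    by apply/funext => s; rewrite XE; ring.
  rewrite RintegralD; [|exact: (finI0.1)|exact: (bmf_integrable finI0 b1)|exact: (bmf_integrable finI0 b3)].
  rewrite RintegralZl; [|exact: (finI0.1)|exact: (bmf_integrable finI0 b2)].
  by rewrite (sharp_cut_integral (crv t) eps0 hrd crc' g2) mulr0 addr0.
rewrite -intX; apply/cvg_at_rightP => u [u0 uc].
under eq_fun => n do rewrite cutE//.
rewrite re_cint.
have [rX _] := cbm_bmf bX; have [M HM] := rX.2.
apply: (@Rint_dct R I0 [set s | ez s%:C = ez t%:C :> C] _ _ M).
- exact: finI0.
- exact: ez_fiber_countable.
- move=> n; have [m1 _] := sharp_cut_bmf (crv t) (u0 n) hrd.
  by apply: measurable_funM => //; exact: rX.1.
- exact: rX.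
- move=> n s Is; rewrite normrM -[M]mul1r; apply: ler_pM => //; last exact: HM.
  by rewrite /sharp_cut; case: ifP; rewrite ?normr1 ?normr0.
(* Off the exceptional fibre the chord is positive, so the cutoff is 1 as soon as the radius is
   smaller. *)
- move=> s Is ns.
  have p0 : 0 < cabs (crv t - crv s).
    have ne : 0 < cabs (ez t%:C - ez s%:C : C) by rewrite cabs_gt0 subr_eq0; apply/eqP => q; exact: ns.
    have := chord st (strip_real s e0); rewrite -(ler_pdivrMl _ _ N0); apply: lt_le_trans.
    by rewrite mulr_gt0// invr_gt0.
  apply: cvg_near_cst; have /cvgrPdist_lt/(_ _ p0) := uc; apply: filterS => n.
  rewrite sub0r normrN gtr0_norm// => h1.
  by rewrite /sharp_cut (ltW h1) mul1r.
Qed.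

End PrincipalValue.

(** * The two sides of the curve *)

Section PlaneTopology.
Context {R : realType}.
Local Notation C := R[i].
Implicit Types (p q : R * R) (z w : C) (A : set (R * R)).

Definition toC p : C := p.1 +i* p.2.
Definition toP z : R * R := (re z, im z).

Lemma toPK z : toC (toP z) = z.
Proof. exact: complex_eta. Qed.

Lemma toCK p : toP (toC p) = p.
Proof. by case: p. Qed.

Lemma toCD p q : toC (p + q) = toC p + toC q.
Proof. exact: complex_eq. Qed.

Lemma toCB p q : toC (p - q) = toC p - toC q.
Proof. exact: complex_eq. Qed.

Lemma toCZ (k : R) p : toC (k *: p) = k%:C * toC p.
Proof. by apply: complex_eq; rewrite !reimE /= ?mul0r ?subr0 ?addr0. Qed.

Lemma enormE p : enorm p = cabs (toC p).
Proof. by rewrite /enorm /dot -!expr2. Qed.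

Lemma dotE p q : dot p q = re (toC p * conjc (toC q)).
Proof. by rewrite reM re_conj im_conj /dot /toC !(reCI, imCI); ring. Qed.

Lemma toC_nbhs p (P : R * R -> Prop) :
  (\forall q \near p, P q) <-> exists2 r : R, 0 < r & forall q, cabs (toC q - toC p) < r -> P q.
Proof.
split.
  case/nbhs_ballP => r /= r0 H; exists r => // q qr; apply: H; split; rewrite /= /ball /= distrC.
    by apply: le_lt_trans qr; have := re_le_cabs (toC q - toC p); rewrite reB.
  by apply: le_lt_trans qr; have := im_le_cabs (toC q - toC p); rewrite imB.
move=> [r r0 H]; apply/nbhs_ballP; exists (r / 2); first by rewrite /= divr_gt0.
move=> q [] /=; rewrite /ball /= => h1 h2; apply: H; apply: le_lt_trans (cabs_le _) _.
rewrite reB imB /toC !(reCI, imCI) distrC [`|q.2 - _|]distrC [ltRHS]splitr.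
exact: ltrD.
Qed.

Lemma toC_open A : (forall p, A p -> exists2 r : R, 0 < r & forall q, cabs (toC q - toC p) < r -> A q) -> open A.
Proof. by move=> H; rewrite openE => p Ap; apply/toC_nbhs; exact: H. Qed.

Lemma open_toC A p : open A -> A p -> exists2 r : R, 0 < r & forall q, cabs (toC q - toC p) < r -> A q.
Proof. by rewrite openE => oA Ap; apply/toC_nbhs; exact: oA. Qed.

Lemma closure_toC A p : closure A p -> forall r : R, 0 < r -> exists2 q, A q & cabs (toC q - toC p) < r.
Proof.
move=> cA r r0; have [|q [Aq Bq]] := cA [set q | cabs (toC q - toC p) < r].
  by apply/toC_nbhs; exists r.
by exists q.
Qed.

Lemma boundary_open A : open A -> boundary A = closure A `\` A.
Proof. by move=> oA; rewrite /boundary (interior_id _).1. Qed.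

Lemma line_path_cont (G G' : C -> C) (D : set C) z w (x : R) : hol1 D G G' -> D (z + x%:C * (w - z)) ->
  {for x, continuous (fun x : R => toP (G (z + x%:C * (w - z))))}.
Proof.
move=> hG /hG [h _]; have [c1 c2] := continuous_lineC z (w - z) x.
have [h1 h2] := ccont_comp_cont c1 c2 (cder_ccont h).
exact: (cvg_pair h1 h2).
Qed.

Lemma segment_image_connected (G G' : C -> C) (D : set C) z w : hol1 D G G' ->
  (forall x : R, 0 <= x <= 1 -> D (z + x%:C * (w - z))) ->
  connected [set toP (G (z + x%:C * (w - z))) | x in `[0, 1]].
Proof.
move=> hG HD; apply: connected_continuous_connected; first exact: segment_connected.
apply: continuous_in_subspaceT => x; rewrite inE /= in_itv /= => x01.
exact: (line_path_cont hG (HD x x01)).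
Qed.

(** The image of the segment is connected and misses the boundary, so its intersection with [O] is
    both open and closed in it. *)
Lemma segment_side (O : set (R * R)) (G G' : C -> C) (D : set C) z w : open O -> hol1 D G G' ->
  (forall x : R, 0 <= x <= 1 -> D (z + x%:C * (w - z))) ->
  (forall v, D v -> ~ boundary O (toP (G v))) -> O (toP (G z)) -> O (toP (G w)).
Proof.
move=> oO hG HD nb Oz; have cA := segment_image_connected hG HD.
set A := [set _ | _ in _] in cA.
have AD p : A p -> ~ boundary O p.
  by move=> [x]; rewrite /= in_itv /= => x01 <-; apply: nb; exact: HD.
have A0 : A (toP (G z)).
  by exists 0; rewrite /= ?in_itv /= ?lexx ?ler01// mul0r addr0.
have A1 : A (toP (G w)).
  by exists 1; rewrite /= ?in_itv /= ?lexx ?ler01// mul1r addrC subrK.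
have E : A `&` O = A.
  apply: cA.
  - by exists (toP (G z)).
  - by exists O.
  - exists (closure O); first exact: closed_closure.
    apply/seteqP; split => p [Ap Op]; split => //; first exact: subset_closure.
    apply: contrapT => nO; apply: (AD p Ap); rewrite boundary_open//.
by rewrite -E in A1; case: A1.
Qed.

Lemma path_connected_connected A : path_connected A -> connected A.
Proof.
move=> pA; have [[p0 Ap0]|/set0P/negP/negPn/eqP ->] := pselect (A !=set0); last exact: connected0.
pose I := [set c : R -> R * R | path_in A c /\ c 0 = p0].
have -> : A = \bigcup_(c in I) [set c x | x in `[0, 1]].
  apply/seteqP; split => [p Ap|p [c [[_ hc] _]] [x x01 <-]]; last exact: hc.
  have [c [h1 h2 h3]] := pA _ _ Ap0 Ap.
  by exists c => //; exists 1 => //; rewrite /= in_itv /= lexx ler01.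
apply: bigcup_connected.
  by exists p0 => c [_ h]; exists 0 => //; rewrite /= in_itv /= lexx ler01.
by move=> c [[cc _] _]; apply: connected_continuous_connected => //; exact: segment_connected.
Qed.

(** The strip is star-shaped around 0, so its image is a union of connected images of segments
    through a common point. *)
Lemma strip_image_connected (G G' : C -> C) (d : R) : 0 < d -> hol1 (strip d) G G' ->
  connected [set toP (G z) | z in strip d].
Proof.
move=> d0 hG.
have sg z (x : R) : strip d z -> 0 <= x <= 1 -> strip d (0 + x%:C * (z - 0)).
  rewrite /strip add0r subr0 imM imC mul0r addr0 reC normrM => hz /andP[x0 x1].
  rewrite ger0_norm//; apply: le_lt_trans hz; rewrite -[leRHS]mul1r.
  exact: ler_wpM2r.
have -> : [set toP (G z) | z in strip d] =
    \bigcup_(z in strip d) [set toP (G (0 + x%:C * (z - 0))) | x in `[0, 1]].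
  apply/seteqP; split => [p [z hz <-]|p [z hz [x /= + <-]]].
    exists z => //; exists 1; first by rewrite /= in_itv /= lexx ler01.
    by rewrite mul1r add0r subr0.
  by rewrite in_itv /= => x01; exists (0 + x%:C * (z - 0)) => //; exact: sg.
apply: bigcup_connected.
  exists (toP (G 0)) => z hz; exists 0; first by rewrite /= in_itv /= lexx ler01.
  by rewrite mul0r addr0.
by move=> z hz; apply: segment_image_connected hG _ => x; exact: sg.
Qed.

End PlaneTopology.

(** * Inner and outer half strips *)

Section CurveSides.
Context {R : realType}.
Local Notation C := R[i].
Implicit Types (p q : R * R) (z w : C) (t s k : R).

(** The upper half strip for [k = 1], the lower one for [k = -1]. *)
Definition side k (d : R) : set C := fun z => 0 < k * im z < d.

Variables (Omega : set (R * R)) (gamma : R -> R * R) (G G' : C -> C) (d N : R).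
Hypotheses (oO : open Omega) (gE : forall t, gamma t = toP (G t%:C))
  (rng : range gamma = boundary Omega) (d0 : 0 < d) (hG : hol1 (strip d) G G')
  (chord : forall z w, strip d z -> strip d w -> cabs (ez z - ez w) <= N * cabs (G z - G w))
  (nz : forall z, strip d z -> G' z != 0).

Lemma side_strip k z : k = 1 \/ k = -1 -> side k d z -> strip d z.
Proof. by move=> [->|->]; rewrite /side /strip ltr_norml; lra. Qed.

Lemma side_im k z : side k d z -> im z != 0.
Proof. by move=> /andP[h _]; apply: contraTneq h => ->; rewrite mulr0 ltxx. Qed.

Lemma strip_ez z w : strip d z -> strip d w -> G z = G w -> ez z = ez w.
Proof.
move=> hz hw e; have := chord hz hw; rewrite e subrr cabs0 mulr0 => h.
by apply/eqP; rewrite -subr_eq0 -cabs_eq0 eq_le h cabs_ge0.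
Qed.

(** By injectivity modulo the period, [G z] on the curve would force [ez z] onto the unit circle. *)
Lemma boundary_off z : strip d z -> im z != 0 -> ~ boundary Omega (toP (G z)).
Proof.
move=> hz iz; rewrite -rng => -[t _]; rewrite gE => e.
have /(strip_ez (strip_real t d0) hz) : G t%:C = G z by rewrite -[LHS]toPK e toPK.
move=> /(f_equal (@Normc.normc R)); rewrite cabs_ez_real cabs_ez => h.
by move/eqP: iz; apply; rewrite -[im z]opprK -[- im z]expRK -h ln1 oppr0.
Qed.

Lemma side_segment k z w (x : R) : k = 1 \/ k = -1 -> side k d z -> side k d w -> 0 <= x <= 1 ->
  side k d (z + x%:C * (w - z)).
Proof.
move=> hk; rewrite /side imD imM imB imC reC mul0r addr0 => /andP[z1 z2] /andP[w1 w2] /andP[x0 x1].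
have -> : k * (im z + x * (im w - im z)) = (1 - x) * (k * im z) + x * (k * im w) by ring.
move: (k * im z) (k * im w) z1 z2 w1 w2 => a b z1 z2 w1 w2; apply/andP; split.
  have [ab|ba] := leP a b; first by apply: lt_le_trans z1 _; nra.
  by apply: lt_le_trans w1 _; nra.
have [ab|ba] := leP a b; first by apply: le_lt_trans w2; nra.
by apply: le_lt_trans z2; nra.
Qed.

Lemma side_Omega k z w : k = 1 \/ k = -1 -> side k d z -> side k d w ->
  Omega (toP (G z)) -> Omega (toP (G w)).
Proof.
move=> hk hz hw; have hs := hol1_sub (fun v => @side_strip k v hk) hG.
apply: (segment_side oO hs).
  by move=> x hx; exact: side_segment.
by move=> v hv; apply: boundary_off; [exact: side_strip hk hv|exact: side_im hv].
Qed.

Lemma off_closure z : strip d z -> im z != 0 -> ~ Omega (toP (G z)) -> ~ closure Omega (toP (G z)).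
Proof.
by move=> hz iz nO cO; apply: (boundary_off hz iz); rewrite boundary_open.
Qed.

Lemma side_closure k z w : k = 1 \/ k = -1 -> side k d z -> side k d w ->
  ~ closure Omega (toP (G z)) -> ~ closure Omega (toP (G w)).
Proof.
move=> hk hz hw nc; apply: off_closure; [exact: side_strip hk hw|exact: side_im hw|].
by move=> /(side_Omega hk hw hz) h; apply: nc; exact: subset_closure.
Qed.

Lemma strip_open_mapping z0 : strip d z0 -> forall r : R, 0 < r -> exists2 rho : R, 0 < rho &
  forall p, cabs (toC p - G z0) < rho -> exists z, [/\ strip d z, cabs (z - z0) < r, G z = toC p &
    cabs (z - z0) <= 2 / cabs (G' z0) * cabs (toC p - G z0)].
Proof.
move=> hz r r0; have [r1 r10 H1] := strip_nbhs hz.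
have q0 : 0 < Num.min r r1 by rewrite lt_min r0.
have [rho rho0 H] := open_mapping r10 H1 hG (nz hz) q0.
exists rho => // p /H [z [h1 h2 h3]]; exists z; split => //.
  by apply: H1; apply: lt_le_trans h1 _; rewrite ge_min lexx orbT.
by apply: lt_le_trans h1 _; rewrite ge_min lexx.
Qed.

(* Moving from [gamma t] along [n = k 'i G' / |G'|] changes the imaginary part of the preimage under [G] in the direction of [k]. *)
Lemma normal_side n t : cabs n = 1 -> re (n * conjc (G' t%:C)) = 0 ->
  (\forall x \near 0^'+, ~ closure Omega (gamma t + x *: toP n)) ->
  exists k, [/\ k = 1 \/ k = -1, n = k%:C * 'i * G' t%:C / (cabs (G' t%:C))%:C &
     forall z, side k d z -> ~ closure Omega (toP (G z))].
Proof.
move=> n1 nG nO; have st := strip_real t d0.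
have m0 : 0 < cabs (G' t%:C) by rewrite cabs_gt0 nz.
set m := cabs (G' t%:C) in m0 *.
have mC : m%:C != 0 :> C by rewrite -cabs_eq0 cabs_real normr_eq0 gt_eqF.
pose y := im (n * conjc (G' t%:C)).
have nE : n * conjc (G' t%:C) = 'i * y%:C.
  apply: complex_eq; first by rewrite nG [RHS]/= mul0r mulr0 subr0.
  by rewrite -/y [RHS]/= mul0r mul1r add0r.
have ym : `|y| = m.
  by have := f_equal (@Normc.normc R) nE; rewrite !cabsM n1 cabs_conj cabs_i cabs_real !mul1r.
pose k := y / m.
have hk : k = 1 \/ k = -1.
  have y0 : y != 0 by rewrite -normr_eq0 ym gt_eqF.
  rewrite /k -ym; have [y1|y1] := leP 0 y; [left|right].
    by rewrite (ger0_norm y1) divff.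
  by rewrite (ltr0_norm y1) invrN mulrN divff.
have n_eq : n = k%:C * 'i * G' t%:C / m%:C.
  have g0 : conjc (G' t%:C) != 0 by rewrite -cabs_eq0 cabs_conj gt_eqF.
  apply: (mulIf g0); rewrite nE.
  have -> : k%:C * 'i * G' t%:C / m%:C * conjc (G' t%:C) = k%:C * 'i * (G' t%:C * conjc (G' t%:C)) / m%:C by ring.
  rewrite -cabs_sqr_conj -/m rmorphXn /= expr2 mulrA mulfK//.
  by rewrite mulrAC -rmorphM /k divfK ?gt_eqF// mulrC.
exists k; split => // z hz.
(* The relative error [m / 4], times the bound [2 / m * x] on the displacement of the preimage,
   gives the margin [x / 2] in [bE]. *)
have m4 : 0 < m / 4 by rewrite divr_gt0.
have [r1 /andP[r10 _] H1] := strong_diff d0 (fun z => @strip_ball R d t z d0) hG m4.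
have q0 : 0 < Num.min r1 d by rewrite lt_min r10.
have [rho rho0 H2] := strip_open_mapping st q0.
have [x [x0 xr nx]] : exists x : R, [/\ 0 < x, x < rho & ~ closure Omega (gamma t + x *: toP n)].
  have : \forall x \near (0 : R)^'+, [/\ 0 < x, x < rho & ~ closure Omega (gamma t + x *: toP n)].
    near=> x; split; near: x => //.
    - exact: nbhs_right_gt.
    - exact: nbhs_right_lt.
  by move=> /(@filter_ex _ _ _ _) [x hx]; exists x.
have pE : toC (gamma t + x *: toP n) = G t%:C + x%:C * n by rewrite toCD toCZ gE !toPK.
have pd : toC (gamma t + x *: toP n) - G t%:C = x%:C * n by rewrite pE addrAC subrr add0r.
have xn : cabs (x%:C * n) = x by rewrite cabsM n1 mulr1 cabs_real gtr0_norm.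
have [|zeta [hz1 hz2 hz3 hz4]] := H2 (gamma t + x *: toP n); first by rewrite pd xn.
rewrite pd xn -/m in hz4.
move: hz2; rewrite lt_min => /andP[hz2 hz5].
have tt : cabs (t%:C - t%:C : C) < r1 by rewrite subrr cabs0.
have := H1 _ _ hz2 tt; rewrite hz3 pd => Hd.
have zs : side k d zeta.
  pose b := zeta - t%:C.
  (* To first order [m * b] is [x * k * 'i]; an error of [x / 2] is too small to change the sign of
     the imaginary part. *)
  have bE : cabs ((x * k)%:C * 'i - m%:C * b) <= x / 2.
    have g0 : G' t%:C != 0 by rewrite -cabs_gt0.
    have E : x%:C * n - G' t%:C * b = G' t%:C * (((x * k)%:C * 'i - m%:C * b) / m%:C).
      have alg (X K I g c u : C) : c != 0 -> X * (K * I * g / c) - g * u = g * ((X * K * I - c * u) / c).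
        by move=> c0; field.
      have -> : (x * k)%:C = x%:C * k%:C :> C by exact: rmorphM.
      rewrite [in LHS]n_eq; exact: (alg x%:C k%:C 'i _ _ b mC).
    move: Hd; rewrite -/b E cabsM cabsM cabsV cabs_real (gtr0_norm m0) -/m mulrCA mulfV ?gt_eqF// mulr1 => h.
    apply: le_trans h _; apply: le_trans (ler_wpM2l (ltW m4) hz4) _.
    by rewrite le_eqVlt; apply/orP; left; apply/eqP; field; rewrite gt_eqF.
  have := le_trans (im_le_cabs _) bE.
  have -> : im ((x * k)%:C * 'i - m%:C * b) = x * k - m * im zeta.
    rewrite imB !imM !reC !imC /b imB imC subr0 !mul0r !addr0.
    by rewrite [im 'i](_ : _ = 1)// mulr1.
  have imd : `|im zeta| < d by exact: hz1.
  rewrite ler_norml => /andP[h1 h2]; apply/andP; split; last first.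
    by apply: le_lt_trans imd; rewrite ler_normr; case: hk => ->; rewrite ?mul1r ?mulN1r lexx ?orbT.
  rewrite -(pmulr_rgt0 _ m0).
  have alg (K X M v : R) : K = 1 \/ K = -1 -> 0 < X -> - (X / 2) <= X * K - M * v ->
      X * K - M * v <= X / 2 -> 0 < M * (K * v).
    by move=> [->|->]; rewrite ?mul1r ?mulN1r ?mulrN; move: (M * v) => u; lra.
  exact: (alg k x m (im zeta) hk x0 h1 h2).
apply: (side_closure hk zs hz).
by rewrite hz3 toCK.
Unshelve. all: by end_near. Qed.

(** A point of [Omega] close to [gamma 0] has a preimage in the strip, off the real line because the
    open set [Omega] is disjoint from its boundary; the half strip of this preimage is the inner
    one. *)
Lemma exists_inner_side : exists2 k, k = 1 \/ k = -1 & forall z, side k d z -> Omega (toP (G z)).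
Proof.
have s0 := strip_real 0 d0.
have [rho rho0 H] := strip_open_mapping s0 (@ltr01 R).
have b0 : boundary Omega (gamma 0) by rewrite -rng; exists 0.
have [q Oq qr] := closure_toC (proj1 b0) rho0.
rewrite gE toPK in qr.
have [z [hz _ Gz _]] := H q qr.
have Oz : Omega (toP (G z)) by rewrite Gz toCK.
have iz : im z != 0.
  apply/eqP => iz; have zE : z = (re z)%:C by exact: complex_eq.
  have : boundary Omega (toP (G z)) by rewrite -rng; exists (re z) => //; rewrite gE -zE.
  by rewrite boundary_open// => -[].
move: hz; rewrite /strip ltr_norml => /andP[z1 z2].
have [ip|im_] := ltP 0 (im z).
  exists 1; [by left|move=> w hw; apply: (@side_Omega 1 z w) => //; first by left].
  by rewrite /side mul1r ip.
exists (-1); [by right|move=> w hw; apply: (@side_Omega (-1) z w) => //; first by right].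
rewrite /side mulN1r; apply/andP; split; last by lra.
by rewrite oppr_gt0 lt_neqAle iz.
Qed.

End CurveSides.

(** * Data of the extended curve *)

Section CurveData.
Context {R : realType}.
Local Notation C := R[i].
Implicit Types (p q : R * R) (z w : C) (t s k : R) (g : R -> R).

Lemma extension_deriv (d : R) g (U U' : C -> C) t : 0 < d -> hol1 (strip d) U U' ->
  (forall t, U t%:C = (g t)%:C) -> U' t%:C = (derive1 g t)%:C.
Proof.
move=> d0 hU e.
have h : cder U (t +i* 0) (U' (t +i* 0)) by have [] := hU _ (strip_real t d0).
have [h1 h2] := rder_horiz h.
have e1 : (fun s => re (U (s +i* 0))) = g by apply/funext => s; rewrite (e s).
have e2 : (fun s => im (U (s +i* 0))) = cst 0 by apply/funext => s; rewrite (e s).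
rewrite e1 in h1; rewrite e2 in h2.
apply: complex_eq; first by rewrite derive1E reC; have [_ <-] := h1.
rewrite imC; have [_ <-] := h2; by rewrite derive_cst.
Qed.

Lemma within_toC (A : set (R * R)) (F : R * R -> R * R) : {within A, continuous F} <->
  (forall p, A p -> forall x : R, 0 < x -> exists2 r : R, 0 < r &
    forall q, A q -> cabs (toC q - toC p) < r -> cabs (toC (F q) - toC (F p)) < x).
Proof.
split=> [/subspace_continuousP H p Ap x x0|H].
  have : \forall q \near within A (nbhs p), cabs (toC (F q) - toC (F p)) < x.
    have S : \forall v \near F p, cabs (toC v - toC (F p)) < x by apply/toC_nbhs; exists x.
    exact: (H p Ap _ S).
  move=> /toC_nbhs [r r0 Hr]; exists r => // q Aq qr; exact: Hr.
apply/subspace_continuousP => p Ap S /toC_nbhs [x x0 Sx].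
have [r r0 Hr] := H p Ap x x0.
by apply/toC_nbhs; exists r => // q qr Aq; apply: Sx; exact: Hr.
Qed.

Lemma rcont_eps (u : R -> C) : (forall t (x : R), 0 < x -> exists2 r : R, 0 < r &
  forall s, `|s - t| < r -> cabs (u s - u t) < x) -> rcont u.
Proof.
move=> H; split=> t; apply/cvgrPdist_lt => x x0; have [r r0 Hr] := H t x x0;
  apply/nbhs_ballP; exists r => // s; rewrite /ball /= distrC => /Hr;
  apply: le_lt_trans; rewrite distrC.
  by rewrite -reB re_le_cabs.
by rewrite -imB im_le_cabs.
Qed.

(* [G] extends the curve to a complex strip, in the complex notation [x + 'i y] for points of the plane. *)
Record curve_data (gamma : R -> R * R) (G G' G'' : C -> C) (d e B N : R) : Prop := CurveData {
  cd_hol : hol1 (strip d) G G';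
  cd_hol' : hol1 (strip d) G' G'';
  cd_per : per G;
  cd_per' : per G';
  cd_val : forall t, gamma t = toP (G t%:C);
  cd_vel : forall t, toC (velocity gamma t) = G' t%:C;
  cd_e0 : 0 < e;
  cd_ed : e < d;
  cd_N0 : 0 < N;
  cd_chord : forall z w, strip e z -> strip e w -> cabs (ez z - ez w) <= N * cabs (G z - G w);
  cd_bA : forall z s, strip e z -> cabs (kerA G G' z s) <= B;
  cd_bT : forall z s, strip e z -> cabs (kerG G G' z s - kerT G G' z s) <= B;
  cd_nz : forall z, strip e z -> G' z != 0;
  cd_speed : strip_ext (fun t => enorm (velocity gamma t)) }.

Lemma period_class (x : R) : exists m : int, 0 <= x + 2 * pi * m%:~R < 2 * pi.
Proof.
have [m hm] := per_reduce x; move: hm; rewrite ler_norml => /andP[h1 h2].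
have p0 := @pi_gt0 R.
have [h|h] := leP 0 (x + 2 * pi * m%:~R).
  by exists m; rewrite h; move: h2 p0; lra.
exists (m + 1); rewrite intrD mulrDr mulr1 addrA.
by move: h1 h p0; move: (x + _) => y; lra.
Qed.

(** The coordinates are extended separately to [U] and [V]; then [G = U + 'i * V] extends the curve,
    although [U] and [V] need not be real off the line. *)
Lemma curve_dataP (gamma : R -> R * R) (A : set (R * R)) : analytic_parameterisation gamma A ->
  exists G G' G'' d e B N, curve_data gamma G G' G'' d e B N.
Proof.
move=> [pg ig rg ag vg].
have a1 : analytic_everywhere (fst \o gamma) by move=> t; have [] := ag t.
have a2 : analytic_everywhere (snd \o gamma) by move=> t; have [] := ag t.
have p1 t : (fst \o gamma) (t + 2 * pi) = (fst \o gamma) t by rewrite /= pg.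
have p2 t : (snd \o gamma) (t + 2 * pi) = (snd \o gamma) t by rewrite /= pg.
have [d1 [U [U' [U'' [d10 hU hU' [pU [pU' pU'']] Uv]]]]] := strip_extension a1 p1.
have [d2 [V [V' [V'' [d20 hV hV' [pV [pV' pV'']] Vv]]]]] := strip_extension a2 p2.
pose d := Num.min d1 d2.
have d0 : 0 < d by rewrite lt_min d10.
have sU f f' : hol1 (strip d1) f f' -> hol1 (strip d) f f' by apply: hol1_sub; exact: strip_minl.
have sV f f' : hol1 (strip d2) f f' -> hol1 (strip d) f f' by apply: hol1_sub; exact: strip_minr.
pose G z := U z + 'i * V z; pose G' z := U' z + 'i * V' z; pose G'' z := U'' z + 'i * V'' z.
have hG : hol1 (strip d) G G' by exact: hol1D (sU _ _ hU) (hol1Z 'i (sV _ _ hV)).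
have hG' : hol1 (strip d) G' G'' by exact: hol1D (sU _ _ hU') (hol1Z 'i (sV _ _ hV')).
have pG : per G by move=> z; rewrite /G pU pV.
have pG' : per G' by move=> z; rewrite /G' pU' pV'.
have pG'' : per G'' by move=> z; rewrite /G'' pU'' pV''.
have cpx (x y : R) : x%:C + 'i * y%:C = x +i* y by apply: complex_eq; rewrite /=; ring.
have val t : gamma t = toP (G t%:C).
  by rewrite /G Uv Vv cpx /toP /=; case: (gamma t).
have U'v t := extension_deriv t d10 hU Uv.
have V'v t := extension_deriv t d20 hV Vv.
have vel t : toC (velocity gamma t) = G' t%:C by rewrite /G' U'v V'v cpx.
have nz t : G' t%:C != 0.
  rewrite -vel; apply: contra (vg t) => /eqP h; apply/eqP.
  by rewrite -[LHS]toCK h.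
have inj t s : G t%:C = G s%:C -> ez t%:C = ez s%:C :> C.
  move=> e; have [m hm] := period_class t; have [n hn] := period_class s.
  have shift x (j : int) : gamma (x + 2 * pi * j%:~R) = gamma x.
    by rewrite val rmorphD (per_int pG) -val.
  have E : t + 2 * pi * m%:~R = s + 2 * pi * n%:~R.
    apply: ig; rewrite ?inE /= ?in_itv //= !shift !val e //.
  have := f_equal (fun x => ez (x%:C : C)) E.
  by rewrite !rmorphD !(per_int (@ez_per R)).
have [e [B [N [e0 ed N0 [hN hA hT]]]]] := kernel_bounds d0 hG hG' pG pG' pG'' inj nz.
have [t|z m|d' d'0 Hd] := @strip_open R (fun z => G' z != 0).
- have n0 : 0 < cabs (G' t%:C) by rewrite cabs_gt0.
  have [h _] := hG' _ (strip_real t d0).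
  have [r r0 H] := cder_ccont h n0.
  exists r => // w /H h1; apply/eqP => w0; move: h1; by rewrite w0 sub0r cabsN ltxx.
- by rewrite (per_int pG').
pose e' := Num.min e d'.
have e'e z : strip e' z -> strip e z by exact: strip_minl.
exists G, G', G'', d, e', B, N; split => //.
- by rewrite lt_min e0.
- by apply: le_lt_trans ed; rewrite ge_min lexx.
- by move=> z w /e'e hz /e'e hw; exact: hN.
- by move=> z s /e'e; exact: hA.
- by move=> z s /e'e; exact: hT.
- by move=> z /strip_minr; exact: Hd.
(* The modulus of [G'] is not holomorphic in general; the speed is extended as the square root of
   the sum of the squares of the extended velocity components. *)
have s1 : strip_ext (derive1 (fst \o gamma)) by exists d1, U', U''; split.
have s2 : strip_ext (derive1 (snd \o gamma)) by exists d2, V', V''; split.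
have := strip_ext_sqrt (strip_extD (strip_extM s1 s1) (strip_extM s2 s2)) _; apply => t.
have := vg t; rewrite /velocity xpair_eqE negb_and => /orP[h|h].
  by apply: ltr_pwDl; [rewrite -expr2 exprn_even_gt0|rewrite -expr2 sqr_ge0].
by apply: ltr_wpDl; [rewrite -expr2 sqr_ge0|rewrite -expr2 exprn_even_gt0].
Qed.

(** The sign [sg] times the non-vanishing speed is continuous, so by the intermediate value theorem
    it cannot change; [k] records whether [tau] and [gamma] have the same orientation. *)
Lemma tangent_sign (gamma : R -> R * R) (tau : R * R -> R * R) G G' G'' (d e B N : R) :
  curve_data gamma G G' G'' d e B N -> unit_tangent gamma tau ->
  exists2 k, k = 1 \/ k = -1 & forall t, toC (tau (gamma t)) = k%:C * G' t%:C / (cabs (G' t%:C))%:C.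
Proof.
move=> cd [ctau ht].
have d0 := lt_trans (cd_e0 cd) (cd_ed cd).
have m0 t : 0 < cabs (G' t%:C).
  by rewrite cabs_gt0; apply: (cd_nz cd); exact: strip_real (cd_e0 cd).
pose sg t : R := re (toC (tau (gamma t)) * conjc (G' t%:C)) / cabs (G' t%:C).
have key t : (sg t = 1 \/ sg t = -1) /\ toC (tau (gamma t)) = (sg t)%:C * G' t%:C / (cabs (G' t%:C))%:C.
  have [h1 [k h2]] := ht t.
  have hC : toC (tau (gamma t)) = k%:C * G' t%:C by rewrite h2 toCZ (cd_vel cd).
  have mC : (cabs (G' t%:C))%:C != 0 :> C by rewrite -cabs_eq0 cabs_real normr_eq0 gt_eqF.
  have sE : sg t = k * cabs (G' t%:C).
    rewrite /sg hC -mulrA -cabs_sqr_conj -rmorphM reC expr2 mulrA mulfK// gt_eqF//.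
  split; last by rewrite hC sE rmorphM /= -!mulrA [_%:C * (_ / _)]mulrCA divff// mulr1.
  have : `|sg t| = 1 by rewrite sE normrM [`|cabs _|]gtr0_norm// -h1 enormE hC cabsM cabs_real.
  by have [s0|s0] := leP 0 (sg t); [rewrite ger0_norm//; left|rewrite ltr0_norm// => <-; right; rewrite opprK].
pose n t : R := re (toC (tau (gamma t)) * conjc (G' t%:C)).
have nE t : n t = sg t * cabs (G' t%:C) by rewrite /sg divfK// gt_eqF.
have cT : rcont (fun t => toC (tau (gamma t))).
  apply: rcont_eps => t x x0.
  have gt : range gamma (gamma t) by exists t.
  have [r r0 H] := (within_toC _ _).1 ctau _ gt _ x0.
  have cG : ccont G t%:C by have [h _] := cd_hol cd (strip_real t d0); exact: cder_ccont h.
  have [r1 r10 H1] := cG r r0; exists r1 => // s st.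
  apply: H; first by exists s.
  by rewrite !(cd_val cd) !toPK; apply: H1; rewrite cabs_realB.
have cG' : rcont (fun t => G' t%:C) := curve_rcont' (cd_hol cd) (cd_e0 cd) (cd_ed cd).
have cn : continuous n by have [h _] := rcontM cT (rcont_conj cG').
have noflip t s : t <= s -> sg t = sg s.
  move=> ts; apply/eqP/negPn/negP => ne.
  have [|c _ nc] := @IVT R n t s 0 ts (continuous_subspaceT cn).
    rewrite !nE; have := m0 t; have := m0 s; move: ne.
    have [[->|->] _] := key t; have [[->|->] _] := key s; rewrite ?eqxx// => _ a b;
      rewrite ge_min le_max !mul1r !mulN1r !oppr_le0 !oppr_ge0 ?(ltW a) ?(ltW b) ?orbT//.
  move: nc; rewrite nE => /eqP; rewrite mulf_eq0 [cabs _ == 0]gt_eqF ?m0// orbF.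
  by have [[->|->] _] := key c; rewrite ?oppr_eq0 oner_eq0.
exists (sg 0); first by have [] := key 0.
move=> t; have -> : sg 0 = sg t.
  by have [/noflip//|/ltW/noflip ->] := leP 0 t.
by have [] := key t.
Qed.

End CurveData.

(** * The transform along the curve *)

Section HilbertOnCurve.
Context {R : realType}.
Local Notation C := R[i].
Local Notation mu := (@lebesgue_measure R).
Implicit Types (p q : R * R) (z w : C) (t s k : R) (g dg : R -> R) (f h : R * R -> R).
Local Notation I0 := (@I0 R).
Local Notation finI0 := (@finI0 R).

Lemma strip_ext_C1per g : strip_ext g -> C1per g (derive1 g).
Proof.
move=> sg; have ag := strip_ext_analytic sg; split.
- exact: strip_ext_per.
- by move=> t; exact: (analytic_is_derive 0 t ag).
- exact: (analytic_cont (k := 1) ag).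
Qed.

Lemma C1perM g dg (h dh : R -> R) : C1per g dg -> C1per h dh ->
  C1per (fun t => g t * h t) (fun t => dg t * h t + g t * dh t).
Proof.
move=> Hg Hh; have cg := C1per_cont Hg; have ch := C1per_cont Hh.
have [pg eg cdg] := Hg; have [ph eh cdh] := Hh; split.
- by move=> t; rewrite pg ph.
- move=> t; apply: (is_derive_eq (is_deriveM (eg t) (eh t))).
  by rewrite -![_ *: _]/(_ * _) addrC mulrC.
- by move=> t; apply: cvgD; apply: cvgM; [exact: cdg|exact: ch|exact: cg|exact: cdh].
Qed.

Lemma C1_on_curve_C1per (gamma : R -> R * R) f : (forall t, gamma (t + 2 * pi) = gamma t) ->
  C1_on_curve gamma f -> C1per (f \o gamma) (derive1 (f \o gamma)).
Proof.
move=> pg [df cdf]; split => // t; first by rewrite /= pg.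
by rewrite derive1E; apply: derivableP; exact: df.
Qed.

Variables (gamma : R -> R * R) (tau : R * R -> R * R) (G G' G'' : C -> C) (d e B N k : R).
Hypotheses (cd : curve_data gamma G G' G'' d e B N) (pg : forall t, gamma (t + 2 * pi) = gamma t)
  (kk : k = 1 \/ k = -1)
  (tE : forall t, toC (tau (gamma t)) = k%:C * G' t%:C / (cabs (G' t%:C))%:C).

Definition speed t : R := cabs (G' t%:C).

Lemma speedE t : enorm (velocity gamma t) = speed t.
Proof. by rewrite enormE (cd_vel cd). Qed.

Lemma speed_ext : strip_ext speed.
Proof.
rewrite (_ : speed = fun t => enorm (velocity gamma t)); first exact: cd_speed cd.
by apply/funext => t; rewrite speedE.
Qed.

Lemma speed_gt0 t : 0 < speed t.
Proof. by rewrite cabs_gt0; apply: (cd_nz cd); exact: strip_real (cd_e0 cd). Qed.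

(** The density of [f] with respect to the parameter instead of arc length. *)
Definition weighted f t : R := speed t * f (gamma t).

Lemma weighted_C1per f : C1_on_curve gamma f -> exists df, C1per (weighted f) df.
Proof.
move=> /(C1_on_curve_C1per pg) Hf; eexists.
exact: (C1perM (strip_ext_C1per speed_ext) Hf).
Qed.

(** In complex notation the kernel of the transform is [k / |G' t|] times the real part of
    [G' t / (G t - G s)], and leaving out the ball becomes [sharp_cut]. *)
Lemma arclength_cut h t (eps : R) : C1_on_curve gamma h -> 0 < eps ->
  arclength_integral gamma (range gamma `\` eball (gamma t) eps)
    (fun q => h q * (dot (tau (gamma t)) (gamma t - q) / enorm (gamma t - q) ^+ 2)) =
  k / speed t * \int[mu]_(s in I0) (sharp_cut (G t%:C) (fun s => G s%:C) eps s *
    (weighted h s * re (kerG G G' t%:C s))).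
Proof.
move=> Hh eps0; have [dh Ch] := weighted_C1per Hh; rewrite /arclength_integral Rintegral_mkcondr.
pose Y s := sharp_cut (G t%:C) (fun s => G s%:C) eps s * (weighted h s * re (kerG G G' t%:C s)).
have pw s : ((fun s => h (gamma s) * (dot (tau (gamma t)) (gamma t - gamma s) / enorm (gamma t - gamma s) ^+ 2)
      * enorm (velocity gamma s)) \_ (gamma @^-1` (range gamma `\` eball (gamma t) eps))) s = k / speed t * Y s.
  have dist : enorm (gamma s - gamma t) = cabs (G t%:C - G s%:C).
    by rewrite enormE toCB !(cd_val cd) !toPK cabsBC.
  rewrite patchE; case: ifPn => hs.
    have h1 : eps <= cabs (G t%:C - G s%:C).
      by move: hs; rewrite inE => -[_]; rewrite /eball /= dist => /negP; rewrite -leNgt.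
    have dif : toC (gamma t - gamma s) = G t%:C - G s%:C by rewrite toCB !(cd_val cd) !toPK.
    rewrite /Y /sharp_cut h1 mul1r speedE /weighted dotE enormE dif tE.
    have D0 : G t%:C - G s%:C != 0 by rewrite -cabs_gt0 (lt_le_trans eps0).
    have m0 := speed_gt0 t.
    have E : re (k%:C * G' t%:C / (cabs (G' t%:C))%:C * conjc (G t%:C - G s%:C)) / cabs (G t%:C - G s%:C) ^+ 2 =
        k / speed t * re (kerG G G' t%:C s).
      have c0 : cabs (G t%:C - G s%:C) ^+ 2 != 0 by rewrite expf_neq0// cabs_eq0.
      apply: (mulIf c0); rewrite divfK//.
      have -> : k%:C * G' t%:C / (cabs (G' t%:C))%:C * conjc (G t%:C - G s%:C) =
          (k / speed t)%:C * (G' t%:C * conjc (G t%:C - G s%:C)).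
        by rewrite rmorphM fmorphV /= /speed; ring.
      rewrite re_realM -[RHS]mulrA; apply: f_equal.
      have alg (x y : C) (r : R) : x * r%:C = y -> re y = re x * r by move=> <-; rewrite reM /= mulr0 subr0.
      by apply: alg; rewrite cabs_sqr_conj mulrA divfK.
    by rewrite E; ring.
  have h1 : (eps <= cabs (G t%:C - G s%:C)) = false.
    apply/negP => h2; move/negP: hs; apply; rewrite inE; split; first by exists s.
    by rewrite /eball /= dist; apply/negP; rewrite -leNgt.
  by rewrite /Y /sharp_cut h1 mul0r mulr0.
have -> : \int[mu]_(s in `[0, 2 * pi]) ((fun s => h (gamma s) *
      (dot (tau (gamma t)) (gamma t - gamma s) / enorm (gamma t - gamma s) ^+ 2)
      * enorm (velocity gamma s)) \_ (gamma @^-1` (range gamma `\` eball (gamma t) eps))) s =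
   \int[mu]_(s in I0) (k / speed t * Y s) by apply: eq_Rintegral => s _; exact: pw.
have cY : rcont (fun s => realC (weighted h) s * G' t%:C).
  by apply: rcontM (rcont_realC (C1per_cont Ch)) (rcont_cst _).
have bY : bmf I0 Y.
  have := sharp_cut_kernel_bmf (G t%:C) eps0 (curve_rder (cd_hol cd) (cd_e0 cd) (cd_ed cd)) cY.
  rewrite (_ : (fun _ => _) = Y)//; apply/funext => s.
  by rewrite /Y /realC -mulrA re_realM.
by rewrite RintegralZl; [|exact: (finI0.1)|exact: (bmf_integrable finI0 bY)].
Qed.

Lemma hilbert_value h t : C1_on_curve gamma h ->
  k * speed t * hilbert_transform gamma tau h (gamma t) =
  circle_transform (weighted h) t + pi^-1 * re (kerA_int G G' (realC (weighted h)) t%:C).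
Proof.
move=> Hh; have [dh Ch] := weighted_C1per Hh.
have L : \int[mu]_(s in I0) (sharp_cut (G t%:C) (fun s => G s%:C) eps s *
    (weighted h s * re (kerG G G' t%:C s))) @[eps --> 0^'+] -->
    pi * circle_transform (weighted h) t + re (kerA_int G G' (realC (weighted h)) t%:C).
  exact: (pv_limit (cd_hol cd) (cd_per cd) (cd_e0 cd) (cd_ed cd) (cd_N0 cd) (cd_chord cd) (cd_bA cd) (cd_bT cd) Ch).
have p0 : pi != 0 :> R by rewrite gt_eqF// pi_gt0.
have m0 := lt0r_neq0 (speed_gt0 t).
have kk1 : k * k = 1 by case: kk => ->; ring.
pose V := pi * circle_transform (weighted h) t + re (kerA_int G G' (realC (weighted h)) t%:C).
rewrite /hilbert_transform.
have -> : lim (arclength_integral gamma (range gamma `\` eball (gamma t) eps)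
    (fun q => h q * (dot (tau (gamma t)) (gamma t - q) / enorm (gamma t - q) ^+ 2)) @[eps --> 0^'+]) = k / speed t * V.
  apply: cvg_lim => //.
  apply: cvg_trans (cvgM (cvg_cst (k / speed t)) L).
  apply: near_eq_cvg; near=> x; rewrite arclength_cut//.
rewrite /V; move: (circle_transform _ _) (re _) => a b.
have -> : k * speed t * (pi^-1 * (k / speed t * (pi * a + b))) = (k * k) * (a + pi^-1 * b).
  by move: p0 m0; generalize (pi : R) (speed t) => p m p0 m0; field; apply/andP; split.
by rewrite kk1 mul1r.
Unshelve. all: by end_near. Qed.

Lemma hilbert_analytic_iff f h : C1_on_curve gamma f -> C1_on_curve gamma h ->
  analytic_on_curve gamma (fun v => f v - hilbert_transform gamma tau h v) <->
  analytic_everywhere (fun t => k * weighted f t - circle_transform (weighted h) t).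
Proof.
move=> Hf Hh; have [dh Ch] := weighted_C1per Hh.
pose a t := re (kerA_int G G' (realC (weighted h)) t%:C).
have aa : analytic_everywhere a := kerA_int_analytic (cd_hol cd) (cd_hol' cd) (cd_per cd) (cd_per' cd)
  (cd_e0 cd) (cd_ed cd) (cd_N0 cd) (cd_chord cd) (cd_bA cd) (C1per_cbm Ch).
pose u t := f (gamma t) - hilbert_transform gamma tau h (gamma t).
have pu t : u (t + 2 * pi) = u t by rewrite /u pg.
have kk1 : k * k = 1 by case: kk => ->; ring.
have E t : k * weighted f t - circle_transform (weighted h) t = k * (speed t * u t) + pi^-1 * a t.
  rewrite /u mulrBr mulrBr [k * (_ * hilbert_transform _ _ _ _)]mulrA (hilbert_value t Hh) /a /weighted.
  by ring.
split => H.
  have su := strip_ext_analytic (strip_extM speed_ext (analytic_strip_ext (H : analytic_everywhere u) pu)).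
  move=> t; rewrite (_ : (fun _ => _) = (fun t => k * (speed t * u t) + pi^-1 * a t)); last by apply/funext => s; exact: E.
  by apply: analytic_atD; apply: analytic_atZ; [exact: su|exact: aa].
have E2 t : speed t * u t = k * ((k * weighted f t - circle_transform (weighted h) t) + - pi^-1 * a t).
  by rewrite E mulNr addrK mulrA kk1 mul1r.
have asu : analytic_everywhere (fun t => speed t * u t).
  move=> t; rewrite (_ : (fun _ => _) = (fun t => k * ((k * weighted f t - circle_transform (weighted h) t) + - pi^-1 * a t))); last by apply/funext => s; exact: E2.
  by apply: analytic_atZ; apply: analytic_atD; [exact: H|apply: analytic_atZ; exact: aa].
have psu t : speed (t + 2 * pi) * u (t + 2 * pi) = speed t * u t.
  by rewrite pu (strip_ext_per speed_ext).
have m0 t := lt0r_neq0 (speed_gt0 t).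
have := strip_ext_analytic (strip_extM (strip_extV speed_ext m0) (analytic_strip_ext asu psu)).
rewrite (_ : (fun _ => _) = u); first by move=> h0 t; exact: h0.
by apply/funext => t; rewrite mulKf.
Qed.

End HilbertOnCurve.

(** * Fields and boundary values *)

Section SideTransforms.
Context {R : realType}.
Local Notation C := R[i].
Implicit Types (z w : C) (t s k : R) (f h df dh : R -> R).

(* Boundary value of [(B1 - 'i B2) * G'] when [f] and [h] are the speed times the tangential and normal components and the normal is [k 'i G' / |G'|]. *)
Definition bdry_value k f h t : C := f t +i* (- k * h t).

(** Reflecting a function on the upper half strip conjugates its boundary value into [f +i* h], the
    one prescribed on the lower half strip; so both sides lead to the same condition. *)
Lemma side_transform_analytic k f df h dh (Psi Psi' : C -> C) (d M : R) : k = 1 \/ k = -1 ->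
  C1per f df -> C1per h dh -> 0 < d -> hol1 (side k d) Psi Psi' -> per Psi ->
  (forall z, side k d z -> cabs (Psi z) <= M) ->
  (forall t (x : R), 0 < x -> exists2 r : R, 0 < r & forall z, side k d z -> cabs (z - t%:C) < r ->
    cabs (Psi z - bdry_value k f h t) < x) ->
  analytic_everywhere (fun t => f t - circle_transform h t).
Proof.
move=> kk Hf Hh d0 hP pP bP lP.
have dist t y : cabs (t +i* y - t%:C : C) = `|y|.
  have -> : t +i* y - t%:C = 'i * y%:C :> C by apply: complex_eq; rewrite !reimE /=; ring.
  by rewrite cabsM cabs_i mul1r cabs_real.
case: kk => kE; rewrite kE in hP bP lP.
  pose Phi z := conjc (Psi (conjc z)).
  have ab : above d `<=` side 1 d by move=> z; rewrite /above /side /= mul1r.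
  have bs z : below d z -> side 1 d (conjc z).
    by rewrite /below /side /= im_conj mul1r => /andP[h1 h2]; apply/andP; split; lra.
  apply: (circle_transform_analytic (Phi := Phi) (M := M) Hf Hh d0 (cdiv_conj (hol1_sub ab hP))).
  - move=> z; rewrite /Phi -(pP (conjc z)); do 2 apply: f_equal.
    by case: z => x y; apply: complex_eq; rewrite /= ?addr0.
  - by move=> z /bs h1; rewrite /Phi cabs_conj; exact: bP.
  move=> t x x0; have [r r0 H] := lP t x x0.
  exists (Num.min r d); first by rewrite lt_min r0.
  move=> y /andP[y1 y2]; have yr : `|y| < Num.min r d by rewrite ltr0_norm// ltrNl.
  move: yr; rewrite lt_min => /andP[yr yd].
  have z1 : side 1 d (conjc (t +i* y)).
    by apply: bs; rewrite /below imCI y2 andbT; move: yd; rewrite ltr0_norm// ltrNl.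
  have E : f t +i* h t = conjc (bdry_value 1 f h t).
    by apply: complex_eq; rewrite /= ?mulN1r ?opprK.
  rewrite E /Phi -conjcB cabs_conj; apply: H => //.
  have -> : conjc (t +i* y) = t +i* (- y) :> C by [].
  by rewrite dist normrN.
have bs : below d `<=` side (-1) d.
  by move=> z; rewrite /below /side /= mulN1r => /andP[h1 h2]; apply/andP; split; lra.
apply: (circle_transform_analytic (Phi := Psi) (M := M) Hf Hh d0 (hol1_sub bs hP) pP).
  by move=> z /bs; exact: bP.
move=> t x x0; have [r r0 H] := lP t x x0.
exists (Num.min r d); first by rewrite lt_min r0.
move=> y /andP[y1 y2]; have yr : `|y| < Num.min r d by rewrite ltr0_norm// ltrNl.
move: yr; rewrite lt_min => /andP[yr yd].
have E : f t +i* h t = bdry_value (-1) f h t by apply: complex_eq; rewrite /= ?opprK ?mul1r.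
rewrite E; apply: H; last by rewrite dist.
by apply: bs; rewrite /below imCI y2 andbT; move: yd; rewrite ltr0_norm// ltrNl.
Qed.

Lemma side_transform_extension k f h dh : k = 1 \/ k = -1 ->
  (forall t, f (t + 2 * pi) = f t) -> C1per h dh ->
  analytic_everywhere (fun t => f t - circle_transform h t) ->
  exists (d : R) (Psi Psi' : C -> C), [/\ 0 < d, hol1 (side k d) Psi Psi', per Psi &
    forall t (x : R), 0 < x -> exists2 r : R, 0 < r &
      forall z, 0 < k * im z -> cabs (z - t%:C) < r -> cabs (Psi z - bdry_value k f h t) < x].
Proof.
move=> kk pf Hh aq.
have [d [Phi [Phi' [d0 hP pP lP]]]] := circle_transform_extension pf Hh aq.
case: kk => ->.
  exists d, (fun z => conjc (Phi (conjc z))), (fun z => conjc (Phi' (conjc z))); split => //.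
  - move=> z; rewrite /side mul1r => hz.
    have hz' : below d (conjc z) by rewrite /below /= im_conj; move: hz => /andP[h1 h2]; apply/andP; split; lra.
    have [h1 h2] := hP _ hz'; split; first exact: cder_conj.
    exact: ccont_conj.
  - move=> z; rewrite -(pP (conjc z)); do 2 apply: f_equal.
    by case: z => x y; apply: complex_eq; rewrite /= ?addr0.
  move=> t x x0; have [r r0 H] := lP t x x0; exists r => // z; rewrite mul1r => z0 zr.
  have -> : bdry_value 1 f h t = conjc (f t +i* h t).
    by apply: complex_eq; rewrite /= ?mulN1r ?opprK.
  rewrite -conjcB cabs_conj; apply: H; first by rewrite im_conj oppr_lt0.
  have -> : conjc z - t%:C = conjc (z - t%:C) by rewrite conjcB; congr (_ - _); apply: complex_eq; rewrite /= ?oppr0.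
  by rewrite cabs_conj.
exists d, Phi, Phi'; split => //.
  by move=> z hz; apply: hP; move: hz; rewrite /side /below /= mulN1r => /andP[h1 h2]; apply/andP; split; lra.
move=> t x x0; have [r r0 H] := lP t x x0; exists r => // z; rewrite mulN1r oppr_gt0 => z0 zr.
have -> : bdry_value (-1) f h t = f t +i* h t by apply: complex_eq; rewrite /= ?opprK ?mul1r.
exact: H.
Qed.

Lemma cder_unique (F : C -> C) z a b : cder F z a -> cder F z b -> a = b.
Proof.
case: z => x y h1 h2; have [r1 i1] := rder_horiz h1; have [r2 i2] := rder_horiz h2.
apply: complex_eq.
  by have [_ <-] := r1; have [_ <-] := r2.
by have [_ <-] := i1; have [_ <-] := i2.
Qed.

Lemma derivable_x_is_derive (g : R * R -> R) (x y : R) : derivable g (x, y) (1, 0) ->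
  is_derive x (1 : R) (fun s => g (s, y)) (partial_x g (x, y)).
Proof.
move=> dg.
have E : (fun h : R => h^-1 *: ((g \o shift (x, y)) (h *: (1, 0)) - g (x, y))) =
         (fun h : R => h^-1 *: (((fun s => g (s, y)) \o shift x) (h *: 1) - g (x, y))).
  apply/funext => h /=; congr (_ *: (g _ - _)).
  by apply: injective_projections; rewrite /= ?scaler0 ?add0r.
split; first by rewrite /derivable -E.
by rewrite /derive -E.
Qed.

Lemma derivable_y_is_derive (g : R * R -> R) (x y : R) : derivable g (x, y) (0, 1) ->
  is_derive y (1 : R) (fun s => g (x, s)) (partial_y g (x, y)).
Proof.
move=> dg.
have E : (fun h : R => h^-1 *: ((g \o shift (x, y)) (h *: (0, 1)) - g (x, y))) =
         (fun h : R => h^-1 *: (((fun s => g (x, s)) \o shift y) (h *: 1) - g (x, y))).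
  apply/funext => h /=; congr (_ *: (g _ - _)).
  by apply: injective_projections; rewrite /= ?scaler0 ?add0r.
split; first by rewrite /derivable -E.
by rewrite /derive -E.
Qed.

Lemma is_derive_derivable_x (g : R * R -> R) (x y c : R) : is_derive x (1 : R) (fun s => g (s, y)) c ->
  derivable g (x, y) (1, 0) /\ partial_x g (x, y) = c.
Proof.
move=> [dg vg].
have E : (fun h : R => h^-1 *: ((g \o shift (x, y)) (h *: (1, 0)) - g (x, y))) =
         (fun h : R => h^-1 *: (((fun s => g (s, y)) \o shift x) (h *: 1) - g (x, y))).
  apply/funext => h /=; congr (_ *: (g _ - _)).
  by apply: injective_projections; rewrite /= ?scaler0 ?add0r.
split; first by rewrite /derivable E.
by rewrite -vg /partial_x /derive E.
Qed.

Lemma is_derive_derivable_y (g : R * R -> R) (x y c : R) : is_derive y (1 : R) (fun s => g (x, s)) c ->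
  derivable g (x, y) (0, 1) /\ partial_y g (x, y) = c.
Proof.
move=> [dg vg].
have E : (fun h : R => h^-1 *: ((g \o shift (x, y)) (h *: (0, 1)) - g (x, y))) =
         (fun h : R => h^-1 *: (((fun s => g (x, s)) \o shift y) (h *: 1) - g (x, y))).
  apply/funext => h /=; congr (_ *: (g _ - _)).
  by apply: injective_projections; rewrite /= ?scaler0 ?add0r.
split; first by rewrite /derivable E.
by rewrite -vg /partial_y /derive E.
Qed.

End SideTransforms.

(** * From a field to analyticity *)

Section FieldToTransform.
Context {R : realType}.
Local Notation C := R[i].
Implicit Types (p q : R * R) (z w : C) (t s k : R).

(* The field [B1 - 'i B2], holomorphic exactly when [B] is divergence and curl free. *)
Definition cfield (B : R * R -> R * R) z : C := conjc (toC (B (toP z))).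

Lemma cfield_hol (V : set (R * R)) (B : R * R -> R * R) : open V -> C1_field V B ->
  (forall p, V p -> divergence B p = 0 /\ curl B p = 0) ->
  exists F', hol1 (fun z => V (toP z)) (cfield B) F'.
Proof.
move=> oV [C1 C2] dc.
pose fx z : C := partial_x (fst \o B) (toP z) +i* (- partial_x (snd \o B) (toP z)).
pose fy z : C := partial_y (fst \o B) (toP z) +i* (- partial_y (snd \o B) (toP z)).
have toPE z : toP z = (re z, im z) by [].
have cpart (g1 g2 : R * R -> R) z : {for toP z, continuous g1} -> {for toP z, continuous g2} ->
    ccont (fun z => g1 (toP z) +i* (- g2 (toP z))) z.
  move=> c1 c2; apply: cont_ccont.
    by rewrite (_ : (fun _ => _) = g1)//; apply/funext => -[].
  rewrite (_ : (fun _ => _) = (fun q => - g2 q)); last by apply/funext => -[].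
  exact: cvgN.
have cfx z : V (toP z) -> ccont fx z.
  by move=> hz; apply: cpart; [have [_ _ h _] := C1 _ hz|have [_ _ h _] := C2 _ hz].
have cfy z : V (toP z) -> ccont fy z.
  by move=> hz; apply: cpart; [have [_ _ _ h] := C1 _ hz|have [_ _ _ h] := C2 _ hz].
exists fx => z hz; split; last exact: cfx.
have [r r0 Hr] := open_toC oV hz; rewrite toPK in Hr.
apply: (@cder_cauchy_riemann R (cfield B) fx fy z r r0) => //.
- move=> w wr; have hw : V (toP w) by apply: Hr; rewrite toPK.
  have [d1 d2 _ _] := C1 _ hw; have [d3 d4 _ _] := C2 _ hw.
  split.
  + exact: derivable_x_is_derive d1.
  + exact: is_deriveN (derivable_x_is_derive d3).
  + exact: derivable_y_is_derive d2.
  + exact: is_deriveN (derivable_y_is_derive d4).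
- exact: cfx.
- exact: cfy.
(* Vanishing divergence and curl amount to [fy = 'i * fx]. *)
have [dv cl] := dc _ hz; move: dv cl; rewrite /divergence /curl /fx /fy.
move: (partial_x _ _) (partial_y _ _) (partial_x _ _) (partial_y _ _) => a b c x h1 h2.
by apply: complex_eq; rewrite !reimE /=; lra.
Qed.

(** With [b] the field and [g] the velocity as complex numbers, the real part of [conjc b * g] is
    their inner product; its imaginary part carries the normal component in [dot_normal]. *)
Lemma dot_tangent (b g : C) k : k = 1 \/ k = -1 -> g != 0 ->
  re (conjc b * g) = k * cabs g * re (b * conjc (k%:C * g / (cabs g)%:C)).
Proof.
move=> kk g0; have c0 : cabs g != 0 by rewrite cabs_eq0.
have kk1 : k * k = 1 by case: kk => ->; ring.
have -> : k%:C * g / (cabs g)%:C = (k / cabs g)%:C * g by rewrite rmorphM fmorphV /=; ring.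
have cr (x : R) (z : C) : conjc (x%:C * z) = x%:C * conjc z.
  by rewrite conjcM; congr (_ * _); apply: complex_eq; rewrite /= ?oppr0.
rewrite cr mulrCA re_realM mulrA.
have -> : k * cabs g * (k / cabs g) = 1 by rewrite -[RHS]kk1; field.
by rewrite mul1r !reM !re_conj !im_conj; ring.
Qed.

Lemma dot_normal (b g : C) k : k = 1 \/ k = -1 -> g != 0 ->
  im (conjc b * g) = - k * cabs g * re (b * conjc (k%:C * 'i * g / (cabs g)%:C)).
Proof.
move=> kk g0; have c0 : cabs g != 0 by rewrite cabs_eq0.
have kk1 : k * k = 1 by case: kk => ->; ring.
have -> : k%:C * 'i * g / (cabs g)%:C = (k / cabs g)%:C * ('i * g) by rewrite rmorphM fmorphV /=; ring.
have cr (x : R) (z : C) : conjc (x%:C * z) = x%:C * conjc z.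
  by rewrite conjcM; congr (_ * _); apply: complex_eq; rewrite /= ?oppr0.
rewrite cr mulrCA re_realM mulrA.
have -> : - k * cabs g * (k / cabs g) = - 1 by rewrite -[in RHS]kk1; field.
rewrite mulN1r conjcM !reM !imM !re_conj !im_conj.
have -> : re 'i = 0 :> R by [].
have -> : im 'i = 1 :> R by [].
ring.
Qed.

Variables (Omega : set (R * R)) (gamma : R -> R * R) (tau nu : R * R -> R * R) (f h : R * R -> R)
  (G G' G'' : C -> C) (d e Bd N k l : R).
Hypotheses (oO : open Omega) (cd : curve_data gamma G G' G'' d e Bd N)
  (rng : range gamma = boundary Omega)
  (kk : k = 1 \/ k = -1) (ll : l = 1 \/ l = -1)
  (tE : forall t, toC (tau (gamma t)) = k%:C * G' t%:C / (cabs (G' t%:C))%:C)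
  (nE : forall t, toC (nu (gamma t)) = l%:C * 'i * G' t%:C / (cabs (G' t%:C))%:C)
  (outer : forall z, side l e z -> ~ closure Omega (toP (G z)))
  (pg : forall t, gamma (t + 2 * pi) = gamma t) (f_C1 : C1_on_curve gamma f) (h_C1 : C1_on_curve gamma h).

Definition closed_side k (d : R) : set C := fun z => 0 <= k * im z < d.

(* Retraction onto the closed exterior side, which makes the field on that side continuous on a whole strip. *)
Definition clamp z : C := re z +i* (l * Num.max (l * im z) 0).

Lemma max0_dist (a b : R) : `|Num.max a 0 - Num.max b 0| <= `|a - b|.
Proof.
have [a0|a0] := leP a 0; have [b0|b0] := leP b 0; rewrite ?subrr ?normr0//.
- by rewrite sub0r normrN gtr0_norm// distrC ler_normr; apply/orP; left; lra.
- by rewrite subr0 gtr0_norm// ler_normr; apply/orP; left; lra.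
Qed.

Lemma clamp_dist z w : cabs (clamp z - clamp w) <= 2 * cabs (z - w).
Proof.
have l1 : `|l| = 1 by case: ll => ->; rewrite ?normrN normr1.
apply: le_trans (cabs_le _) _; rewrite reB imB !(reCI, imCI) -mulrBr normrM l1 mul1r.
rewrite mulr2n mulrDl mul1r; apply: lerD; first by rewrite -reB re_le_cabs.
apply: le_trans (max0_dist _ _) _; rewrite -mulrBr normrM l1 mul1r -imB.
exact: im_le_cabs.
Qed.

Lemma clamp_id z : 0 <= l * im z -> clamp z = z.
Proof.
move=> h0; rewrite /clamp max_l// mulrA.
have -> : l * l = 1 by case: ll => ->; ring.
by rewrite mul1r complex_eta.
Qed.

Lemma clamp_side (dl : R) z : strip dl z -> closed_side l dl (clamp z).
Proof.
rewrite /strip /closed_side imCI mulrA => hz.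
have -> : l * l = 1 by case: ll => ->; ring.
rewrite mul1r le_max lexx orbT /= gt_max; apply/andP; split; last exact: le_lt_trans (normr_ge0 _) hz.
apply: le_lt_trans (ler_norm _) _; rewrite normrM.
have l1 : `|l| = 1 by case: ll => ->; rewrite ?normrN normr1.
by rewrite l1 mul1r.
Qed.

Lemma field_transform (U : set (R * R)) (B : R * R -> R * R) : open U -> closure Omega `<=` U ->
  C1_field (U `\` closure Omega) B -> {within U `\` Omega, continuous B} ->
  (forall p, (U `\` closure Omega) p -> divergence B p = 0 /\ curl B p = 0) ->
  (forall v, boundary Omega v -> dot (B v) (tau v) = f v) ->
  (forall v, boundary Omega v -> dot (B v) (nu v) = h v) ->
  analytic_everywhere (fun t => k * weighted gamma G' f t - circle_transform (weighted gamma G' h) t).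
Proof.
move=> oU cU C1B cB dc Bt Bn.
have [df Cf] := weighted_C1per cd pg f_C1.
have [dh Ch] := weighted_C1per cd pg h_C1.
have Ckf : C1per (fun t => k * weighted gamma G' f t) (fun t => 0 * weighted gamma G' f t + k * df t).
  apply: C1perM Cf; split => // t; first exact: is_derive_cst.
  exact: cvg_cst.
have e0 := cd_e0 cd. have d0 := lt_trans e0 (cd_ed cd).
have hG : hol1 (strip e) G G' by apply: hol1_sub (cd_hol cd) => z hz; exact: lt_trans hz (cd_ed cd).
have hG' : hol1 (strip e) G' G'' by apply: hol1_sub (cd_hol' cd) => z hz; exact: lt_trans hz (cd_ed cd).
have gamma_bd t : boundary Omega (toP (G t%:C)) by rewrite -rng -(cd_val cd); exists t.
have gamma_cl t : closure Omega (toP (G t%:C)) by have [] := gamma_bd t.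
(* The strip is narrowed until its image lies in [U]. *)
have [t|z m|dl0 dl00 Hdl] := @strip_open R (fun z => U (toP (G z))).
- have [r r0 Hr] := open_toC oU (cU _ (gamma_cl t)); rewrite toPK in Hr.
  have [hd _] := hG _ (strip_real t e0).
  have [r1 r10 H1] := cder_ccont hd r0.
  by exists r1 => // w /H1 hw; apply: Hr; rewrite toPK.
- by rewrite (per_int (cd_per cd)).
pose dl := Num.min dl0 e.
have dl_gt0 : 0 < dl by rewrite lt_min dl00.
have sdl z : strip dl z -> U (toP (G z)) /\ strip e z.
  by move=> hz; split; [apply: Hdl; exact: strip_minl hz|exact: strip_minr hz].
have side_s z : side l dl z -> strip dl z by exact: side_strip.
have side_U z : side l dl z -> (U `\` closure Omega) (toP (G z)).
  move=> hz; have [Uz ez_] := sdl _ (side_s z hz); split => //; apply: outer.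
  move: hz => /andP[h1 h2]; apply/andP; split => //.
  by apply: lt_le_trans h2 _; rewrite ge_min lexx orbT.
have cside_U z : closed_side l dl z -> (U `\` Omega) (toP (G z)).
  move=> /andP[h1 h2]; move: h1; rewrite le_eqVlt => /orP[/eqP h1|h1].
    have iz : im z = 0.
      by move/esym/eqP: h1; rewrite mulf_eq0 => /orP[|/eqP//]; case: ll => ->; rewrite ?oppr_eq0 oner_eq0.
    have zE : z = (re z)%:C by exact: complex_eq.
    rewrite zE; split; first exact: cU.
    by have := gamma_bd (re z); rewrite boundary_open// => -[].
  have [h3 h4] := side_U z (introT andP (conj h1 h2)); split => // /subset_closure; exact: h4.
have oV : open (U `\` closure Omega).
  by rewrite setDE; apply: openI => //; rewrite openC; exact: closed_closure.
have [F' hF] := cfield_hol oV C1B dc.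
pose Psi z := cfield B (G z) * G' z.
have hPsi : exists g, hol1 (side l dl) Psi g.
  have s1 : side l dl `<=` strip e by move=> z /side_s /sdl [].
  have h1 := hol1_comp (hol1_sub s1 hG) hF side_U.
  by eexists; exact: hol1M h1 (hol1_sub s1 hG').
have [Psi' hP] := hPsi.
have pPsi : per Psi by move=> z; rewrite /Psi (cd_per cd) (cd_per' cd).
pose Psic z := Psi (clamp z).
have cPsic z : strip dl z -> ccont Psic z.
  move=> hz; have hc := clamp_side hz.
  have hcs : strip e (clamp z).
    have : strip dl (clamp z).
      move: hc => /andP[h1 h2]; rewrite /strip.
      by move: h1 h2; case: ll => ->; rewrite ?mul1r ?mulN1r ltr_norml => *; apply/andP; split; lra.
    by move=> /sdl [].
  have [hd cG'] := hG _ hcs.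
  have cclamp : ccont clamp z by apply: (@ccont_lip R clamp z 1 2) => // w _; exact: clamp_dist.
  apply: ccontM; last exact: ccont_comp cclamp cG'.
  move=> x x0; have [r r0 Hr] := (within_toC _ _).1 cB _ (cside_U _ hc) x x0.
  have [r1 r10 H1] := ccont_comp cclamp (cder_ccont hd) r0.
  have [r2 r20 H2] := strip_nbhs hz.
  exists (Num.min r1 r2); first by rewrite lt_min r10.
  move=> w; rewrite lt_min => /andP[w1 w2].
  rewrite /cfield -conjcB cabs_conj; apply: Hr.
    by apply: cside_U; apply: clamp_side; exact: H2.
  by rewrite !toPK; exact: H1.
have pPsic : per Psic.
  move=> z; have E : clamp (z + (2 * pi)%:C) = clamp z + (2 * pi)%:C.
    by apply: complex_eq; rewrite /clamp !(reD, imD) !(reCI, imCI) ?imC ?reC ?addr0.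
  by rewrite /Psic E pPsi.
have [M HM] := per_bounded dl_gt0 cPsic pPsic.
have PsicE z : 0 <= l * im z -> Psic z = Psi z by move=> h0; rewrite /Psic clamp_id.
have val t : Psi t%:C = bdry_value l (fun t => k * weighted gamma G' f t) (weighted gamma G' h) t.
  have g0 : G' t%:C != 0 by apply: (cd_nz cd); exact: strip_real.
  pose b := toC (B (toP (G t%:C))).
  have t1 := Bt _ (gamma_bd t); have n1 := Bn _ (gamma_bd t).
  rewrite -(cd_val cd) dotE tE in t1; rewrite -(cd_val cd) dotE nE in n1.
  apply: complex_eq.
    by rewrite /Psi /cfield (dot_tangent _ kk g0) -(cd_val cd) t1 reCI /weighted /speed mulrA.
  by rewrite /Psi /cfield (dot_normal _ ll g0) -(cd_val cd) n1 imCI /weighted /speed mulrA.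
(* [per_bounded] gives its bound on half the width of the strip. *)
have dl2 : 0 < dl / 2 by rewrite divr_gt0.
have s2 : side l (dl / 2) `<=` side l dl.
  by move=> z /andP[h1 h2]; apply/andP; split => //; apply: lt_trans h2 _; rewrite ltr_pdivrMr// ltr_pMr// ltr1n.
apply: (side_transform_analytic (M := M) ll Ckf Ch dl2 (hol1_sub s2 hP) pPsi).
  move=> z hz; have /andP[h1 h2] := hz; rewrite -PsicE; last exact: ltW.
  apply: HM; apply: ltW.
  exact: (side_strip ll hz).
move=> t x x0; have [r r0 H] := cPsic _ (strip_real t dl_gt0) x x0.
exists r => // z /andP[h1 h2] zr; have := H z zr.
rewrite PsicE; last exact: ltW.
by rewrite PsicE ?imC ?mulr0// val.
Qed.

End FieldToTransform.

(** * Fields from holomorphic functions *)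

Section HolomorphicFields.
Context {R : realType}.
Local Notation C := R[i].
Implicit Types (p q : R * R) (z w : C) (t s k : R).

(** Differentiates a function transported by [G] without constructing a local inverse: points near
    [G z0] have preimages whose distance to [z0] is bounded linearly, so an error small against
    [z - z0] is small against [w - G z0]. *)
Lemma cder_push (G Q F : C -> C) z0 a b (K : R) : cder G z0 a -> a != 0 -> cder Q z0 b -> 0 < K ->
  F (G z0) = Q z0 ->
  (forall r : R, 0 < r -> exists2 rho : R, 0 < rho & forall w, cabs (w - G z0) < rho ->
    exists z, [/\ cabs (z - z0) < r, G z = w, F w = Q z & cabs (z - z0) <= K * cabs (w - G z0)]) ->
  cder F (G z0) (b / a).
Proof.
move=> [rG [cG G0 GE]] a0 [pQ [cQ Q0 QE]] K0 F0 H; apply/cderP => e e0.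
pose E z := pQ z - b / a * rG z.
have cE : ccont E z0 by apply: ccontB => //; apply: ccontM => //; exact: ccont_cst.
have E0 : E z0 = 0 by rewrite /E G0 Q0 divfK// subrr.
have [r r0 Hr] := cE _ (divr_gt0 e0 K0).
have [rho rho0 Hrho] := H r r0; exists rho => // w /Hrho [z [zr Gz Fz zK]].
have -> : F w - F (G z0) - b / a * (w - G z0) = E z * (z - z0).
  by rewrite F0 Fz QE -Gz GE /E; ring.
rewrite cabsM; have := Hr z zr; rewrite E0 subr0 ltr_pdivlMr// => h1.
apply: le_trans (ler_wpM2l (cabs_ge0 _) zK) _; rewrite mulrA.
by apply: ler_wpM2r; [exact: cabs_ge0|exact: ltW].
Qed.

Lemma toC_continuous (V : set (R * R)) (g : R * R -> R) (F : C -> C) p : open V -> V p ->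
  (forall q, V q -> g q = re (F (toC q))) -> ccont F (toC p) -> {for p, continuous g}.
Proof.
move=> oV Vp gF cF; apply/cvgrPdist_lt => x x0.
have [r r0 Hr] := cF x x0; have [r1 r10 H1] := open_toC oV Vp.
apply/toC_nbhs; exists (Num.min r r1); first by rewrite lt_min r0.
move=> q; rewrite lt_min => /andP[q1 q2].
rewrite !gF//; last exact: H1.
by rewrite -reB (le_lt_trans (re_le_cabs _))// cabsBC Hr.
Qed.

Lemma hol_C1_field (V : set (R * R)) (F F' : C -> C) : open V -> hol1 (fun z => V (toP z)) F F' ->
  let B p := toP (conjc (F (toC p))) in
  C1_field V B /\ forall p, V p -> divergence B p = 0 /\ curl B p = 0.
Proof.
move=> oV hF B.
have hp p : V p -> [/\ derivable (fst \o B) p (1, 0) /\ partial_x (fst \o B) p = re (F' (toC p)),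
    derivable (fst \o B) p (0, 1) /\ partial_y (fst \o B) p = re ('i * F' (toC p)),
    derivable (snd \o B) p (1, 0) /\ partial_x (snd \o B) p = re ('i * F' (toC p)) &
    derivable (snd \o B) p (0, 1) /\ partial_y (snd \o B) p = re (- F' (toC p))].
  case: p => x y Vp; have [hd _] : cder F (x +i* y) (F' (x +i* y)) /\ ccont F' (x +i* y).
    exact: hF.
  have [hx1 hx2] := rder_horiz hd; have [hy1 hy2] := rder_vert hd.
  split.
  - apply: is_derive_derivable_x; rewrite (_ : (fun s => _) = (fun s => re (F (s +i* y))))//.
    by apply/funext => s; rewrite /B /toP /= re_conj.
  - apply: is_derive_derivable_y; rewrite (_ : (fun s => _) = (fun s => re (F (x +i* s))))//.
    by apply/funext => s; rewrite /B /toP /= re_conj.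
  - apply: is_derive_derivable_x; rewrite (_ : (fun s => _) = - (fun s => im (F (s +i* y)))).
      have -> : re ('i * F' (toC (x, y))) = - im (F' (x +i* y)).
        by rewrite /toC /=; move: (F' _) => v; rewrite reM /=; ring.
      exact: is_deriveN.
    by apply/funext => s; rewrite /B /toP /= im_conj.
  - apply: is_derive_derivable_y; rewrite (_ : (fun s => _) = - (fun s => im (F (x +i* s)))).
      have -> : re (- F' (toC (x, y))) = - im ('i * F' (x +i* y)).
        by rewrite /toC /=; move: (F' _) => v; rewrite reN imM /=; ring.
      exact: is_deriveN.
    by apply/funext => s; rewrite /B /toP /= im_conj.
have cF p : V p -> ccont F' (toC p) by move=> Vp; have [|] := hF (toC p); rewrite ?toCK.
have ci p : V p -> ccont (fun w => 'i * F' w) (toC p).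
  by move=> Vp; apply: ccontM; [exact: ccont_cst|exact: cF].
split.
  split=> p Vp; have [[a1 _] [a2 _] [a3 _] [a4 _]] := hp p Vp; split; [exact: a1|exact: a2| | |exact: a3|exact: a4| |].
  - by apply: (toC_continuous oV Vp _ (cF p Vp)) => q Vq; have [[_ h] _ _ _] := hp q Vq; exact: h.
  - by apply: (toC_continuous oV Vp _ (ci p Vp)) => q Vq; have [_ [_ h] _ _] := hp q Vq; exact: h.
  - by apply: (toC_continuous oV Vp _ (ci p Vp)) => q Vq; have [_ _ [_ h] _] := hp q Vq; exact: h.
  - by apply: (toC_continuous oV Vp _ (ccontN (cF p Vp))) => q Vq; have [_ _ _ [_ h]] := hp q Vq; exact: h.
move=> p /hp [[_ x1] [_ y1] [_ x2] [_ y2]].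
by rewrite /divergence /curl x1 y1 x2 y2 reN !subrr.
Qed.

End HolomorphicFields.

(** * Construction of the field *)

Section TransformField.
Context {R : realType}.
Local Notation C := R[i].
Implicit Types (p q : R * R) (z w : C) (t s k : R).

Variables (Omega : set (R * R)) (gamma : R -> R * R) (tau nu : R * R -> R * R) (f h : R * R -> R)
  (G G' G'' : C -> C) (d e Bd N k l : R).
Hypotheses (oO : open Omega) (cd : curve_data gamma G G' G'' d e Bd N)
  (rng : range gamma = boundary Omega) (cO : path_connected Omega)
  (kk : k = 1 \/ k = -1) (ll : l = 1 \/ l = -1)
  (tE : forall t, toC (tau (gamma t)) = k%:C * G' t%:C / (cabs (G' t%:C))%:C)
  (nE : forall t, toC (nu (gamma t)) = l%:C * 'i * G' t%:C / (cabs (G' t%:C))%:C)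
  (outer : forall z, side l e z -> ~ closure Omega (toP (G z)))
  (inner : forall z, side (- l) e z -> Omega (toP (G z)))
  (pg : forall t, gamma (t + 2 * pi) = gamma t) (f_C1 : C1_on_curve gamma f) (h_C1 : C1_on_curve gamma h)
  (an : analytic_everywhere (fun t => k * weighted gamma G' f t - circle_transform (weighted gamma G' h) t)).

(** [U] is the closure of [Omega] together with the image of a strip, and on the outer side the
    field is the conjugate of [Psi / G'] transported by [G]. *)
Lemma transform_field : exists (U : set (R * R)) (B : R * R -> R * R),
  [/\ open U, connected U & closure Omega `<=` U] /\
  [/\ C1_field (U `\` closure Omega) B,
      {within U `\` Omega, continuous B},
      forall p, (U `\` closure Omega) p -> divergence B p = 0 /\ curl B p = 0,
      forall v, boundary Omega v -> dot (B v) (tau v) = f v &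
      forall v, boundary Omega v -> dot (B v) (nu v) = h v].
Proof.
have [df Cf] := weighted_C1per cd pg f_C1.
have [dh Ch] := weighted_C1per cd pg h_C1.
have e0 := cd_e0 cd. have ed := cd_ed cd.
pose kf t := k * weighted gamma G' f t.
have pkf t : kf (t + 2 * pi) = kf t by rewrite /kf; have [-> _ _] := Cf.
have [d' [Psi [Psi' [d'0 hP pP lP]]]] := side_transform_extension ll pkf Ch an.
pose dl := Num.min d' e.
have dl0 : 0 < dl by rewrite lt_min d'0.
have sdl z : strip dl z -> strip e z by exact: strip_minr.
have se z : strip e z -> strip d z by move=> hz; exact: lt_trans hz ed.
have hG : hol1 (strip dl) G G' by apply: hol1_sub (cd_hol cd) => z /sdl /se.
have hG' : hol1 (strip dl) G' G'' by apply: hol1_sub (cd_hol' cd) => z /sdl /se.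
have nz z : strip dl z -> G' z != 0 by move=> /sdl; exact: (cd_nz cd).
have chord z w : strip dl z -> strip dl w -> cabs (ez z - ez w) <= N * cabs (G z - G w).
  by move=> /sdl hz /sdl hw; exact: (cd_chord cd).
have gamma_bd t : boundary Omega (toP (G t%:C)) by rewrite -rng -(cd_val cd); exists t.
have gamma_cl t : closure Omega (toP (G t%:C)) by have [] := gamma_bd t.
have om := strip_open_mapping hG nz.
pose u t := bdry_value l kf (weighted gamma G' h) t.
have pu t : u (t + 2 * pi) = u t by rewrite /u /bdry_value pkf; have [-> _ _] := Ch.
have cu t : forall x : R, 0 < x -> exists2 r : R, 0 < r & forall s, `|s - t| < r -> cabs (u s - u t) < x.
  move=> x x0; have x2 : 0 < x / 2 by rewrite divr_gt0.
  have l1 : `|l| = 1 by case: ll => ->; rewrite ?normrN normr1.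
  have k1 : `|k| = 1 by case: kk => ->; rewrite ?normrN normr1.
  have cf : continuous (weighted gamma G' f) := C1per_cont Cf.
  have ch : continuous (weighted gamma G' h) := C1per_cont Ch.
  have /cvgrPdist_lt/(_ _ x2)/nbhs_ballP[r1 r10 H1] := cf t.
  have /cvgrPdist_lt/(_ _ x2)/nbhs_ballP[r2 r20 H2] := ch t.
  exists (Num.min r1 r2); first by rewrite lt_min r10.
  move=> s; rewrite lt_min => /andP[s1 s2].
  apply: le_lt_trans (cabs_le _) _; rewrite reB imB /u /bdry_value !(reCI, imCI) /kf -!mulrBr !normrM normrN k1 l1 !mul1r.
  rewrite [ltRHS]splitr; apply: ltrD; rewrite distrC.
    by apply: H1; rewrite /ball /= distrC.
  by apply: H2; rewrite /ball /= distrC.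
(* Off the outer side the boundary value is continued along verticals; [Hx] is then continuous on
   the whole strip, which spares a one-sided argument at the curve. *)
pose Hx z := (if 0 < l * im z then Psi z else u (re z)) / G' z.
have pHx : per Hx.
  move=> z; rewrite /Hx imD imC addr0 pP (cd_per' cd).
  by rewrite reD reC pu.
have strip_im z0 z : `|l * im z - l * im z0| <= cabs (z - z0).
  have l1 : `|l| = 1 by case: ll => ->; rewrite ?normrN normr1.
  by rewrite -mulrBr normrM l1 mul1r -imB im_le_cabs.
have sabs z : strip dl z -> l * im z < dl.
  rewrite /strip ltr_norml => /andP[h1 h2].
  by case: ll => ->; rewrite ?mul1r ?mulN1r//; lra.
pose n z := if 0 < l * im z then Psi z else u (re z).
have cn z0 : strip dl z0 -> ccont n z0.
  move=> hz0; have [z0p|z0n] := ltP 0 (l * im z0).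
    have hs : side l d' z0.
      by rewrite /side z0p; apply: lt_le_trans (sabs _ hz0) _; rewrite ge_min lexx.
    have [hd _] := hP _ hs.
    apply: (ccont_local (f := Psi) z0p) (cder_ccont hd) => w hw.
    rewrite /n ifT//; have := le_lt_trans (strip_im z0 w) hw.
    by rewrite ltr_norml => /andP[]; lra.
  have real_part x : 0 < x -> exists2 r : R, 0 < r & forall z, cabs (z - z0) < r -> cabs (u (re z) - u (re z0)) < x.
    move=> x0; have [r r0 Hr] := cu (re z0) x x0; exists r => // z hz; apply: Hr.
    by rewrite -reB; exact: le_lt_trans (re_le_cabs _) hz.
  have nz0 : n z0 = u (re z0) by rewrite /n ltNge z0n.
  move: z0n; rewrite le_eqVlt => /orP[/eqP z00|z0n] x x0; have [r r0 Hr] := real_part x x0.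
    have iz : im z0 = 0.
      by move/eqP: z00; rewrite mulf_eq0 => /orP[|/eqP//]; case: ll => ->; rewrite ?oppr_eq0 oner_eq0.
    have zE : z0 = (re z0)%:C by exact: complex_eq.
    have [r1 r10 H1] := lP (re z0) x x0.
    exists (Num.min r r1); first by rewrite lt_min r0.
    move=> z; rewrite lt_min => /andP[hz1 hz2]; rewrite nz0 /n; case: ifP => hz.
      by apply: H1 => //; rewrite -zE.
    exact: Hr.
  exists (Num.min r (- (l * im z0))); first by rewrite lt_min r0 oppr_gt0.
  move=> z; rewrite lt_min => /andP[hz1 hz2]; rewrite nz0 /n ifF; first exact: Hr.
  apply/negbTE; rewrite -leNgt; have := le_lt_trans (strip_im z0 z) hz2.
  by rewrite ltr_norml => /andP[]; lra.
have cHx z0 : strip dl z0 -> ccont Hx z0.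
  move=> hz0; apply: ccontM; first exact: cn.
  by apply: ccontV; [exact: nz|exact: (hG _ hz0).2].
(* Any preimage in the strip will do: two of them differ by a multiple of the period, and [Hx] is
   periodic. *)
pose inv p : C := xget 0 [set z | strip dl z /\ G z = toC p].
have invP z : strip dl z -> strip dl (inv (toP (G z))) /\ G (inv (toP (G z))) = G z.
  move=> hz; have : [set w | strip dl w /\ G w = toC (toP (G z))] (inv (toP (G z))).
    by apply: (@xgetPex _ 0 [set w | strip dl w /\ G w = toC (toP (G z))]); exists z; rewrite toPK.
  by move=> [h1 h2]; split => //; rewrite h2 toPK.
have inv_shift z : strip dl z -> exists m : int, inv (toP (G z)) = z + (2 * pi * m%:~R)%:C.
  by move=> hz; have [h1 h2] := invP z hz; apply: ez_eq_shift; exact: (strip_ez chord h1 hz h2).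
have Hx_inv z : strip dl z -> Hx (inv (toP (G z))) = Hx z.
  by move=> /inv_shift [m ->]; rewrite (per_int pHx).
pose F w := Hx (inv (toP w)).
have FG z : strip dl z -> F (G z) = Hx z by exact: Hx_inv.
pose B p := toP (conjc (F (toC p))).
pose Im : set (R * R) := [set toP (G z) | z in strip dl].
pose U := closure Omega `|` Im.
have oIm : open Im.
  apply: toC_open => p [z hz <-]; have [rho rho0 H] := om z hz 1 ltr01.
  exists rho => // q; rewrite toPK => /H [w [hw _ Gw _]].
  by exists w => //; rewrite Gw toCK.
(* Every boundary point lies on the curve, hence in the open set [Im]; this makes [U] open. *)
have UE : U = Omega `|` Im.
  apply/seteqP; split=> p [hp|hp]; try by right.
    have [Op|nOp] := pselect (Omega p); [by left|right].
    have : boundary Omega p by rewrite boundary_open.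
    by rewrite -rng => -[t _ <-]; exists t%:C; rewrite ?(cd_val cd)//; exact: strip_real.
  by left; exact: subset_closure.
have minus_l : - l = 1 \/ - l = -1 by case: ll => ->; [right|left; rewrite opprK].
have outside p : (U `\` Omega) p -> exists z, [/\ strip dl z, 0 <= l * im z & p = toP (G z)].
  rewrite UE => -[[//|[z hz <-]] nOp]; exists z; split => //.
  rewrite leNgt; apply/negP => zn; apply: nOp; apply: inner.
  rewrite /side mulNr oppr_gt0 zn /=.
  have := sdl _ hz; rewrite /strip ltr_norml => /andP[h1 h2].
  by case: ll => ->; rewrite ?mul1r ?mulN1r; lra.
have outside' p : (U `\` closure Omega) p -> exists z, [/\ strip dl z, 0 < l * im z & p = toP (G z)].
  move=> [Up nc]; have [|z [h1 h2 h3]] := outside p; first by split => // /subset_closure.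
  exists z; split => //; rewrite lt_neqAle h2 andbT eq_sym; apply/eqP => z0.
  have iz : im z = 0.
    by move/eqP: z0; rewrite mulf_eq0 => /orP[|/eqP//]; case: ll => ->; rewrite ?oppr_eq0 oner_eq0.
  have zE : z = (re z)%:C by exact: complex_eq.
  by apply: nc; rewrite h3 zE.
have oU : open U by rewrite UE; apply: openU.
have oV : open (U `\` closure Omega).
  by rewrite setDE; apply: openI => //; rewrite openC; exact: closed_closure.
(* The preimages from [strip_open_mapping], with their linear bound, make [cder_push] applicable;
   the derivative is [Q' / G'] at any preimage. *)
have [F' hF] : exists F', hol1 (fun w => (U `\` closure Omega) (toP w)) F F'.
  pose Q z := Psi z / G' z.
  pose Q' z := Psi' z * (G' z)^-1 + Psi z * (- G'' z / G' z ^+ 2).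
  pose S z := strip dl z /\ 0 < l * im z.
  have Sd z : S z -> side l d' z.
    by move=> [h1 h2]; rewrite /side h2; apply: lt_le_trans (sabs _ h1) _; rewrite ge_min lexx.
  have hQ : hol1 S Q Q'.
    apply: hol1M; first by apply: hol1_sub hP => z; exact: Sd.
    move=> z [hz _]; have [h1 h2] := hG' z hz; have gz := nz z hz; split; first exact: cderV.
    apply: ccontM; first exact: ccontN.
    by apply: ccontV; [rewrite expf_neq0|apply: ccontX; exact: cder_ccont h1].
  have openS z : S z -> exists2 r : R, 0 < r & forall w, cabs (w - z) < r -> S w.
    move=> [h1 h2]; have [r r0 Hr] := strip_nbhs h1.
    exists (Num.min r (l * im z)); first by rewrite lt_min r0.
    move=> w; rewrite lt_min => /andP[w1 w2]; split; first exact: Hr.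
    by have := le_lt_trans (strip_im z w) w2; rewrite ltr_norml => /andP[]; lra.
  have HxQ z : S z -> Hx z = Q z by move=> [_ h2]; rewrite /Hx h2.
  have loc z : S z -> forall r : R, 0 < r -> exists2 rho : R, 0 < rho & forall w, cabs (w - G z) < rho ->
      exists v, [/\ cabs (v - z) < r, G v = w, S v & cabs (v - z) <= 2 / cabs (G' z) * cabs (w - G z)].
    move=> Sz r r0; have [r1 r10 H1] := openS z Sz.
    have q0 : 0 < Num.min r r1 by rewrite lt_min r0.
    have [rho rho0 H] := om z Sz.1 _ q0; exists rho => // w hw.
    have [|v [h1 h2 h3 h4]] := H (toP w); first by rewrite toPK.
    move: h2; rewrite lt_min => /andP[h2 h5]; rewrite toPK in h3 h4.
    by exists v; split => //; exact: H1.
  have dF z : S z -> cder F (G z) (Q' z / G' z).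
    move=> Sz; have gz := nz z Sz.1.
    apply: (@cder_push _ G Q F z (G' z) (Q' z) (2 / cabs (G' z))) => //.
    - by have [] := hG z Sz.1.
    - by have [] := hQ z Sz.
    - by rewrite divr_gt0// cabs_gt0.
    - by rewrite FG ?HxQ//; exact: Sz.1.
    - move=> r r0; have [rho rho0 H] := loc z Sz r r0; exists rho => // w /H [v [h1 h2 h3 h4]].
      by exists v; split => //; rewrite -h2 FG ?HxQ//; exact: h3.1.
  pose F' w := Q' (inv (toP w)) / G' (inv (toP w)).
  have F'G z : S z -> F' (G z) = Q' z / G' z.
    move=> Sz; have [h1 h2] := invP z Sz.1; have [m hm] := inv_shift z Sz.1.
    have Si : S (inv (toP (G z))) by split => //; rewrite hm imD imC addr0; exact: Sz.2.
    by apply: (@cder_unique _ F (G z)); [rewrite -h2; rewrite /F' ?h2; have := dF _ Si; rewrite h2|exact: dF].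
  exists F' => w /outside' [z [h1 h2 h3]].
  have wE : w = G z by rewrite -[LHS]toPK h3 toPK.
  have Sz : S z by [].
  rewrite wE F'G//; split; first exact: dF.
  have cq : ccont (fun v => Q' v / G' v) z.
    apply: ccontM; first by have [] := hQ z Sz.
    by apply: ccontV; [exact: nz|exact: (hG _ h1).2].
  move=> x x0; have [r r0 Hr] := cq x x0; have [rho rho0 H] := loc z Sz r r0.
  exists rho => // v /H [y [y1 y2 y3 _]]; rewrite -y2 !F'G//; exact: Hr.
have [C1B dc] := hol_C1_field oV hF.
exists U, B; split.
  split => //.
    apply: connectedU; last exact: strip_image_connected dl0 hG.
      by exists (toP (G 0%:C)); split; [exact: gamma_cl|exists 0%:C => //; exact: strip_real].
    by apply: connected_closure; exact: path_connected_connected.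
  by move=> p hp; left.
have bval t : toC (B (gamma t)) = conjc (u t / G' t%:C).
  rewrite /B (cd_val cd) !toPK FG; last exact: strip_real.
  by rewrite /Hx imC mulr0 ltxx reC.
split => //.
- apply/within_toC => p hp x x0; have [z [h1 h2 h3]] := outside p hp.
  have [r r0 Hr] := cHx z h1 x x0; have [rho rho0 H] := om z h1 r r0.
  exists rho => // q hq; rewrite h3 toPK => /H [w [w1 w2 w3 _]].
  have qE : toC q = G w by [].
  rewrite /B !toPK qE !FG// -conjcB cabs_conj; exact: Hr.
- move=> v; rewrite -rng => -[t _ <-].
  have g0 := nz _ (strip_real t dl0).
  have := dot_tangent (toC (B (gamma t))) kk g0.
  rewrite -tE -dotE bval conjcK divfK// /u /bdry_value reCI /kf /weighted /speed => E.
  have c0 : k * cabs (G' t%:C) != 0.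
    by rewrite mulf_neq0 ?cabs_eq0//; case: kk => ->; rewrite ?oppr_eq0 oner_eq0.
  by apply/esym; apply: (mulfI c0); rewrite -E mulrA.
- move=> v; rewrite -rng => -[t _ <-].
  have g0 := nz _ (strip_real t dl0).
  have := dot_normal (toC (B (gamma t))) ll g0.
  rewrite -nE -dotE bval conjcK divfK// /u /bdry_value imCI /weighted /speed => E.
  have c0 : - l * cabs (G' t%:C) != 0.
    by rewrite mulf_neq0 ?cabs_eq0// oppr_eq0; case: ll => ->; rewrite ?oppr_eq0 oner_eq0.
  by apply/esym; apply: (mulfI c0); rewrite -E mulrA.
Qed.

End TransformField.

Theorem theorem2p3 (R : realType) (Omega : set (R * R))
    (gamma : R -> R * R) (tau nu : R * R -> R * R) (f h : R * R -> R)
    (Omega_open : open Omega)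
    (Omega_bounded : bounded_set Omega)
    (Omega_simply_connected : simply_connected Omega)
    (gamma_param : analytic_parameterisation gamma (boundary Omega))
    (tau_tangent : unit_tangent gamma tau)
    (nu_normal : unit_outward_normal Omega gamma nu)
    (f_C1 : C1_on_curve gamma f)
    (h_C1 : C1_on_curve gamma h) :
  (exists (U : set (R * R)) (B : R * R -> R * R),
      [/\ open U, connected U & closure Omega `<=` U] /\
      [/\ C1_field (U `\` closure Omega) B,
          {within U `\` Omega, continuous B},
          forall p, (U `\` closure Omega) p -> divergence B p = 0 /\ curl B p = 0,
          forall v, boundary Omega v -> dot (B v) (tau v) = f v &
          forall v, boundary Omega v -> dot (B v) (nu v) = h v])
  <->
  analytic_on_curve gamma (fun v => f v - hilbert_transform gamma tau h v).
Proof.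
have [pg _ rng _ _] := gamma_param.
have [G [G' [G'' [d [e [Bd [N cd]]]]]]] := curve_dataP gamma_param.
have [k kk tE] := tangent_sign cd tau_tangent.
have hG : hol1 (strip e) G G' by apply: hol1_sub (cd_hol cd) => z hz; exact: lt_trans hz (cd_ed cd).
have side_in := exists_inner_side Omega_open (cd_val cd) rng (cd_e0 cd) hG (cd_chord cd) (cd_nz cd).
have [l0 ll0 inner0] := side_in.
pose l := - l0.
have ll : l = 1 \/ l = -1 by rewrite /l; case: ll0 => ->; rewrite ?opprK; [right|left].
have inner z : side (- l) e z -> Omega (toP (G z)) by rewrite opprK; exact: inner0.
have side_ex (m : R) : m = 1 \/ m = -1 -> exists z : R[i], side m e z.
  move=> mm; have e0 := cd_e0 cd; exists (0 +i* (m * (e / 2))); rewrite /side imCI mulrA.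
  have -> : m * m = 1 by case: mm => ->; ring.
  by rewrite mul1r divr_gt0//= ltr_pdivrMr// ltr_pMr// ltr1n.
have normal t : toC (nu (gamma t)) = l%:C * 'i * G' t%:C / (cabs (G' t%:C))%:C /\
    forall z, side l e z -> ~ closure Omega (toP (G z)).
  have [n1 n2 n3] := nu_normal t.
  have m1 : cabs (toC (nu (gamma t))) = 1 by rewrite -enormE.
  have m2 : re (toC (nu (gamma t)) * conjc (G' t%:C)) = 0 by rewrite -(cd_vel cd) -dotE.
  have m3 : \forall x \near 0^'+, ~ closure Omega (gamma t + x *: toP (toC (nu (gamma t)))) by rewrite toCK.
  have [m [mm mE mO]] := normal_side Omega_open (cd_val cd) rng (cd_e0 cd) hG (cd_chord cd) (cd_nz cd) m1 m2 m3.
  (* The side found by [normal_side] is mapped outside, so it cannot be the inner one; the sign of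
     the normal is therefore the same at every point. *)
  have ml : m = l.
    have [z hz] := side_ex m mm.
    have ne : m <> l0.
      by move=> ml0; apply: (mO z hz); apply: subset_closure; apply: inner0; rewrite -ml0.
    by rewrite /l; case: mm ne => ->; case: ll0 => -> ne; rewrite ?opprK//; case: ne.
  by rewrite -ml.
have nE t := (normal t).1.
have outer := (normal 0).2.
split=> [[U [B [[oU _ cU] [C1B cB dc Bt Bn]]]]|an].
  apply/(hilbert_analytic_iff cd pg kk tE f_C1 h_C1).
  exact: (field_transform Omega_open cd rng kk ll tE nE outer pg f_C1 h_C1 oU cU C1B cB dc Bt Bn).
have {}an := (hilbert_analytic_iff cd pg kk tE f_C1 h_C1).1 an.
exact: (transform_field Omega_open cd rng Omega_simply_connected.1 kk ll tE nE inner pg f_C1 h_C1 an).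
Qed.
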